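(* Let $\nu>-1$, $\delta>0$ and $1<p\le\infty$. Suppose the real parameters $a,A$ satisfy (1) $a>-1/p-(\nu+1/2)$ ($\ge$ if $p=\infty$); (2) $A<1-1/p+(\nu+1/2)$ ($\le$ if $p=1$); (3) $a>-\delta-1/p$ ($\ge$ if $p=\infty$); (4) $A\le 1+\delta-1/p$; (5) $A\le a$; and in at least one of each of the following pairs the inequality is strict: (2) and (5); (3) and (5); and (4) and (5) except for $p=\infty$. Then there is $C$ independent of $f$ such that $$\|x^aB^\delta(f,x)\|_{L^p((0,1),dx)}\le C\|x^Af(x)\|_{L^p((0,1),dx)}.$$
   Context: Let $J_\nu$ be the Bessel function of order $\nu>-1$ and $0<s_1<s_2<\dots$ its successive positive zeros. Let $\phi_j(x)=\frac{\sqrt{2x}J_\nu(s_jx)}{|J_{\nu+1}(s_j)|}$, $j\ge1$, a complete orthonormal system in $L^2((0,1),dx)$, and $b_j(f)=\int_0^1 f(y)\phi_j(y)\,dy$. For $\delta>0$, $R>0$, $B_R^\delta(f,x)=\sum_{j\ge1}(1-s_j^2/R^2)_+^\delta b_j(f)\phi_j(x)$ with $(1-s^2)_+=\max\{1-s^2,0\}$, and $B^\delta(f,x)=\sup_{R>0}|B_R^\delta(f,x)|$. *)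

(* Defs.v *)
From HB Require Import structures.
From mathcomp Require Import all_boot all_order all_algebra.
From mathcomp Require Import all_classical all_reals all_analysis.
Set Implicit Arguments. Unset Strict Implicit. Unset Printing Implicit Defensive.
Import Order.TTheory GRing.Theory Num.Def Num.Theory.
Import numFieldNormedType.Exports.
Local Open Scope classical_set_scope.
Local Open Scope ring_scope.

Section Defs.
Context {R : realType}.

Definition Gamma (s : R) : R :=
  fine (\int[lebesgue_measure]_(t in `]0%R, +oo[) ((t `^ (s - 1)) * expR (- t))%:E)%E.

Definition besselJ (nu z : R) : R :=
  limn (series (fun m : nat =>
    (-1) ^+ m / ((m`!)%:R * Gamma (m%:R + nu + 1)) * (z / 2) `^ (2 * m%:R + nu)))%R.

(* s enumerates, in increasing order, the positive zeros of J_nu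
   (index shift: s 0 is the paper's s_1) *)
Definition bessel_zeros (nu : R) (s : nat -> R) : Prop :=
  {homo s : m n / (m < n)%N >-> m < n} /\
  (forall z : R, (0 < z /\ besselJ nu z = 0) <-> exists j, s j = z).

Definition phi (nu : R) (s : nat -> R) (j : nat) (x : R) : R :=
  Num.sqrt (2 * x) * besselJ nu (s j * x) / `|besselJ (nu + 1) (s j)|.

Definition coef (nu : R) (s : nat -> R) (f : R -> R) (j : nat) : R :=
  fine (\int[lebesgue_measure]_(y in `]0%R, 1%R[) (f y * phi nu s j y)%:E)%E.

Definition bochner_riesz (nu : R) (s : nat -> R) (delta : R) (f : R -> R)
    (Rad x : R) : R :=
  limn (series (fun j : nat =>
    (Num.max (1 - s j ^+ 2 / Rad ^+ 2) 0) `^ delta * coef nu s f j * phi nu s j x)).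

Definition bochner_riesz_max (nu : R) (s : nat -> R) (delta : R) (f : R -> R)
    (x : R) : \bar R :=
  ereal_sup [set (`|bochner_riesz nu s delta f Rad x|)%:E | Rad in [set r : R | 0 < r]].

Lemma measurable01 : measurable (`]0%R, 1%R[ : set R).
Proof. exact: measurable_itv. Qed.

Definition Lnorm01 (p : \bar R) (g : R -> \bar R) : \bar R :=
  Lnorm (mrestr (@lebesgue_measure R) measurable01) p g.

Definition invp (p : \bar R) : R :=
  match p with r%:E => r^-1 | _ => 0 end.

End Defs.

(* Main.v *)
Require Import Defs.
From HB Require Import structures.
From mathcomp Require Import all_boot all_order all_algebra.
From mathcomp Require Import all_classical all_reals all_analysis.
From mathcomp Require Import measurable_realfun ess_sup_inf.
From mathcomp Require Import ring lra.
Set Implicit Arguments. Unset Strict Implicit. Unset Printing Implicit Defensive.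
Import Order.TTheory GRing.Theory Num.Def Num.Theory.
Import numFieldNormedType.Exports.
Local Open Scope classical_set_scope.
Local Open Scope ring_scope.

(* Write [kap = nu + 1/2] and [phi_j x = x^kap e_j x]. The kernel of [B_R^delta] is
   [K_R(x, z) = sum_j (1 - s_j^2/R^2)_+^delta phi_j x phi_j z], and everything follows from
     |K_R(x, z)| <= C R Phi(R x) Phi(R z) (1 + R |x - z|)^(-1 - delta),  Phi z = min(z, 1)^kap.
   Instead of asymptotic expansions of the zeros, this bound uses the finite propagation speed
   of the wave equation [w_tt = w_xx + (2 kap/x) w_x]: the operator with symbol [cos (t s_j)]
   does not connect points at distance more than [t]. This is an energy estimate for partial
   sums of the eigenfunction expansion; their remainder is controlled by the min-max principle
   for [s_n], obtained from a Jacobi factorization between the zeros of the eigenfunctions. At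
   distance [d] one may thus replace the Riesz multiplier by its difference to an average of
   cosines of frequency at most [d]; this difference has size [(R d)^(-delta)] near [R] and
   decays fast away from [R].
   With [theta = min(kap, delta)], the weighted kernel is then dominated by Hardy kernels
   [x^b z^(-1-b)] ([2x <= z]) and their transposes, bounded by Schur's test, and, near the
   diagonal, by an approximate identity, bounded by the Hardy-Littlewood maximal function. The
   extreme cases [A = 1 + delta - 1/p] and, for [p = oo], [a + theta = 0], where the Hardy
   kernels are not bounded, use the decay in [R] of the kernel. *)

(** * Calculus on the line *)

(** Completeness of the eigenfunctions is nowhere an input, so the wave started at a compactly
    supported [f] is available only through partial sums, whose support is all of [[0, 1]]. What
    replaces completeness is quantitative: the min-max principle and Green's formula show that the
    remainder of [f] after [n] terms has squared gradient norm [O(s_n^(-2))]. The weight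
    [exp (2 rho x)] enlarges this error at most by [exp (2 rho)], so [rho] is chosen before [n].
    About the Bessel function little enters: its equation, [bj nu 0 != 0], and that [s] lists
    exactly the positive zeros in increasing order. Negative [kap], down to [-1/2] excluded, shapes
    the estimates: there [phi_j] is unbounded at 0, which is why integrals carry the weight
    [x^(2 kap)], [Phi] is kept throughout and [2 kap > -1] is spent repeatedly. At distance [d] the
    multiplier, not smooth at [R], yields only [(R d)^(-delta)]; the other factor [(R d)^(-1)] comes
    from counting, since at most [C / d] zeros lie within [1 / d] of [R]. *)

Section Derivatives.
Context {R : realType}.
Implicit Types (f g : R -> R) (x a b c : R).

Lemma der_eq f x a b : is_derive x 1 f a -> a = b -> is_derive x 1 f b.
Proof. by move=> h <-. Qed.

Lemma der_cst x c : is_derive x 1 (fun _ : R => c) 0.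
Proof. exact: is_derive_cst. Qed.

Lemma der_id x : is_derive x 1 (fun t : R => t) 1.
Proof. exact: is_derive_id. Qed.

Lemma derD f g x a b : is_derive x 1 f a -> is_derive x 1 g b ->
  is_derive x 1 (fun t => f t + g t) (a + b).
Proof. by move=> ? ?; exact: is_deriveD. Qed.

Lemma derN f x a : is_derive x 1 f a -> is_derive x 1 (fun t => - f t) (- a).
Proof. by move=> ?; exact: is_deriveN. Qed.

Lemma derB f g x a b : is_derive x 1 f a -> is_derive x 1 g b ->
  is_derive x 1 (fun t => f t - g t) (a - b).
Proof. by move=> ? ?; exact: is_deriveB. Qed.

Lemma derM f g x a b : is_derive x 1 f a -> is_derive x 1 g b ->
  is_derive x 1 (fun t => f t * g t) (a * g x + f x * b).
Proof.
move=> hf hg; apply: (der_eq (is_deriveM hf hg)).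
by rewrite /GRing.scale /= addrC mulrC [f x * b]mulrC mulrC [X in _ + X]mulrC.
Qed.

Lemma derZ c f x a : is_derive x 1 f a -> is_derive x 1 (fun t => c * f t) (c * a).
Proof. by move=> hf; apply: (der_eq (derM (der_cst x c) hf)); rewrite mul0r add0r. Qed.

Lemma derX f x a n : is_derive x 1 f a ->
  is_derive x 1 (fun t => f t ^+ n) (n%:R * f x ^+ n.-1 * a).
Proof.
move=> hf; have := @is_deriveX _ _ f n x 1 a hf.
case: n => [|n] h.
  by rewrite !mul0r; under eq_fun do rewrite expr0; exact: der_cst.
move: h; rewrite [X in is_derive _ _ X _](_ : _ = (fun t => f t ^+ n.+1)); last first.
  by apply/funext => t; rewrite fctE.
by move=> h; apply: (der_eq h); rewrite /GRing.scale /= mulr_natl.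
Qed.

Lemma der_comp f g x a b : is_derive x 1 g b -> is_derive (g x) 1 f a ->
  is_derive x 1 (fun t => f (g t)) (a * b).
Proof. by move=> hg hf; exact: is_derive1_comp. Qed.

Lemma derV f x a : f x != 0 -> is_derive x 1 f a ->
  is_derive x 1 (fun t => (f t)^-1) (- a / f x ^+ 2).
Proof.
move=> f0 hf; apply: (der_eq (is_deriveV f0 hf)).
by rewrite /GRing.scale /= mulrC mulrN mulNr.
Qed.

Lemma der_sum (I : Type) (s : seq I) (F : I -> R -> R) (a : I -> R) x :
  (forall i, is_derive x 1 (F i) (a i)) ->
  is_derive x 1 (fun t => \sum_(i <- s) F i t) (\sum_(i <- s) a i).
Proof.
move=> h; elim: s => [|i s IH].
  rewrite big_nil; under eq_fun do rewrite big_nil; exact: der_cst.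
rewrite big_cons; under eq_fun do rewrite big_cons; exact: derD.
Qed.

Lemma der_continuous f x a : is_derive x 1 f a -> {for x, continuous f}.
Proof.
move=> [h _]; apply: differentiable_continuous; exact/derivable1_diffP.
Qed.

Lemma der_eq_near f g x a : is_derive x 1 f a -> (\near x, f x = g x) ->
  is_derive x 1 g a.
Proof. by move=> hf fg; apply: (@near_eq_is_derive _ _ _ f g) => //; rewrite oner_eq0. Qed.

Lemma der_powR c x : 0 < x -> is_derive x 1 (fun t : R => t `^ c) (c * x `^ (c - 1)).
Proof. exact: is_derive1_powR. Qed.

Lemma le_of_der_ge0 f (df : R -> R) a b : a <= b ->
  {within `[a, b], continuous f} ->
  (forall x, a < x < b -> is_derive x 1 f (df x)) ->
  (forall x, a < x < b -> 0 <= df x) -> f a <= f b.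
Proof.
move=> ab cf hf h0.
apply: (@ger0_derive1_le_cc _ f a b) => //; rewrite ?in_itv /= ?lexx ?ab //.
  by move=> x; rewrite in_itv /= => /hf[].
by move=> x; rewrite in_itv /= => xab; have [_] := hf _ xab;
  rewrite derive1E => ->; exact: h0.
Qed.

End Derivatives.

(** * Fundamental theorem of calculus on closed and on open intervals *)

Section FTC.
Context {R : realType}.
Notation mu := (@lebesgue_measure R).
Implicit Types (f F : R -> R) (a b : R).

Lemma FTC_cc f F a b : a < b ->
  (forall x, a <= x <= b -> is_derive x 1 F (f x)) ->
  (forall x, a <= x <= b -> {for x, continuous f}) ->
  mu.-integrable `[a, b] (EFin \o f) /\
  (\int[mu]_(x in `[a, b]) (f x)%:E)%E = (F b - F a)%:E.
Proof.
move=> ab hF cf.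
have cw : {within `[a, b], continuous f}.
  by apply: continuous_in_subspaceT => x; rewrite inE /= in_itv; exact: cf.
have cF x : a <= x <= b -> {for x, continuous F}.
  by move=> h; apply: der_continuous (hF _ h).
split.
  by apply: continuous_compact_integrable => //; exact: segment_compact.
apply: continuous_FTC2 => //.
  split.
  - by move=> x; rewrite in_itv /= => /andP[ax xb]; have [] := hF x; rewrite ?ltW.
  - by apply: cvg_at_right_filter; apply: cF; rewrite lexx ltW.
  - by apply: cvg_at_left_filter; apply: cF; rewrite lexx ltW.
move=> x; rewrite in_itv /= => /andP[ax xb]; rewrite derive1E.
by have [|_ ->] := hF x; rewrite ?ltW.
Qed.

(** Closed intervals exhausting []a, b[]. The shift by 3 removes at most a third of the length at
    each end, so that none of them degenerates. *)
Definition innerD a b (n : nat) : set R := `[a + (b - a) / (n + 3)%:R, b - (b - a) / (n + 3)%:R].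

Lemma innerD_bigcup a b : a < b -> \bigcup_n innerD a b n = `]a, b[%classic.
Proof.
move=> ab; have ba : 0 < b - a by rewrite subr_gt0.
apply/seteqP; split => x /=.
  move=> [n _]; rewrite /innerD /= !in_itv /= => /andP[h1 h2].
  have h : 0 < (b - a) / (n + 3)%:R by rewrite divr_gt0 // ltr0n addn3.
  by apply/andP; split; [apply: lt_le_trans h1; rewrite ltrDl|
    apply: le_lt_trans h2 _; rewrite ltrBlDr ltrDl].
rewrite in_itv /= => /andP[ax xb].
pose e := Num.min (x - a) (b - x).
have e0 : 0 < e by rewrite lt_min !subr_gt0 ax.
have : exists n : nat, (b - a) / e < n%:R.
  exists (Num.truncn ((b - a) / e)).+1; exact: truncnS_gt.
move=> [n hn]; exists n => //; rewrite /innerD /= in_itv /=.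
have h : (b - a) / (n + 3)%:R <= e.
  rewrite ler_pdivrMr ?ltr0n ?addn3 // mulrC -ler_pdivrMr //.
  by apply: (le_trans (ltW hn)); rewrite ler_nat leqW // leqW // leqW.
have [ea eb] : e <= x - a /\ e <= b - x by rewrite !ge_min !lexx orbT.
by apply/andP; split; lra.
Qed.

Lemma innerD_nd a b : a < b -> nondecreasing_seq (innerD a b).
Proof.
move=> ab m n mn; rewrite subsetEset /innerD => x /=; rewrite !in_itv /=.
have : (b - a) / (n + 3)%:R <= (b - a) / (m + 3)%:R.
  by apply: ler_wpM2l; [rewrite subr_ge0 ltW|rewrite lef_pV2 ?posrE ?ltr0n ?addn3 // ler_nat ?addn3 ?ltnS].
by move=> h /andP[h1 h2]; apply/andP; split; lra.
Qed.

Lemma innerD_lt a b n : a < b -> a + (b - a) / (n + 3)%:R < b - (b - a) / (n + 3)%:R.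
Proof.
move=> ab; have : (b - a) / (n + 3)%:R <= (b - a) / 3.
  by apply: ler_wpM2l; [rewrite subr_ge0 ltW|rewrite lef_pV2 ?posrE ?ltr0n ?addn3 // ler_nat ?addn3 ?ltnS].
have : 0 < b - a by rewrite subr_gt0.
by lra.
Qed.

Lemma innerD_in a b n x : a < b -> innerD a b n x -> a < x < b.
Proof.
move=> ab Dx; have : (\bigcup_n innerD a b n) x by exists n.
by rewrite innerD_bigcup // /= in_itv.
Qed.

Lemma innerD_pin a b (n : nat) x : a < b ->
  a + (b - a) / (n + 3)%:R <= x <= b - (b - a) / (n + 3)%:R -> a < x < b.
Proof. by move=> ab h; apply: (@innerD_in a b n x ab); rewrite /innerD /= in_itv. Qed.

Lemma cvg_innerD0 a b : a < b -> (b - a) / (n + 3)%:R @[n --> \oo] --> (0 : R).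
Proof.
move=> ab; rewrite -[X in _ --> X](mulr0 (b - a)).
apply: cvgMr.
have : (fun n : nat => (n.+1%:R)^-1 : R) @ \oo --> (0 : R) by exact: cvg_harmonic.
move=> h; have := h; rewrite -(cvg_shiftn 2) /=.
by under eq_fun do rewrite -addnS.
Qed.

Lemma cvg_innerD a b F : a < b -> F x @[x --> a^'+] --> F a -> F x @[x --> b^'-] --> F b ->
  (F (b - (b - a) / (n + 3)%:R) - F (a + (b - a) / (n + 3)%:R)) @[n --> \oo]
    --> F b - F a.
Proof.
move=> ab Fa Fb; apply: cvgB.
  move/cvg_at_leftP : Fb; apply; split.
    by move=> n; rewrite ltrBlDr ltrDl divr_gt0 ?subr_gt0 // ltr0n addn3.
  by rewrite -[X in _ --> X]subr0; apply: cvgB; [exact: cvg_cst|exact: cvg_innerD0].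
move/cvg_at_rightP : Fa; apply; split.
  by move=> n; rewrite ltrDl divr_gt0 ?subr_gt0 // ltr0n addn3.
by rewrite -[X in _ --> X]addr0; apply: cvgD; [exact: cvg_cst|exact: cvg_innerD0].
Qed.

Lemma oo_continuous_measurable f a b :
  (forall x, a < x < b -> {for x, continuous f}) -> measurable_fun `]a, b[ f.
Proof.
move=> cf; apply: open_continuous_measurable_fun; first exact: interval_open.
by move=> x; rewrite inE /= in_itv /=; exact: cf.
Qed.

(** Monotone convergence along [innerD]. Only [F] is controlled at the endpoints, which admits
    integrands such as [x^al] with [-1 < al < 0]. *)
Lemma FTC_oo_ge0 f F a b : a < b ->
  (forall x, a < x < b -> is_derive x 1 F (f x)) ->
  (forall x, a < x < b -> {for x, continuous f}) ->
  (forall x, a < x < b -> 0 <= f x) ->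
  F x @[x --> a^'+] --> F a -> F x @[x --> b^'-] --> F b ->
  mu.-integrable `]a, b[ (EFin \o f) /\
  (\int[mu]_(x in `]a, b[) (f x)%:E)%E = (F b - F a)%:E.
Proof.
move=> ab hF cf f0 Fa Fb.
have mf := oo_continuous_measurable cf.
have mEf : measurable_fun `]a, b[ (EFin \o f) by exact/measurable_EFinP.
have h : (\int[mu]_(x in `]a, b[) (f x)%:E)%E = (F b - F a)%:E.
  rewrite -innerD_bigcup //; have mD n : measurable (innerD a b n) by exact: measurable_itv.
  have mfD n : measurable_fun (innerD a b n) (EFin \o f).
    by apply: measurable_funS mEf => // x /(innerD_in ab) /=; rewrite in_itv.
  have f0D n x : innerD a b n x -> (0 <= (EFin \o f) x)%E.
    by move=> /(innerD_in ab) /f0; rewrite lee_fin.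
  have H := @ge0_nondecreasing_set_cvg_integral _ _ R _ _ mu (innerD_nd ab) mD mfD f0D.
  apply: (cvg_unique _ H) => //.
  rewrite (_ : (fun i => _) = (fun n : nat =>
     (F (b - (b - a) / (n + 3)%:R) - F (a + (b - a) / (n + 3)%:R))%:E)).
    by apply: cvg_EFin; [exact: nearW|exact: cvg_innerD].
  apply/funext => n; rewrite /innerD; apply: (FTC_cc _ _ _).2.
  - exact: innerD_lt.
  - by move=> x /(innerD_pin ab); exact: hF.
  - by move=> x /(innerD_pin ab); exact: cf.
split => //; apply/integrableP; split => //.
rewrite (_ : integral _ _ _ = (F b - F a)%:E) ?ltry // -h; apply: eq_integral => x.
by rewrite inE /= in_itv /= => /f0 fx; rewrite ger0_norm.
Qed.

Lemma cvg_integral_innerD f a b : a < b ->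
  measurable_fun `]a, b[ f ->
  mu.-integrable `]a, b[ (EFin \o f) ->
  (\int[mu]_(x in innerD a b n) (f x)%:E)%E @[n --> \oo] -->
    (\int[mu]_(x in `]a, b[) (f x)%:E)%E.
Proof.
move=> ab mf intf.
have mD n : measurable (innerD a b n) by exact: measurable_itv.
have DS n : innerD a b n `<=` `]a, b[%classic by move=> x /(innerD_in ab) /=; rewrite in_itv.
have [|||||_ _] := @dominated_convergence _ _ R mu `]a, b[%classic (measurable_itv _)
  (fun n => (EFin \o f) \_ (innerD a b n)) (EFin \o f) (abse \o (EFin \o f)).
- move=> n; apply/(measurable_restrict _ (mD n)) => //=.
  by apply: (@measurable_funS _ _ _ _ `]a, b[%classic) => //; last exact/measurable_EFinP.
- exact/measurable_EFinP.
- apply: aeW => x xab; apply: cvg_near_cst.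
  have : (\bigcup_n innerD a b n) x by rewrite innerD_bigcup.
  move=> [N _ DN]; exists N => // n /= Nn; rewrite patchE mem_set //.
  by have := innerD_nd ab Nn; rewrite subsetEset; apply.
- exact: integrable_abse.
- by apply: aeW => x n xab; rewrite /= patchE; case: ifP => _ /=; rewrite ?lexx ?normr0 ?lee_fin.
apply: cvg_trans; apply: near_eq_cvg; apply: nearW => n /=.
by rewrite -integral_mkcondr setIidr.
Qed.

(** Made for Jacobi's identity, whose [dF] may be singular at both ends: [dF] and [f] are compared
    on the closed subintervals, and only the integral of [f] and the values of [F] pass to the
    limit. *)
Lemma FTC_oo_le f dF F a b : a < b ->
  (forall x, a < x < b -> is_derive x 1 F (dF x)) ->
  (forall x, a < x < b -> {for x, continuous dF}) ->
  (forall x, a < x < b -> {for x, continuous f}) ->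
  (forall x, a < x < b -> dF x <= f x) ->
  mu.-integrable `]a, b[ (EFin \o f) ->
  F x @[x --> a^'+] --> F a -> F x @[x --> b^'-] --> F b ->
  ((F b - F a)%:E <= \int[mu]_(x in `]a, b[) (f x)%:E)%E.
Proof.
move=> ab hF cdF cf dFf intf Fa Fb.
have mf := oo_continuous_measurable cf.
have H : ((F (b - (b - a) / (n + 3)%:R) - F (a + (b - a) / (n + 3)%:R))%:E @[n --> \oo]
    --> (F b - F a)%:E)%E.
  by apply: cvg_EFin; [exact: nearW|exact: cvg_innerD].
apply: (lee_cvg_to H (cvg_integral_innerD ab mf intf)); apply: nearW => n; rewrite -(FTC_cc (f := dF) (F := F) _ _ _).2.
- have lt := innerD_lt n ab; apply: le_integral => //.
  + apply: (FTC_cc (F := F) lt _ _).1 => x /(innerD_pin ab); [exact: hF|exact: cdF].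
  + apply: (@integrableS _ _ _ mu `]a, b[%classic (innerD a b n)) => //.
    exact: measurable_itv.
    by move=> x /(innerD_in ab) /=; rewrite in_itv.
  + by move=> x; rewrite inE => /(innerD_in ab) xab; rewrite lee_fin; exact: dFf.
- exact: innerD_lt.
- by move=> x /(innerD_pin ab); exact: hF.
- by move=> x /(innerD_pin ab); exact: cdF.
Qed.

Lemma FTC_oo f F a b : a < b ->
  (forall x, a < x < b -> is_derive x 1 F (f x)) ->
  (forall x, a < x < b -> {for x, continuous f}) ->
  mu.-integrable `]a, b[ (EFin \o f) ->
  F x @[x --> a^'+] --> F a -> F x @[x --> b^'-] --> F b ->
  (\int[mu]_(x in `]a, b[) (f x)%:E)%E = (F b - F a)%:E.
Proof.
move=> ab hF cf intf Fa Fb.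
have mf := oo_continuous_measurable cf.
apply: (cvg_unique _ (cvg_integral_innerD ab mf intf)) => //.
rewrite (_ : (fun i => _) = (fun n : nat =>
   (F (b - (b - a) / (n + 3)%:R) - F (a + (b - a) / (n + 3)%:R))%:E)).
  by apply: cvg_EFin; [exact: nearW|exact: cvg_innerD].
apply/funext => n; rewrite /innerD; apply: (FTC_cc _ _ _).2.
- exact: innerD_lt.
- by move=> x /(innerD_pin ab); exact: hF.
- by move=> x /(innerD_pin ab); exact: cf.
Qed.

End FTC.

(** * Integrals over []0, 1[] with weight [x^al] *)

Section WeightedIntegral.
Context {R : realType}.
Notation mu := (@lebesgue_measure R).
Implicit Types (f g F : R -> R) (a b c x : R).

Definition wI (al : R) g : R := \int[mu]_(x in `]0, 1[) (g x * x `^ al).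

Lemma continuous_bounded01 g : continuous g ->
  exists M, 0 <= M /\ forall x, 0 <= x <= 1 -> `|g x| <= M.
Proof.
move=> cg; have [] := @EVT_max R (fun x => `|g x|) 0 1 ler01.
  by apply: continuous_subspaceT => x; apply: cvg_norm; exact: cg.
move=> c _ h; exists `|g c|; split => // x x01; apply: h; by rewrite in_itv.
Qed.

Lemma continuous_powR al x : 0 < x -> {for x, continuous (fun t : R => t `^ al)}.
Proof. by move=> x0; exact: der_continuous (der_powR al x0). Qed.

Lemma continuous_powRM al g x : 0 < x -> {for x, continuous g} ->
  {for x, continuous (fun t : R => g t * t `^ al)}.
Proof. by move=> x0 cg; apply: cvgM => //; exact: continuous_powR. Qed.

Variable al : R.
Hypothesis al1 : -1 < al.

Let al0 : 0 < al + 1. Proof. by rewrite -ltrBlDr sub0r. Qed.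

Lemma der_powR_prim c x : c != 0 -> 0 < x ->
  is_derive x 1 (fun t : R => t `^ c / c) (x `^ (c - 1)).
Proof.
move=> c0 x0; apply: der_eq (derM (der_powR c x0) (der_cst x c^-1)) _.
by rewrite mulr0 addr0 mulrAC mulfV // mul1r.
Qed.

Lemma integrable_powR :
  mu.-integrable `]0, 1[ (fun x => (x `^ al)%:E).
Proof.
have h := (@FTC_oo_ge0 R (fun x => x `^ al) (fun x => x `^ (al + 1) / (al + 1)) 0 1 _ _ _ _ _ _).
apply: (h _ _ _ _ _ _).1 => //.
- move=> x /andP[x0 _]; apply: der_eq (der_powR_prim _ x0) _; first by rewrite gt_eqF.
  by rewrite addrK.
- by move=> x /andP[x0 _]; exact: continuous_powR.
- by move=> x _; exact: powR_ge0.
- apply: cvgMl; rewrite powR0 ?gt_eqF //; exact: powR_cvg0.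
- apply: cvg_at_left_filter; apply: cvgMl; exact: continuous_powR.
Qed.

Lemma wI_integrable g : continuous g ->
  mu.-integrable `]0, 1[ (EFin \o (fun x => g x * x `^ al)).
Proof.
move=> cg; have [M [M0 hM]] := continuous_bounded01 cg.
apply: (@le_integrable _ _ _ mu _ _ _ (fun x => (M%:E * (x `^ al)%:E)%E)) => //.
- apply/measurable_EFinP; apply: oo_continuous_measurable => x /andP[x0 _].
  by apply: continuous_powRM => //; exact: cg.
- move=> x /=; rewrite in_itv /= => /andP[x0 x1].
  rewrite lee_fin normrM [X in _ <= X]ger0_norm ?mulr_ge0 ?powR_ge0 //.
  rewrite (ger0_norm (powR_ge0 _ _)) ler_wpM2r ?powR_ge0 // hM // !ltW //.
- exact: integrableZl (integrable_powR).
Qed.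

Lemma wI_FTC g F : continuous g ->
  (forall x, 0 < x < 1 -> is_derive x 1 F (g x * x `^ al)) ->
  F x @[x --> 0^'+] --> F 0 -> F x @[x --> 1^'-] --> F 1 ->
  wI al g = F 1 - F 0.
Proof.
move=> cg hF F0 F1; rewrite /wI /Rintegral (@FTC_oo R _ F) //.
- by move=> x /andP[x0 _]; apply: continuous_powRM => //; exact: cg.
- exact: wI_integrable.
Qed.

Lemma eq_wI f g : (forall x, 0 < x < 1 -> f x = g x) -> wI al f = wI al g.
Proof.
by move=> h; apply: eq_Rintegral => x; rewrite inE /= in_itv /= => /h ->.
Qed.

Lemma wI_D f g : continuous f -> continuous g ->
  wI al (fun x => f x + g x) = wI al f + wI al g.
Proof.
move=> cf cg; rewrite /wI -RintegralD //; try exact: wI_integrable.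
by apply: eq_Rintegral => x _; rewrite mulrDl.
Qed.

Lemma wI_Z c f : continuous f -> wI al (fun x => c * f x) = c * wI al f.
Proof.
move=> cf; rewrite /wI -RintegralZl //; try exact: wI_integrable.
by apply: eq_Rintegral => x _; rewrite mulrA.
Qed.

Lemma wI_B f g : continuous f -> continuous g ->
  wI al (fun x => f x - g x) = wI al f - wI al g.
Proof.
move=> cf cg; rewrite /wI -RintegralB //; try exact: wI_integrable.
by apply: eq_Rintegral => x _; rewrite mulrBl.
Qed.

Lemma wI_ge0 f : (forall x, 0 < x < 1 -> 0 <= f x) -> 0 <= wI al f.
Proof.
move=> f0; apply: Rintegral_ge0 => x /=; rewrite in_itv /= => /f0 h.
by rewrite mulr_ge0 ?powR_ge0.
Qed.

Lemma wI_le f g : continuous f -> continuous g ->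
  (forall x, 0 < x < 1 -> f x <= g x) -> wI al f <= wI al g.
Proof.
move=> cf cg fg; rewrite -subr_ge0 -wI_B //; apply: wI_ge0 => x /fg.
by rewrite subr_ge0.
Qed.

Lemma continuous_sumf (I : Type) (s : seq I) (F : I -> R -> R) :
  (forall i, continuous (F i)) -> continuous (fun x => \sum_(i <- s) F i x).
Proof.
move=> h; elim: s => [|i s IH].
  rewrite (_ : (fun x => _) = cst 0); first by move=> x; exact: cvg_cst.
  by apply/funext => x; rewrite big_nil.
rewrite (_ : (fun x => _) = (fun x => F i x + \sum_(j <- s) F j x)).
  by move=> x; apply: cvgD; [exact: h|exact: IH].
by apply/funext => x; rewrite big_cons.
Qed.

Lemma wI0 : wI al (fun _ => 0) = 0.
Proof.
rewrite -[RHS](mul0r (wI al (fun=> 1))) -wI_Z; last by move=> x; exact: cvg_cst.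
by apply: eq_wI => x _; rewrite mul0r.
Qed.

Lemma wI_sum (I : Type) (s : seq I) (F : I -> R -> R) :
  (forall i, continuous (F i)) ->
  wI al (fun x => \sum_(i <- s) F i x) = \sum_(i <- s) wI al (F i).
Proof.
move=> h; elim: s => [|i s IH].
  by rewrite big_nil -[RHS]wI0; apply: eq_wI => x _; rewrite big_nil.
rewrite big_cons -IH -wI_D //; last exact: continuous_sumf.
by apply: eq_wI => x _; rewrite big_cons.
Qed.

Lemma cfM f g : continuous f -> continuous g -> continuous (fun x => f x * g x).
Proof. by move=> cf cg x; apply: cvgM; [exact: cf|exact: cg]. Qed.

Lemma cfD f g : continuous f -> continuous g -> continuous (fun x => f x + g x).
Proof. by move=> cf cg x; apply: cvgD; [exact: cf|exact: cg]. Qed.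

Lemma cfB f g : continuous f -> continuous g -> continuous (fun x => f x - g x).
Proof. by move=> cf cg x; apply: cvgB; [exact: cf|exact: cg]. Qed.

Lemma cfZ c f : continuous f -> continuous (fun x => c * f x).
Proof. by move=> cf; apply: cfM => // x; exact: cvg_cst. Qed.

Lemma cfX f n : continuous f -> continuous (fun x => f x ^+ n).
Proof.
move=> cf; elim: n => [|n IH].
  by under eq_fun do rewrite expr0; move=> x; exact: cvg_cst.
by under eq_fun do rewrite exprS; exact: cfM.
Qed.

Lemma wI_cauchy f g : continuous f -> continuous g ->
  wI al (fun x => f x * g x) ^+ 2 <=
  wI al (fun x => f x ^+ 2) * wI al (fun x => g x ^+ 2).
Proof.
move=> cf cg.
set A := wI al (fun x => f x ^+ 2); set B := wI al (fun x => f x * g x).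
set C := wI al (fun x => g x ^+ 2).
have A0 : 0 <= A by apply: wI_ge0 => x _; exact: sqr_ge0.
have C0 : 0 <= C by apply: wI_ge0 => x _; exact: sqr_ge0.
have key t u : 0 <= t ^+ 2 * A - 2 * t * u * B + u ^+ 2 * C.
  have : 0 <= wI al (fun x => (t * f x - u * g x) ^+ 2).
    by apply: wI_ge0 => x _; exact: sqr_ge0.
  rewrite (@eq_wI _ (fun x => (t ^+ 2 * f x ^+ 2 - 2 * t * u * (f x * g x)) + u ^+ 2 * g x ^+ 2)).
    have c1 := cfX (n := 2) cf; have c2 := cfM cf cg; have c3 := cfX (n := 2) cg.
    have c1' := cfZ (c := t ^+ 2) c1; have c2' := cfZ (c := 2 * t * u) c2.
    by rewrite (wI_D (cfB c1' c2') (cfZ c3)) (wI_B c1' c2') !wI_Z.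
  by move=> x _; ring.
have [C00|Cn0] := eqVneq C 0.
  have [->|Bn0] := eqVneq B 0; first by rewrite expr0n /= mulr_ge0.
  (* When [C = 0] and [B != 0] the form is affine in its second argument; at [(A + 1) / B] it equals
     [- A - 2 < 0], a contradiction. *)
  have := key 1 ((A + 1) / B); rewrite C00 !mulr0 addr0 expr1n mul1r mulr1.
  have -> : 2 * ((A + 1) / B) * B = 2 * (A + 1) by field.
  lra.
have := key C B; have : 0 < C by rewrite lt_neqAle eq_sym Cn0.
move=> Cp.
have -> : C ^+ 2 * A - 2 * C * B * B + B ^+ 2 * C = C * (A * C - B ^+ 2) by ring.
by rewrite pmulr_rge0 // subr_ge0.
Qed.

End WeightedIntegral.

(** * The Gamma function and Bessel functions *)

Section GammaFunction.
Context {R : realType}.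
Notation mu := (@lebesgue_measure R).
Implicit Types (x t : R).

(** From [expR t >= (t / N)^N] with [N - 1 > |x|]. It makes the boundary term at infinity vanish in
    the functional equation of [Gamma]. *)
Lemma powR_expRN_le x : exists K, 0 <= K /\ forall t, 1 <= t -> t `^ x * expR (- t) <= K / t.
Proof.
pose N := (Num.truncn `|x|).+2.
exists (N%:R ^+ N); split; first by rewrite exprn_ge0.
move=> t t1; have t0 : 0 < t by apply: lt_le_trans t1.
have N0 : (0 : R) < N%:R by rewrite ltr0n.
have h1 : (t / N%:R) ^+ N <= expR t.
  have -> : expR t = expR (t / N%:R) ^+ N.
    by rewrite -expRM_natl mulrCA mulfV ?mulr1 // gt_eqF.
  apply: lerXn2r; rewrite ?nnegrE ?expR_ge0 ?divr_ge0 // ltW //.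
  by apply: lt_le_trans (expR_ge1Dx _); rewrite ltrDr.
have h2 : t `^ x <= t ^+ N.-1.
  rewrite -powR_mulrn ?(ltW t0) //; apply: ler_powR => //.
  apply: (le_trans (ler_norm _)); rewrite /N /=; apply: ltW; exact: truncnS_gt.
rewrite expRN ler_pdivrMr ?expR_gt0 // mulrAC ler_pdivlMr //.
apply: (@le_trans _ _ (t ^+ N)).
  by rewrite [X in _ <= X]exprSr ler_wpM2r // ltW.
apply: le_trans (ler_wpM2l _ h1); last by rewrite exprn_ge0.
by rewrite exprMn exprVn mulrCA mulfV ?mulr1 // expf_neq0 // gt_eqF.
Qed.

Let E (n : nat) : set R := `[(n.+2%:R)^-1, n.+2%:R].

Let Ebig : \bigcup_n E n = `]0, +oo[%classic.
Proof.
apply/seteqP; split => t /=.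
  move=> [n _]; rewrite /E /= !in_itv /= andbT => /andP[h _].
  by apply: lt_le_trans h; rewrite invr_gt0.
rewrite in_itv /= andbT => t0.
pose n := (Num.truncn (t + t^-1)).+1; have hn : t + t^-1 < n%:R by exact: truncnS_gt.
exists n => //; rewrite /E /= in_itv /=.
have ti0 : 0 < t^-1 by rewrite invr_gt0.
have h : (n%:R : R) <= n.+2%:R by rewrite ler_nat leqW.
apply/andP; split; last by lra.
by rewrite -(invrK t) lef_pV2 ?posrE ?invr_gt0 //; lra.
Qed.

Let End : nondecreasing_seq E.
Proof.
move=> m n mn; rewrite subsetEset /E => x /=; rewrite !in_itv /=.
have h : (m.+2%:R : R) <= n.+2%:R by rewrite ler_nat !ltnS.
have h2 : (n.+2%:R : R)^-1 <= m.+2%:R^-1 by rewrite lef_pV2 ?posrE.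
by move=> /andP[h1 h3]; rewrite (le_trans h2 h1) (le_trans h3 h).
Qed.

Let E_gt0 n x : (n.+2%:R)^-1 <= x <= n.+2%:R -> 0 < x.
Proof. by move=> /andP[h _]; apply: lt_le_trans h; rewrite invr_gt0. Qed.

Let E_lt n : (n.+2%:R : R)^-1 < n.+2%:R.
Proof.
apply: (@lt_trans _ _ 1); last by rewrite ltr1n.
by rewrite invf_lt1 ?ltr1n.
Qed.

Let gam x t := t `^ (x - 1) * expR (- t).

Let gam_ge0 x t : 0 <= gam x t.
Proof. by rewrite mulr_ge0 ?powR_ge0 ?expR_ge0. Qed.

Let gam_cont x t : 0 < t -> {for t, continuous (gam x)}.
Proof.
move=> t0; apply: cvgM; first exact: continuous_powR.
by apply: continuous_comp; [exact: opp_continuous|exact: continuous_expR].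
Qed.

Let gam_meas x : measurable_fun (`]0%R, +oo[ : set R) (EFin \o gam x).
Proof.
apply/measurable_EFinP; apply: open_continuous_measurable_fun; first exact: interval_open.
by move=> t; rewrite inE /= in_itv /= andbT; exact: gam_cont.
Qed.

Let gam_cvg x : (\int[mu]_(t in E n) (gam x t)%:E)%E @[n --> \oo] -->
  (\int[mu]_(t in `]0%R, +oo[) (gam x t)%:E)%E.
Proof.
rewrite -Ebig; apply: ge0_nondecreasing_set_cvg_integral => //.
- by move=> n; exact: measurable_itv.
- move=> n; apply: measurable_funS (gam_meas x) => //.
  by rewrite -Ebig; exact: bigcup_sup.
- by move=> n t _; rewrite lee_fin.
Qed.

Let gam_int x n : mu.-integrable (E n) (EFin \o gam x).
Proof.
apply: continuous_compact_integrable; first exact: segment_compact.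
by apply: continuous_in_subspaceT => t; rewrite inE /E /= in_itv /= => /E_gt0; exact: gam_cont.
Qed.

Let prim x t := t `^ x * expR (- t).

(** Integration by parts on the compact intervals [E n], then monotone convergence. As an identity
    of extended integrals it avoids the question of finiteness. *)
Lemma Gamma_integralD1 x : 0 < x ->
  (\int[mu]_(t in `]0%R, +oo[) (t `^ (x + 1 - 1) * expR (- t))%:E =
   x%:E * \int[mu]_(t in `]0%R, +oo[) (t `^ (x - 1) * expR (- t))%:E)%E.
Proof.
move=> x0.
have step n : (\int[mu]_(t in E n) (gam (x + 1) t)%:E =
    x%:E * (\int[mu]_(t in E n) (gam x t)%:E) +
    (prim x (n.+2%:R)^-1 - prim x n.+2%:R)%:E)%E.
  have <- : (\int[mu]_(t in E n) (gam (x + 1) t - x * gam x t)%:E =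
     (prim x (n.+2%:R)^-1 - prim x n.+2%:R)%:E)%E.
    rewrite (FTC_cc (F := fun t => - prim x t) (E_lt n) _ _).2.
    - by rewrite opprK addrC.
    - move=> t /E_gt0 t0.
      have dN : is_derive t 1 (fun u : R => - u) (-1) by exact: derN (der_id t).
      apply: der_eq (derN (derM (der_powR x t0) (der_comp dN (is_derive_expR _)))) _.
      by rewrite /gam addrK; ring.
    - move=> t /E_gt0 t0; apply: cvgB; first exact: gam_cont.
      by apply: cvgMr; exact: gam_cont.
  have mE : measurable (E n) by exact: measurable_itv.
  have iz : mu.-integrable (E n) (fun t => (x%:E * (gam x t)%:E)%E) by apply: integrableZl => //; exact: gam_int.
  rewrite -(@integralZl _ _ _ mu (E n) mE _ (gam_int x n) x) -integralD //=; last first.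
    rewrite (_ : (fun t => _) = (fun t => (gam (x + 1) t)%:E - (x%:E * (gam x t)%:E))%E) //.
    by apply: integrableB => //; exact: gam_int.
  by apply: eq_integral => t _; rewrite -EFinM -EFinD; congr (_%:E); ring.
have H := @gam_cvg (x + 1).
suff H' : (\int[mu]_(t in E n) (gam (x + 1) t)%:E)%E @[n --> \oo] -->
    (x%:E * \int[mu]_(t in `]0%R, +oo[) (gam x t)%:E)%E.
  exact: (cvg_unique _ H H').
rewrite (_ : (fun n => _) = (fun n => (x%:E * (\int[mu]_(t in E n) (gam x t)%:E) +
    (prim x (n.+2%:R)^-1 - prim x n.+2%:R)%:E)%E)); last by apply/funext => n.
rewrite -[X in _ --> X]adde0; apply: cvgeD.
- by rewrite fin_num_adde_defl.
- apply: cvgeZl; [by []|exact: gam_cvg].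
apply: cvg_EFin; first exact: nearW.
rewrite -[X in _ --> X](subr0 0); apply: cvgB.
- have h : prim x t @[t --> 0^'+] --> 0.
    rewrite -[X in _ --> X](mul0r (expR (- 0))); apply: cvgM; first exact: powR_cvg0.
    apply: cvg_at_right_filter; apply: continuous_comp; [exact: opp_continuous|exact: continuous_expR].
  move/cvg_at_rightP : h; apply; split; first by move=> n; rewrite invr_gt0.
  have := @cvg_harmonic R; rewrite -(cvg_shiftS _) /=; exact.
- have [K [K0 hK]] := powR_expRN_le x.
  apply: (@squeeze_cvgr _ _ _ _ (fun _ => 0) (fun n : nat => K * n.+2%:R^-1)).
  + apply: nearW => n; rewrite mulr_ge0 ?powR_ge0 ?expR_ge0 //=; apply: hK.
    by rewrite ler1n.
  + exact: cvg_cst.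
  + rewrite -[X in _ --> X](mulr0 K); apply: cvgMr.
    have := @cvg_harmonic R; rewrite -(cvg_shiftS _) /=; exact.
Qed.

Lemma GammaD1 x : 0 < x -> Gamma (x + 1) = x * Gamma x.
Proof.
move=> x0; rewrite /Gamma Gamma_integralD1 //.
have : (0 <= \int[mu]_(t in `]0%R, +oo[) (t `^ (x - 1) * expR (- t))%:E)%E.
  by apply: integral_ge0 => t _; rewrite lee_fin gam_ge0.
(* If the integral were infinite, [fine] would send both sides to 0. *)
case: (integral _ _ _) => //= _.
by rewrite gt0_muley ?lte_fin //= mulr0.
Qed.

End GammaFunction.

(** * Power series of the Bessel functions *)

Section BesselSeries.
Context {R : realType}.
Implicit Types (nu w z : R) (m : nat).

(** Coefficients in the variable [w = (z / 2)^2]: there [besselJ nu z] is [(z / 2)^nu] times an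
    entire power series. *)
Definition bc nu m : R := (-1) ^+ m / ((m`!)%:R * Gamma (m%:R + nu + 1)).
Definition bser nu w : R := limn (pseries (bc nu) w).

Lemma bc_GammaD1 nu m : -1 < nu ->
  Gamma (m.+1%:R + nu + 1) = (m%:R + nu + 1) * Gamma (m%:R + nu + 1).
Proof.
move=> nu1; rewrite -GammaD1; last first.
  by have : (0 : R) <= m%:R by []; lra.
by congr Gamma; rewrite -natr1; ring.
Qed.

(** For [m >= 1] the factor [m + nu + 1] of the functional equation is at least 1, so [|1 / Gamma|]
    does not increase from index 1 on; the values at indices 0 and 1 suffice for [K]. The convention
    [0^-1 = 0] is harmless here. *)
Lemma bc_bound nu : -1 < nu -> exists K, 0 <= K /\ forall m, `|bc nu m| <= K / (m`!)%:R.
Proof.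
move=> nu1; pose g m := Gamma (m%:R + nu + 1).
pose K : R := `|(g 0%N)^-1| + `|(g 1%N)^-1|.
have gS m : g m.+1 = (m%:R + nu + 1) * g m by exact: bc_GammaD1.
have gK m : `|(g m)^-1| <= K.
  case: m => [|m]; first by rewrite lerDl.
  elim: m => [|m IH]; first by rewrite lerDr.
  apply: le_trans IH; rewrite gS invfM normrM ler_piMl //.
  have h : (1 : R) <= m.+1%:R + nu + 1 by have := ler0n R m; rewrite -natr1; lra.
  rewrite ger0_norm ?invr_ge0 ?invf_le1 //; [exact: (lt_le_trans ltr01 h)|exact: (le_trans ler01 h)].
exists K; split; first by rewrite addr_ge0.
move=> m; rewrite /bc invfM mulrA mulrAC normrM normrM normrX normrN1 expr1n mul1r.
by rewrite [X in _ * X]ger0_norm ?invr_ge0 //; apply: ler_wpM2r; [rewrite invr_ge0|exact: gK].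
Qed.

Lemma bser_cvg nu w : -1 < nu -> cvgn (pseries (bc nu) w).
Proof.
move=> nu1; have [K [K0 hK]] := bc_bound nu1.
apply: normed_cvg; rewrite /normed_series_of /=.
apply: (@series_le_cvg _ _ (fun n => K * exp_coeff `|w| n)).
- by move=> n; exact: normr_ge0.
- by move=> n; rewrite mulr_ge0 // exp_coeff_ge0.
- move=> n; rewrite /= normrM normrX /exp_coeff /= mulrCA [leLHS]mulrC.
  by apply: ler_wpM2l; rewrite ?exprn_ge0.
- apply: is_cvg_seriesZ; exact: is_cvg_series_exp_coeff.
Qed.

Lemma pseriesN (f : nat -> R) w : pseries (- f) w = - pseries f w.
Proof.
apply/funext => n; rewrite [RHS](_ : _ = - \sum_(0 <= i < n) f i * w ^+ i) // -sumrN.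
by apply: eq_bigr => i _; rewrite -mulNr.
Qed.

Lemma bc_diffs nu : -1 < nu -> pseries_diffs (bc nu) = - bc (nu + 1).
Proof.
move=> nu1; apply/funext => m; rewrite /pseries_diffs fctE /bc exprS.
rewrite factS natrM.
have -> : m.+1%:R + nu + 1 = m%:R + (nu + 1) + 1 by rewrite -natr1; ring.
rewrite !invfM; have m0 : (m.+1%:R : R) != 0 by rewrite pnatr_eq0.
have -> : forall a b c d : R, d != 0 -> d * (-1 * a * (d^-1 * b * c)) = - (a * (b * c)).
  by move=> a b c d d0; field.
  by [].
by [].
Qed.

Lemma bser_der nu w : -1 < nu -> is_derive w 1 (bser nu) (- bser (nu + 1) w).
Proof.
move=> nu1; have nu2 : -1 < nu + 1 by lra.
have nu3 : -1 < nu + 1 + 1 by lra.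
have := @pseries_snd_diffs R (bc nu) (`|w| + 1) w.
rewrite bc_diffs // pseries_diffsN bc_diffs // opprK => h.
apply: der_eq (h _ _ _ _) _.
- exact: bser_cvg.
- by rewrite pseriesN; apply: is_cvgN; exact: bser_cvg.
- exact: bser_cvg.
- by rewrite [X in _ < X]ger0_norm ?ltrDl // addr_ge0.
by apply/cvg_lim => //; rewrite pseriesN; apply: cvgN; exact: bser_cvg.
Qed.

(** The three-term recurrence [J_nu + J_(nu+2) = (2 (nu + 1) / z) J_(nu+1)], after division by
    [(z / 2)^nu]. *)
Lemma bser_rec nu w : -1 < nu ->
  bser nu w = (nu + 1) * bser (nu + 1) w - w * bser (nu + 1 + 1) w.
Proof.
move=> nu1; have nu2 : -1 < nu + 1 by lra.
have nu3 : -1 < nu + 1 + 1 by lra.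
have h1 := @pseries_diffs_equiv R (bc (nu + 1)) w.
have c3 := bser_cvg (w := w) nu3.
rewrite bc_diffs // pseriesN in h1.
have {}h1 := h1 (is_cvgN c3).
rewrite limN // in h1.
apply/cvg_lim => //.
rewrite (_ : pseries (bc nu) w = (fun n => (nu + 1) * pseries (bc (nu + 1)) w n +
   w * series (fun i => i%:R * bc (nu + 1) i * w ^+ i.-1) n)).
  have C1 : (nu + 1) * pseries (bc (nu + 1)) w n @[n --> \oo] --> (nu + 1) * bser (nu + 1) w.
    by apply: cvgMr; exact: bser_cvg.
  have C2 : w * series (fun i => i%:R * bc (nu + 1) i * w ^+ i.-1) n @[n --> \oo] -->
      w * - bser (nu + 1 + 1) w.
    by apply: cvgMr; exact: h1.
  by rewrite -mulrN; exact: (cvgD C1 C2).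
apply/funext => n; rewrite /pseries /series /= !mulr_sumr -big_split /=.
apply: eq_bigr => i _.
have -> : w * (i%:R * bc (nu + 1) i * w ^+ i.-1) = i%:R * bc (nu + 1) i * w ^+ i.
  by case: i => [|i]; rewrite ?mul0r ?mulr0 // exprS /=; ring.
rewrite mulrA -mulrDl -mulrDl; congr (_ * _).
rewrite /bc; have -> : i%:R + (nu + 1) + 1 = i.+1%:R + nu + 1 by rewrite -natr1; ring.
rewrite bc_GammaD1 //.
have h0 : (i%:R + nu + 1 : R) != 0 by rewrite gt_eqF //; have := ler0n R i; lra.
rewrite !invfM.
have -> : forall a b c d e : R, d != 0 -> e = d -> e * (a * (b * (d^-1 * c))) = a * (b * c).
  by move=> a b c d e' d0 ->; field.
  by [].
  by [].
by ring.
Qed.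

(* Up to the constant [2 `^ nu], [bj nu z = z `^ (- nu) * besselJ nu z], an entire even function. *)
Definition bj nu z : R := bser nu ((z / 2) ^+ 2).

Lemma bj_der nu z : -1 < nu -> is_derive z 1 (bj nu) (- (z * (bj (nu + 1) z / 2))).
Proof.
move=> nu1.
have d : is_derive z 1 (fun t : R => (t / 2) ^+ 2) (2%:R * (z / 2) ^+ 1 * (1 * 2^-1 + z * 0)).
  exact: derX (derM (der_id z) (der_cst z 2^-1)).
apply: der_eq (der_comp d (bser_der _ nu1)) _.
by rewrite /bj expr1; move: (bser _ _) => b; field.
Qed.

Lemma bj_der2 nu z : -1 < nu ->
  is_derive z 1 (fun t => t * (bj (nu + 1) t / 2)) (bj nu z - (2 * nu + 1) * (bj (nu + 1) z / 2)).
Proof.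
move=> nu1; have nu2 : -1 < nu + 1 by lra.
apply: der_eq (derM (der_id z) (derM (bj_der z nu2) (der_cst z 2^-1))) _.
have r : bj nu z = (nu + 1) * bj (nu + 1) z - (z / 2) ^+ 2 * bj (nu + 1 + 1) z :=
  bser_rec _ nu1.
by rewrite r; move: (bj (nu + 1) z) (bj (nu + 1 + 1) z) => b c; field.
Qed.

Lemma besselJE nu z : -1 < nu -> 0 < z -> besselJ nu z = (z / 2) `^ nu * bj nu z.
Proof.
move=> nu1 z0; have z20 : 0 < z / 2 by rewrite divr_gt0.
rewrite /besselJ; apply/cvg_lim => //.
rewrite (_ : series _ = (fun n => (z / 2) `^ nu * pseries (bc nu) ((z / 2) ^+ 2) n)).
  by apply: cvgMr; exact: bser_cvg.
apply/funext => n; rewrite /pseries /series /= mulr_sumr; apply: eq_bigr => i _.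
rewrite powRD; last by rewrite (gt_eqF z20) implybT.
rewrite -natrM powR_mulrn ?(ltW z20) // exprM /bc; ring.
Qed.

Lemma bj_cont nu : -1 < nu -> continuous (bj nu).
Proof. by move=> nu1 z; exact: der_continuous (bj_der z nu1). Qed.

End BesselSeries.

(* [y = bj nu] and [k = bj (nu + 1) / 2]; the hypotheses [yD] and [kD] are Bessel's equation
   written as a first-order system. *)
Section BesselODE.
Context {R : realType}.
Implicit Types (x z t a b c : R) (j : nat).
Variables (kap : R) (y k : R -> R).
Hypothesis yD : forall z, is_derive z 1 y (- (z * k z)).
Hypothesis kD : forall z, is_derive z 1 (fun t => t * k t) (y z - 2 * kap * k z).

(* [uf] is [Num.sqrt z * besselJ nu z] up to a constant, and [vf] its derivative; [Ef] is
   almost conserved as [z] grows. *)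
Definition uf z := z `^ kap * y z.
Definition vf z := kap * (z `^ (kap - 1) * y z) - z `^ kap * (z * k z).
Definition Ef z := uf z ^+ 2 + vf z ^+ 2.

Lemma powRS z (a : R) : 0 < z -> z `^ a = z * z `^ (a - 1).
Proof.
move=> z0; rewrite -{2}(powRr1 (ltW z0)) -powRD; last by rewrite (gt_eqF z0) implybT.
by congr powR; ring.
Qed.

Lemma uf_der z : 0 < z -> is_derive z 1 uf (vf z).
Proof.
move=> z0; apply: der_eq (derM (der_powR kap z0) (yD z)) _.
by rewrite /vf; move: (y z) (k z) (powR _ _) (powR _ _) => a b c d; ring.
Qed.

Lemma vf_der z : 0 < z -> is_derive z 1 vf (- uf z + kap * (kap - 1) * uf z / z ^+ 2).
Proof.
move=> z0; have zn : z != 0 by rewrite gt_eqF.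
apply: der_eq (derB (derZ kap (derM (der_powR (kap - 1) z0) (yD z)))
  (derM (der_powR kap z0) (kD z))) _.
rewrite /uf; have e1 := powRS kap z0; have e2 := powRS (kap - 1) z0.
rewrite e1 e2; move: (y z) (k z) (powR _ _) => a b c; by field.
Qed.

Let C : R := `|kap * (kap - 1)|.

Lemma Ef_der z : 0 < z ->
  is_derive z 1 Ef (2 * (kap * (kap - 1)) * (uf z * vf z) / z ^+ 2).
Proof.
move=> z0; have zn : z != 0 by rewrite gt_eqF.
apply: der_eq (derD (derX 2 (uf_der z0)) (derX 2 (vf_der z0))) _.
rewrite /= !expr1; move: (uf z) (vf z) => a b; by field.
Qed.

Lemma Ef_ge0 z : 0 <= Ef z. Proof. by rewrite addr_ge0 ?sqr_ge0. Qed.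

Lemma Ef_der_le z : 0 < z ->
  `|2 * (kap * (kap - 1)) * (uf z * vf z) / z ^+ 2| <= C / z ^+ 2 * Ef z.
Proof.
move=> z0; rewrite /Ef /C; move: (uf z) (vf z) (kap * (kap - 1)) => a b c.
have zn : z != 0 by rewrite gt_eqF.
have -> : 2 * c * (a * b) / z ^+ 2 = (c / z ^+ 2) * (2 * (a * b)) by field.
rewrite normrM normf_div (ger0_norm (exprn_ge0 2 (ltW z0))).
apply: ler_wpM2l; first by rewrite divr_ge0 ?normr_ge0 ?exprn_ge0 ?(ltW z0).
have := sqr_ge0 (a - b); have := sqr_ge0 (a + b); rewrite sqrrB sqrrD ler_norml.
by move=> h1 h2; apply/andP; split; lra.
Qed.

Let expC_der (c : R) z : 0 < z ->
  is_derive z 1 (fun t => expR (c / t)) (expR (c / z) * (- c / z ^+ 2)).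
Proof.
move=> z0; have zn : z != 0 by rewrite gt_eqF.
have h : is_derive z 1 (fun t : R => c / t) (- c / z ^+ 2).
  apply: der_eq (derZ c (derV zn (der_id z))) _; by field.
by apply: der_eq (der_comp h (is_derive_expR _)) _.
Qed.

Let within_of_der (f df : R -> R) a b : 0 < a ->
  (forall z, 0 < z -> is_derive z 1 f (df z)) -> {within `[a, b], continuous f}.
Proof.
move=> a0 h; apply: continuous_in_subspaceT => z; rewrite inE /= in_itv /= => /andP[az _].
by apply: der_continuous (h z _); exact: lt_le_trans az.
Qed.

(** Gronwall's argument with the integrable rate [C / z^2]: the product [Ef t * expR (C / t)] is
    nonincreasing. For the lower bound, [Ef t * expR (- C / t)] is nondecreasing. *)
Lemma Ef_upper z0 z : 0 < z0 -> z0 <= z -> Ef z <= Ef z0 * expR (C / z0).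
Proof.
move=> z00 zz.
have zp : 0 < z by exact: lt_le_trans zz.
pose f t := - (Ef t * expR (C / t)).
pose df t := - (2 * (kap * (kap - 1)) * (uf t * vf t) / t ^+ 2 * expR (C / t) +
   Ef t * (expR (C / t) * (- C / t ^+ 2))).
have fD (t : R) : 0 < t -> is_derive t 1 f (df t).
  by move=> t0; exact: derN (derM (Ef_der t0) (expC_der C t0)).
have := @le_of_der_ge0 R f df z0 z zz (within_of_der z00 fD).
rewrite /f lerN2 => h.
have {}h : Ef z * expR (C / z) <= Ef z0 * expR (C / z0).
  apply: h => [t|t] /andP[t1 _]; first by apply: fD; exact: lt_trans t1.
  have t0 : 0 < t by exact: lt_trans t1.
  have := Ef_der_le t0; rewrite ler_norml => /andP[_ hle].
  rewrite /df; have -> : forall a b c d e : R, - (a * b + c * (b * (- d / e))) = b * (d / e * c - a).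
    by move=> *; ring.
  by rewrite mulr_ge0 ?expR_ge0 // subr_ge0.
apply: le_trans h; rewrite ler_peMr ?Ef_ge0 // -expR0 ler_expR.
by apply: divr_ge0; [exact: normr_ge0|exact: ltW].
Qed.

Lemma Ef_lower z0 z : 0 < z0 -> z0 <= z -> Ef z0 * expR (- C / z0) <= Ef z.
Proof.
move=> z00 zz.
have zp : 0 < z by exact: lt_le_trans zz.
pose f t := Ef t * expR (- C / t).
pose df t := 2 * (kap * (kap - 1)) * (uf t * vf t) / t ^+ 2 * expR (- C / t) +
   Ef t * (expR (- C / t) * (- - C / t ^+ 2)).
have fD (t : R) : 0 < t -> is_derive t 1 f (df t).
  by move=> t0; exact: derM (Ef_der t0) (expC_der (- C) t0).
have h : Ef z0 * expR (- C / z0) <= Ef z * expR (- C / z).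
  apply: (@le_of_der_ge0 R f df z0 z zz (within_of_der z00 fD)) => t /andP[t1 _].
    by apply: fD; exact: lt_trans t1.
  have t0 : 0 < t by exact: lt_trans t1.
  have := Ef_der_le t0; rewrite ler_norml => /andP[hle _].
  rewrite /df; have -> : forall a b c d e : R, a * b + c * (b * (- - d / e)) = b * (a - - (d / e * c)).
    by move=> *; ring.
  by rewrite mulr_ge0 ?expR_ge0 // subr_ge0.
apply: (le_trans h); rewrite ler_piMr ?Ef_ge0 // -[leRHS]expR0 ler_expR.
by rewrite mulNr oppr_le0 divr_ge0 ?normr_ge0 // ltW.
Qed.

Lemma uf_le_Ef z : `|uf z| <= Num.sqrt (Ef z).
Proof.
by rewrite -sqrtr_sqr ler_wsqrtr // /Ef lerDl sqr_ge0.
Qed.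

Lemma vf_le_Ef z : `|vf z| <= Num.sqrt (Ef z).
Proof.
by rewrite -sqrtr_sqr ler_wsqrtr // /Ef lerDr sqr_ge0.
Qed.

Lemma uf_vf_bounded z0 : 0 < z0 -> exists M, 0 < M /\
  forall z, z0 <= z -> `|uf z| <= M /\ `|vf z| <= M.
Proof.
move=> z00; exists (Num.sqrt (Ef z0 * expR (C / z0)) + 1); split.
  by rewrite ltr_wpDl ?sqrtr_ge0.
move=> z zz; have h : Num.sqrt (Ef z) <= Num.sqrt (Ef z0 * expR (C / z0)) + 1.
  by apply: (le_trans (ler_wsqrtr (Ef_upper z00 zz))); rewrite lerDl.
by split; apply: le_trans h; [exact: uf_le_Ef|exact: vf_le_Ef].
Qed.

Definition Phi z : R := if z <= 1 then z `^ kap else 1.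

Lemma Phi_gt0 z : 0 < z -> 0 < Phi z.
Proof. by move=> z0; rewrite /Phi; case: ifP => // _; exact: powR_gt0. Qed.

Lemma uf_le_Phi : exists M, 0 < M /\ forall z, 0 < z -> `|uf z| <= M * Phi z.
Proof.
have [M [M0 hM]] := uf_vf_bounded ltr01.
have cy : continuous y by move=> z; exact: der_continuous (yD z).
have [M' [M'0 hM']] := continuous_bounded01 cy.
exists (M + M'); split; first exact: ltr_pwDl.
move=> z z0; rewrite /Phi; case: ifPn => [z1|]; last first.
  by rewrite -ltNge mulr1 => /ltW z1; apply: (le_trans (hM z z1).1); rewrite lerDl.
rewrite /uf normrM (ger0_norm (powR_ge0 _ _)) mulrC; apply: ler_wpM2r; first exact: powR_ge0.
by apply: (le_trans (hM' z _)); rewrite ?(ltW z0) ?z1 // lerDr ltW.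
Qed.

Variable s : nat -> R.
Hypothesis s_mono : {homo s : m n / (m < n)%N >-> m < n}.
Hypothesis s_zero : forall z, 0 < z /\ y z = 0 <-> exists j, s j = z.

Lemma s_gt0 j : 0 < s j.
Proof. by have [_ h] := s_zero (s j); have [] := h (ex_intro _ j erefl). Qed.

Lemma y_s j : y (s j) = 0.
Proof. by have [_ h] := s_zero (s j); have [] := h (ex_intro _ j erefl). Qed.

Lemma s_lt i j : (s i < s j) = (i < j)%N.
Proof. exact: (leW_mono (le_mono s_mono)). Qed.

Lemma uf_s j : uf (s j) = 0. Proof. by rewrite /uf y_s mulr0. Qed.

Lemma vf_s j : vf (s j) = - ((s j) `^ kap * (s j * k (s j))).
Proof. by rewrite /vf y_s !mulr0 add0r. Qed.

(** Otherwise [Ef_upper] would make [uf] vanish beyond [s 0], and the midpoint of [s 0] and [s 1]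
    would be a zero strictly between consecutive ones. *)
Lemma Ef_s0_gt0 : 0 < Ef (s 0%N).
Proof.
rewrite lt_neqAle Ef_ge0 andbT; apply/negP => /eqP E0.
have z0 : 0 < (s 0%N + s 1%N) / 2 by rewrite divr_gt0 // addr_gt0 ?s_gt0.
have h01 : s 0%N < s 1%N by exact: s_mono.
have := Ef_upper (s_gt0 0) (z := (s 0%N + s 1%N) / 2).
rewrite -E0 mul0r => /(_ _) h.
have {}h : Ef ((s 0%N + s 1%N) / 2) <= 0 by apply: h; lra.
have : uf ((s 0%N + s 1%N) / 2) = 0.
  have := le_trans _ h; move: (sqr_ge0 (vf ((s 0%N + s 1%N) / 2))) (sqr_ge0 (uf ((s 0%N + s 1%N) / 2))).
  rewrite /Ef in h => a b _; apply/eqP; rewrite -sqrf_eq0; apply/eqP; lra.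
move/eqP; rewrite mulf_eq0 gt_eqF ?powR_gt0 //= => /eqP y0.
have [[i hi] _] := conj ((s_zero _).1 (conj z0 y0)) I.
have : (0 < i)%N by rewrite -s_lt hi; lra.
have : (i < 1)%N by rewrite -s_lt hi; lra.
by case: i {hi}.
Qed.

Lemma s_le i j : (s i <= s j) = (i <= j)%N.
Proof. exact: (le_mono s_mono). Qed.

(** At a zero [Ef] reduces to [vf ^+ 2], so [Ef_lower] applies. This bounds from below the
    normalizing denominators of the eigenfunctions. *)
Lemma vf_s_lower : exists c, 0 < c /\ forall j, c <= (s j) `^ kap * `|s j * k (s j)|.
Proof.
exists (Num.sqrt (Ef (s 0%N) * expR (- C / s 0%N))); split.
  by rewrite sqrtr_gt0 mulr_gt0 ?expR_gt0 // Ef_s0_gt0.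
move=> j; have h := Ef_lower (s_gt0 0) (z := s j).
have {}h : Ef (s 0%N) * expR (- C / s 0%N) <= Ef (s j) by apply: h; rewrite s_le.
apply: (le_trans (ler_wsqrtr h)).
rewrite /Ef uf_s expr0n /= add0r sqrtr_sqr vf_s normrN normrM.
by rewrite (ger0_norm (powR_ge0 _ _)).
Qed.

(** By Rolle [vf] vanishes between two consecutive zeros, while [|vf| >= c] at the zeros themselves;
    since [|vf'| <= D], this takes a distance of at least [c / D]. *)
Lemma s_gap : exists g, 0 < g /\ forall j, s j + g <= s j.+1.
Proof.
have [c [c0 hc]] := vf_s_lower.
have [M [M0 hM]] := uf_vf_bounded (s_gt0 0).
pose D := M + C * M / s 0%N ^+ 2.
have D0 : 0 < D.
  rewrite ltr_pwDl // divr_ge0 ?exprn_ge0 ?(ltW (s_gt0 0)) //.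
  by rewrite mulr_ge0 ?normr_ge0 ?(ltW M0).
exists (c / D); split; first by rewrite divr_gt0.
move=> j; have sj : s j < s j.+1 by exact: s_mono.
have pos z : s j <= z -> 0 < z by move=> h; exact: lt_le_trans (s_gt0 j) h.
have [xi xij [_ vxi]] : exists2 xi, xi \in `]s j, s j.+1[ & is_derive xi 1 uf 0.
  apply: (@Rolle R uf (s j) (s j.+1)) => //.
  - by move=> x; rewrite in_itv /= => /andP[/ltW /pos h _]; have [] := uf_der h.
  - exact: within_of_der (s_gt0 j) uf_der.
  - by rewrite !uf_s.
move: xij; rewrite in_itv /= => /andP[xi1 xi2].
have xi0 := pos _ (ltW xi1).
have vxi0 : vf xi = 0 by have [_ <-] := uf_der xi0.
have wv : {within `[s j, xi], continuous vf} := within_of_der (s_gt0 j) vf_der.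
have [t tin ht] := @MVT R vf (fun z => - uf z + kap * (kap - 1) * uf z / z ^+ 2) (s j) xi xi1
   (fun t ht => vf_der (pos t (ltW (andP ht).1))) wv.
move: tin; rewrite in_itv /= => /andP[t1 t2].
have t0 := pos _ (ltW t1).
have hs0 : s 0%N <= t by apply: le_trans (ltW t1); rewrite s_le.
have hd : `|- uf t + kap * (kap - 1) * uf t / t ^+ 2| <= D.
  apply: (le_trans (ler_normD _ _)); rewrite normrN /D.
  have [h1 _] := hM t hs0; apply: lerD => //.
  rewrite normf_div normrM (ger0_norm (exprn_ge0 2 (ltW t0))).
  apply: ler_pM; rewrite ?mulr_ge0 ?normr_ge0 ?invr_ge0 ?exprn_ge0 ?(ltW t0) //.
    by apply: ler_wpM2l; first exact: normr_ge0.
  by rewrite lef_pV2 ?posrE ?exprn_gt0 ?s_gt0 // lerXn2r ?nnegrE ?(ltW (s_gt0 0)) ?(ltW t0).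
have := hc j; rewrite -(ger0_norm (powR_ge0 (s j) kap)) -normrM -normrN -vf_s => hcj.
have : `|vf xi - vf (s j)| <= D * (xi - s j).
  rewrite ht normrM [X in _ * X]ger0_norm ?subr_ge0 ?(ltW xi1) //.
  by apply: ler_wpM2r; rewrite ?subr_ge0 ?(ltW xi1).
rewrite vxi0 sub0r normrN => h.
rewrite -lerBrDl ler_pdivrMr //; apply: (le_trans hcj); apply: (le_trans h).
by rewrite mulrC ler_wpM2r ?(ltW D0) // lerB // ltW.
Qed.

Lemma s_lower : exists g, 0 < g /\ forall j, g * j.+1%:R <= s j.
Proof.
have [g [g0 hg]] := s_gap.
exists (Num.min g (s 0%N)); split; first by rewrite lt_min g0 s_gt0.
elim=> [|j IH]; first by rewrite mulr1 ge_min lexx orbT.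
apply: le_trans (hg j); rewrite -natr1 mulrDr mulr1 lerD // ge_min lexx //.
Qed.

End BesselODE.

(** * Eigenfunctions and the min-max principle *)

Section Limits.
Context {R : realType}.
Implicit Types (f g r w : R -> R) (x a b c al : R).

Lemma cvg0_powRM al g : -1 < al -> continuous g ->
  t `^ al * (t * g t) @[t --> 0^'+] --> (0 : R).
Proof.
move=> al1 cg.
have h : t `^ (al + 1) * g t @[t --> 0^'+] --> 0 * g 0.
  apply: cvgM; first by apply: powR_cvg0; lra.
  by apply: cvg_at_right_filter; exact: cg.
rewrite mul0r in h; apply: cvg_trans h; apply: near_eq_cvg; near=> t.
have t0 : 0 < t by near: t; exact: nbhs_right_gt.
by rewrite mulrA; congr (_ * _); rewrite (powRS _ t0) addrK mulrC.
Unshelve. all: by end_near. Qed.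

Lemma sqr_continuous_at f x :
  {for x, continuous f} -> {for x, continuous (fun t => f t ^+ 2)}.
Proof.
move=> cf; rewrite (_ : (fun t => f t ^+ 2) = (fun t => f t * f t)).
  by apply: cvgM; exact: cf.
by apply/funext => t; rewrite expr2.
Qed.

(** The double zero of [r ^+ 2] beats the simple zero of [w]. This removes the singularity of the
    boundary term in Jacobi's identity. *)
Lemma sqr_div_cvg0 r (dr : R -> R) w (dw : R -> R) c :
  (forall x, is_derive x 1 r (dr x)) -> continuous dr ->
  (forall x, is_derive x 1 w (dw x)) -> continuous dw ->
  r c = 0 -> w c = 0 -> dw c != 0 ->
  r x ^+ 2 / w x @[x --> c^'] --> (0 : R).
Proof.
move=> hr cdr hw cdw rc wc dwc.
have cr x : {for x, continuous r} := der_continuous (hr x).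
have cw x : {for x, continuous w} := der_continuous (hw x).
have : \forall x \near c, dw x != 0.
  have := cdw c; move/cvgr_norm_gt => h.
  near=> x; rewrite -normr_gt0; near: x; apply: h; by rewrite normr_gt0.
move=> /nbhs_ballP[e /= e0 he].
apply: (@lhopital R (fun x => r x ^+ 2) (fun x => 2%:R * r x ^+ 1 * dr x) w dw (c - e) (c + e)).
- by rewrite in_itv /= ltrBlDr !ltrDl e0.
- by move=> x _; exact: derX (hr x).
- rewrite -[X in _ --> X](expr0n R 2) -rc.
  by apply: (@cvg_comp _ _ _ r (fun t => t ^+ 2)); [exact: cr|exact: exprn_continuous].
- by rewrite -wc; exact: cw.
- move=> x; rewrite inE /= in_itv /= => -[/andP[h1 h2] _].
  by apply: he; rewrite /ball /= ltr_norml; apply/andP; split; lra.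
rewrite -[X in _ --> X](_ : 2%:R * r c ^+ 1 * dr c / dw c = 0); last first.
  by rewrite rc !(mulr0, mul0r).
apply: cvgM; last by apply: cvgV => //; exact: cdw.
apply: cvgM; last exact: cdr.
by apply: cvgM; [exact: cvg_cst|rewrite expr1; exact: cr].
Unshelve. all: by end_near. Qed.

End Limits.

(** * Orthonormal eigenfunctions of the Bessel operator *)

Section Eigenfunctions.
Context {R : realType}.
Notation mu := (@lebesgue_measure R).
Implicit Types (x z t a b c sig : R) (i j : nat) (g : R -> R).
Variables (kap : R) (y k : R -> R).
Hypothesis kap1 : -1 < 2 * kap.
Hypothesis yD : forall z, is_derive z 1 y (- (z * k z)).
Hypothesis kD : forall z, is_derive z 1 (fun t => t * k t) (y z - 2 * kap * k z).
Hypothesis kc : continuous k.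
Hypothesis y0 : y 0 != 0.
Notation al := (2 * kap).

Lemma continuous_scale g c : continuous g -> continuous (fun t => g (c * t)).
Proof.
move=> cg x; apply: (@cvg_comp _ _ _ (fun t => c * t) (g)); last exact: cg.
by apply: cvgMr; exact: cvg_id.
Qed.

Lemma cf_id : continuous (fun t : R => t). Proof. by move=> x; exact: cvg_id. Qed.
Lemma cf_cst c : continuous (fun t : R => c). Proof. by move=> x; exact: cvg_cst. Qed.

Lemma der_scale g c x a : is_derive (c * x) 1 g a ->
  is_derive x 1 (fun t => g (c * t)) (c * a).
Proof.
move=> h; apply: der_eq (der_comp (derZ c (der_id x)) h) _; by rewrite mulr1 mulrC.
Qed.

(** Divergence form: the boundary term at 0 is of order [x^(al + 1)] and vanishes because [al > -1],
    so only the value at 1 survives. *)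
Lemma wI_flux g (G : R -> R) : continuous g -> continuous G ->
  (forall x, 0 < x < 1 -> is_derive x 1 (fun t => t `^ al * (t * g t)) (G x * x `^ al)) ->
  wI al G = g 1.
Proof.
move=> cg cG hG; rewrite (@wI_FTC _ _ kap1 _ (fun t => t `^ al * (t * g t))) //.
- by rewrite mul0r mulr0 subr0 powR1 !mul1r.
- by rewrite mul0r mulr0; exact: cvg0_powRM.
- apply: cvg_at_left_filter; apply: cvgM; first exact: continuous_powR.
  by apply: cvgM; [exact: cvg_id|exact: cg].
Qed.

Lemma flux_der sig x : 0 < x ->
  is_derive x 1 (fun t => t `^ al * (t * (sig ^+ 2 * k (sig * t))))
    (sig ^+ 2 * y (sig * x) * x `^ al).
Proof.
move=> x0.
have h := derZ sig (der_scale (kD (sig * x))).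
have e : (fun t => t * (sig ^+ 2 * k (sig * t))) = (fun t => sig * (sig * t * k (sig * t))).
  by apply/funext => t; rewrite expr2; ring.
have h2 := derM (der_powR al x0) h.
rewrite (_ : (fun t => t `^ al * (t * (sig ^+ 2 * k (sig * t)))) =
  (fun t => t `^ al * (sig * (sig * t * k (sig * t))))); last first.
  by apply/funext => t; rewrite -(congr1 (fun f => f t) e).
apply: der_eq h2 _; rewrite (powRS al x0).
by move: (powR _ _) (y _) (k _) => A B C; ring.
Qed.

Lemma ysc_der sig x : is_derive x 1 (fun t => y (sig * t)) (- (x * (sig ^+ 2 * k (sig * x)))).
Proof. by apply: der_eq (der_scale (yD (sig * x))) _; ring. Qed.

Section Normalized.
Variable s : nat -> R.
Hypothesis s_gt0 : forall j, 0 < s j.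
Hypothesis ys : forall j, y (s j) = 0.
Hypothesis ks : forall j, k (s j) != 0.
Hypothesis s_inj : forall i j, s i = s j -> i = j.

Definition ec j := Num.sqrt 2 / `|s j * k (s j)|.
Definition ef j x := ec j * y (s j * x).
(** The derivative of [ef j] divided by [- x]: continuous at 0 as well, and [x^al * (x * eq_ j x)]
    is the flux in the equation. *)
Definition eq_ j x := ec j * (s j ^+ 2 * k (s j * x)).
Definition de j x := - (x * eq_ j x).

Lemma ec_gt0 j : 0 < ec j.
Proof. by rewrite divr_gt0 ?sqrtr_gt0 // normr_gt0 mulf_neq0 ?ks // gt_eqF. Qed.

Lemma ef_der j x : is_derive x 1 (ef j) (de j x).
Proof. by apply: der_eq (derZ (ec j) (ysc_der (s j) x)) _; rewrite /de /eq_; ring. Qed.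

Lemma ef_cont j : continuous (ef j).
Proof. by move=> x; exact: der_continuous (ef_der j x). Qed.

Lemma eq_cont j : continuous (eq_ j).
Proof. by apply: cfZ; apply: cfZ; exact: continuous_scale. Qed.

Lemma de_cont j : continuous (de j).
Proof. by move=> x; apply: cvgN; apply: cfM; [exact: cf_id|exact: eq_cont]. Qed.

Lemma ef1 j : ef j 1 = 0.
Proof. by rewrite /ef mulr1 ys mulr0. Qed.

Lemma eflux_der j x : 0 < x ->
  is_derive x 1 (fun t => t `^ al * (t * eq_ j t)) (s j ^+ 2 * ef j x * x `^ al).
Proof.
move=> x0; have := derZ (ec j) (flux_der (s j) x0).
rewrite (_ : (fun t => ec j * _) = (fun t => t `^ al * (t * eq_ j t))); last first.
  by apply/funext => t; rewrite /eq_; ring.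
by move=> h; apply: der_eq h _; rewrite /ef; ring.
Qed.

Lemma wI_ibp j g (dg : R -> R) : (forall x, is_derive x 1 g (dg x)) -> continuous dg ->
  s j ^+ 2 * wI al (fun x => ef j x * g x) =
  eq_ j 1 * g 1 + wI al (fun x => de j x * dg x).
Proof.
move=> hg cdg; have cg : continuous g by move=> x; exact: der_continuous (hg x).
have ce := @ef_cont j; have cd := @de_cont j; have cq := @eq_cont j.
have c1 : continuous (fun x => ef j x * g x) by exact: cfM.
have c2 : continuous (fun x => de j x * dg x) by exact: cfM.
have := @wI_flux (fun x => eq_ j x * g x)
  (fun x => s j ^+ 2 * (ef j x * g x) - de j x * dg x).
rewrite wI_B ?wI_Z //; last exact: cfZ.
move=> h; apply/eqP; rewrite -subr_eq; apply/eqP; apply: h.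
- exact: cfM.
- by apply: cfB => //; exact: cfZ.
move=> x /andP[x0 _]; have := derM (eflux_der j x0) (hg x).
rewrite (_ : (fun t => _ * g t) = (fun t => t `^ al * (t * (eq_ j t * g t)))); last first.
  by apply/funext => t; ring.
by move=> h2; apply: der_eq h2 _; rewrite /de; ring.
Qed.

Lemma ef_orth i j : i != j -> wI al (fun x => ef i x * ef j x) = 0.
Proof.
move=> ij.
have h1 := wI_ibp i (ef_der j) (@de_cont j).
have h2 := wI_ibp j (ef_der i) (@de_cont i).
rewrite ef1 mulr0 add0r in h1; rewrite ef1 mulr0 add0r in h2.
have e1 : wI al (fun x => ef j x * ef i x) = wI al (fun x => ef i x * ef j x).
  by apply: eq_wI => x _; rewrite mulrC.
have e2 : wI al (fun x => de j x * de i x) = wI al (fun x => de i x * de j x).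
  by apply: eq_wI => x _; rewrite mulrC.
rewrite e1 e2 -h1 in h2; apply/eqP; move/eqP: h2; rewrite -subr_eq0 -mulrBl mulf_eq0.
rewrite subr_eq0 eqrXn2 ?(ltW (s_gt0 _)) // => /orP[/eqP/s_inj ji|//].
by rewrite ji eqxx in ij.
Qed.

(** A Pohozaev (or Lommel) identity: an explicit flux built from [ef j] and its derivative has
    divergence [2 s_j^2 ef_j^2], so the norm is read off from its value at 1, which is the square of
    [eq_ j 1]. *)
Lemma ef_norm j : wI al (fun x => ef j x ^+ 2) = 1.
Proof.
have ce := @ef_cont j; have cq := @eq_cont j.
have c2 : continuous (fun x => ef j x ^+ 2) by exact: cfX.
have := @wI_flux (fun x => (x * eq_ j x) ^+ 2 + s j ^+ 2 * ef j x ^+ 2 - (al - 1) * (ef j x * eq_ j x))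
  (fun x => 2 * s j ^+ 2 * ef j x ^+ 2).
rewrite wI_Z // ef1 expr0n /= mul0r !mulr0 addr0 subr0 mul1r => h.
have {}h : 2 * s j ^+ 2 * wI al (fun x => ef j x ^+ 2) = eq_ j 1 ^+ 2.
  apply: h.
  - apply: cfB; last by apply: cfZ; exact: cfM.
    by apply: cfD; [apply: cfX; apply: cfM => //; exact: cf_id|exact: cfZ].
  - exact: cfZ.
  move=> x /andP[x0 _].
  have dp := der_powR al x0.
  have h1 := eflux_der j x0.
  have dh : is_derive x 1 (fun t => t * eq_ j t) (s j ^+ 2 * ef j x - al * eq_ j x).
    have hh := derZ (ec j * s j) (der_scale (kD (s j * x))).
    rewrite (_ : (fun t => ec j * s j * _) = (fun t => t * eq_ j t)) in hh; last first.
      by apply/funext => t; rewrite /eq_; ring.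
    by apply: der_eq hh _; rewrite /eq_ /ef; ring.
  have dG := derB (derD (derM (der_id x) (derX 2 dh))
     (derZ (s j ^+ 2) (derM (der_id x) (derX 2 (ef_der j x)))))
     (derZ (al - 1) (derM (ef_der j x) dh)).
  have := derM dp dG.
  rewrite (_ : (fun t => t `^ al * _) = (fun t => t `^ al * (t *
    ((t * eq_ j t) ^+ 2 + s j ^+ 2 * ef j t ^+ 2 - (al - 1) * (ef j t * eq_ j t))))); last first.
    by apply/funext => t; ring.
  move=> hh; apply: der_eq hh _; rewrite (powRS al x0) /de /=.
  by move: (ef j x) (eq_ j x) (powR _ _) => A B C; ring.
have s2 : s j ^+ 2 != 0 by rewrite expf_neq0 // gt_eqF.
have e : eq_ j 1 ^+ 2 = 2 * s j ^+ 2.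
  rewrite /eq_ /ec mulr1 exprMn expr_div_n sqr_sqrtr // real_normK ?num_real //.
  by field; rewrite ks gt_eqF.
rewrite e in h; apply: (mulfI (x := 2 * s j ^+ 2)); last by rewrite mulr1.
by rewrite mulf_neq0.
Qed.

End Normalized.

(* Between zeros of [w], Jacobi's identity
   [r'^2 - sig^2 r^2 = (r' - r w'/w)^2 + x^(-al) (x^al r^2 w'/w)']. *)
Section Jacobi.
Variables (sig a b : R) (r dr : R -> R).
Hypotheses (sig0 : 0 < sig) (a0 : 0 <= a) (ab : a < b).
Hypothesis rD : forall x, is_derive x 1 r (dr x).
Hypothesis drc : continuous dr.
Let w x := y (sig * x).
Let p x := sig ^+ 2 * k (sig * x).
Hypothesis wab : forall x, a < x < b -> w x != 0.
Hypothesis Ha : a = 0 \/ [/\ w a = 0, k (sig * a) != 0 & r a = 0].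
Hypothesis Hb : [/\ w b = 0, k (sig * b) != 0 & r b = 0].

Let wD x : is_derive x 1 w (- (x * p x)). Proof. exact: ysc_der. Qed.
Let pc : continuous p. Proof. by apply: cfZ; exact: continuous_scale. Qed.
Let rc : continuous r. Proof. by move=> x; exact: der_continuous (rD x). Qed.
Let wc : continuous w. Proof. by move=> x; exact: der_continuous (wD x). Qed.

(** The flux [x^al r^2 w' / w], where [w' = - x p]. At a zero of [w] the convention [0^-1 = 0] gives
    [F = 0], which is its actual limit, because [r] vanishes there too. *)
Let F x := - (x `^ al * (x * p x)) * (r x ^+ 2 / w x).

Let F_cvg0 c : 0 < c -> w c = 0 -> k (sig * c) != 0 -> r c = 0 ->
  F x @[x --> c^'] --> F c.
Proof.
move=> c0 wc0 kc0 rc0.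
have -> : F c = - (c `^ al * (c * p c)) * 0 by rewrite /F wc0 invr0 !mulr0.
apply: cvgM.
  apply: cvg_trans (_ : - (x `^ al * (x * p x)) @[x --> c] --> _).
    by apply: cvg_app; exact: cvg_within.
  apply: cvgN; apply: cvgM; first exact: continuous_powR.
  by apply: cvgM; [exact: cvg_id|exact: pc].
apply: (sqr_div_cvg0 rD drc wD) => //.
  by move=> x; apply: cvgN; apply: cfM; [exact: cf_id|exact: pc].
rewrite oppr_eq0; apply: mulf_neq0; first by rewrite gt_eqF.
by apply: mulf_neq0 => //; rewrite expf_neq0 // gt_eqF.
Qed.

Lemma jacobi_ge0 :
  mu.-integrable `]a, b[ (EFin \o (fun x => (dr x ^+ 2 - sig ^+ 2 * r x ^+ 2) * x `^ al)) ->
  (0 <= \int[mu]_(x in `]a, b[) ((dr x ^+ 2 - sig ^+ 2 * r x ^+ 2) * x `^ al)%:E)%E.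
Proof.
move=> intf; have [wb kb rb] := Hb; have b0 : 0 < b by exact: le_lt_trans ab.
pose dF x := x `^ al * (- sig ^+ 2 * r x ^+ 2 - 2 * (x * p x) * (r x * dr x / w x)
   - (x * p x) ^+ 2 * (r x / w x) ^+ 2).
have Fb : F b = 0 by rewrite /F wb invr0 !mulr0.
have Fa : F a = 0.
  case: Ha => [->|[wa _ _]]; first by rewrite /F mul0r mulr0 oppr0 mul0r.
  by rewrite /F wa invr0 !mulr0.
have := @FTC_oo_le R (fun x => (dr x ^+ 2 - sig ^+ 2 * r x ^+ 2) * x `^ al) dF F a b ab.
rewrite Fb Fa subrr; apply => //.
- move=> x /andP[ax xb]; have x0 : 0 < x by exact: le_lt_trans ax.
  have wx : w x != 0 by apply: wab; rewrite ax.
  have := derM (derN (flux_der sig x0)) (derM (derX 2 (rD x)) (derV wx (wD x))).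
  move=> h; apply: der_eq h _; rewrite /dF -/(w x) -/(p x) /=.
  by move: (w x) wx (p x) (r x) (dr x) (powR _ _) => W W0 P r' d' A; field.
- move=> x /andP[ax xb]; have x0 : 0 < x by exact: le_lt_trans ax.
  have wx : w x != 0 by apply: wab; rewrite ax.
  have iw : {for x, continuous (fun t => (w t)^-1)} by apply: cvgV => //; exact: wc.
  have cxp : {for x, continuous (fun t => t * p t)} by apply: cvgM; [exact: cvg_id|exact: pc].
  apply: cvgM; first exact: continuous_powR.
  apply: cvgB; first apply: cvgB.
  + by apply: cvgMr; apply: (cfX rc).
  + apply: cvgM; first exact: cvgMr.
    by apply: cvgM => //; apply: cvgM; [exact: rc|exact: drc].
  + apply: cvgM.
      exact: sqr_continuous_at cxp.
    have c3 : {for x, continuous (fun t => r t / w t)} by apply: cvgM => //; exact: rc.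
    exact: sqr_continuous_at c3.
- move=> x /andP[ax xb]; have x0 : 0 < x by exact: le_lt_trans ax.
  apply: continuous_powRM => //; apply: cfB; first exact: cfX.
  by apply: cfZ; exact: cfX.
- move=> x /andP[ax xb]; rewrite /dF mulrC; apply: ler_wpM2r; first exact: powR_ge0.
  rewrite -subr_ge0.
  have -> : dr x ^+ 2 - sig ^+ 2 * r x ^+ 2 - (- sig ^+ 2 * r x ^+ 2 -
    2 * (x * p x) * (r x * dr x / w x) - (x * p x) ^+ 2 * (r x / w x) ^+ 2) =
    (dr x + x * p x * (r x / w x)) ^+ 2 by ring.
  exact: sqr_ge0.
- case: Ha => [a00|[wa ka ra]].
    rewrite a00; have h : x `^ al * (x * p x) * (r x ^+ 2 / w x) @[x --> 0^'+] --> 0 * (r 0 ^+ 2 / w 0).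
      apply: cvgM; first exact: cvg0_powRM.
      apply: cvg_at_right_filter; apply: cvgM; first exact: (cfX rc).
      by apply: cvgV; [rewrite /w mulr0|exact: wc].
    have hN : - (x `^ al * (x * p x) * (r x ^+ 2 / w x)) @[x --> 0^'+] -->
      - (0 * (r 0 ^+ 2 / w 0)) := cvgN h.
    rewrite mul0r oppr0 in hN.
    rewrite (_ : F = (fun x => - (x `^ al * (x * p x) * (r x ^+ 2 / w x)))); first exact: hN.
    by apply/funext => x; rewrite /F mulNr.
  have [a00|an0] := eqVneq a 0; last first.
    have ap : 0 < a by rewrite lt_neqAle eq_sym an0.
    rewrite -Fa; exact: cvg_dnbhs_at_right (F_cvg0 ap wa ka ra).
  by move: wa; rewrite a00 /w mulr0 => e; move: y0; rewrite e eqxx.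
- rewrite -Fb; exact: cvg_dnbhs_at_left (F_cvg0 b0 wb kb rb).
Qed.

End Jacobi.
End Eigenfunctions.

(** * Min-max principle *)

Section MinMax.
Context {R : realType}.
Notation mu := (@lebesgue_measure R).
Implicit Types (x z t a b sig : R) (i j n : nat) (g h : R -> R) (c : nat -> R).
Variables (kap : R) (y k : R -> R).
Hypothesis kap1 : -1 < 2 * kap.
Hypothesis yD : forall z, is_derive z 1 y (- (z * k z)).
Hypothesis kD : forall z, is_derive z 1 (fun t => t * k t) (y z - 2 * kap * k z).
Hypothesis kc : continuous k.
Hypothesis y0 : y 0 != 0.
Variable s : nat -> R.
Hypothesis s_mono : {homo s : m n / (m < n)%N >-> m < n}.
Hypothesis s_zero : forall z, 0 < z /\ y z = 0 <-> exists j, s j = z.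
Hypothesis ks : forall j, k (s j) != 0.
Notation al := (2 * kap).
Notation ef := (ef y k s).
Notation de := (de k s).

Let sgt0 j : 0 < s j. Proof. exact: s_gt0 s_zero j. Qed.
Let ys j : y (s j) = 0. Proof. exact: y_s s_zero j. Qed.
Let slt i j : (s i < s j) = (i < j)%N. Proof. exact: s_lt. Qed.
Let sinj i j : s i = s j -> i = j.
Proof.
move=> e; apply/eqP; rewrite eqn_leq -(s_le s_mono) -(s_le s_mono) e lexx //.
Qed.

Let efc j : continuous (ef j). Proof. exact: ef_cont. Qed.
Let dec j : continuous (de j). Proof. exact: de_cont. Qed.
Let efD j x : is_derive x 1 (ef j) (de j x). Proof. exact: ef_der. Qed.

Definition psum c n x := \sum_(i < n) c i * ef i x.
Definition dpsum c n x := \sum_(i < n) c i * de i x.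

Lemma psum_cont c n : continuous (psum c n).
Proof. by apply: continuous_sumf => i; exact: cfZ. Qed.

Lemma dpsum_cont c n : continuous (dpsum c n).
Proof. by apply: continuous_sumf => i; exact: cfZ. Qed.

Lemma psum_der c n x : is_derive x 1 (psum c n) (dpsum c n x).
Proof. by apply: der_sum => i; exact: derZ. Qed.

Lemma psum1 c n : psum c n 1 = 0.
Proof. by apply: big1 => i _; rewrite ef1 // mulr0. Qed.

Lemma wI_psum h c n : continuous h ->
  wI al (fun x => h x * psum c n x) = \sum_(i < n) c i * wI al (fun x => h x * ef i x).
Proof.
move=> ch.
rewrite (@eq_wI _ _ _ (fun x => \sum_(i < n) c i * (h x * ef i x))); last first.
  by move=> x _; rewrite mulr_sumr; apply: eq_bigr => i _; rewrite mulrCA.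
rewrite wI_sum //; last by move=> i; apply: cfZ; exact: cfM.
by apply: eq_bigr => i _; rewrite wI_Z //; exact: cfM.
Qed.

Lemma wI_dpsum h c n : continuous h ->
  wI al (fun x => h x * dpsum c n x) = \sum_(i < n) c i * wI al (fun x => h x * de i x).
Proof.
move=> ch.
rewrite (@eq_wI _ _ _ (fun x => \sum_(i < n) c i * (h x * de i x))); last first.
  by move=> x _; rewrite mulr_sumr; apply: eq_bigr => i _; rewrite mulrCA.
rewrite wI_sum //; last by move=> i; apply: cfZ; exact: cfM.
by apply: eq_bigr => i _; rewrite wI_Z //; exact: cfM.
Qed.

Lemma wI_orth i j : wI al (fun x => ef i x * ef j x) = (i == j)%:R.
Proof.
have [->|ij] := eqVneq i j; last exact: ef_orth.
transitivity (wI al (fun x => ef j x ^+ 2)); last exact: ef_norm.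
by apply: eq_wI => x _; rewrite expr2.
Qed.

Lemma wI_psum_ef c n j : (j < n)%N -> wI al (fun x => ef j x * psum c n x) = c j.
Proof.
move=> jn; rewrite wI_psum // (bigD1 (Ordinal jn)) //= big1 ?addr0.
  by rewrite wI_orth eqxx mulr1.
move=> i /negP ij; rewrite wI_orth; case: eqP => [e|_]; rewrite ?mulr0 //.
by exfalso; apply: ij; apply/eqP; exact: val_inj.
Qed.

Lemma wI_psum_sqr c n : wI al (fun x => psum c n x ^+ 2) = \sum_(i < n) c i ^+ 2.
Proof.
rewrite (@eq_wI _ _ _ (fun x => psum c n x * psum c n x)); last by move=> x _; rewrite expr2.
rewrite wI_psum; last exact: psum_cont.
apply: eq_bigr => i _; rewrite expr2; congr (_ * _); rewrite -[RHS](@wI_psum_ef c n i) //.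
by apply: eq_wI => x _; rewrite mulrC.
Qed.

Lemma wI_de g (dg : R -> R) j : (forall x, is_derive x 1 g (dg x)) -> continuous dg ->
  g 1 = 0 -> wI al (fun x => dg x * de j x) = s j ^+ 2 * wI al (fun x => g x * ef j x).
Proof.
move=> hg cdg g1.
have h : s j ^+ 2 * wI al (fun x => ef j x * g x) =
  eq_ k s j 1 * g 1 + wI al (fun x => de j x * dg x) by exact: wI_ibp.
rewrite g1 mulr0 add0r in h.
rewrite (@eq_wI _ _ _ (fun x => de j x * dg x)); last by move=> x _; rewrite mulrC.
rewrite -h //; congr (_ * _); apply: eq_wI => x _; by rewrite mulrC.
Qed.

Lemma wI_dpsum_sqr c n :
  wI al (fun x => dpsum c n x ^+ 2) = \sum_(i < n) c i ^+ 2 * s i ^+ 2.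
Proof.
rewrite (@eq_wI _ _ _ (fun x => dpsum c n x * dpsum c n x)); last by move=> x _; rewrite expr2.
rewrite wI_dpsum; last exact: dpsum_cont.
apply: eq_bigr => i _.
rewrite (@wI_de (psum c n) (dpsum c n) i (psum_der c n) (@dpsum_cont c n) (psum1 c n)).
rewrite (@eq_wI _ _ _ (fun x => ef i x * psum c n x)); last by move=> x _; rewrite mulrC.
by rewrite wI_psum_ef //; ring.
Qed.

Section Nodes.
Variables (n : nat) (r dr : R -> R).
Hypothesis rD : forall x, is_derive x 1 r (dr x).
Hypothesis drc : continuous dr.
Let sig := s n.
(** The left end 0, followed by the zeros [s m / s n] of [ef n] in []0, 1]]; the last one, [X n.+1],
    is 1. *)
Let X (m : nat) : R := if m is m'.+1 then s m' / sig else 0.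
Hypothesis rX : forall m, (m <= n)%N -> r (X m.+1) = 0.
Let f x := (dr x ^+ 2 - sig ^+ 2 * r x ^+ 2) * x `^ al.

Let sig0 : 0 < sig. Proof. exact: sgt0. Qed.
Let rc : continuous r. Proof. by move=> x; exact: der_continuous (rD x). Qed.
Let cint : continuous (fun x => dr x ^+ 2 - sig ^+ 2 * r x ^+ 2).
Proof. by apply: cfB; [exact: cfX|apply: cfZ; exact: cfX]. Qed.
Let intf : mu.-integrable `]0, 1[ (EFin \o f). Proof. exact: wI_integrable. Qed.

Let Xlt m : X m < X m.+1.
Proof.
case: m => [|m] /=; first by rewrite divr_gt0.
by rewrite ltr_pM2r ?invr_gt0 // slt.
Qed.
Let X_ge0 m : 0 <= X m.
Proof. by case: m => [|m] //=; rewrite divr_ge0 // ltW. Qed.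
Let Xn : X n.+1 = 1. Proof. by rewrite /X divff // gt_eqF. Qed.
Let X_le1 m : (m <= n)%N -> X m.+1 <= 1.
Proof. by move=> mn; rewrite /X ler_pdivrMr // mul1r (s_le s_mono). Qed.

Let sub m : (m <= n)%N -> (`]X m, X m.+1[%classic : set R) `<=` `]0, 1[%classic.
Proof.
move=> mn x /=; rewrite !in_itv /= => /andP[h1 h2]; apply/andP; split.
  exact: le_lt_trans h1.
by apply: (lt_le_trans h2); exact: X_le1.
Qed.

Let sX m : sig * X m.+1 = s m. Proof. by rewrite /X mulrC divfK // gt_eqF. Qed.

Let step m : (m <= n)%N -> 0 <= \int[mu]_(x in `]X m, X m.+1[) f x.
Proof.
move=> mn; rewrite /Rintegral fine_ge0 //.
apply: (@jacobi_ge0 _ kap y k _ yD kD kc _ sig _ _ r dr) => //.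
- move=> x /andP[h1 h2]; apply/negP => /eqP yx.
  have x0 : 0 < sig * x by rewrite mulr_gt0 //; exact: le_lt_trans h1.
  have [i hi] := (s_zero (sig * x)).1 (conj x0 yx).
  have h3 : s i < s m by rewrite hi mulrC -ltr_pdivlMr.
  have h4 : (i < m)%N by rewrite -slt.
  case: m mn h1 h2 h3 h4 => [|m] // mn h1 h2 h3; rewrite ltnS leqNgt -slt.
  by rewrite hi mulrC -ltr_pdivrMr // h1.
- case: m mn => [|m] mn; [by left|right; split].
  + by rewrite sX.
  + by rewrite sX.
  + by apply: rX; exact: ltnW.
- split.
  + by rewrite sX.
  + by rewrite sX.
  + exact: rX.
- by apply: integrableS intf => //; exact: sub.
Qed.

(** Jacobi's inequality on each of the [n + 1] nodal intervals of [ef n], in the interior of which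
    [ef n] has no zero, then summation. *)
Lemma nodes_ge0 : 0 <= wI al (fun x => dr x ^+ 2 - sig ^+ 2 * r x ^+ 2).
Proof.
suff H m : (m <= n.+1)%N -> 0 <= \int[mu]_(x in `]0, X m[) f x.
  by rewrite /wI -{1}Xn; exact: H.
elim: m => [|m IH] mn.
  rewrite (_ : `]0, X 0%N[%classic = set0) ?Rintegral_set0 //.
  by rewrite set_itv_ge // bnd_simp ltxx.
have m1 : (m <= n)%N by [].
have int1 : mu.-integrable `]0, X m.+1[ (EFin \o f).
  apply: integrableS intf => // x /=; rewrite !in_itv /= => /andP[-> h].
  by apply: (lt_le_trans h); exact: X_le1.
have := @Rintegral_itvB R f (BRight 0) (BLeft (X m.+1)) (X m) int1.
rewrite !bnd_simp => /(_ (X_ge0 m) (Xlt m)) h.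
rewrite -(subrK (\int[mu]_(x in `]0, X m]) f x) (\int[mu]_(x in `]0, X m.+1[) f x)) h.
apply: addr_ge0; first exact: step.
rewrite -Rintegral_itv_bndo_bndc; first by apply: IH; exact: leqW.
apply: integrableS int1 => // x /=; rewrite !in_itv /= => /andP[-> h'].
by apply: (lt_trans h'); exact: Xlt.
Qed.

End Nodes.

(* Some combination of the first [n] eigenfunctions interpolates [r] at the interior zeros of
   [ef n]; subtracting it reduces the claim to [nodes_ge0]. *)
Lemma minmax n (r dr : R -> R) :
  (forall x, is_derive x 1 r (dr x)) -> continuous dr -> r 1 = 0 ->
  (forall j, (j < n)%N -> wI al (fun x => r x * ef j x) = 0) ->
  s n ^+ 2 * wI al (fun x => r x ^+ 2) <= wI al (fun x => dr x ^+ 2).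
Proof.
move=> rD drc r1 orth; have rc : continuous r by move=> x; exact: der_continuous (rD x).
have sn0 := sgt0 n.
(* [nodes_ge0] applied to [r] minus its interpolant; by orthogonality the cross terms vanish, and
   the squares split into those of [r] and those of the coefficients. *)
have key c : (forall m, (m < n)%N -> r (s m / s n) = psum c n (s m / s n)) ->
    s n ^+ 2 * (wI al (fun x => r x ^+ 2) + \sum_(i < n) c i ^+ 2) <=
    wI al (fun x => dr x ^+ 2) + \sum_(i < n) c i ^+ 2 * s i ^+ 2.
  move=> hc.
  have cp := @psum_cont c n; have cdp := @dpsum_cont c n.
  have := @nodes_ge0 n (fun x => r x - psum c n x) (fun x => dr x - dpsum c n x).
  have hD x : is_derive x 1 (fun x => r x - psum c n x) (dr x - dpsum c n x).
    by apply: derB => //; exact: psum_der.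
  have hc' : continuous (fun x => dr x - dpsum c n x) by exact: cfB.
  have hX m : (m <= n)%N -> r (s m / s n) - psum c n (s m / s n) = 0.
    rewrite leq_eqVlt => /orP[/eqP ->|mn]; last by rewrite hc // subrr.
    by rewrite divff ?gt_eqF // r1 psum1 subrr.
  move=> /(_ hD hc' hX).
  have c1 : continuous (fun x => (dr x - dpsum c n x) ^+ 2) by exact: cfX.
  have c2 : continuous (fun x => (r x - psum c n x) ^+ 2) by apply: cfX; exact: cfB.
  rewrite wI_B ?wI_Z //; last exact: cfZ.
  have -> : wI al (fun x => (r x - psum c n x) ^+ 2) =
      wI al (fun x => r x ^+ 2) + \sum_(i < n) c i ^+ 2.
    rewrite (@eq_wI _ _ _ (fun x => r x ^+ 2 - 2 * (r x * psum c n x) + psum c n x ^+ 2)); last first.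
      by move=> x _; ring.
    have d1 := cfX (n := 2) rc; have d2 := cfM rc cp; have d3 := cfX (n := 2) cp.
    rewrite (wI_D kap1 (cfB d1 (cfZ (c := 2) d2)) d3) (wI_B kap1 d1 (cfZ (c := 2) d2)) wI_Z //.
    rewrite wI_psum_sqr wI_psum // big1 ?mulr0 ?subr0 // => i _.
    by rewrite orth // mulr0.
  have -> : wI al (fun x => (dr x - dpsum c n x) ^+ 2) =
      wI al (fun x => dr x ^+ 2) + \sum_(i < n) c i ^+ 2 * s i ^+ 2.
    rewrite (@eq_wI _ _ _ (fun x => dr x ^+ 2 - 2 * (dr x * dpsum c n x) + dpsum c n x ^+ 2)); last first.
      by move=> x _; ring.
    have d1 := cfX (n := 2) drc; have d2 := cfM drc cdp; have d3 := cfX (n := 2) cdp.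
    rewrite (wI_D kap1 (cfB d1 (cfZ (c := 2) d2)) d3) (wI_B kap1 d1 (cfZ (c := 2) d2)) wI_Z //.
    rewrite wI_dpsum_sqr wI_dpsum // big1 ?mulr0 ?subr0 // => i _.
    by rewrite (wI_de _ rD) // orth // !mulr0.
  by rewrite subr_ge0.
have [c hc] : exists c, forall m, (m < n)%N -> r (s m / s n) = psum c n (s m / s n).
  case: n sn0 orth key => [|n] sn0 orth key; first by exists (fun=> 0).
  pose M : 'M[R]_n.+1 := \matrix_(i < n.+1, m < n.+1) ef i (s m / s n.+1).
  (* The interpolation matrix is invertible: a combination with coefficients [c] that vanishes at
     every node gives, by [nodes_ge0], a nonnegative sum of the terms [c_i^2 (s_i^2 - s_(n+1)^2)],
     all of which are nonpositive, hence [c = 0]. *)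
  have rf : row_free M.
    apply: inj_row_free => v vM.
    pose c (i : nat) := v 0 (inord i).
    have cv (i : 'I_n.+1) : c i = v 0 i by rewrite /c inord_val.
    have h0 m : (m <= n.+1)%N -> psum c n.+1 (s m / s n.+1) = 0.
      rewrite leq_eqVlt => /orP[/eqP ->|mn].
        by rewrite divff ?gt_eqF // psum1.
      have := congr1 (fun A : 'rV[R]_n.+1 => A 0 (Ordinal mn)) vM.
      rewrite !mxE => e; rewrite -[RHS]e; apply: eq_bigr => i _.
      by rewrite !mxE cv.
    have := @nodes_ge0 n.+1 (psum c n.+1) (dpsum c n.+1) (psum_der c n.+1) (@dpsum_cont c n.+1) h0.
    have c1 := @psum_cont c n.+1; have c2 := @dpsum_cont c n.+1.
    have d1 := cfX (n := 2) c1; have d2 := cfX (n := 2) c2.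
    rewrite (wI_B kap1 d2 (cfZ (c := s n.+1 ^+ 2) d1)) wI_Z // wI_psum_sqr wI_dpsum_sqr.
    rewrite mulr_sumr -sumrB => hs.
    have hneg (i : 'I_n.+1) : c i ^+ 2 * s i ^+ 2 - s n.+1 ^+ 2 * c i ^+ 2 <= 0.
      rewrite mulrC -mulrBl mulr_le0_ge0 ?sqr_ge0 // subr_le0 lerXn2r ?nnegrE ?(ltW (sgt0 _)) //.
      by rewrite (s_le s_mono) ltnW.
    have hz : \sum_(i < n.+1) - (c i ^+ 2 * s i ^+ 2 - s n.+1 ^+ 2 * c i ^+ 2) = 0.
      apply: le_anti; rewrite sumrN oppr_le0 hs /= oppr_ge0.
      by apply: sumr_le0 => i _; exact: hneg.
    apply/rowP => i; rewrite mxE -cv.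
    have /eqP := hz; rewrite psumr_eq0; last by move=> j _; rewrite oppr_ge0.
    move=> /allP /(_ i (mem_index_enum _)) /=; rewrite oppr_eq0 mulrC -mulrBl mulf_eq0.
    case/orP; last by rewrite sqrf_eq0 => /eqP.
    rewrite subr_eq0 eqrXn2 ?(ltW (sgt0 _)) // => /eqP /sinj e.
    by have := ltn_ord i; rewrite {1}e ltnn.
  pose v : 'rV[R]_n.+1 := \row_m r (s m / s n.+1).
  pose u := v *m invmx M.
  exists (fun i => u 0 (inord i)) => m mn.
  have : u *m M = v by rewrite /u mulmxKV // -row_free_unit.
  move/(congr1 (fun A : 'rV[R]_n.+1 => A 0 (Ordinal mn))); rewrite !mxE => <-.
  by apply: eq_bigr => i _; rewrite !mxE inord_val.
(* The interpolating coefficients come with the favourable sign, since [s i <= s n] for [i < n]. *)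
have := key c hc; rewrite mulrDr mulr_sumr => h.
suff h2 : \sum_(i < n) c i ^+ 2 * s i ^+ 2 <= \sum_(i < n) s n ^+ 2 * c i ^+ 2 by lra.
apply: ler_sum => i _; rewrite mulrC ler_wpM2r ?sqr_ge0 //.
by rewrite lerXn2r ?nnegrE ?(ltW (sgt0 _)) // (s_le s_mono) ltnW.
Qed.

End MinMax.

(** * Finite propagation speed *)

Section FinitePropagation.
Context {R : realType}.
Implicit Types (x z t a b sig rho tau : R) (i j n : nat) (c : nat -> R).
Variables (kap : R) (y k : R -> R).
Hypothesis kap1 : -1 < 2 * kap.
Hypothesis yD : forall z, is_derive z 1 y (- (z * k z)).
Hypothesis kD : forall z, is_derive z 1 (fun t => t * k t) (y z - 2 * kap * k z).
Hypothesis kc : continuous k.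
Hypothesis y0 : y 0 != 0.
Variable s : nat -> R.
Hypothesis s_mono : {homo s : m n / (m < n)%N >-> m < n}.
Hypothesis s_zero : forall z, 0 < z /\ y z = 0 <-> exists j, s j = z.
Hypothesis ks : forall j, k (s j) != 0.
Notation al := (2 * kap).
Notation ef := (ef y k s).
Notation de := (de k s).
Notation psum := (psum y k s).
Notation dpsum := (dpsum k s).

Let sgt0 j : 0 < s j. Proof. exact: s_gt0 s_zero j. Qed.
Let ys j : y (s j) = 0. Proof. exact: y_s s_zero j. Qed.
Let efc j : continuous (ef j). Proof. exact: ef_cont. Qed.
Let dec j : continuous (de j). Proof. exact: de_cont. Qed.
Let efD j x : is_derive x 1 (ef j) (de j x). Proof. exact: ef_der. Qed.
Let pc c n : continuous (psum c n). Proof. exact: psum_cont. Qed.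
Let dpc c n : continuous (dpsum c n). Proof. exact: dpsum_cont. Qed.

Lemma wI_cont_bilinear (W : R -> R) (F G : nat -> R -> R) c (d : nat -> R) n : continuous W ->
  (forall i, continuous (F i)) -> (forall i, continuous (G i)) ->
  wI al (fun x => W x * ((\sum_(i < n) c i * F i x) * (\sum_(j < n) d j * G j x))) =
  \sum_(i < n) \sum_(j < n) c i * d j * wI al (fun x => W x * (F i x * G j x)).
Proof.
move=> cW cF cG.
have cc i j : continuous (fun x => W x * (F i x * G j x)) by apply: cfM => //; exact: cfM.
rewrite (@eq_wI _ _ _ (fun x => \sum_(i < n) \sum_(j < n) c i * d j * (W x * (F i x * G j x)))).
  rewrite wI_sum //; last by move=> i; apply: continuous_sumf => j; exact: cfZ.
  apply: eq_bigr => i _; rewrite wI_sum //; last by move=> j; exact: cfZ.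
  by apply: eq_bigr => j _; rewrite wI_Z.
move=> x _; rewrite mulr_suml mulr_sumr; apply: eq_bigr => i _.
by rewrite mulr_sumr mulr_sumr; apply: eq_bigr => j _; ring.
Qed.

Section Energy.
Variables (rho : R) (b : nat -> R) (n : nat).
Hypothesis rho0 : 0 <= rho.
Let ew x := expR (2 * rho * x).
Let ewD x : is_derive x 1 ew (2 * rho * ew x).
Proof.
apply: der_eq (der_comp (derZ (2 * rho) (der_id x)) (is_derive_expR _)) _.
by rewrite mulr1 mulrC.
Qed.
Let ewc : continuous ew. Proof. by move=> x; exact: der_continuous (ewD x). Qed.

(** Gram matrices for the weight [ew]. They turn the energy into a finite quadratic form in the
    coefficients, so that its time derivative involves no differentiation under the integral. *)
Let M i j := wI al (fun x => ew x * (ef i x * ef j x)).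
Let S i j := wI al (fun x => ew x * (de i x * de j x)).
Let N i j := wI al (fun x => ew x * (de i x * ef j x)).

Let Msym i j : M i j = M j i.
Proof. by apply: eq_wI => x _; ring. Qed.
Let Ssym i j : S i j = S j i.
Proof. by apply: eq_wI => x _; ring. Qed.

Let MSN i j : s i ^+ 2 * M i j = S i j + 2 * rho * N i j.
Proof.
have gD x : is_derive x 1 (fun x => ew x * ef j x) (2 * rho * ew x * ef j x + ew x * de j x).
  exact: derM.
have cg : continuous (fun x => 2 * rho * ew x * ef j x + ew x * de j x).
  by apply: cfD; apply: cfM => //; exact: cfZ.
have h : s i ^+ 2 * wI al (fun x => ef i x * (ew x * ef j x)) =
  eq_ k s i 1 * (ew 1 * ef j 1) +
  wI al (fun x => de i x * (2 * rho * ew x * ef j x + ew x * de j x)).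
  by apply: (@wI_ibp R kap y k _ _ _ _ s i (fun x => ew x * ef j x)).
rewrite ef1 // !mulr0 add0r in h.
rewrite /M (@eq_wI _ _ _ (fun x => ef i x * (ew x * ef j x))) ?h; last first.
  by move=> x _; ring.
rewrite (@eq_wI _ _ _ (fun x => ew x * (de i x * de j x) + 2 * rho * (ew x * (de i x * ef j x)))); last first.
  by move=> x _; ring.
have c1 : continuous (fun x => ew x * (de i x * de j x)) by do 2 apply: cfM => //.
have c2 : continuous (fun x => ew x * (de i x * ef j x)) by do 2 apply: cfM => //.
by rewrite wI_D ?wI_Z //; exact: cfZ.
Qed.

Definition cosc t i := b i * cos (s i * t).
(** The time derivative of [cosc], that is, the velocity of the wave started at rest with
    coefficients [b]; not to be confused with the function [sinc] below. *)
Definition sinc_ t i := - (b i * (s i * sin (s i * t))).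

Let cosD t i : is_derive t 1 (fun t => cosc t i) (sinc_ t i).
Proof.
apply: der_eq (derZ (b i) (der_comp (derZ (s i) (der_id t)) (is_derive_cos _))) _.
by rewrite /sinc_; ring.
Qed.

Let sinD t i : is_derive t 1 (fun t => sinc_ t i) (- (s i ^+ 2 * cosc t i)).
Proof.
have := derN (derZ (b i) (derZ (s i) (der_comp (derZ (s i) (der_id t)) (is_derive_sin (s i * t))))).
by move=> h; apply: der_eq h _; rewrite /cosc; ring.
Qed.

(* The weight [ew] makes the energy grow at most like [expR (2 * rho * t)]; letting [rho] tend
   to infinity confines the wave to the region [x <= y1 + t]. *)
Definition energy t := wI al (fun x => ew x * (psum (sinc_ t) n x ^+ 2 + dpsum (cosc t) n x ^+ 2)).

Let energyE t : energy t = \sum_(i < n) \sum_(j < n)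
  (sinc_ t i * sinc_ t j * M i j + cosc t i * cosc t j * S i j).
Proof.
rewrite /energy (@eq_wI _ _ _ (fun x => ew x * (psum (sinc_ t) n x * psum (sinc_ t) n x) +
   ew x * (dpsum (cosc t) n x * dpsum (cosc t) n x))); last by move=> x _; ring.
rewrite wI_D //; try by do 2 apply: cfM => //.
rewrite !wI_cont_bilinear // -big_split /=; apply: eq_bigr => i _.
by rewrite -big_split.
Qed.

Let cross t := wI al (fun x => ew x * (dpsum (cosc t) n x * psum (sinc_ t) n x)).

(** Conservation of energy up to the weight: after integration by parts only the terms where [ew] is
    differentiated remain. *)
Let energyD t : is_derive t 1 energy (- (4 * rho) * cross t).
Proof.
rewrite (_ : energy = fun t => \sum_(i < n) \sum_(j < n)
  (sinc_ t i * sinc_ t j * M i j + cosc t i * cosc t j * S i j)); last first.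
  by apply/funext => u; exact: energyE.
have h : is_derive t 1 (fun t => \sum_(i < n) \sum_(j < n)
    (sinc_ t i * sinc_ t j * M i j + cosc t i * cosc t j * S i j))
  (\sum_(i < n) \sum_(j < n)
    (((- (s i ^+ 2 * cosc t i)) * sinc_ t j + sinc_ t i * (- (s j ^+ 2 * cosc t j))) * M i j +
     (sinc_ t i * cosc t j + cosc t i * sinc_ t j) * S i j)).
  apply: der_sum => i; apply: der_sum => j.
  have hh := derD (derM (derM (sinD t i) (sinD t j)) (der_cst t (M i j)))
      (derM (derM (cosD t i) (cosD t j)) (der_cst t (S i j))).
  by apply: der_eq hh _; ring.
apply: der_eq h _.
have -> : - (4 * rho) * cross t = (- (2 * rho)) * cross t + (- (2 * rho)) * cross t by ring.
rewrite /cross wI_cont_bilinear //.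
rewrite [in X in _ = _ + X]exchange_big /= !mulr_sumr -big_split /=.
apply: eq_bigr => i _; rewrite !mulr_sumr -big_split /=; apply: eq_bigr => j _.
have e1 := MSN i j; have e2 := MSN j i; rewrite Msym Ssym in e2.
have -> : forall A B C D m u : R, (- (A * B) * C + D * - (u * m)) * M i j + (D * m + B * C) * S i j =
   - (B * C) * (A * M i j) - (D * m) * (u * M i j) + (D * m + B * C) * S i j by move=> *; ring.
rewrite -/(N i j) -/(N j i).
by rewrite e1 e2; ring.
Qed.

(** Since [- 4 rho u v <= 2 rho (u^2 + v^2)], the energy satisfies [energy' <= 2 rho energy]. The
    rate equals the exponent of the weight: this is propagation at speed 1. *)
Lemma energy_le t : 0 <= t -> energy t <= expR (2 * rho * t) * energy 0.
Proof.
move=> t0.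
have cw u : continuous (fun x => ew x * (psum (sinc_ u) n x ^+ 2 + dpsum (cosc u) n x ^+ 2)).
  by apply: cfM => //; apply: cfD; exact: cfX.
have hc u : - (4 * rho) * cross u <= 2 * rho * energy u.
  have : 0 <= wI al (fun x => ew x * (psum (sinc_ u) n x + dpsum (cosc u) n x) ^+ 2).
    by apply: wI_ge0 => x _; rewrite mulr_ge0 ?expR_ge0 ?sqr_ge0.
  rewrite (@eq_wI _ _ _ (fun x => ew x * (psum (sinc_ u) n x ^+ 2 + dpsum (cosc u) n x ^+ 2) +
     2 * (ew x * (dpsum (cosc u) n x * psum (sinc_ u) n x)))); last by move=> x _; ring.
  have c2 : continuous (fun x => ew x * (dpsum (cosc u) n x * psum (sinc_ u) n x)).
    by do 2 apply: cfM => //.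
  rewrite wI_D ?wI_Z //; last exact: cfZ.
  rewrite -/(energy u) -/(cross u) => h.
  have -> : - (4 * rho) * cross u = 2 * rho * (- (2 * cross u)) by ring.
  by apply: ler_wpM2l; [rewrite mulr_ge0|lra].
pose f u := - (energy u * expR (- (2 * rho * u))).
pose df u := - ((- (4 * rho) * cross u) * expR (- (2 * rho * u)) +
   energy u * (expR (- (2 * rho * u)) * - (2 * rho))).
have fD (u : R) : is_derive u 1 f (df u).
  have d := der_comp (derN (derZ (2 * rho) (der_id u))) (is_derive_expR (- (2 * rho * u))).
  rewrite mulr1 in d; exact: derN (derM (energyD u) d).
have : f 0 <= f t.
  apply: (@le_of_der_ge0 R f df 0 t t0) => // [|u _].
    by apply: continuous_subspaceT => u; exact: der_continuous (fD u).
  rewrite /df.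
  have -> : forall A B e : R, - (A * e + B * (e * - (2 * rho))) = e * (2 * rho * B - A).
    by move=> *; ring.
  by rewrite mulr_ge0 ?expR_ge0 // subr_ge0.
rewrite /f lerN2 mulr0 oppr0 expR0 mulr1 => h.
by rewrite -ler_pdivrMl ?expR_gt0 // -expRN mulrC.
Qed.

Lemma energy0 : energy 0 = wI al (fun x => ew x * dpsum b n x ^+ 2).
Proof.
apply: eq_wI => x _.
have -> : psum (sinc_ 0) n x = 0.
  by apply: big1 => i _; rewrite /sinc_ mulr0 sin0 !mulr0 oppr0 mul0r.
rewrite expr0n /= add0r; congr (_ * _ ^+ 2).
by apply: eq_bigr => i _; rewrite /cosc mulr0 cos0 mulr1.
Qed.

Lemma wI_ew_le (g : R -> R) x1 : continuous g -> (forall x, x < x1 -> g x = 0) ->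
  wI al (fun x => expR (- (2 * rho * x)) * g x ^+ 2) <=
  expR (- (2 * rho * x1)) * wI al (fun x => g x ^+ 2).
Proof.
move=> cg gx; have c1 := cfX (n := 2) cg.
have ec : continuous (fun x : R => expR (- (2 * rho * x))).
  by move=> x; exact: der_continuous (der_comp (derN (derZ (2 * rho) (der_id x))) (is_derive_expR _)).
rewrite -wI_Z //; apply: (wI_le kap1); [exact: cfM|exact: cfZ|].
move=> x _; have [xx|xx] := ltP x x1; first by rewrite gx // expr0n /= !mulr0.
apply: ler_wpM2r; first exact: sqr_ge0.
by rewrite ler_expR lerN2 ler_wpM2l // mulr_ge0.
Qed.

(** Cauchy-Schwarz after moving [exp (rho x)] onto the velocity and [exp (- rho x)] onto [g]; the
    support of [g] to the right of [x1] turns the latter into a gain. *)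
Lemma wI_speed_le (g : R -> R) t x1 : continuous g -> (forall x, x < x1 -> g x = 0) ->
  0 <= t ->
  wI al (fun x => psum (sinc_ t) n x * g x) ^+ 2 <=
  expR (2 * rho * (t - x1)) * wI al (fun x => g x ^+ 2) *
  wI al (fun x => ew x * dpsum b n x ^+ 2).
Proof.
move=> cg gx t0.
pose e1 x := expR (rho * x); pose e2 x := expR (- (rho * x)).
have e1c : continuous e1.
  by move=> x; exact: der_continuous (der_comp (derZ rho (der_id x)) (is_derive_expR _)).
have e2c : continuous e2.
  by move=> x; exact: der_continuous (der_comp (derN (derZ rho (der_id x))) (is_derive_expR _)).
have := @wI_cauchy R al kap1 (fun x => e1 x * psum (sinc_ t) n x) (fun x => e2 x * g x)
  (cfM e1c (@pc _ _)) (cfM e2c cg).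
rewrite (@eq_wI _ _ _ (fun x => psum (sinc_ t) n x * g x)); last first.
  move=> x _; rewrite /e1 /e2 expRN; field; exact: lt0r_neq0 (expR_gt0 _).
move=> h; apply: (le_trans h).
have h1 : wI al (fun x => (e1 x * psum (sinc_ t) n x) ^+ 2) <= energy t.
  apply: wI_le => //.
  - by apply: cfX; exact: cfM.
  - by apply: cfM => //; apply: cfD; exact: cfX.
  move=> x _; rewrite exprMn /ew /e1 -expRM_natl mulrA; apply: ler_wpM2l; first exact: expR_ge0.
  by rewrite lerDl sqr_ge0.
have h2 : wI al (fun x => (e2 x * g x) ^+ 2) <=
    expR (- (2 * rho * x1)) * wI al (fun x => g x ^+ 2).
  apply: le_trans (wI_ew_le cg gx).
  rewrite (@eq_wI _ _ _ (fun x => expR (- (2 * rho * x)) * g x ^+ 2)) //.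
  by move=> x _; rewrite exprMn /e2 -expRM_natl; congr (expR _ * _); ring.
have p0 (u : R -> R) : 0 <= wI al (fun x => u x ^+ 2) by apply: wI_ge0 => x _; exact: sqr_ge0.
apply: le_trans (ler_pM (p0 _) (p0 _) h1 h2) _.
rewrite mulrC -energy0.
have -> : 2 * rho * (t - x1) = 2 * rho * t + - (2 * rho * x1) by ring.
rewrite expRD.
have -> : forall A B C D : R, A * B * C * D = (B * C) * (A * D) by move=> *; ring.
by apply: ler_wpM2l; [rewrite mulr_ge0 ?expR_ge0|exact: energy_le].
Qed.

End Energy.

Section Domain.
Variables (f h Lf : R -> R) (y1 : R).
Hypothesis fD : forall x, is_derive x 1 f (- (x * h x)).
Hypothesis hc : continuous h.
Hypothesis Lfc : continuous Lf.
Hypothesis LfD : forall x, 0 < x ->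
  is_derive x 1 (fun t => t `^ al * (t * h t)) (Lf x * x `^ al).
Hypothesis h1 : h 1 = 0.
Hypothesis f1 : f 1 = 0.
Hypothesis fy : forall x, y1 < x -> f x = 0.
Hypothesis hy : forall x, y1 < x -> h x = 0.
Let b j := wI al (fun x => f x * ef j x).
Let df x := - (x * h x).
Let fc : continuous f. Proof. by move=> x; exact: der_continuous (fD x). Qed.
Let dfc : continuous df. Proof. by move=> x; apply: cvgN; apply: cfM; [exact: cf_id|exact: hc]. Qed.

(** Green's formula. [LfD] says in divergence form that [Lf = - f'' - (2 kap / x) f'], that is, [f]
    lies in the domain of the operator; the boundary term at 1 vanishes by [h1]. *)
Lemma wI_Lf (g dg : R -> R) : (forall x, is_derive x 1 g (dg x)) -> continuous dg ->
  wI al (fun x => Lf x * g x) = wI al (fun x => df x * dg x).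
Proof.
move=> gD dgc; have gc : continuous g by move=> x; exact: der_continuous (gD x).
have := @wI_flux _ kap kap1 (fun x => h x * g x) (fun x => Lf x * g x - df x * dg x).
have c1 : continuous (fun x => Lf x * g x) by exact: cfM.
have c2 : continuous (fun x => df x * dg x) by exact: cfM.
rewrite h1 mul0r wI_B // => H; apply/eqP; rewrite -subr_eq0; apply/eqP; apply: H.
- exact: cfM.
- exact: cfB.
move=> x /andP[x0 _]; have := derM (LfD x0) (gD x).
rewrite (_ : (fun t => _ * g t) = (fun t => t `^ al * (t * (h t * g t)))); last first.
  by apply/funext => t; ring.
by move=> h2; apply: der_eq h2 _; rewrite /df; ring.
Qed.

Lemma coef_Lf j : s j ^+ 2 * b j = wI al (fun x => Lf x * ef j x).
Proof.
rewrite (wI_Lf (efD j) (@dec j)).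
have e : wI al (fun x => df x * de j x) = s j ^+ 2 * b j by exact: wI_de.
by rewrite e.
Qed.

Let resid n := wI al (fun x => (df x - dpsum b n x) ^+ 2).

Lemma wI_rest_ef n j : (j < n)%N -> wI al (fun x => (f x - psum b n x) * ef j x) = 0.
Proof.
move=> jn; rewrite (@eq_wI _ _ _ (fun x => f x * ef j x - ef j x * psum b n x)); last first.
  by move=> x _; ring.
rewrite wI_B //; try exact: cfM.
have -> : wI al (fun x => ef j x * psum b n x) = b j by exact: wI_psum_ef.
by rewrite subrr.
Qed.

Let restD n x : is_derive x 1 (fun x => f x - psum b n x) (df x - dpsum b n x).
Proof. by apply: derB => //; exact: psum_der. Qed.

Let L2 := wI al (fun x => Lf x ^+ 2).
Let X n := wI al (fun x => (f x - psum b n x) ^+ 2).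

Let rest_le n : s n ^+ 2 * X n <= resid n.
Proof.
apply: (@minmax _ kap y k _ _ _ _ _ s _ _ _ n (fun x => f x - psum b n x)) => //.
- by apply: cfB => //; exact: dpc.
- by rewrite f1 psum1 // subrr.
- by move=> j; exact: wI_rest_ef.
Qed.

Let resid_sqr n : resid n ^+ 2 <= L2 * X n.
Proof.
have -> : resid n = wI al (fun x => Lf x * (f x - psum b n x)); last first.
  by apply: wI_cauchy => //; exact: cfB.
rewrite (wI_Lf (restD n)); last by apply: cfB => //; exact: dpc.
rewrite /resid (@eq_wI _ _ _ (fun x => df x * (df x - dpsum b n x) -
   (df x - dpsum b n x) * dpsum b n x)); last by move=> x _; ring.
have c1 : continuous (fun x => df x - dpsum b n x) by exact: cfB.
rewrite wI_B //; try exact: cfM.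
rewrite [X in _ - X](_ : _ = 0) ?subr0 //.
have -> : wI al (fun x => (df x - dpsum b n x) * dpsum b n x) =
  \sum_(i < n) b i * wI al (fun x => (df x - dpsum b n x) * de i x) by exact: wI_dpsum.
apply: big1 => i _.
have -> : wI al (fun x => (df x - dpsum b n x) * de i x) =
  s i ^+ 2 * wI al (fun x => (f x - psum b n x) * ef i x).
  by apply: wI_de => //; rewrite f1 psum1 // subrr.
by rewrite wI_rest_ef // !mulr0.
Qed.

(** Green's formula and orthogonality give [resid^2 <= L2 * X], the min-max principle gives
    [s_n^2 * X <= resid]; multiplying and dividing by [resid] proves convergence with a rate,
    without completeness. *)
Lemma resid_le n : resid n <= L2 / s n ^+ 2.
Proof.
have s2 : 0 < s n ^+ 2 by rewrite exprn_gt0.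
have L0 : 0 <= L2 by apply: wI_ge0 => x _; exact: sqr_ge0.
have [->|rn] := eqVneq (resid n) 0; first by rewrite divr_ge0 // ltW.
have r0 : 0 < resid n.
  by rewrite lt_neqAle eq_sym rn; apply: wI_ge0 => x _; exact: sqr_ge0.
rewrite ler_pdivlMr // -(ler_pM2l r0) mulrA -expr2.
apply: (@le_trans _ _ (L2 * X n * s n ^+ 2)).
  by apply: ler_wpM2r; [exact: ltW|exact: resid_sqr].
by rewrite -mulrA mulrC; apply: ler_wpM2r => //; rewrite mulrC; exact: rest_le.
Qed.

Lemma rest_norm_le n : X n <= L2 / s n ^+ 4.
Proof.
have s2 : 0 < s n ^+ 2 by rewrite exprn_gt0.
rewrite ler_pdivlMr ?exprn_gt0 // (exprM _ 2 2) expr2 mulrA -ler_pdivlMr //.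
by rewrite mulrC; apply: le_trans (rest_le n) (resid_le n).
Qed.

Lemma inv_s_small (K eps : R) : 0 <= K -> 0 < eps ->
  exists N : nat, forall n, (N <= n)%N -> K / s n ^+ 2 <= eps.
Proof.
move=> K0 e0; have [g [g0 hg]] : exists g, 0 < g /\ forall j, g * j.+1%:R <= s j.
  exact: (s_lower yD kD s_mono s_zero).
exists (Num.truncn (K / (g ^+ 2 * eps))).+1 => n hn.
have hK : K / (g ^+ 2 * eps) <= n.+1%:R.
  apply: ltW; apply: (lt_le_trans (truncnS_gt _)).
  by rewrite ler_nat leqW.
have g2 : 0 < g ^+ 2 by rewrite exprn_gt0.
rewrite ler_pdivrMr ?exprn_gt0 //.
rewrite ler_pdivrMr ?mulr_gt0 // in hK.
apply: (le_trans hK).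
have : (g * n.+1%:R) ^+ 2 <= s n ^+ 2.
  by rewrite lerXn2r ?nnegrE ?mulr_ge0 ?(ltW g0) ?(ltW (sgt0 n)).
move=> h3; have h4 : (n.+1%:R : R) <= n.+1%:R ^+ 2.
  by rewrite expr2 ler_peMr // ler1n.
have -> : n.+1%:R * (g ^+ 2 * eps) = eps * (g ^+ 2 * n.+1%:R) by ring.
apply: ler_wpM2l; first exact: ltW.
apply: le_trans h3; rewrite exprMn; apply: ler_wpM2l => //; exact: ltW.
Qed.

Section Pairing.
Variables (g : R -> R) (x1 t : R).
Hypothesis gc : continuous g.
Hypothesis gx : forall x, x < x1 -> g x = 0.
Hypothesis t0 : 0 <= t.
Hypothesis y1x1 : y1 + t < x1.
Let G := wI al (fun x => g x ^+ 2).
Let A := wI al (fun x => df x ^+ 2).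
Let Q rho n := expR (2 * rho * (t - x1)) * G *
  (2 * (expR (2 * rho * y1) * A + expR (2 * rho) * (L2 / s n ^+ 2))).
(** Pairing of [g] with the [n]-th partial sum of the wave started at [f], at time [u]. *)
Let Lam n u := \sum_(i < n) cosc b u i * wI al (fun x => g x * ef i x).

Let G0 : 0 <= G. Proof. by apply: wI_ge0 => x _; exact: sqr_ge0. Qed.
Let A0 : 0 <= A. Proof. by apply: wI_ge0 => x _; exact: sqr_ge0. Qed.
Let L20 : 0 <= L2. Proof. by apply: wI_ge0 => x _; exact: sqr_ge0. Qed.

(** The gradient of the partial sum is that of [f], supported in [x <= y1] and so weighing at most
    [exp (2 rho y1)], minus that of the remainder, for which the full weight [exp (2 rho)] is
    paid. *)
Let init_le rho n : 0 <= rho ->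
  wI al (fun x => expR (2 * rho * x) * dpsum b n x ^+ 2) <=
  2 * (expR (2 * rho * y1) * A + expR (2 * rho) * (L2 / s n ^+ 2)).
Proof.
move=> rho0.
have ec : continuous (fun x => expR (2 * rho * x)).
  by move=> x; exact: der_continuous (der_comp (derZ (2 * rho) (der_id x)) (is_derive_expR _)).
have c1 : continuous (fun x => df x ^+ 2) by exact: cfX.
have c2 : continuous (fun x => (df x - dpsum b n x) ^+ 2) by apply: cfX; exact: cfB.
apply: (@le_trans _ _ (2 * (expR (2 * rho * y1) * A + expR (2 * rho) * resid n))).
  rewrite -!wI_Z // -wI_D ?wI_Z //; try exact: cfZ.
  rewrite -wI_Z //; last by apply: cfD; exact: cfZ.
  apply: wI_le => //.
  - by apply: cfM => //; exact: cfX.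
  - by apply: cfZ; apply: cfD; exact: cfZ.
  move=> x /andP[x0 x1'].
  have h2 : dpsum b n x ^+ 2 <= 2 * (df x ^+ 2 + (df x - dpsum b n x) ^+ 2).
    move: (df x) (dpsum b n x) => u v; rewrite -subr_ge0.
    have -> : 2 * (u ^+ 2 + (u - v) ^+ 2) - v ^+ 2 = (2 * u - v) ^+ 2 by ring.
    exact: sqr_ge0.
  apply: (le_trans (ler_wpM2l (expR_ge0 _) h2)).
  rewrite mulrCA; apply: ler_wpM2l => //; rewrite mulrDr; apply: lerD.
    have [xy|xy] := leP x y1; last by rewrite /df hy // mulr0 oppr0 expr0n /= !mulr0.
    by apply: ler_wpM2r; rewrite ?sqr_ge0 // ler_expR ler_wpM2l // mulr_ge0.
  apply: ler_wpM2r; rewrite ?sqr_ge0 // ler_expR ler_piMr ?mulr_ge0 // ltW //.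
by apply: ler_wpM2l => //; rewrite lerD2l; apply: ler_wpM2l; rewrite ?expR_ge0 // resid_le.
Qed.

Let Lam_le rho n : 0 <= rho -> `|Lam n t - Lam n 0| <= t * Num.sqrt (Q rho n).
Proof.
move=> rho0.
pose dL (u : R) : R := \sum_(i < n) sinc_ b u i * wI al (fun x => g x * ef i x).
have LD (u : R) : is_derive u 1 (Lam n) (dL u).
  apply: der_sum => i.
  have d : is_derive u 1 (fun u => cosc b u i) (sinc_ b u i).
    apply: der_eq (derZ (b i) (der_comp (derZ (s i) (der_id u)) (is_derive_cos _))) _.
    by rewrite /sinc_; ring.
  by apply: der_eq (derM d (der_cst u _)) _; rewrite mulr0 addr0.
have dLE (u : R) : dL u = wI al (fun x => psum (sinc_ b u) n x * g x).
  rewrite (@eq_wI _ _ _ (fun x => g x * psum (sinc_ b u) n x)); last by move=> x _; rewrite mulrC.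
  by apply/esym; exact: wI_psum.
have hd (u : R) : 0 <= u -> u <= t -> `|dL u| <= Num.sqrt (Q rho n).
  move=> u0 ut; rewrite -sqrtr_sqr; apply: ler_wsqrtr; rewrite dLE.
  apply: (le_trans (wI_speed_le b n rho0 gc gx u0)).
  rewrite /Q; apply: ler_pM.
  - by rewrite mulr_ge0 ?expR_ge0.
  - by apply: wI_ge0 => x _; rewrite mulr_ge0 ?expR_ge0 ?sqr_ge0.
  - apply: ler_wpM2r => //; by rewrite ler_expR ler_wpM2l ?mulr_ge0 // lerB.
  - exact: init_le.
have Lc : {within `[0, t], continuous (Lam n)}.
  by apply: continuous_subspaceT => u; exact: der_continuous (LD u).
set q := Num.sqrt _ in hd *.
have hq1 : q * 0 - Lam n 0 <= q * t - Lam n t.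
  apply: (@le_of_der_ge0 R (fun u => q * u - Lam n u) (fun u => q * 1 - dL u) 0 t t0) => [|u].
  - by apply: continuous_subspaceT => u; exact: der_continuous (derB (derZ q (der_id u)) (LD u)).
  - move=> /andP[/ltW u0 /ltW ut]; have := hd u u0 ut; rewrite ler_norml => /andP[_ hh].
    by rewrite mulr1 subr_ge0.
have hq2 : q * 0 + Lam n 0 <= q * t + Lam n t.
  apply: (@le_of_der_ge0 R (fun u => q * u + Lam n u) (fun u => q * 1 + dL u) 0 t t0) => [|u].
  - by apply: continuous_subspaceT => u; exact: der_continuous (derD (derZ q (der_id u)) (LD u)).
  - move=> /andP[/ltW u0 /ltW ut]; have := hd u u0 ut; rewrite ler_norml => /andP[hh _].
    by rewrite mulr1; lra.
by rewrite ler_norml; apply/andP; split; lra.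
Qed.

(** At time 0 the supports of [f] and [g] are disjoint, so only the remainder of the expansion
    contributes. *)
Let Lam0_le n : `|Lam n 0| <= Num.sqrt (G * L2) / s n ^+ 2.
Proof.
have e : Lam n 0 = - wI al (fun x => g x * (f x - psum b n x)).
  rewrite (@eq_wI _ _ _ (fun x => g x * f x - g x * psum b n x)); last by move=> x _; ring.
  rewrite wI_B //; try exact: cfM.
  have -> : wI al (fun x => g x * f x) = 0.
    rewrite -[RHS](wI0 kap1); apply: eq_wI => x _; have [xx|xx] := ltP x x1.
      by rewrite gx // mul0r.
    rewrite fy ?mulr0 // (lt_le_trans _ xx) // (le_lt_trans _ y1x1) // lerDl //.
  rewrite sub0r opprK; transitivity (wI al (fun x => g x * psum b n x)) => //.
  have -> : wI al (fun x => g x * psum b n x) = \sum_(i < n) b i * wI al (fun x => g x * ef i x).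
    exact: wI_psum.
  by apply: eq_bigr => i _; rewrite /cosc mulr0 cos0 mulr1.
have s2 : 0 < s n ^+ 2 by rewrite exprn_gt0.
rewrite e normrN ler_pdivlMr //.
have -> : forall w0 : R, `|w0| * s n ^+ 2 = Num.sqrt ((w0 * s n ^+ 2) ^+ 2).
  by move=> w0; rewrite sqrtr_sqr normrM (ger0_norm (ltW s2)).
apply: ler_wsqrtr; rewrite exprMn.
have hw := wI_cauchy kap1 gc (cfB fc (@pc b n)).
have h2 := rest_norm_le n.
apply: (@le_trans _ _ (G * X n * (s n ^+ 2) ^+ 2)).
  by apply: ler_wpM2r => //; exact: sqr_ge0.
rewrite -mulrA; apply: ler_wpM2l => //; rewrite -exprM.
by rewrite ler_pdivlMr ?exprn_gt0 // in h2.
Qed.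

(** Order of choices: first [rho], with [u = 2 rho d] for the excess distance [d], so large that the
    main term, of order [exp (- u)], is small ([exp u >= u] suffices); then [n], large compared with
    the weight put on the remainder. *)
Lemma cos_propagation (eps : R) : 0 < eps ->
  exists N : nat, forall n, (N <= n)%N -> `|Lam n t| <= eps.
Proof.
move=> e0; pose e1 : R := eps / (2 * (t + 1)).
have t1 : 0 < t + 1 by exact: ltr_wpDl.
have e10 : 0 < e1 by rewrite divr_gt0 // mulr_gt0.
pose d := x1 - y1 - t; have d0 : 0 < d by rewrite /d subr_gt0 ltrBrDl.
pose u := 4 * (G * A) / e1 ^+ 2 + 1.
have GA : 0 <= G * A by exact: mulr_ge0.
have u0 : 0 < u.
  by apply: ltr_wpDl => //; apply: divr_ge0; [exact: mulr_ge0|exact: sqr_ge0].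
pose rho := u / (2 * d).
have rho0 : 0 <= rho by rewrite divr_ge0 ?mulr_ge0 // ltW.
have hA : expR (2 * rho * (t - x1)) * G * (2 * (expR (2 * rho * y1) * A)) <= e1 ^+ 2 / 2.
  have -> : forall a c : R, a * G * (2 * (c * A)) = 2 * (G * A) * (a * c) by move=> *; ring.
  rewrite -expRD.
  have -> : 2 * rho * (t - x1) + 2 * rho * y1 = - u.
    by rewrite /rho /d; field; rewrite gt_eqF.
  rewrite expRN ler_pdivrMr ?expR_gt0 //.
  apply: (@le_trans _ _ (e1 ^+ 2 / 2 * u)).
    rewrite /u; have -> : e1 ^+ 2 / 2 * (4 * (G * A) / e1 ^+ 2 + 1) = 2 * (G * A) + e1 ^+ 2 / 2.
      by field; rewrite gt_eqF.
    by rewrite lerDl divr_ge0 ?sqr_ge0.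
  apply: ler_wpM2l; first by rewrite divr_ge0 ?sqr_ge0.
  by apply: le_trans (expR_ge1Dx u); rewrite lerDr.
have e12 : 0 < e1 ^+ 2 / 2 by rewrite divr_gt0 ?exprn_gt0.
have K0 : 0 <= expR (2 * rho * (t - x1)) * G * (2 * (expR (2 * rho) * L2)).
  by rewrite !mulr_ge0 ?expR_ge0.
have [N1 hN1] := inv_s_small K0 e12.
have [N2 hN2] := inv_s_small (sqrtr_ge0 (G * L2)) (divr_gt0 e0 (ltr0n R 2)).
exists (maxn N1 N2) => n; rewrite geq_max => /andP[/hN1 k1 /hN2 k2].
have hQ : Num.sqrt (Q rho n) <= e1.
  rewrite -[leRHS](ger0_norm (ltW e10)) -sqrtr_sqr; apply: ler_wsqrtr.
  have -> : Q rho n = expR (2 * rho * (t - x1)) * G * (2 * (expR (2 * rho * y1) * A)) +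
     expR (2 * rho * (t - x1)) * G * (2 * (expR (2 * rho) * L2)) / s n ^+ 2.
    by rewrite /Q; field; rewrite gt_eqF.
  by lra.
have h3 := Lam_le n rho0; have h4 := Lam0_le n.
have h5 : t * Num.sqrt (Q rho n) <= eps / 2.
  apply: (@le_trans _ _ (t * e1)); first by apply: ler_wpM2l.
  rewrite /e1; have -> : eps / 2 = (t + 1) * (eps / (2 * (t + 1))) by field; rewrite gt_eqF.
  by apply: ler_wpM2r; [rewrite divr_ge0 ?mulr_ge0 // ltW|rewrite lerDl].
have h6 : `|Lam n t| <= `|Lam n t - Lam n 0| + `|Lam n 0|.
  by apply: le_trans (ler_normD _ _); rewrite subrK.
by lra.
Qed.

End Pairing.
End Domain.
End FinitePropagation.

(** * Integrals of continuous functions over segments *)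

Section SegmentIntegral.
Context {R : realType}.
Notation mu := (@lebesgue_measure R).
Implicit Types (f g w : R -> R) (a b c : R).

Definition cI a b f : R := \int[mu]_(x in `[a, b]) f x.

Lemma cI_integrable a b f : continuous f -> mu.-integrable `[a, b] (EFin \o f).
Proof.
move=> cf; apply: continuous_compact_integrable; first exact: segment_compact.
exact: continuous_subspaceT.
Qed.

Lemma cI_EFin a b f : continuous f ->
  (\int[mu]_(x in `[a, b]) (f x)%:E)%E = (cI a b f)%:E.
Proof.
move=> cf; rewrite /cI /Rintegral fineK //; apply: integrable_fin_num => //.
exact: cI_integrable.
Qed.

Lemma cI_D a b f g : continuous f -> continuous g ->
  cI a b (fun x => f x + g x) = cI a b f + cI a b g.
Proof. by move=> cf cg; rewrite /cI -RintegralD //; exact: cI_integrable. Qed.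

Lemma cI_Z a b c f : continuous f -> cI a b (fun x => c * f x) = c * cI a b f.
Proof. by move=> cf; rewrite /cI -RintegralZl //; exact: cI_integrable. Qed.

Lemma eq_cI a b f g : (forall x, a <= x <= b -> f x = g x) -> cI a b f = cI a b g.
Proof.
by move=> h; apply: eq_Rintegral => x; rewrite inE /= in_itv /= => /h ->.
Qed.

Lemma cI_sum a b n (F : nat -> R -> R) : (forall i, continuous (F i)) ->
  cI a b (fun x => \sum_(i < n) F i x) = \sum_(i < n) cI a b (F i).
Proof.
move=> h; elim: n => [|n IH].
  rewrite big_ord0 (@eq_cI _ _ _ (fun x => 0 * (fun=> 0) x)); last first.
    by move=> x _; rewrite big_ord0 mul0r.
  by rewrite cI_Z ?mul0r // => x; exact: cvg_cst.
rewrite big_ord_recr /= -IH -cI_D //; last exact: continuous_sumf.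
by apply: eq_cI => x _; rewrite big_ord_recr.
Qed.

Lemma cI_FTC a b f (F : R -> R) : a < b -> (forall x : R, is_derive x 1 F (f x)) -> continuous f ->
  cI a b f = F b - F a.
Proof.
move=> ab FD cf.
have [_ h] : mu.-integrable `[a, b] (EFin \o f) /\
  (\int[mu]_(x in `[a, b]) (f x)%:E)%E = (F b - F a)%:E.
  by apply: FTC_cc => // x _; exact: cf.
by rewrite /cI /Rintegral h.
Qed.

Lemma cI_cst a b c : a < b -> cI a b (fun=> c) = c * (b - a).
Proof.
move=> ab; have FD (x : R) : is_derive x 1 (fun t => c * t) c.
  by have h := derZ c (der_id x); apply: der_eq h _; rewrite mulr1.
have e := @cI_FTC a b (fun=> c) (fun t => c * t) ab FD (@cf_cst R c).
by rewrite e mulrBr.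
Qed.

End SegmentIntegral.

(** * Multipliers generated by cosines of bounded frequency *)

Section NullSums.
Context {R : realType}.
Notation mu := (@lebesgue_measure R).
Implicit Types (c q : nat -> R) (a b t h r z : R) (n j M : nat).

(* Sums over [j] are only used through their vanishing: [q] ranges over multipliers, [c j] is the
   product of the coefficients of two functions with distant supports. *)
Definition nullsum c q := (\sum_(j < n) c j * q j) @[n --> \oo] --> (0 : R).

Lemma nullsumD c q p : nullsum c q -> nullsum c p -> nullsum c (fun j => q j + p j).
Proof.
move=> hq hp.
have h : \sum_(j < n) c j * q j + \sum_(j < n) c j * p j @[n --> \oo] --> (0 + 0 : R).
  exact: (cvgD hq hp).
rewrite addr0 in h.
rewrite /nullsum (_ : (fun n => _) =
  (fun n => \sum_(j < n) c j * q j + \sum_(j < n) c j * p j)); first exact: h.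
by apply/funext => n; rewrite -big_split /=; apply: eq_bigr => j _; rewrite mulrDr.
Qed.

Lemma nullsumZ c q a : nullsum c q -> nullsum c (fun j => a * q j).
Proof.
move=> hq; have h : a * (\sum_(j < n) c j * q j) @[n --> \oo] --> a * 0 by exact: cvgMr.
rewrite mulr0 in h; rewrite /nullsum (_ : (fun n => _) = (fun n => a * (\sum_(j < n) c j * q j))); first exact: h.
by apply/funext => n; rewrite mulr_sumr; apply: eq_bigr => j _; rewrite mulrCA.
Qed.

Lemma nullsum_sum c (q : nat -> nat -> R) n : (forall i, (i < n)%N -> nullsum c (q i)) ->
  nullsum c (fun j => \sum_(i < n) q i j).
Proof.
elim: n => [|n IH] h.
  rewrite /nullsum (_ : (fun n => _) = cst 0); first exact: cvg_cst.
  by apply/funext => n; apply: big1 => j _; rewrite big_ord0 mulr0.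
rewrite (_ : (fun j => _) = (fun j => \sum_(i < n) q i j + q n j)); last first.
  by apply/funext => j; rewrite big_ord_recr.
by apply: nullsumD; [apply: IH => i /ltnW|]; apply: h.
Qed.

(** Dominated convergence in [r]: the partial sums are bounded by [B] uniformly in [n] and [r]. *)
Lemma nullsum_swap c (B : R) (w : R -> R) (q : R -> nat -> R) a b :
  (forall n, \sum_(j < n) `|c j| <= B) -> continuous w ->
  (forall j, continuous (fun r => q r j)) ->
  (forall r j, `|q r j| <= 1) ->
  (forall r, a <= r <= b -> nullsum c (q r)) ->
  nullsum c (fun j => cI a b (fun r => w r * q r j)).
Proof.
move=> hB cw cq q1 hq.
pose S n r := \sum_(j < n) c j * q r j.
have cS n : continuous (S n).
  by apply: continuous_sumf => j; apply: cfM; [move=> x; exact: cvg_cst|exact: cq].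
have cwS n : continuous (fun r => w r * S n r) by exact: cfM.
have B0 : 0 <= B by apply: le_trans (hB 0%N); rewrite big_ord0.
have hS n r : `|S n r| <= B.
  apply: le_trans (hB n); apply: (le_trans (ler_norm_sum _ _ _)).
  by apply: ler_sum => j _; rewrite normrM ler_piMr.
have [|||||_ _ H] := @dominated_convergence _ _ R mu `[a, b]%classic (measurable_itv _)
  (fun n r => (w r * S n r)%:E) (fun=> 0%E) (fun r => (`|w r| * B)%:E).
- by move=> n; apply: (measurable_int mu); exact: cI_integrable.
- exact: measurable_cst.
- apply: aeW => r; rewrite /= in_itv /= => rab.
  apply: cvg_EFin; first exact: nearW.
  by rewrite -(mulr0 (w r)); apply: cvgMr; exact: hq.
- apply: cI_integrable => x; apply: cvgM; last exact: cvg_cst.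
  by apply: cvg_norm; exact: cw.
- by apply: aeW => r n _; rewrite /= lee_fin normrM ler_wpM2l.
rewrite integral0 in H.
have {}H : (\sum_(j < n) c j * cI a b (fun r => w r * q r j))%:E @[n --> \oo] --> (0 : R)%:E.
  apply: cvg_trans H; apply: near_eq_cvg; apply: nearW => n /=.
  rewrite cI_EFin //; congr (_%:E).
  rewrite (@eq_cI _ _ _ _ (fun r => \sum_(j < n) c j * (w r * q r j))); last first.
    by move=> r _; rewrite /S mulr_sumr; apply: eq_bigr => j _; rewrite mulrCA.
  have cwq j : continuous (fun r => w r * q r j) by exact: cfM.
  rewrite (@cI_sum _ _ _ n (fun j r => c j * (w r * q r j))); last by move=> j; exact: cfZ.
  by apply: eq_bigr => j _; rewrite cI_Z.
by move/fine_cvg: H.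
Qed.

Definition sinc z : R := if z == 0 then 1 else sin z / z.

(** Averaging a cosine over times in [[t - h, t + h]] multiplies it by [sinc (h z)]. Each factor
    [sinc] therefore costs propagation time [h]. *)
Lemma sinc_avg h t z b :
  sinc (h * z) * cos (t * z + b) = cI (-1) 1 (fun r => 2^-1 * cos ((t + r * h) * z + b)).
Proof.
have N11 : -1 < 1 :> R by lra.
have ca : continuous (fun r => cos ((t + r * h) * z + b)).
  move=> r; have d := derD (derM (derD (der_cst r t) (derM (der_id r) (der_cst r h))) (der_cst r z)) (der_cst r b).
  exact: der_continuous (der_comp d (is_derive_cos _)).
rewrite cI_Z //; rewrite /sinc; case: ifPn => [/eqP hz|hz].
  rewrite (@eq_cI _ _ _ _ (fun=> cos (t * z + b))).
    by rewrite cI_cst // mul1r opprK; field.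
  move=> r _; congr cos; have -> : (t + r * h) * z + b = t * z + r * (h * z) + b by ring.
  by rewrite hz mulr0 addr0.
have FD (r : R) : is_derive r 1 (fun r => sin ((t + r * h) * z + b) / (h * z)) (cos ((t + r * h) * z + b)).
  have d := derD (derM (derD (der_cst r t) (derM (der_id r) (der_cst r h))) (der_cst r z)) (der_cst r b).
  have d2 := derM (der_comp d (is_derive_sin _)) (der_cst r (h * z)^-1).
  apply: der_eq d2 _; move: (cos _) (sin _) => C S; field.
  by move: hz; rewrite mulf_eq0 negb_or andbC.
rewrite (@cI_FTC _ (-1) 1 _ _ N11 FD ca).
have -> : (t + 1 * h) * z + b = (t * z + b) + h * z by ring.
have -> : (t + -1 * h) * z + b = (t * z + b) - h * z by ring.
rewrite sinD sinB; move: (sin _) (cos _) (cos (h * z)) (sin (h * z)) => A B C D.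
field.
by move: hz; rewrite mulf_eq0 negb_or andbC.
Qed.

Lemma sinc_norm z : `|sinc z| <= 1.
Proof.
have := @sinc_avg 1 0 z 0; rewrite mul0r add0r cos0 mulr1 mul1r => ->.
have N11 : -1 < 1 :> R by lra.
have ca : continuous (fun r : R => 2^-1 * cos ((0 + r * 1) * z + 0)).
  apply: cfZ => r; have d := derD (derM (derD (der_cst r 0) (derM (der_id r) (der_cst r 1))) (der_cst r z)) (der_cst r 0).
  exact: der_continuous (der_comp d (is_derive_cos _)).
rewrite /cI.
have h : (`|\int[mu]_(r in `[(-1)%R, 1%R]) (2^-1 * cos ((0 + r * 1) * z + 0))| <=
  \int[mu]_(r in `[(-1)%R, 1%R]) `|2^-1 * cos ((0 + r * 1) * z + 0)|)%R.
  by apply: le_normr_Rintegral => //; exact: cI_integrable.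
apply: (le_trans h).
have e1 : cI (-1) 1 (fun=> 2^-1 : R) = 1 by rewrite cI_cst //; field.
rewrite -[leRHS]e1; apply: le_Rintegral => //.
- by apply: cI_integrable => x; apply: cvg_norm; exact: ca.
- by apply: cI_integrable => x; exact: cvg_cst.
- move=> r _; rewrite normrM ger0_norm // ler_piMr //.
  by rewrite ler_norml; apply/andP; split; [exact: cos_geN1|exact: cos_le1].
Qed.

Lemma sinc_opp z : sinc (- z) = sinc z.
Proof. by rewrite /sinc oppr_eq0 sinN; case: ifP => // _; rewrite invrN mulrNN. Qed.

Definition sincM M h t b z := sinc (h * z) ^+ M * cos (t * z + b).

(** Only functions even in [s_j] are superpositions of [cos (t s_j)], hence the mean over [s_j] and
    [- s_j]. Induction on [M]: one more [sinc] widens the window of times by [h]. *)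
Lemma sinc_nullsum (s : nat -> R) c (B T : R) h :
  (forall n, \sum_(j < n) `|c j| <= B) -> 0 <= h ->
  (forall t, 0 <= t < T -> nullsum c (fun j => cos (s j * t))) ->
  forall M v t b, `|t| + M%:R * h < T ->
  nullsum c (fun j => 2^-1 * (sincM M h t b (s j - v) + sincM M h t b (- s j - v))).
Proof.
move=> hB h0 hT; elim=> [|M IH] v t b ht.
  rewrite (_ : (fun j => _) = (fun j => cos (- (t * v) + b) * cos (s j * `|t|))).
    by apply: nullsumZ; apply: hT; rewrite normr_ge0 /=; move: ht; rewrite mul0r addr0.
  apply/funext => j; rewrite /sincM !expr0 !mul1r.
  have -> : cos (s j * `|t|) = cos (t * s j).
    by rewrite mulrC; case: (ger0P t) => // _; rewrite mulNr cosN.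
  have -> : t * (s j - v) + b = (- (t * v) + b) + t * s j by ring.
  have -> : t * (- s j - v) + b = (- (t * v) + b) - t * s j by ring.
  by rewrite cosD cosB; field.
have N11 : -1 < 1 :> R by lra.
have ccos z : continuous (fun r => cos ((t + r * h) * z + b)).
  move=> r; have d := derD (derM (derD (der_cst r t) (derM (der_id r) (der_cst r h))) (der_cst r z)) (der_cst r b).
  exact: der_continuous (der_comp d (is_derive_cos _)).
have cG z : continuous (fun r => sincM M h (t + r * h) b z) by exact: cfZ.
rewrite (_ : (fun j => _) = (fun j => cI (-1) 1 (fun r => (fun=> 2^-1) r *
   (2^-1 * (sincM M h (t + r * h) b (s j - v) + sincM M h (t + r * h) b (- s j - v)))))).
  apply: (nullsum_swap hB).
  - by move=> x; exact: cvg_cst.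
  - by move=> j; apply: cfZ; apply: cfD.
  - move=> r j; rewrite normrM ger0_norm //.
    have hG z : `|sincM M h (t + r * h) b z| <= 1.
      rewrite normrM normrX mulr_ile1 ?exprn_ge0 //; first by rewrite exprn_ile1 ?sinc_norm.
      by rewrite ler_norml; apply/andP; split; [exact: cos_geN1|exact: cos_le1].
    have := le_trans (ler_normD _ _) (lerD (hG (s j - v)) (hG (- s j - v))).
    by move=> hh; rewrite mulrC ler_pdivrMr // mul1r; apply: (le_trans hh).
  - move=> r /andP[r1 r2]; apply: IH.
    apply: le_lt_trans ht; rewrite -natr1 mulrDl mul1r.
    have hr : `|r * h| <= h by rewrite normrM (ger0_norm h0) ler_piMl // ler_norml r1 r2.
    by have := ler_normD t (r * h); lra.
apply/funext => j.
have key z : sincM M.+1 h t b z = cI (-1) 1 (fun r => 2^-1 * sincM M h (t + r * h) b z).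
  rewrite /sincM exprSr -mulrA sinc_avg -cI_Z; last exact: cfZ.
  by apply: eq_cI => r _; rewrite mulrCA.
rewrite !key -cI_D; try exact: cfZ.
rewrite -cI_Z; last by apply: cfD; exact: cfZ.
by apply: eq_cI => r _; ring.
Qed.

End NullSums.

(** * Truncated powers, bumps and concentration at a point *)

Section PositivePart.
Context {R : realType}.
Implicit Types (v x : R) (n : nat).

Definition ppow n v : R := Num.max 0 v ^+ n.

Lemma continuous_max0 : continuous (fun v : R => Num.max 0 v).
Proof. by move=> v; apply: continuous_max; [exact: cvg_cst|exact: cvg_id]. Qed.

Lemma ppow_cont n : continuous (ppow n).
Proof. exact: cfX continuous_max0. Qed.

Lemma ppow_der n v : is_derive v 1 (ppow n.+2) (n.+2%:R * ppow n.+1 v).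
Proof.
rewrite /ppow; case: (ltrgtP v 0) => [v0|v0|->].
- rewrite expr0n mulr0.
  apply: der_eq_near (der_cst v 0) _; near=> t.
  by rewrite max_l ?expr0n // ltW //; near: t; exact: lt_nbhsl.
- have d := derX n.+2 (der_id v); rewrite mulr1 /= in d.
  apply: der_eq_near d _; near=> t.
  by rewrite max_r // ltW //; near: t; exact: lt_nbhsr.
- rewrite expr0n mulr0.
  apply/is_derive1_caratheodory; exists (ppow n.+1); split.
  + move=> z; rewrite /ppow maxxx expr0n !subr0 exprSr.
    case: (leP z 0) => z0; last by [].
    by rewrite expr0n /= !mul0r.
  + exact: ppow_cont.
  + by rewrite /ppow maxxx expr0n.
Unshelve. all: by end_near. Qed.

Lemma ppow_ge0 n v : 0 <= ppow n v.
Proof. by rewrite exprn_ge0 // le_max lexx. Qed.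

Lemma ppow_eq0 n v : v <= 0 -> ppow n.+1 v = 0.
Proof. by move=> v0; rewrite /ppow max_l // expr0n. Qed.

Lemma ppow_gt0 n v : 0 < v -> 0 < ppow n v.
Proof. by move=> v0; rewrite /ppow exprn_gt0 // lt_max v0 orbT. Qed.

End PositivePart.

Section Bumps.
Context {R : realType}.
Notation mu := (@lebesgue_measure R).
Implicit Types (x t eta om : R) (f g e : R -> R).
Variable (al : R).
Hypothesis al1 : -1 < al.

Lemma wI_gt0 f c : 0 < c < 1 -> continuous f -> (forall x, 0 < x < 1 -> 0 <= f x) ->
  0 < f c -> 0 < wI al f.
Proof.
move=> /andP[c0 c1] fc f0 fc0.
have [r r0 hr] : exists2 r : R, 0 < r & forall x, `|x - c| < r -> f c / 2 * (c `^ al / 2) < f x * x `^ al.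
  have h : {for c, continuous (fun t : R => f t * t `^ al)} by apply: continuous_powRM => //; exact: fc.
  have pc : 0 < c `^ al by exact: powR_gt0.
  have fpc : f c / 2 * (c `^ al / 2) < f c * c `^ al by nra.
  have := h _ (lt_nbhsr fpc).
  by move/nbhs_ballP => [r /= r0 hr]; exists r => // x hx; apply: hr; rewrite /ball /= distrC.
pose q := Num.min (r / 2) ((1 - c) / 2).
have q0 : 0 < q by rewrite lt_min; apply/andP; split; lra.
have [qr qc] : q <= r / 2 /\ q <= (1 - c) / 2 by split; rewrite ge_min lexx ?orbT.
set D := f c / 2 * (c `^ al / 2) in hr.
have D0 : 0 < D by rewrite /D; have := powR_gt0 al c0; nra.
have sub : (`[c, c + q]%classic : set R) `<=` `]0, 1[%classic.
  by move=> x /=; rewrite !in_itv /= => /andP[? ?]; apply/andP; split; lra.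
have int1 := wI_integrable al1 fc.
have h1 : (D * q)%:E = (\int[mu]_(x in `[c, (c + q)%R]) D%:E)%E.
  rewrite (integral_cst mu) // EFinM; congr (_ * _)%E.
  have m1 := @lebesgue_measure_itv R (Interval (BLeft c) (BRight (c + q))).
  by rewrite /= lte_fin ltrDl q0 -EFinD addrAC subrr add0r in m1; exact/esym.
have h2 : ((D * q)%:E <= \int[mu]_(x in `]0%R, 1%R[) (f x * x `^ al)%:E)%E.
  rewrite h1.
  apply: (@le_trans _ _ (\int[mu]_(x in `[c, (c + q)%R]) (f x * x `^ al)%:E)%E).
    apply: ge0_le_integral => //.
    - by move=> x _; rewrite lee_fin ltW.
    - apply: measurable_funS sub _ => //; exact: (measurable_int mu int1).
    - move=> x /=; rewrite in_itv /= => /andP[x1 x2]; rewrite lee_fin ltW // hr //.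
      by rewrite ger0_norm; lra.
  apply: ge0_subset_integral => //; first exact: (measurable_int mu int1).
  by move=> x /=; rewrite in_itv /= => hx; rewrite lee_fin mulr_ge0 ?powR_ge0 //; exact: f0.
rewrite /wI /Rintegral -lte_fin fineK; last exact: integrable_fin_num.
by apply: lt_le_trans h2; rewrite lte_fin mulr_gt0.
Qed.

Lemma wI_approx f e om c : continuous f -> continuous e -> (forall x, 0 < x < 1 -> 0 <= f x) ->
  (forall x, 0 < x < 1 -> f x != 0 -> `|e x - c| <= om) ->
  `|wI al (fun x => f x * e x) - c * wI al f| <= om * wI al f.
Proof.
move=> fc ec f0 h.
rewrite -(wI_Z al1 c fc) -wI_B //; [|exact: cfM|exact: cfZ].
have hx x : 0 < x < 1 -> `|f x * e x - c * f x| <= om * f x.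
  move=> x01; have [->|fx] := eqVneq (f x) 0; first by rewrite mul0r !mulr0 subr0 normr0.
  rewrite (_ : f x * e x - c * f x = (e x - c) * f x); last by ring.
  by rewrite normrM (ger0_norm (f0 _ x01)) ler_wpM2r ?f0 // h.
have cd : continuous (fun x => f x * e x - c * f x) by apply: cfB; [exact: cfM|exact: cfZ].
rewrite ler_norml; apply/andP; split.
  rewrite -mulNr -(wI_Z al1 (- om) fc); apply: wI_le => //; first exact: cfZ.
  by move=> x /hx; rewrite ler_norml => /andP[+ _]; rewrite mulNr.
rewrite -(wI_Z al1 om fc); apply: wI_le => //; first exact: cfZ.
by move=> x /hx; rewrite ler_norml => /andP[].
Qed.

Section Bump.
Variables (y0 eta : R).
Hypotheses (y00 : 0 < y0) (eta0 : 0 < eta).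
Let W x := (eta * y0) ^+ 2 - (x ^+ 2 - y0 ^+ 2) ^+ 2.
(** Through [W] a function of [x^2], so that its derivative is [- x] times the [C^1] function
    [bump_h]; the exponent 3 leaves [bump_L], the image under the operator, continuous. On [x > 0]
    the support lies within [eta] of [y0]. *)
Definition bumpf x := ppow 3 (W x).
Definition bump_h x := 12 * ppow 2 (W x) * (x ^+ 2 - y0 ^+ 2).
Let dh x := 12 * (2 * ppow 1 (W x) * (- (4 * x * (x ^+ 2 - y0 ^+ 2)))) * (x ^+ 2 - y0 ^+ 2) +
  12 * ppow 2 (W x) * (2 * x).
Definition bump_L x := (al + 1) * bump_h x + x * dh x.

Let WD x : is_derive x 1 W (- (4 * x * (x ^+ 2 - y0 ^+ 2))).
Proof.
have d := derB (der_cst x ((eta * y0) ^+ 2)) (derX 2 (derB (derX 2 (der_id x)) (der_cst x (y0 ^+ 2)))).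
by apply: der_eq d _; rewrite /=; ring.
Qed.

Let Wc : continuous W.
Proof. by move=> x; exact: der_continuous (WD x). Qed.

Let pc n : continuous (fun x => ppow n (W x)).
Proof. by move=> x; apply: continuous_comp; [exact: Wc|exact: ppow_cont]. Qed.

Let c2 : continuous (fun x => x ^+ 2 - y0 ^+ 2).
Proof. by apply: cfB; [apply: cfX; exact: cf_id|exact: cf_cst]. Qed.

Lemma bump_der x : is_derive x 1 bumpf (- (x * bump_h x)).
Proof.
have d := der_comp (WD x) (ppow_der 1 (W x)).
by apply: der_eq d _; rewrite /bump_h; ring.
Qed.

Lemma bump_h_cont : continuous bump_h.
Proof. by apply: cfM c2; apply: cfZ; exact: pc. Qed.

Lemma bump_cont : continuous bumpf.
Proof. exact: pc. Qed.

Let hD x : is_derive x 1 bump_h (dh x).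
Proof.
have d := derM (derZ 12 (der_comp (WD x) (ppow_der 0 (W x)))) (derB (derX 2 (der_id x)) (der_cst x (y0 ^+ 2))).
by apply: der_eq d _; rewrite /dh /=; ring.
Qed.

Lemma bump_L_cont : continuous bump_L.
Proof.
apply: cfD; first by apply: cfZ; exact: bump_h_cont.
apply: cfM; first exact: cf_id.
apply: cfD; last by apply: cfM; [apply: cfZ; exact: pc|apply: cfZ; exact: cf_id].
apply: cfM c2; apply: cfZ; apply: cfM; first by apply: cfZ; exact: pc.
have -> : (fun x => - (4 * x * (x ^+ 2 - y0 ^+ 2))) = (fun x => -4 * (x * (x ^+ 2 - y0 ^+ 2))).
  by apply/funext => x; ring.
by apply: cfZ; apply: cfM c2; exact: cf_id.
Qed.

Lemma bump_LD x : 0 < x ->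
  is_derive x 1 (fun t => t `^ al * (t * bump_h t)) (bump_L x * x `^ al).
Proof.
move=> x0; have d := derM (der_powR al x0) (derM (der_id x) (hD x)).
apply: der_eq d _; rewrite /bump_L (powRS al x0).
by move: (x `^ (al - 1)) (bump_h x) (dh x) => u v w; ring.
Qed.

Lemma bump_W x : 0 < x -> eta <= `|x - y0| -> W x <= 0.
Proof.
move=> x0 h; rewrite subr_le0 -[leRHS]real_normK ?num_real // lerXn2r ?nnegrE ?normr_ge0 //.
  by rewrite mulr_ge0 ?ltW.
rewrite (_ : x ^+ 2 - y0 ^+ 2 = (x - y0) * (x + y0)); last by ring.
rewrite normrM (@ger0_norm _ (x + y0)); last by rewrite addr_ge0 // ltW.
by apply: ler_pM => //; rewrite ?lerDr ltW.
Qed.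

Lemma bump_eq0 x : 0 < x -> eta <= `|x - y0| -> bumpf x = 0 /\ bump_h x = 0.
Proof. by move=> x0 h; rewrite /bumpf /bump_h !ppow_eq0 ?mulr0 ?mul0r //; exact: bump_W. Qed.

Lemma bump_ge0 x : 0 <= bumpf x. Proof. exact: ppow_ge0. Qed.

Lemma bump_gt0 : 0 < bumpf y0.
Proof.
by apply: ppow_gt0; rewrite /W subrr expr0n subr0 exprn_gt0 // mulr_gt0.
Qed.

End Bump.

Section Concentration.
Variables (bmp : R -> R -> R) (x0 : R) (e : R -> R).
Hypothesis x001 : 0 < x0 < 1.
Hypothesis ec : continuous e.
Hypothesis bc : forall eta, 0 < eta -> continuous (bmp eta).
Hypothesis b0 : forall eta x, 0 <= bmp eta x.
Hypothesis bpos : forall eta, 0 < eta -> 0 < bmp eta x0.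
Hypothesis bz : forall eta x, 0 < eta -> 0 < x -> eta <= `|x - x0| -> bmp eta x = 0.

Definition bmean eta := wI al (fun x => bmp eta x * e x) / wI al (bmp eta).

Let pos eta : 0 < eta -> 0 < wI al (bmp eta).
Proof. by move=> e0; apply: (wI_gt0 x001 (bc e0) _ (bpos e0)) => x _; exact: b0. Qed.

Let approx eta c om : 0 < eta ->
  (forall x, 0 < x < 1 -> `|x - x0| < eta -> `|e x - c| <= om) ->
  `|bmean eta - c| <= om.
Proof.
move=> e0 h; have p := pos e0.
have := @wI_approx _ e om c (bc e0) ec (fun x _ => b0 eta x).
have h2 x : 0 < x < 1 -> bmp eta x != 0 -> `|e x - c| <= om.
  move=> x01 bx; apply: h => //; rewrite ltNge; apply/negP => hx.
  by move: bx; rewrite bz ?eqxx //; case/andP: x01.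
move=> /(_ h2); rewrite /bmean; move: (wI al _) (wI al _) p => u v p hu.
have -> : u / v - c = (u - c * v) / v by field; rewrite gt_eqF.
by rewrite normrM normfV (gtr0_norm p) ler_pdivrMr.
Qed.

Lemma bmean_le eta C : 0 < eta ->
  (forall x, 0 < x < 1 -> `|x - x0| < eta -> `|e x| <= C) -> `|bmean eta| <= C.
Proof.
by move=> e0 h; rewrite -[bmean _]subr0; apply: approx => // x hx hx2; rewrite subr0 h.
Qed.

Lemma bmean_cvg : bmean eta @[eta --> 0^'+] --> e x0.
Proof.
apply/cvgrPdist_le => eps eps0.
have /cvgrPdist_le/(_ _ eps0)/nbhs_ballP[r /= r0 hr] := @ec x0.
near=> eta; rewrite distrC; apply: approx => // x _ hx.
rewrite distrC; apply: hr; rewrite /ball /= distrC.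
by apply: (lt_le_trans hx); near: eta; exact: nbhs_right_le.
Unshelve. all: by end_near. Qed.

End Concentration.

End Bumps.

Section Tent.
Context {R : realType}.
Implicit Types (x t : R).

(** Only one of two paired test functions has to lie in the domain of the operator; for the other
    one, continuity and small support suffice. *)
Definition tent (x0 eta t : R) : R := Num.max 0 (eta - `|t - x0|).

Lemma tent_cont x0 eta : continuous (tent x0 eta).
Proof.
move=> t; apply: (@continuous_comp _ _ _ (fun t => eta - `|t - x0|) (fun v => Num.max 0 v)); last exact: continuous_max0.
apply: cvgB; first exact: cvg_cst.
by apply: cvg_norm; apply: cvgB; [exact: cvg_id|exact: cvg_cst].
Qed.

Lemma tent_ge0 x0 eta t : 0 <= tent x0 eta t.
Proof. by rewrite le_max lexx. Qed.

Lemma tent_eq0 x0 eta t : eta <= `|t - x0| -> tent x0 eta t = 0.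
Proof. by move=> h; rewrite /tent max_l // subr_le0. Qed.

Lemma tent_gt0 x0 eta : 0 < eta -> 0 < tent x0 eta x0.
Proof. by move=> h; rewrite /tent subrr normr0 subr0 lt_max h orbT. Qed.

End Tent.

Lemma norm_le_split {R : realFieldType} (a b c e eps : R) : `|b| <= eps / 8 -> `|a| <= eps / 8 ->
  `|e + a| <= eps / 4 -> `|c - e| <= eps / 4 -> `|c + b| <= eps.
Proof.
rewrite !ler_norml => /andP[? ?] /andP[? ?] /andP[? ?] /andP[? ?]; apply/andP; split; lra.
Qed.

(** * From pairings of functions to kernels at two points *)

Section KernelPropagation.
Context {R : realType}.
Implicit Types (x z t a b eta : R) (i j n : nat) (c q : nat -> R).
Variables (kap : R) (y k : R -> R).
Hypothesis kap1 : -1 < 2 * kap.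
Hypothesis yD : forall z, is_derive z 1 y (- (z * k z)).
Hypothesis kD : forall z, is_derive z 1 (fun t => t * k t) (y z - 2 * kap * k z).
Hypothesis kc : continuous k.
Hypothesis y0 : y 0 != 0.
Variable s : nat -> R.
Hypothesis s_mono : {homo s : m n / (m < n)%N >-> m < n}.
Hypothesis s_zero : forall z, 0 < z /\ y z = 0 <-> exists j, s j = z.
Hypothesis ks : forall j, k (s j) != 0.
Notation al := (2 * kap).
Notation ef := (ef y k s).

Let sgt0 j : 0 < s j. Proof. exact: (s_gt0 s_zero). Qed.
Let ys j : y (s j) = 0. Proof. exact: (y_s s_zero). Qed.
Let slt i j : (s i < s j) = (i < j)%N. Proof. exact: s_lt. Qed.
Let sinj i j : s i = s j -> i = j.
Proof.
by move=> e; apply/eqP; move: (slt i j) (slt j i); rewrite e ltxx; case: ltngtP.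
Qed.
Let efc j : continuous (ef j). Proof. exact: ef_cont. Qed.

(** The upper bound for [uf] at [s_j x], divided by the lower bound of [vf_s_lower] for the
    normalization. *)
Lemma ef_le : exists C : R, 0 < C /\ forall j x, 0 < x -> x `^ kap * `|ef j x| <= C * Phi kap (s j * x).
Proof.
have [M [M0 hM]] := uf_le_Phi yD kD.
have [c [c0 hc]] := vf_s_lower yD kD s_mono s_zero.
exists (Num.sqrt 2 / c * M); split; first by rewrite mulr_gt0 // divr_gt0 ?sqrtr_gt0.
move=> j x x0; have sj := sgt0 j.
rewrite /ef normrM (ger0_norm (ltW (ec_gt0 sgt0 ks j))) /ec.
have := hM (s j * x) (mulr_gt0 sj x0); rewrite /uf normrM (ger0_norm (powR_ge0 _ _)) => hu.
have := hc j; have : 0 < `|s j * k (s j)| by rewrite normr_gt0 mulf_neq0 // gt_eqF.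
rewrite (powRM _ (ltW sj) (ltW x0)) in hu.
have pj : 0 < s j `^ kap by exact: powR_gt0.
move: `|s j * k (s j)| `|y (s j * x)| (x `^ kap) (s j `^ kap) (powR_ge0 x kap) pj hu (normr_ge0 (y (s j * x))) => D Y X S X0 S0 hu Y0 D0 hD.
have h2 : 0 <= Num.sqrt 2 :> R by rewrite sqrtr_ge0.
rewrite (_ : X * (Num.sqrt 2 / D * Y) = (Num.sqrt 2 / (S * D)) * (S * X * Y)); last first.
  by field; rewrite !gt_eqF.
rewrite -[leRHS]mulrA.
apply: ler_pM => //.
- by rewrite divr_ge0 // mulr_ge0 // ltW.
- by rewrite !mulr_ge0 // ltW.
- by rewrite ler_wpM2l // lef_pV2 // posrE mulr_gt0.
Qed.

Lemma ef_bounded a : 0 < a -> exists C : R, 0 < C /\ forall j x, a <= x -> x < 1 -> `|ef j x| <= C.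
Proof.
move=> a0; have [C [C0 hC]] := ef_le.
pose P := 1 + (s 0%N * a) `^ kap; pose Q := a `^ (- kap) + 1.
have sa : 0 < s 0%N * a by rewrite mulr_gt0.
have P0 : 0 < P by rewrite /P; have := powR_ge0 (s 0%N * a) kap; lra.
have Q0 : 0 < Q by rewrite /Q; have := powR_ge0 a (- kap); lra.
exists (Q * (C * P)); split; first by rewrite !mulr_gt0.
move=> j x ax x1; have x0 := lt_le_trans a0 ax.
have hx : 1 <= Q * x `^ kap.
  rewrite /Q; case: (leP 0 kap) => hk.
    have : 1 <= a `^ (- kap) * x `^ kap.
      by rewrite powRN mulrC ler_pdivlMr ?powR_gt0 // mul1r ge0_ler_powR // nnegrE ltW.
    by move=> h; rewrite mulrDl mul1r; have := powR_ge0 x kap; lra.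
  have : 1 <= x `^ kap.
    rewrite -(opprK kap) powRN invr_ge1 ?unitfE ?gt_eqF ?powR_gt0 //.
    apply: (@le_trans _ _ (1 `^ (- kap))); last by rewrite powR1.
    by apply: ge0_ler_powR; rewrite ?nnegrE ?oppr_ge0 ?ltW.
  by move=> h; rewrite mulrDl mul1r; have := mulr_ge0 (powR_ge0 a (-kap)) (powR_ge0 x kap); lra.
have hP : Phi kap (s j * x) <= P.
  rewrite /Phi /P; case: ifPn => h; last by have := powR_ge0 (s 0%N * a) kap; lra.
  have sax : s 0%N * a <= s j * x.
    by apply: ler_pM => //; [exact: ltW|exact: ltW|rewrite (s_le s_mono)].
  case: (leP 0 kap) => hk.
    apply: (@le_trans _ _ 1); last by have := powR_ge0 (s 0%N * a) kap; lra.
    apply: (@le_trans _ _ (1 `^ kap)); last by rewrite powR1.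
    by apply: ge0_ler_powR => //; rewrite nnegrE ?mulr_ge0 // ltW.
  apply: (@le_trans _ _ ((s 0%N * a) `^ kap)); last by lra.
  rewrite -(opprK kap) !(powRN _ (- kap)) lef_pV2 ?posrE ?powR_gt0 ?mulr_gt0 //.
  apply: ge0_ler_powR => //; rewrite ?nnegrE ?oppr_ge0 ?mulr_ge0 //; exact: ltW.
apply: (@le_trans _ _ (Q * x `^ kap * `|ef j x|)); first by rewrite ler_peMl.
rewrite -mulrA; apply: ler_wpM2l; first exact: ltW.
apply: (le_trans (hC j x x0)); apply: ler_wpM2l => //; exact: ltW.
Qed.

Lemma sum_inv_sqr_le n : \sum_(j < n) (j.+1%:R ^+ 2)^-1 <= 2 - 2 / (n%:R + 1) :> R.
Proof.
elim: n => [|n IH]; first by rewrite big_ord0 add0r invr1 mulr1 subrr.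
rewrite big_ord_recr /=; apply: (le_trans (lerD IH (lexx _))).
rewrite -[n.+1%:R]natr1.
have : 0 <= n%:R :> R by [].
move: (n%:R : R) => v v0.
rewrite -subr_ge0 (_ : _ - _ = v / ((v + 1) ^+ 2 * (v + 1 + 1))).
  by rewrite divr_ge0 // mulr_ge0 ?exprn_ge0 //; lra.
by field; apply/andP; split; rewrite gt_eqF //; lra.
Qed.

Lemma sum_inv_s_le : exists B : R, 0 < B /\ forall n, \sum_(j < n) (s j ^+ 2)^-1 <= B.
Proof.
have [g [g0 hg]] := s_lower yD kD s_mono s_zero.
exists (2 / g ^+ 2); split; first by rewrite divr_gt0 // exprn_gt0.
move=> n; apply: (@le_trans _ _ (\sum_(j < n) (j.+1%:R ^+ 2)^-1 / g ^+ 2)).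
  apply: ler_sum => j _; rewrite -invfM lef_pV2 ?posrE ?mulr_gt0 ?exprn_gt0 //.
  rewrite mulrC -exprMn lerXn2r ?nnegrE ?mulr_ge0 ?(ltW g0) ?(ltW (sgt0 j)) //.
rewrite -mulr_suml; apply: ler_wpM2r; first by rewrite invr_ge0 exprn_ge0 // ltW.
by apply: (le_trans (sum_inv_sqr_le n)); rewrite gerBl divr_ge0.
Qed.

Lemma tail_small (q : nat -> R) (B eps : R) : (forall n, \sum_(j < n) `|q j| <= B) -> 0 < eps ->
  exists m : nat, forall n, (m <= n)%N -> \sum_(m <= j < n) `|q j| <= eps.
Proof.
move=> qB eps0; pose u n : R := \sum_(0 <= j < n) `|q j|.
have und : nondecreasing_seq u.
  by move=> m n mn; rewrite /u (@big_cat_nat _ _ _ m 0%N n) //= lerDl sumr_ge0.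
have uB : has_ubound (range u).
  by exists B => _ [n _ <-]; rewrite /u big_mkord.
have cu := nondecreasing_cvgn und uB.
have ub n : u n <= sup (range u) by apply: ub_le_sup => //; exists n.
have /cvgrPdist_le/(_ _ eps0) [m _ hm] := cu.
exists m => n mn; have := hm m (leqnn m); have := ub n.
rewrite {1}/u (@big_cat_nat _ _ _ m 0%N n) //= -/(u m) ger0_norm ?subr_ge0 //.
by move: (sup _) (u m) (\sum_(m <= i < n) _) => a b c; lra.
Qed.

(* Any multiplier [q] built from [cos (s j * t)], [t < T], annihilates pairings of
   functions at distance more than [T]; letting them concentrate at two points gives
   the same for the kernel of [q]. *)
Lemma kernel_propagation (q : nat -> R) (T B x1 x2 : R) :
  0 < x1 -> x1 + T < x2 -> x2 < 1 -> 0 <= T ->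
  (forall n, \sum_(j < n) `|q j| <= B) ->
  (forall (c : nat -> R) (B' : R), (forall n, \sum_(j < n) `|c j| <= B') ->
     (forall t, 0 <= t < T -> nullsum c (fun j => cos (s j * t))) -> nullsum c q) ->
  \sum_(j < n) q j * (ef j x1 * ef j x2) @[n --> \oo] --> (0 : R).
Proof.
move=> x10 x12 x21 T0 qB hq.
have x20 : 0 < x2 by lra.
(* Supports of radius [d] around [x1] and [x2] stay more than [T] apart and at distance at least
   [x1 / 2] from 0. *)
pose d := Num.min ((x2 - x1 - T) / 3) (x1 / 2).
have d0 : 0 < d by rewrite lt_min; apply/andP; split; lra.
have [d1 d2] : d <= (x2 - x1 - T) / 3 /\ d <= x1 / 2 by split; rewrite ge_min lexx ?orbT.
have x1h : 0 < x1 / 2 by lra.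
have [C [C0 hC]] := ef_bounded x1h.
have pairing0 eta : 0 < eta -> eta <= d ->
  nullsum (fun j => wI al (fun x => bumpf x1 eta x * ef j x) * wI al (fun x => tent x2 eta x * ef j x)) q.
  move=> eta0 etad.
  set f := bumpf x1 eta; set g := tent x2 eta.
  have fz x : x1 + eta < x -> f x = 0 /\ bump_h x1 eta x = 0.
    by move=> hx; apply: bump_eq0; rewrite ?ger0_norm; lra.
  have gz x : x < x2 - eta -> g x = 0.
    by move=> hx; apply: tent_eq0; rewrite ler0_norm; lra.
  have [f1 h1] := fz 1 ltac:(lra).
  have Lc := @bump_L_cont R al x1 eta.
  have gc := @tent_cont R x2 eta.
  have cL := coef_Lf kap1 yD kD kc s (bump_der x1 eta) (bump_h_cont (y0 := x1) (eta := eta)) Lc (bump_LD al x1 eta) h1 f1.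
  have [B2 [B20 hB2]] := sum_inv_s_le.
  set L2 := wI al (fun x => bump_L al x1 eta x ^+ 2) in cL *.
  set G2 := wI al (fun x => g x ^+ 2).
  have cs (w : R -> R) j : continuous w -> `|wI al (fun x => w x * ef j x)| <= Num.sqrt (wI al (fun x => w x ^+ 2)).
    move=> wc; rewrite -sqrtr_sqr ler_sqrt; last by apply: wI_ge0 => x _; exact: sqr_ge0.
    have := wI_cauchy kap1 wc (@efc j).
    by rewrite (ef_norm kap1 yD kD kc sgt0 ys ks) mulr1.
  (* The bump lies in the domain, so its coefficients are [O(s_j^(-2))]; those of the tent are
     bounded. The products are thus absolutely summable. *)
  apply: (hq _ (Num.sqrt L2 * Num.sqrt G2 * B2)).
    move=> n; apply: (@le_trans _ _ (\sum_(j < n) Num.sqrt L2 * Num.sqrt G2 * (s j ^+ 2)^-1)).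
      apply: ler_sum => j _; rewrite normrM.
      have s20 : 0 < s j ^+ 2 by rewrite exprn_gt0.
      rewrite mulrAC; apply: ler_pM => //; last exact: cs.
      by rewrite ler_pdivlMr // mulrC -{1}(ger0_norm (ltW s20)) -normrM cL; exact: cs.
    by rewrite -mulr_sumr; apply: ler_wpM2l.
  move=> t /andP[t0 tT]; apply/cvgrPdist_le => eps eps0.
  have lt12 : x1 + eta + t < x2 - eta by lra.
  have [N hN] := @cos_propagation _ _ _ _ kap1 yD kD kc y0 _ s_mono s_zero ks _ _ _ (x1 + eta)
     (bump_der x1 eta) (bump_h_cont (y0 := x1) (eta := eta)) Lc (bump_LD al x1 eta) h1 f1
     (fun x hx => (fz x hx).1) (fun x hx => (fz x hx).2) g (x2 - eta) t gc gz t0 lt12 eps eps0.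
  exists N => // n /= /hN; rewrite sub0r normrN; apply: le_trans; rewrite le_eqVlt; apply/orP; left; apply/eqP; congr normr.
  by apply: eq_bigr => j _; rewrite /cosc mulrAC.
pose F j := bmean al (bumpf x1) (ef j); pose G j := bmean al (tent x2) (ef j).
have x101 : 0 < x1 < 1 by rewrite x10 /=; lra.
have x201 : 0 < x2 < 1 by rewrite x20 /=; lra.
have hC1 j : `|ef j x1| <= C by apply: hC; lra.
have hC2 j : `|ef j x2| <= C by apply: hC; lra.
have F_le j eta : 0 < eta -> eta <= d -> `|F j eta| <= C.
  move=> e0 ed; apply: (bmean_le kap1 x101 (@efc j)) => //.
  - by move=> ? _; exact: bump_cont.
  - by move=> *; exact: bump_ge0.
  - by move=> *; exact: bump_gt0.
  - by move=> ? ? ? ? h; exact: (bump_eq0 _ _ _ h).1.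
  - by move=> x /andP[_ xl1]; rewrite ltr_norml => /andP[hx _]; apply: hC => //; lra.
have G_le j eta : 0 < eta -> eta <= d -> `|G j eta| <= C.
  move=> e0 ed; apply: (bmean_le kap1 x201 (@efc j)) => //.
  - by move=> ? _; exact: tent_cont.
  - by move=> *; exact: tent_ge0.
  - by move=> *; exact: tent_gt0.
  - by move=> ? ? ? _; exact: tent_eq0.
  - by move=> x /andP[_ xl1]; rewrite ltr_norml => /andP[hx _]; apply: hC => //; lra.
have F_cvg j : F j eta @[eta --> 0^'+] --> ef j x1.
  apply: (bmean_cvg kap1 x101 (@efc j)) => //.
  - by move=> ? _; exact: bump_cont.
  - by move=> *; exact: bump_ge0.
  - by move=> *; exact: bump_gt0.
  - by move=> ? ? ? ? h; exact: (bump_eq0 _ _ _ h).1.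
have G_cvg j : G j eta @[eta --> 0^'+] --> ef j x2.
  apply: (bmean_cvg kap1 x201 (@efc j)) => //.
  - by move=> ? _; exact: tent_cont.
  - by move=> *; exact: tent_ge0.
  - by move=> *; exact: tent_gt0.
  - by move=> ? ? ? _; exact: tent_eq0.
have FG0 eta : 0 < eta -> eta <= d -> \sum_(j < n) q j * (F j eta * G j eta) @[n --> \oo] --> (0 : R).
  move=> e0 ed; have h := pairing0 eta e0 ed.
  pose w := (wI al (bumpf x1 eta))^-1 * (wI al (tent x2 eta))^-1.
  have h2 : w * (\sum_(j < n) wI al (fun x => bumpf x1 eta x * ef j x) * wI al (fun x => tent x2 eta x * ef j x) * q j) @[n --> \oo] --> w * 0.
    by apply: cvgMr; exact: h.
  rewrite mulr0 in h2; apply: cvg_trans h2; apply: near_eq_cvg; apply: nearW => n /=.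
  by rewrite mulr_sumr; apply: eq_bigr => j _; rewrite /F /G /bmean /w; ring.
apply/cvgrPdist_le => eps eps0.
have C20 : 0 < 8 * C ^+ 2 by rewrite mulr_gt0 ?exprn_gt0.
(* The limits in [n] and in [eta] are exchanged by cutting at [m]: the tail is small uniformly in
   [eta], because [q] is summable and all means are bounded by [C], and finitely many terms converge
   as [eta] tends to 0. *)
have [m hm] := tail_small qB (divr_gt0 eps0 C20).
have : \sum_(j < m) q j * (F j eta * G j eta) @[eta --> 0^'+] --> \sum_(j < m) q j * (ef j x1 * ef j x2).
  elim: (m) => [|p IH].
    rewrite big_ord0 (_ : (fun eta => _) = fun=> 0); first exact: cvg_cst.
    by apply/funext => eta; rewrite big_ord0.
  rewrite big_ord_recr /= (_ : (fun eta => _) =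
    fun eta => \sum_(j < p) q j * (F j eta * G j eta) + q p * (F p eta * G p eta)).
    by apply: cvgD => //; apply: cvgMr; exact: cvgM.
  by apply/funext => eta; rewrite big_ord_recr.
have eps4 : 0 < eps / 4 by lra.
move=> /cvgrPdist_le/(_ _ eps4) hfin.
have [eta [e0 ed hfin2]] : exists eta, [/\ 0 < eta, eta <= d & `|\sum_(j < m) q j * (ef j x1 * ef j x2) - \sum_(j < m) q j * (F j eta * G j eta)| <= eps / 4].
  have [eta h] : exists eta, [/\ 0 < eta, eta <= d & `|\sum_(j < m) q j * (ef j x1 * ef j x2) - \sum_(j < m) q j * (F j eta * G j eta)| <= eps / 4].
    apply: (@filter_ex _ (0^'+ : set_system R)); near=> eta; split.
    - by [].
    - by near: eta; exact: nbhs_right_le.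
    - by near: eta.
  by exists eta.
have /cvgrPdist_le/(_ _ eps4) hlim := FG0 eta e0 ed.
near=> n.
have mn : (m <= n)%N by near: n; exact: nbhs_infty_ge.
have hl : `|0 - \sum_(j < n) q j * (F j eta * G j eta)| <= eps / 4 by near: n.
rewrite sub0r normrN; rewrite sub0r normrN in hl.
have tail (v : nat -> R) : (forall j, `|v j| <= C ^+ 2) -> `|\sum_(m <= j < n) q j * v j| <= eps / 8.
  move=> hv; apply: (le_trans (ler_norm_sum _ _ _)).
  apply: (@le_trans _ _ (\sum_(m <= j < n) `|q j| * C ^+ 2)).
    by apply: ler_sum => j _; rewrite normrM ler_wpM2l.
  rewrite -mulr_suml.
  apply: (@le_trans _ _ (eps / (8 * C ^+ 2) * C ^+ 2)).
    by apply: ler_wpM2r; [exact: sqr_ge0|exact: hm].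
  by rewrite le_eqVlt; apply/orP; left; apply/eqP; field; rewrite gt_eqF.
have t1 := tail (fun j => ef j x1 * ef j x2).
have t2 := tail (fun j => F j eta * G j eta).
have {}t1 : `|\sum_(m <= j < n) q j * (ef j x1 * ef j x2)| <= eps / 8.
  by apply: t1 => j; rewrite normrM expr2; apply: ler_pM; [exact: normr_ge0|exact: normr_ge0|exact: hC1|exact: hC2].
have {}t2 : `|\sum_(m <= j < n) q j * (F j eta * G j eta)| <= eps / 8.
  by apply: t2 => j; rewrite normrM expr2; apply: ler_pM => //; [exact: F_le|exact: G_le].
move: hl hfin2; rewrite -!(big_mkord xpredT (fun j => q j * (ef j x1 * ef j x2))) -!(big_mkord xpredT (fun j => q j * (F j eta * G j eta))).
rewrite !(@big_cat_nat _ _ _ m 0%N n) //=.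
move: t1 t2; move: (\sum_(m <= i < n) _) (\sum_(m <= i < n) _) (\sum_(0 <= i < m) _) (\sum_(0 <= i < m) _) => a b c e.
exact: norm_le_split.
Unshelve. all: by end_near. Qed.

End KernelPropagation.

(** * The Riesz multiplier *)

Section FiniteDifferences.
Context {R : realType}.
Implicit Types (x t a b w r B : R) (f : R -> R) (K k : nat) (g : nat -> R -> R).

Fixpoint dif K w f x : R :=
  if K is K'.+1 then dif K' w (fun t => f (t + w) - f t) x else f x.

(** The coefficient at [k = 0] is made explicit because it isolates [f x] from the values at the
    other points, which will be averaged. *)
Lemma dif_expand K : exists a : nat -> R, a 0%N = (-1) ^+ K /\
  forall w f x, dif K w f x = \sum_(k < K.+1) a k * f (x + k%:R * w).
Proof.
elim: K => [|K [a [a0 IH]]].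
  exists (fun=> 1); split => // w f x.
  by rewrite big_ord_recr big_ord0 /= add0r mul1r mul0r addr0.
exists (fun k => (if k is k'.+1 then a k' else 0) - (if (k <= K)%N then a k else 0)).
split=> [|w f x /=]; first by rewrite leq0n sub0r a0 exprS mulN1r.
rewrite IH (eq_bigr (fun k : 'I_K.+1 => a k * f (x + k%:R * w + w) - a k * f (x + k%:R * w))); last first.
  by move=> i _; rewrite mulrBr.
rewrite sumrB; under [in RHS]eq_bigr do rewrite mulrBl.
rewrite sumrB; congr (_ - _).
  rewrite [RHS]big_ord_recl /= mul0r add0r; apply: eq_bigr => i _.
  rewrite /bump /=; congr (_ * f _); rewrite -natr1; ring.
rewrite [RHS]big_ord_recr /= ltnn mul0r addr0; apply: eq_bigr => i _.
by rewrite -ltnS ltn_ord.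
Qed.

Lemma dif_norm K w f x B : (forall k, (k <= K)%N -> `|f (x + k%:R * w)| <= B) ->
  `|dif K w f x| <= 2 ^+ K * B.
Proof.
elim: K f B => [|K IH] f B h /=.
  by have := h 0%N isT; rewrite mul0r addr0 expr0 mul1r.
rewrite exprSr -mulrA; apply: IH => k kK.
have h1 := h k (leq_trans kK (leqnSn _)); have h2 := h k.+1 kK.
have -> : x + k%:R * w + w = x + k.+1%:R * w by rewrite -natr1; ring.
by apply: (le_trans (ler_normB _ _)); lra.
Qed.

Lemma mean_value_le f (df : R -> R) x w B :
  (forall t, `|t - x| <= `|w| -> is_derive t 1 f (df t)) ->
  (forall t, `|t - x| <= `|w| -> `|df t| <= B) -> `|f (x + w) - f x| <= `|w| * B.
Proof.
move=> fD fB.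
have key a b : a <= b -> (forall t, a <= t <= b -> `|t - x| <= `|w|) -> `|f b - f a| <= (b - a) * B.
  move=> ab h.
  have [||c] := @MVT_segment R f df a b ab.
  - by move=> t; rewrite in_itv /= => /andP[? ?]; apply: fD; apply: h; rewrite !ltW.
  - apply: derivable_within_continuous => t; rewrite in_itv /= => tab.
    by have [] := fD t (h t tab).
  rewrite in_itv /= => cab ->; rewrite normrM mulrC (ger0_norm (_ : 0 <= b - a)) ?subr_ge0 //.
  by apply: ler_wpM2l; rewrite ?subr_ge0 //; apply: fB; exact: h.
have [w0|w0] := leP 0 w.
  have -> : `|w| = x + w - x by rewrite ger0_norm // addrAC subrr add0r.
  apply: key; first by rewrite lerDl.
  by move=> t /andP[? ?]; rewrite (ger0_norm w0) ger0_norm; lra.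
rewrite distrC; have -> : `|w| = x - (x + w) by rewrite ltr0_norm //; ring.
apply: key; first by rewrite gerDl ltW.
by move=> t /andP[? ?]; rewrite (ltr0_norm w0) ler0_norm; lra.
Qed.

Lemma dif_le K w g x r B : 0 <= r ->
  (forall k t, (k < K)%N -> `|t - x| <= r + K%:R * `|w| -> is_derive t 1 (g k) (g k.+1 t)) ->
  (forall t, `|t - x| <= r + K%:R * `|w| -> `|g K t| <= B) ->
  forall t, `|t - x| <= r -> `|dif K w (g 0%N) t| <= `|w| ^+ K * B.
Proof.
elim: K g B => [|K IH] g B r0 gD gB t tr /=.
  by rewrite expr0 mul1r; apply: gB; rewrite mul0r addr0.
rewrite exprSr -mulrA.
have w0 := normr_ge0 w.
have step u : `|u - x| <= r + K%:R * `|w| -> `|u + w - x| <= r + K.+1%:R * `|w|.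
  move=> h; have -> : u + w - x = (u - x) + w by ring.
  by apply: (le_trans (ler_normD _ _)); rewrite -natr1; move: (`|w|) (`|u - x|) h => W U h; lra.
have step0 u : `|u - x| <= r + K%:R * `|w| -> `|u - x| <= r + K.+1%:R * `|w|.
  by move=> h; apply: (le_trans h); rewrite -natr1; move: (`|w|) w0 => W W0; lra.
apply: (IH (fun k t => g k (t + w) - g k t)) => // [k u kK hu|u hu].
  apply: derB; last by apply: gD; [exact: ltnW|exact: step0].
  have d := der_comp (derD (der_id u) (der_cst u w)) (gD k (u + w) (ltnW kK) (step u hu)).
  by apply: der_eq d _; rewrite addr0 mulr1.
apply: (@mean_value_le (g K) (g K.+1)) => v hv.
  apply: gD => //; have -> : v - x = (v - u) + (u - x) by ring.
  by apply: (le_trans (ler_normD _ _)); rewrite -natr1; lra.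
apply: gB; have -> : v - x = (v - u) + (u - x) by ring.
by apply: (le_trans (ler_normD _ _)); rewrite -natr1; lra.
Qed.

End FiniteDifferences.

Lemma le0_powR_anti {R : realType} (c a b : R) : c <= 0 -> 0 < a -> a <= b -> b `^ c <= a `^ c.
Proof.
move=> c0 a0 ab; have b0 := lt_le_trans a0 ab.
rewrite -(opprK c) !(powRN _ (- c)) lef_pV2 ?posrE ?powR_gt0 //.
by apply: ge0_ler_powR => //; rewrite ?nnegrE ?oppr_ge0 // ltW.
Qed.

(** * Differences of the Riesz multiplier *)

Section RieszMultiplier.
Context {R : realType}.
Implicit Types (x t v w d r B : R) (k : nat).
Variable delta : R.
Hypothesis delta0 : 0 < delta.

Definition rm v : R := Num.max (1 - v ^+ 2) 0 `^ delta.

Lemma rm_ge0 v : 0 <= rm v. Proof. exact: powR_ge0. Qed.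

Lemma rm_le1 v : rm v <= 1.
Proof.
apply: (@le_trans _ _ (1 `^ delta)); last by rewrite powR1.
apply: ge0_ler_powR; rewrite ?nnegrE ?(ltW delta0) ?le_max ?lexx ?orbT //.
by rewrite ge_max ler01 andbT lerBlDr lerDl sqr_ge0.
Qed.

Lemma rm_eq0 v : 1 <= `|v| -> rm v = 0.
Proof.
move=> v1; rewrite /rm max_r; first by rewrite powR0 // gt_eqF.
by rewrite subr_le0 -real_normK ?num_real // expr_ge1.
Qed.

Lemma rm_even v : rm (- v) = rm v. Proof. by rewrite /rm sqrrN. Qed.

Lemma max_powR_cont : continuous (fun v : R => Num.max v 0 `^ delta).
Proof.
move=> v; case: (ltrgtP v 0) => v0.
- have h : {for v, continuous (fun _ : R => 0 : R)} by exact: cvg_cst.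
  rewrite /continuous_at max_r ?ltW // powR0 ?gt_eqF //.
  apply: cvg_trans h; apply: near_eq_cvg; near=> t.
  by rewrite max_r ?powR0 ?gt_eqF //; apply: ltW; near: t; exact: lt_nbhsl.
- have h := der_continuous (der_powR delta v0).
  rewrite /continuous_at max_l ?ltW //; apply: cvg_trans h; apply: near_eq_cvg; near=> t.
  by rewrite max_l //; apply: ltW; near: t; exact: lt_nbhsr.
- rewrite /continuous_at v0 maxxx powR0 ?gt_eqF //.
  apply/cvgrPdist_le => eps eps0; near=> t.
  rewrite sub0r normrN ger0_norm ?powR_ge0 //.
  have -> : eps = (eps `^ delta^-1) `^ delta by rewrite -powRrM mulVf ?gt_eqF // powRr1 // ltW.
  apply: ge0_ler_powR; rewrite ?nnegrE ?powR_ge0 ?(ltW delta0) ?le_max ?lexx ?orbT //.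
  rewrite ge_max powR_ge0 andbT; apply: ltW; near: t.
  by apply: lt_nbhsl; exact: powR_gt0.
Unshelve. all: by end_near. Qed.

Lemma rm_cont : continuous rm.
Proof.
move=> v; apply: (@continuous_comp _ _ _ (fun v => 1 - v ^+ 2) (fun v => Num.max v 0 `^ delta)).
  by apply: cvgB; [exact: cvg_cst|apply: cfX; exact: cf_id].
exact: max_powR_cont.
Qed.

(** The polynomial factor in the [k]-th derivative of [(1 - v^2)^delta], which is [rmp k] times
    [(1 - v^2)^(delta - k)]. *)
Fixpoint rmp k : {poly R} :=
  if k is k'.+1 then (rmp k')^`() * (1 - 'X ^+ 2) - (2 * (delta - k'%:R)) *: ('X * rmp k') else 1.

Definition rmd k v : R := (rmp k).[v] * (1 - v ^+ 2) `^ (delta - k%:R).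

Lemma der_horner (p : {poly R}) x : is_derive x 1 (horner p) (p^`()).[x].
Proof. by apply: DeriveDef; [exact: derivable_horner|rewrite derivE derive1E]. Qed.

Lemma rmd_der k v : `|v| < 1 -> is_derive v 1 (rmd k) (rmd k.+1 v).
Proof.
move=> v1; have q0 : 0 < 1 - v ^+ 2.
  by rewrite subr_gt0 -real_normK ?num_real // expr_lt1.
have dq : is_derive v 1 (fun t => 1 - t ^+ 2) (- (2 * v)).
  have d := derB (der_cst v 1) (derX 2 (der_id v)); apply: der_eq d _.
  by rewrite /=; ring.
have d := derM (der_horner (rmp k) v) (der_comp dq (der_powR (delta - k%:R) q0)).
apply: der_eq d _; rewrite /rmd /= !(hornerD, hornerN, hornerZ, hornerM, hornerXn, hornerX, hornerC).
have -> : delta - k.+1%:R = delta - k%:R - 1 by rewrite -natr1; ring.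
rewrite (powRS (delta - k%:R) q0).
by move: (_ `^ _) ((rmp k)^`().[v]) (rmp k).[v] => a b c; ring.
Qed.

Lemma rm_rmd v : `|v| < 1 -> rm v = rmd 0 v.
Proof.
move=> v1; rewrite /rm /rmd /= hornerC mul1r subr0 max_l //.
by rewrite subr_ge0 -real_normK ?num_real // expr_le1 // ltW.
Qed.

Lemma horner_bounded (p : {poly R}) : exists B : R, 0 <= B /\ forall v, `|v| <= 1 -> `|p.[v]| <= B.
Proof.
exists (\sum_(i < size p) `|p`_i|); split; first exact: sumr_ge0.
move=> v v1; rewrite horner_coef; apply: (le_trans (ler_norm_sum _ _ _)).
by apply: ler_sum => i _; rewrite normrM normrX ler_piMr // exprn_ile1.
Qed.

Lemma eq_dif K w (f g : R -> R) x : (forall k, (k <= K)%N -> f (x + k%:R * w) = g (x + k%:R * w)) ->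
  dif K w f x = dif K w g x.
Proof.
have [a [_ h]] := @dif_expand R K; move=> e; rewrite !h.
by apply: eq_bigr => k _; rewrite e // -ltnS ltn_ord.
Qed.

(** With [d = |t - 1|]: if [d > 2 K |w|], all points of the difference stay on one side of 1 at
    distance at least [d / 2], and the [K]-th derivative (or 0) is used. Otherwise
    [1 - v^2 <= 6 K |w|] at every point [v], and the size of the multiplier suffices. Each regime
    implies both bounds. *)
Lemma rm_dif_le K : delta <= K%:R -> exists C : R, 0 < C /\ forall w t, 0 <= t ->
  `|dif K w rm t| <= C * `|w| `^ delta /\
  (t != 1 -> `|dif K w rm t| <= C * (`|w| ^+ K * `|t - 1| `^ (delta - K%:R))).
Proof.
move=> dK.
have K0 : 0 < K%:R :> R by exact: lt_le_trans dK.
have [B [B0 hB]] := horner_bounded (rmp K).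
pose C1 := B * 4 `^ (K%:R - delta).
pose C2 := 2 ^+ K * (6 * K%:R) `^ delta.
pose C3 := 2 ^+ K * (6 * K%:R) `^ delta * (2 * K%:R) `^ (K%:R - delta).
have C10 : 0 <= C1 by rewrite mulr_ge0 ?powR_ge0.
have C20 : 0 <= C2 by rewrite mulr_ge0 ?powR_ge0 ?exprn_ge0.
have C30 : 0 <= C3 by rewrite !mulr_ge0 ?powR_ge0 ?exprn_ge0.
exists (C1 + C2 + C3 + 1); split; first by lra.
move=> w t t0.
pose d : R := `|t - 1|; pose W : R := `|w|; rewrite -/d -/W.
have W0 : 0 <= W by exact: normr_ge0.
have d0 : 0 <= d by exact: normr_ge0.
have [hd|hd] := ltP (2 * K%:R * W) d.
  have dpos : 0 < d by apply: le_lt_trans hd; rewrite !mulr_ge0 // ltW.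
  have KW : K%:R * W < d / 2 by lra.
  have e1 : `|dif K w rm t| <= C1 * (W ^+ K * d `^ (delta - K%:R)).
    have [t1|t1] := ltP t 1; last first.
      have dt : d = t - 1 by rewrite /d ger0_norm // subr_ge0.
      rewrite (@eq_dif _ _ _ (fun=> 0)).
        have [a [_ ->]] := @dif_expand R K; rewrite big1 ?normr0; last by move=> i _; rewrite mulr0.
        by rewrite !mulr_ge0 ?powR_ge0 ?exprn_ge0.
      move=> k kK; apply: rm_eq0; apply: le_trans (ler_norm _).
      have : `|k%:R * w| <= K%:R * W by rewrite normrM ger0_norm // ler_wpM2r // ler_nat.
      by rewrite ler_norml => /andP[? _]; lra.
    have dt : d = 1 - t by rewrite /d ltr0_norm ?subr_lt0 // opprB.
    (* Here [1 - v >= d / 2] and [1 + v >= 1 / 2]; the latter uses [t >= 0], which keeps away from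
       the other singularity, at -1. *)
    have in1 v : `|v - t| <= d / 2 -> `|v| < 1 /\ d / 4 <= 1 - v ^+ 2.
      rewrite ler_norml => /andP[h1 h2]; split; first by rewrite ltr_norml; apply/andP; split; lra.
      by nra.
    rewrite (@eq_dif _ _ _ (rmd 0)); last first.
      move=> k kK; apply: rm_rmd; apply: (in1 _ _).1.
      rewrite addrAC subrr add0r; apply: le_trans (ltW KW).
      by rewrite normrM ger0_norm // ler_wpM2r // ler_nat.
    have -> : C1 * (W ^+ K * d `^ (delta - K%:R)) = W ^+ K * (B * (d / 4) `^ (delta - K%:R)).
      rewrite powRM ?(ltW dpos) // /C1 -(opprB delta) powRN.
      rewrite -[in RHS]powR_inv1 // -powRrM mulN1r powRN; ring.
    apply: (@dif_le _ K w rmd t 0) => //.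
    - move=> k v kK; rewrite add0r => hv; apply: rmd_der; apply: (in1 _ _).1.
      by apply: (le_trans hv); exact: ltW.
    - move=> v; rewrite add0r => hv; have [v1 v2] := in1 v (le_trans hv (ltW KW)).
      rewrite /rmd normrM (ger0_norm (powR_ge0 _ _)); apply: ler_pM; [exact: normr_ge0|exact: powR_ge0|exact: (hB _ (ltW v1))|].
      by apply: le0_powR_anti => //; rewrite ?subr_le0 ?divr_gt0.
    - by rewrite subrr normr0.
  split; last first.
    move=> _; apply: (le_trans e1); apply: ler_wpM2r; last by lra.
    by rewrite mulr_ge0 ?exprn_ge0 ?powR_ge0.
  apply: (le_trans e1); apply: (@le_trans _ _ (C1 * W `^ delta)); last first.
    by apply: ler_wpM2r; [exact: powR_ge0|lra].
  apply: ler_wpM2l => //.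
  have [->|Wn] := eqVneq W 0.
    rewrite expr0n; have -> : (K == 0%N) = false by apply/negbTE; rewrite -(eqr_nat R) gt_eqF.
    by rewrite mul0r powR_ge0.
  have Wp : 0 < W by rewrite lt_neqAle eq_sym Wn.
  have -> : W `^ delta = W ^+ K * W `^ (delta - K%:R).
    by rewrite -powR_mulrn // -powRD ?(gt_eqF Wp) ?implybT // addrC subrK.
  apply: ler_wpM2l; first exact: exprn_ge0.
  apply: le0_powR_anti; rewrite ?subr_le0 //; apply: ltW; apply: le_lt_trans hd.
  have K1 : 1 <= K%:R :> R by rewrite ler1n -(ltr_nat R).
  by rewrite ler_peMl //; lra.
have e2 : `|dif K w rm t| <= C2 * W `^ delta.
  rewrite /C2 -mulrA -powRM ?mulr_ge0 ?(ltW K0) //; apply: dif_norm => k kK.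
  have kW : `|k%:R * w| <= K%:R * W by rewrite normrM ger0_norm // ler_wpM2r // ler_nat.
  set v := t + k%:R * w.
  have v1 : `|1 - v| <= 3 * K%:R * W.
    rewrite /v (_ : 1 - _ = - ((t - 1) + k%:R * w)); last by ring.
    by rewrite normrN; apply: (le_trans (ler_normD _ _)); rewrite -/d; lra.
  rewrite (ger0_norm (rm_ge0 _)) /rm; apply: ge0_ler_powR; rewrite ?nnegrE ?(ltW delta0) //.
  - by rewrite le_max lexx orbT.
  - by rewrite !mulr_ge0 // ltW.
  rewrite ge_max; apply/andP; split; last by rewrite !mulr_ge0 // ltW.
  move: v1; rewrite ler_norml => /andP[va vb].
  have [v0|v0] := leP (-1) v; last first.
    by have : 0 <= K%:R * W; [rewrite mulr_ge0 // ltW|nra].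
  have [v2|v2] := leP v 1; first by nra.
  by have : 0 <= K%:R * W; [rewrite mulr_ge0 // ltW|nra].
split.
  by apply: (le_trans e2); apply: ler_wpM2r; [exact: powR_ge0|lra].
move=> t1; have dpos : 0 < d by rewrite normr_gt0 subr_eq0.
have Wp : 0 < W by rewrite lt_neqAle W0 andbT; apply/eqP => W00; move: hd; rewrite -W00 mulr0 leNgt dpos.
apply: (le_trans e2); apply: (@le_trans _ _ (C3 * (W ^+ K * d `^ (delta - K%:R)))); last first.
  by apply: ler_wpM2r; [rewrite mulr_ge0 ?exprn_ge0 ?powR_ge0|lra].
rewrite /C3 -/C2 -mulrA; apply: ler_wpM2l => //.
have -> : W `^ delta = W ^+ K * W `^ (delta - K%:R).
  by rewrite -powR_mulrn // -powRD ?(gt_eqF Wp) ?implybT // addrC subrK.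
rewrite mulrCA; apply: ler_wpM2l; first exact: exprn_ge0.
rewrite -(opprB K%:R delta) !(powRN _ (K%:R - delta)) -ler_pdivrMr ?invr_gt0 ?powR_gt0 // invrK.
rewrite mulrC ler_pdivrMr ?powR_gt0 // -powRM ?mulr_ge0 ?(ltW K0) //.
by apply: ge0_ler_powR; rewrite ?nnegrE ?subr_ge0 ?mulr_ge0 ?(ltW K0).
Qed.

End RieszMultiplier.

(** * Changes of variables and of domain in segment integrals *)

Section Substitution.
Context {R : realType}.
Notation mu := (@lebesgue_measure R).
Implicit Types (x t u v w lam al L a b r : R) (f g : R -> R).

Lemma cI_affine g lam al a b : 0 < al -> a <= b -> continuous g ->
  cI (al * a + lam) (al * b + lam) g = al * cI a b (fun u => g (al * u + lam)).
Proof.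
move=> al0 ab cg.
have FD u : is_derive u 1 (fun u => al * u + lam) al.
  by have d := derD (derZ al (der_id u)) (der_cst u lam); apply: der_eq d _; rewrite mulr1 addr0.
have Fc : continuous (fun u => al * u + lam) by move=> u; exact: der_continuous (FD u).
have F' : (fun u => al * u + lam)^`()%classic = cst al.
  by apply/funext => u; rewrite derive1E; apply: derive_val.
have cgF : continuous (fun u => g (al * u + lam)).
  by move=> u; apply: (@continuous_comp _ _ _ (fun u => al * u + lam) g); [exact: Fc|exact: cg].
rewrite -cI_Z //; apply: EFin_inj; rewrite -!cI_EFin //; last exact: cfZ.
rewrite (@integration_by_substitution_increasing _ (fun u => al * u + lam) g) //.
- by apply: eq_integral => u _; rewrite F' /= mulrC.
- by move=> u v _ _ uv; rewrite ltrD2r ltr_pM2l.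
- by rewrite F' => u _; exact: cvg_cst.
- by rewrite F'; exact: is_cvg_cst.
- by rewrite F'; exact: is_cvg_cst.
- split.
  + by move=> u _; have [] := FD u.
  + by apply: cvg_at_right_filter; exact: Fc.
  + by apply: cvg_at_left_filter; exact: Fc.
- exact: continuous_subspaceT.
Qed.

Lemma cI_support g a b c d : a <= c -> d <= b -> (forall x, x < c \/ d < x -> g x = 0) ->
  cI a b g = cI c d g.
Proof.
move=> ac db h; rewrite /cI /Rintegral; congr fine.
rewrite [LHS]integral_mkcond [RHS]integral_mkcond; congr (integral _ _ _).
apply/funext => x; rewrite /patch; case: ifPn => /= [|].
  rewrite inE /= in_itv /= => /andP[xa xb]; case: ifPn => //.
  rewrite notin_setE /= in_itv /= => /negP; rewrite negb_and -!ltNge => /orP[] hx; congr (_%:E); apply: h; by [left|right].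
rewrite notin_setE /= in_itv /= => hx; case: ifPn => //.
rewrite inE /= in_itv /= => /andP[xc xd]; exfalso; apply: hx.
by rewrite (le_trans ac xc) (le_trans xd db).
Qed.

Lemma cI_subset g a b c d : a <= c -> d <= b -> continuous g -> (forall x, 0 <= g x) ->
  cI c d g <= cI a b g.
Proof.
move=> ac db cg g0; rewrite -lee_fin -!cI_EFin //.
apply: ge0_subset_integral.
- exact: measurable_itv.
- exact: measurable_itv.
- exact: (measurable_int mu (cI_integrable a b cg)).
- by move=> x _; rewrite lee_fin.
- by move=> x; rewrite /= !in_itv /= => /andP[? ?]; apply/andP; split; lra.
Qed.

Lemma cI_opp g r : 0 <= r -> continuous g -> cI (- r) r g = cI (- r) r (fun v => g (- v)).
Proof.
move=> r0 cg.
have cgN : continuous (fun v => g (- v)).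
  by move=> v; apply: (@continuous_comp _ _ _ (fun v => - v) g); [exact: opp_continuous|exact: cg].
apply: EFin_inj; rewrite -!cI_EFin //.
have := @integration_by_substitution_oppr _ g (- r) r.
by rewrite opprK => ->//; [lra|exact: continuous_subspaceT].
Qed.

End Substitution.

(** * The band-limited weight *)

Section SincKernel.
Context {R : realType}.
Notation mu := (@lebesgue_measure R).
Implicit Types (x t u v w lam al L : R) (f g chi : R -> R) (K M : nat).

Lemma sinc_cont : continuous (@sinc R).
Proof.
move=> z; have [->|z0] := eqVneq z 0; last first.
  have d := derM (is_derive_sin z) (derV z0 (der_id z)).
  apply: (@der_continuous R _ z).
  apply: (@der_eq_near _ _ _ _ _ d); near=> t.
  rewrite /sinc; case: eqVneq => // t0; exfalso; move: t0; apply/eqP.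
  by near: t; exact: open_neq.
have [g [h1 h2 h3]] := (@is_derive1_caratheodory _ _ _ _).1 (is_derive_sin (0 : R)).
suff -> : @sinc R = g by [].
apply/funext => u; rewrite /sinc; case: eqVneq => [->|u0].
  by rewrite h3 cos0.
by have := h1 u; rewrite sin0 !subr0 => ->; rewrite mulfK.
Unshelve. all: by end_near. Qed.

Lemma sinc_sqr_le (z : R) : sinc z ^+ 2 <= 2 / (1 + z ^+ 2).
Proof.
have h1 : sinc z ^+ 2 <= 1.
  rewrite -real_normK ?num_real // -[leRHS](expr1n _ 2) lerXn2r ?nnegrE //.
  exact: sinc_norm.
have h2 : z ^+ 2 * sinc z ^+ 2 <= 1.
  rewrite -exprMn /sinc; case: eqVneq => [->|z0]; first by rewrite mul0r expr0n.
  rewrite mulrCA mulfV // mulr1 -[leRHS](cos2Dsin2 z) lerDr sqr_ge0 //.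
have h3 : 0 < 1 + z ^+ 2 by have := sqr_ge0 z; lra.
by rewrite ler_pdivlMr // mulrDr mulr1 mulrC; lra.
Qed.

Variable K : nat.
Let M := K.+1.
(** A power of [sinc] is band-limited; the exponent [2 (K + 1)] is even, so the weight is
    nonnegative, and large enough for [(1 + u^2)^K * chi u] to be integrable. *)
Definition chi u : R := sinc u ^+ (2 * M).

Lemma chi_ge0 u : 0 <= chi u. Proof. by rewrite /chi exprM exprn_ge0 // sqr_ge0. Qed.

Lemma chi_cont : continuous chi. Proof. exact: cfX sinc_cont. Qed.

Lemma chi_even u : chi (- u) = chi u. Proof. by rewrite /chi sinc_opp. Qed.

Lemma chi_decay u : (1 + u ^+ 2) ^+ K * chi u <= 2 ^+ M / (1 + u ^+ 2).
Proof.
have h3 : 0 < 1 + u ^+ 2 by have := sqr_ge0 u; lra.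
rewrite ler_pdivlMr // mulrAC -exprSr /chi exprM -exprMn.
rewrite /M lerXn2r ?nnegrE //.
  by apply: mulr_ge0; [exact: ltW|exact: sqr_ge0].
by have := sinc_sqr_le u; rewrite ler_pdivlMr // mulrC.
Qed.

Lemma chi_mass L : 0 < L -> cI (- L) L (fun u => (1 + u ^+ 2) ^+ K * chi u) <= 2 ^+ M * pi.
Proof.
move=> L0; have LL : - L < L by lra.
have cp : continuous (fun u : R => 1 + u ^+ 2).
  by apply: cfD; [exact: cf_cst|apply: cfX; exact: cf_id].
have c1 : continuous (fun u : R => (1 + u ^+ 2)^-1).
  move=> u; apply: cvgV; last exact: cp.
  by rewrite gt_eqF //; have := sqr_ge0 u; lra.
have FD u : is_derive u 1 (@atan R) ((1 + u ^+ 2)^-1) by exact: is_derive1_atan.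
have e := cI_FTC LL FD c1.
apply: (@le_trans _ _ (cI (- L) L (fun u => 2 ^+ M * (1 + u ^+ 2)^-1))).
  apply: le_Rintegral => //.
  - by apply: cI_integrable; apply: cfM chi_cont; exact: cfX.
  - by apply: cI_integrable; exact: cfZ.
  - by move=> u _; exact: chi_decay.
rewrite cI_Z // e; apply: ler_wpM2l; first exact: exprn_ge0.
by have := atan_ltpi2 L; have := atan_gtNpi2 (- L); lra.
Qed.

Let cL (n : nat) : R := cI (- n.+1%:R) n.+1%:R chi.

Lemma chi_total : exists c0 : R, 0 < c0 /\ cI (- n.+1%:R) n.+1%:R chi @[n --> \oo] --> c0.
Proof.
have N11 : -1 < 1 :> R by lra.
have cL0 n : 0 < cL n.
  have h : {for 0, continuous chi} by exact: chi_cont.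
  have c01 : 2^-1 < chi 0 by rewrite /chi /sinc eqxx expr1n; lra.
  have /nbhs_ballP[r /= r0 hr] := h _ (lt_nbhsr c01).
  pose q := Num.min (r / 2) 1.
  have q0 : 0 < q by rewrite lt_min; apply/andP; split; lra.
  have [qr q1] : q <= r / 2 /\ q <= 1 by split; rewrite ge_min lexx ?orbT.
  have n1 : 1 <= n.+1%:R :> R by rewrite ler1n.
  apply: (@lt_le_trans _ _ (cI (- q) q (fun=> 2^-1 : R))).
    by rewrite cI_cst; lra.
  apply: (@le_trans _ _ (cI (- q) q chi)).
    apply: le_Rintegral => //.
    - by apply: cI_integrable; exact: cf_cst.
    - by apply: cI_integrable; exact: chi_cont.
    - move=> x; rewrite /= in_itv /= => /andP[x1 x2]; apply: ltW; apply: hr; rewrite /ball /= sub0r normrN.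
      by apply: (@le_lt_trans _ _ q); [rewrite ler_norml x1 x2|lra].
  apply: cI_subset => //; [lra|lra|exact: chi_cont|exact: chi_ge0].
have cLm : nondecreasing_seq cL.
  move=> n p np; have : n.+1%:R <= p.+1%:R :> R by rewrite ler_nat.
  by move=> h; apply: cI_subset => //; [lra|exact: chi_cont|exact: chi_ge0].
have ub : has_ubound (range cL).
  exists (2 ^+ M * pi) => _ [n _ <-].
  have n0 : 0 < n.+1%:R :> R by [].
  apply: le_trans (chi_mass n0); apply: le_Rintegral => //.
  - by apply: cI_integrable; exact: chi_cont.
  - apply: cI_integrable; apply: cfM chi_cont; apply: cfX.
    by apply: cfD; [exact: cf_cst|apply: cfX; exact: cf_id].
  - move=> u _; rewrite ler_peMl ?chi_ge0 // exprn_ege1 // lerDl sqr_ge0 //.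
exists (sup (range cL)); split; last exact: nondecreasing_cvgn.
by apply: (lt_le_trans (cL0 0%N)); apply: ub_le_sup => //; exists 0%N.
Qed.

End SincKernel.

Section MultiplierSplit.
Context {R : realType}.
Notation mu := (@lebesgue_measure R).
Implicit Types (x t u v w lam al L : R) (K P : nat).
Variable delta : R.
Hypothesis delta0 : 0 < delta.

Definition rmR Rad lam : R := rm delta (lam / Rad).

Section Fixed.
Variables (K : nat) (Rad tau : R).
Hypotheses (Rad0 : 0 < Rad) (tau0 : 0 < tau).
Let m := rmR Rad.
Notation chi := (@chi R K).

Let mc : continuous m.
Proof.
move=> v; apply: (@continuous_comp _ _ _ (fun v => v / Rad) (rm delta)).
  by apply: cvgM; [exact: cvg_id|exact: cvg_cst].
exact: rm_cont.
Qed.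

Let m0 v : v < - Rad \/ Rad < v -> m v = 0.
Proof.
move=> h; apply: rm_eq0 => //; rewrite normrM normfV (gtr0_norm Rad0) ler_pdivlMr // mul1r.
by rewrite ler_normr; case: h => h; apply/orP; [right|left]; lra.
Qed.

Let m_even v : m (- v) = m v.
Proof. by rewrite /m /rmR mulNr rm_even. Qed.

Let chiE u : chi u = sinc u ^+ (2 * K.+1). Proof. by []. Qed.

Let chi_aff al b : continuous (fun v => chi (al * v + b)).
Proof.
move=> v; apply: (@continuous_comp _ _ _ (fun v => al * v + b) chi); last exact: chi_cont.
by apply: cvgD; [apply: cvgMr; exact: cvg_id|exact: cvg_cst].
Qed.

(** Convolution of the multiplier with the dilate of [chi] by [h]; the segment [[- Rad, Rad]]
    contains the support of [m]. *)
Definition bandconv h lam : R := h * cI (- Rad) Rad (fun v => m v * chi (h * v + - (h * lam))).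

Lemma bandconv_subst h lam L : 0 < h -> h * (Rad + `|lam|) <= L ->
  cI (- L) L (fun u => m (lam + u / h) * chi u) = bandconv h lam.
Proof.
move=> h0 hL.
have hR : h * Rad + h * `|lam| <= L by rewrite -mulrDr.
have LL : - L <= L by have := mulr_ge0 (ltW h0) (ltW Rad0); have := mulr_ge0 (ltW h0) (normr_ge0 lam); lra.
pose g v := m v * chi (h * v + - (h * lam)).
have cg : continuous g by apply: cfM mc _; exact: chi_aff.
rewrite /bandconv -(@cI_support _ g (h^-1 * (- L) + lam) (h^-1 * L + lam) (- Rad) Rad).
- rewrite cI_affine ?invr_gt0 // mulrA mulfV ?gt_eqF // mul1r.
  apply: eq_cI => u _; rewrite /g; have -> : lam + u / h = h^-1 * u + lam by ring.
  congr (m _ * chi _).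
  by field; rewrite gt_eqF.
- have : `|lam| + Rad <= h^-1 * L by rewrite mulrC ler_pdivlMr // mulrC addrC.
  by have := ler_norm lam; lra.
- have : `|lam| + Rad <= h^-1 * L by rewrite mulrC ler_pdivlMr // mulrC addrC.
  by have := ler_norm (- lam); rewrite normrN; lra.
- by move=> v /m0; rewrite /g => ->; rewrite mul0r.
Qed.

(** Since [m] and [chi] are even, the convolution equals its symmetrization in [s_j], which is a
    superposition of the multipliers of [sinc_nullsum]. *)
Lemma bandconv_nullsum (s : nat -> R) (c : nat -> R) (B T : R) h :
  (forall n, \sum_(j < n) `|c j| <= B) -> 0 < h -> (2 * K.+1)%:R * h < T ->
  (forall t, 0 <= t < T -> nullsum c (fun j => cos (s j * t))) ->
  nullsum c (fun j => bandconv h (s j)).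
Proof.
move=> hB h0 hT hc; apply: nullsumZ.
rewrite (_ : (fun j => _) = (fun j => cI (- Rad) Rad (fun v => m v *
   (2^-1 * (sincM (2 * K.+1) h 0 0 (s j - v) + sincM (2 * K.+1) h 0 0 (- s j - v)))))).
  apply: (nullsum_swap hB mc).
  - move=> j; apply: cfZ; apply: cfD.
      rewrite (_ : (fun v => _) = (fun v => chi ((- h) * v + h * s j))); first exact: chi_aff.
      by apply/funext => v; rewrite /sincM mul0r addr0 cos0 mulr1 chiE; congr (sinc _ ^+ _); ring.
    rewrite (_ : (fun v => _) = (fun v => chi ((- h) * v + - (h * s j)))); first exact: chi_aff.
    by apply/funext => v; rewrite /sincM mul0r addr0 cos0 mulr1 chiE; congr (sinc _ ^+ _); ring.
  - move=> v j; rewrite normrM ger0_norm //.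
    have hG z : `|sincM (2 * K.+1) h 0 0 z| <= 1.
      by rewrite /sincM mul0r addr0 cos0 mulr1 normrX exprn_ile1 ?sinc_norm.
    have := le_trans (ler_normD _ _) (lerD (hG (s j - v)) (hG (- s j - v))).
    by move=> hh; rewrite mulrC ler_pdivrMr // mul1r; apply: (le_trans hh).
  - move=> v _; apply: (sinc_nullsum hB (ltW h0) hc).
    by rewrite normr0 add0r.
apply/funext => j.
have e1 v : sincM (2 * K.+1) h 0 0 (s j - v) = chi (h * v + - (h * s j)).
  rewrite /sincM mul0r addr0 cos0 mulr1 -chi_even chiE; congr (sinc _ ^+ _); ring.
have e2 v : sincM (2 * K.+1) h 0 0 (- s j - v) = chi (h * (- v) + - (h * s j)).
  rewrite /sincM mul0r addr0 cos0 mulr1 chiE; congr (sinc _ ^+ _); ring.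
have c1 : continuous (fun v => m v * chi (h * v + - (h * s j))).
  by apply: cfM mc _; exact: chi_aff.
have c2 : continuous (fun v => m v * chi (h * (- v) + - (h * s j))).
  apply: cfM mc _; rewrite (_ : (fun v => _) = (fun v => chi ((- h) * v + - (h * s j)))); first exact: chi_aff.
  by apply/funext => v; congr (chi _); ring.
symmetry; rewrite (@eq_cI _ _ _ _ (fun v => 2^-1 * (m v * chi (h * v + - (h * s j)) + m v * chi (h * (- v) + - (h * s j))))); last first.
  by move=> v _; rewrite e1 e2; ring.
rewrite cI_Z ?cI_D //; last exact: cfD.
rewrite [X in 2^-1 * (_ + X)](_ : _ = cI (- Rad) Rad (fun v => m v * chi (h * v + - (h * s j)))); first by field.
rewrite [RHS](cI_opp (ltW Rad0) c1).
by apply: eq_cI => v _; rewrite m_even.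
Qed.

End Fixed.
End MultiplierSplit.

Ltac positivity := repeat first [assumption | done | (apply: ltW; assumption) | apply: mulr_gt0 | apply: addr_gt0
  | rewrite invr_gt0 | apply: powR_gt0 | apply: exprn_gt0 | apply: mulr_ge0 | apply: addr_ge0
  | rewrite invr_ge0 | apply: powR_ge0 | apply: exprn_ge0 | apply: sumr_ge0 | apply: ltW].

Section MultiplierError.
Context {R : realType}.
Implicit Types (x t u v w lam al L : R) (K P : nat).
Variable delta : R.
Hypothesis delta0 : 0 < delta.
Notation rmR := (rmR delta).
Notation bandconv := (bandconv delta).

Lemma dif_rmR K Rad w lam : Rad != 0 -> dif K w (rmR Rad) lam = dif K (w / Rad) (rm delta) (lam / Rad).
Proof.
move=> Rad0; have [a [_ h]] := @dif_expand R K; rewrite !h; apply: eq_bigr => k _.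
by rewrite /rmR; congr (_ * rm _ _); field.
Qed.

(* Averaging the [K]-th difference of the multiplier against the band-limited weight
   [chi] produces a multiplier [m1] of finite propagation speed; the error inherits the
   Hoelder smoothness [delta] at [Rad] and the decay of the [K]-th derivative away from it. *)
Lemma multiplier_split P : exists C : R, 0 < C /\ forall Rad T, 0 < Rad -> 0 < T ->
  exists m1 : R -> R,
  (forall (s c : nat -> R) (B : R), (forall n, \sum_(j < n) `|c j| <= B) ->
     (forall t, 0 <= t < T -> nullsum c (fun j => cos (s j * t))) ->
     nullsum c (fun j => m1 (s j))) /\
  (forall lam, 0 <= lam ->
     `|rmR Rad lam - m1 lam| <= C * (Rad * T) `^ (- delta) / (1 + T * `|lam - Rad|) ^+ P).
Proof.
have hn : exists n : nat, delta <= n%:R.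
  by exists (Num.bound delta); apply: ltW; apply: archi_boundP; exact: ltW.
have [n0 hn0] := hn.
(* The order of differences: [K >= delta] for [rm_dif_le], and [K - delta >= P] for the decay away
   from [Rad]. *)
pose K := (P + n0)%N.
have dK : delta <= K%:R by apply: (le_trans hn0); rewrite ler_nat leq_addl.
have PK : P%:R <= K%:R - delta by rewrite natrD; lra.
have [C1 [C10 hC1]] := rm_dif_le delta0 dK.
have [c0 [c00 hc0]] := @chi_total R K.
have [a [a0 ha]] := @dif_expand R K.
(* One more than the number of [sinc] factors in [chi], so that as many windows of width [T / S] add
   up to less than [T]. *)
pose S := (2 * K.+1).+1.
have S1 : 1 <= S%:R :> R by rewrite ler1n.
have S0 : 0 < S%:R :> R by [].
pose I0 : R := 2 ^+ K.+1 * pi.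
have I00 : 0 < I0 by rewrite mulr_gt0 ?exprn_gt0 ?pi_gt0.
pose C := c0^-1 * (C1 * I0) * S%:R `^ delta * (2 * S%:R) ^+ P.
exists C; split; first by rewrite /C; positivity.
move=> Rad T Rad0 T0.
pose tau : R := T / S%:R.
have tau0 : 0 < tau by rewrite divr_gt0.
(* The point of index [k + 1] in the difference lies at [(k + 1) u / tau] from [lam], so its average
   against [chi] is a convolution with parameter [tau / (k + 1)]. *)
pose J (k : nat) (lam : R) : R := bandconv K Rad (tau / k.+1%:R) lam.
exists (fun lam => c0^-1 * \sum_(k < K) (- (-1) ^+ K * a k.+1) * J k lam); split.
  move=> s c B hB hc; apply: nullsumZ.
  apply: (@nullsum_sum _ _ (fun k j => (- (-1) ^+ K * a k.+1) * J k (s j))) => k kK; apply: nullsumZ.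
  apply: (@bandconv_nullsum _ _ _ _ _ _ s c B T) => //; first by rewrite divr_gt0.
  apply: (@le_lt_trans _ _ ((2 * K.+1)%:R * tau)).
    by apply: ler_wpM2l => //; rewrite ler_pdivrMr // ler_peMr ?ler1n // ltW.
  by rewrite /tau mulrA ltr_pdivrMr // mulrC ltr_pM2l // ltr_nat.
move=> lam lam0.
set m := rmR Rad.
have mc : continuous m.
  move=> v; apply: (@continuous_comp _ _ _ (fun v => v / Rad) (rm delta)); last exact: rm_cont.
  by apply: cvgM; [exact: cvg_id|exact: cvg_cst].
pose D := tau * `|lam - Rad|.
have D0 : 0 <= D by rewrite mulr_ge0 // ltW.
pose E := (Rad * tau) `^ (- delta) * (2 / (1 + D)) ^+ P.
have Rt0 : 0 < Rad * tau by rewrite mulr_gt0.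
have difE u : dif K (u / tau) m lam = dif K (u / (Rad * tau)) (rm delta) (lam / Rad).
  by rewrite /m dif_rmR ?gt_eqF //; congr (dif _ _ _ _); field; rewrite !gt_eqF.
have uK u : `|u| ^+ K <= (1 + u ^+ 2) ^+ K.
  rewrite lerXn2r ?nnegrE ?addr_ge0 ?sqr_ge0 //.
  have := sqr_ge0 (`|u| - 1); have := normr_ge0 u; rewrite -(real_normK (num_real u)).
  by move: (`|u|) => U; nra.
(* Within [1 / tau] of [Rad] the Hoelder bound is used and no decay is asked for; farther away the
   bound by [D^(delta - K)] supplies it. *)
have E1 : 1 <= (2 / (1 + D)) ^+ P \/ (1 < D /\ D `^ (delta - K%:R) <= (2 / (1 + D)) ^+ P).
  have [D1|D1] := leP D 1; [left|right].
    by rewrite exprn_ege1 // ler_pdivlMr ?mul1r; lra.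
  split=> //; have Dp : 0 < D by lra.
  apply: (@le_trans _ _ (D `^ (- P%:R))).
    by rewrite -[D `^ _]/(powR _ _); apply: ler_powR; [exact: ltW|lra].
  have D1p : 0 < 1 + D by lra.
  have Di : D^-1 <= 2 / (1 + D).
    rewrite ler_pdivlMr // mulrDr mulr1 mulVf ?gt_eqF //.
    have : D^-1 <= 1 by rewrite invf_le1 // ltW.
    lra.
  rewrite powRN powR_mulrn // -exprVn; apply: lerXn2r => //; rewrite nnegrE.
    by rewrite invr_ge0.
  by apply: divr_ge0 => //; exact: ltW.
have difB u : `|dif K (u / tau) m lam| <= C1 * E * (1 + u ^+ 2) ^+ K.
  have [h1 h2] := hC1 (u / (Rad * tau)) (lam / Rad) (divr_ge0 lam0 (ltW Rad0)).
  rewrite difE.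
  have wE : `|u / (Rad * tau)| = `|u| / (Rad * tau).
    by rewrite normrM normfV (gtr0_norm Rt0).
  rewrite wE in h1 h2.
  case: E1 => [E1|[D1 E1]].
    apply: (le_trans h1); rewrite -mulrA; apply: ler_wpM2l; first exact: ltW.
    rewrite powRM ?invr_ge0 ?(ltW Rt0) // mulrC /E -mulrA.
    rewrite -[(Rad * tau)^-1](powR_inv1 (ltW Rt0)) -powRrM mulN1r.
    apply: ler_wpM2l; first exact: powR_ge0.
    apply: (@le_trans _ _ (1 * (1 + u ^+ 2) ^+ K)); last by apply: ler_wpM2r => //; rewrite exprn_ge0 // addr_ge0 ?sqr_ge0.
    rewrite mul1r.
    have [u1|u1] := leP `|u| 1.
      apply: (@le_trans _ _ 1); last by rewrite exprn_ege1 // lerDl sqr_ge0.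
      apply: (@le_trans _ _ (1 `^ delta)); last by rewrite powR1.
      by apply: ge0_ler_powR; rewrite ?nnegrE // ltW.
    apply: (le_trans _ (uK u)); rewrite -powR_mulrn //; apply: ler_powR => //; exact: ltW.
  have lR : lam / Rad != 1.
    apply/eqP => e; move: D1; rewrite /D (_ : lam = Rad) ?subrr ?normr0 ?mulr0; first by lra.
    by rewrite -[lam](divfK (lt0r_neq0 Rad0)) e mul1r.
  apply: (le_trans (h2 lR)); rewrite -mulrA; apply: ler_wpM2l; first exact: ltW.
  have -> : `|lam / Rad - 1| = D / (Rad * tau).
    rewrite (_ : lam / Rad - 1 = (lam - Rad) / Rad); last by field; rewrite gt_eqF.
    by rewrite normrM normfV (gtr0_norm Rad0) /D; field; rewrite !gt_eqF.
  rewrite exprMn powRM ?invr_ge0 ?(ltW Rt0) //.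
  rewrite -[(Rad * tau)^-1](powR_inv1 (ltW Rt0)) -powRrM mulN1r opprB.
  rewrite -(powR_mulrn K (powR_ge0 _ (-1))) -powRrM mulN1r.
  have e1 : (Rad * tau) `^ (- K%:R) * (Rad * tau) `^ (K%:R - delta) = (Rad * tau) `^ (- delta).
    by rewrite -powRD ?(gt_eqF Rt0) ?implybT //; congr (_ `^ _); ring.
  rewrite (_ : _ * _ * (_ * _) = `|u| ^+ K * ((Rad * tau) `^ (- delta) * D `^ (delta - K%:R))); last first.
    by rewrite -e1; ring.
  rewrite mulrC; apply: ler_pM => //; first by rewrite mulr_ge0 ?powR_ge0.
  by rewrite /E; apply: ler_wpM2l => //; exact: powR_ge0.
have E0 : 0 <= E by rewrite mulr_ge0 ?powR_ge0 // exprn_ge0 // divr_ge0 //; lra.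
have difc : continuous (fun u => dif K (u / tau) m lam).
  rewrite (_ : (fun u => _) = (fun u => \sum_(k < K.+1) a k * m (lam + k%:R * (u / tau)))); last first.
    by apply/funext => u; rewrite ha.
  apply: continuous_sumf => k; apply: cfZ => u.
  apply: (@continuous_comp _ _ _ (fun u => lam + k%:R * (u / tau)) m); last exact: mc.
  apply: cvgD; first exact: cvg_cst.
  by apply: cvgMr; apply: cvgM; [exact: cvg_id|exact: cvg_cst].
have cc := @chi_cont R K.
have bound L : 0 < L -> `|cI (- L) L (fun u => dif K (u / tau) m lam * chi K u)| <= C1 * E * I0.
  move=> L0.
  have cd : continuous (fun u => dif K (u / tau) m lam * chi K u) by exact: cfM.
  have cp : continuous (fun u : R => (1 + u ^+ 2) ^+ K * chi K u).
    by apply: cfM cc; apply: cfX; apply: cfD; [exact: cf_cst|apply: cfX; exact: cf_id].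
  apply: (le_trans (le_normr_Rintegral _ _)) => //; first exact: cI_integrable.
  apply: (@le_trans _ _ (cI (- L) L (fun u => C1 * E * ((1 + u ^+ 2) ^+ K * chi K u)))).
    apply: le_Rintegral => //.
    - by apply: cI_integrable => x; apply: cvg_norm; exact: cd.
    - by apply: cI_integrable; exact: cfZ.
    - move=> u _; rewrite normrM (ger0_norm (chi_ge0 K u)) mulrA; apply: ler_wpM2r => //; exact: chi_ge0.
  rewrite cI_Z //; apply: ler_wpM2l; last exact: chi_mass.
  by rewrite mulr_ge0 // ltW.
(* The term of index 0 yields [m lam] times the mass of [chi]; all others are values of [J] once
   [[- L, L]] covers the support of the multiplier. *)
have expand L : tau * (Rad + `|lam|) <= L ->
  cI (- L) L (fun u => dif K (u / tau) m lam * chi K u) =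
  (-1) ^+ K * (m lam * cI (- L) L (chi K) - \sum_(k < K) (- (-1) ^+ K * a k.+1) * J k lam).
  move=> hL.
  have cmk k : continuous (fun u => m (lam + k%:R * (u / tau)) * chi K u).
    apply: cfM cc => u.
    apply: (@continuous_comp _ _ _ (fun u => lam + k%:R * (u / tau)) m); last exact: mc.
    apply: cvgD; first exact: cvg_cst.
    by apply: cvgMr; apply: cvgM; [exact: cvg_id|exact: cvg_cst].
  rewrite (@eq_cI _ _ _ _ (fun u => \sum_(k < K.+1) a k * (m (lam + k%:R * (u / tau)) * chi K u))); last first.
    by move=> u _; rewrite ha mulr_suml; apply: eq_bigr => k _; rewrite -mulrA.
  rewrite (@cI_sum _ _ _ K.+1 (fun k u => a k * (m (lam + k%:R * (u / tau)) * chi K u))); last by move=> k; exact: cfZ.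
  rewrite big_ord_recl /= a0 mulrBr; congr (_ + _).
    rewrite (@eq_cI _ _ _ _ (fun u => (-1) ^+ K * m lam * chi K u)); last first.
      by move=> u _; rewrite mul0r addr0 mulrA.
    by rewrite (cI_Z _ _ _ cc) mulrA.
  rewrite mulr_sumr -sumrN; apply: eq_bigr => k _; rewrite /bump /= (cI_Z _ _ _ (cmk (1 + k)%N)).
  have -> : cI (- L) L (fun u => m (lam + (1 + k)%:R * (u / tau)) * chi K u) = J k lam.
    have h0 : 0 < tau / k.+1%:R by rewrite divr_gt0.
    have hL' : tau / k.+1%:R * (Rad + `|lam|) <= L.
      apply: le_trans hL; apply: ler_wpM2r; first by rewrite addr_ge0 // ltW.
      by rewrite ler_pdivrMr // ler_peMr ?ler1n // ltW.
    have e := bandconv_subst delta0 K Rad0 h0 hL'.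
    rewrite /J -e; apply: eq_cI => u _; congr (m _ * _); rewrite add1n; field; rewrite gt_eqF //=.
    by rewrite gt_eqF.
  have ss : (-1) ^+ K * (-1) ^+ K = 1 :> R by rewrite -exprD -signr_odd oddD addbb expr0.
  have -> : - ((-1) ^+ K * (- (-1) ^+ K * a k.+1 * J k lam)) = (-1) ^+ K * (-1) ^+ K * (a k.+1 * J k lam) by ring.
  by rewrite ss mul1r.
have key : `|m lam * c0 - \sum_(k < K) (- (-1) ^+ K * a k.+1) * J k lam| <= C1 * E * I0.
  set Z := \sum_(k < K) _.
  have lim : `|m lam * cI (- n.+1%:R) n.+1%:R (chi K) - Z| @[n --> \oo] --> `|m lam * c0 - Z|.
    by apply: cvg_norm; apply: cvgB; [apply: cvgMr; exact: hc0|exact: cvg_cst].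
  apply: (@cvgr_to_le _ _ _ _ _ _ _ lim).
  near=> n.
  have hL : tau * (Rad + `|lam|) <= n.+1%:R.
    by apply: (@le_trans _ _ n%:R); [near: n; exact: nbhs_infty_ger|rewrite ler_nat].
  have n0' : 0 < n.+1%:R :> R by [].
  have := bound _ n0'; rewrite expand // normrM normrX normrN1 expr1n mul1r.
  by [].
have -> : m lam - c0^-1 * \sum_(k < K) - (-1) ^+ K * a k.+1 * J k lam =
  c0^-1 * (m lam * c0 - \sum_(k < K) - (-1) ^+ K * a k.+1 * J k lam).
  by rewrite mulrBr mulrCA mulVf ?gt_eqF // mulr1.
rewrite normrM (gtr0_norm (_ : 0 < c0^-1)) ?invr_gt0 //.
apply: (@le_trans _ _ (c0^-1 * (C1 * E * I0))).
  by apply: ler_wpM2l => //; rewrite invr_ge0 ltW.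
rewrite /C /E.
have -> : (Rad * tau) `^ (- delta) = S%:R `^ delta * (Rad * T) `^ (- delta).
  rewrite /tau mulrA powRM ?invr_ge0 ?mulr_ge0 ?(ltW Rad0) ?(ltW T0) //.
  by rewrite -[(S%:R)^-1]powR_inv1 // -powRrM mulrNN mul1r mulrC.
have hD : (2 / (1 + D)) ^+ P <= (2 * S%:R) ^+ P / (1 + T * `|lam - Rad|) ^+ P.
  have q0 : 0 < 1 + T * `|lam - Rad| by have := mulr_ge0 (ltW T0) (normr_ge0 (lam - Rad)); lra.
  have q1 : 0 < 1 + D by lra.
  rewrite -exprVn -exprMn lerXn2r ?nnegrE ?divr_ge0 ?mulr_ge0 ?invr_ge0 ?(ltW q0) ?(ltW q1) //.
  rewrite -mulrA ler_pM2l // ler_pdivlMr // mulrC ler_pdivrMr //.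
  rewrite /D /tau mulrDr mulr1.
  have -> : S%:R * (T / S%:R * `|lam - Rad|) = T * `|lam - Rad| by field; rewrite gt_eqF.
  lra.
move: hD; move: ((2 / (1 + D)) ^+ P) ((2 * S%:R) ^+ P) ((1 + _) ^+ P) => u v w uvw.
have -> : c0^-1 * (C1 * I0) * S%:R `^ delta * v * (Rad * T) `^ (- delta) / w =
  (c0^-1 * C1 * I0 * (S%:R `^ delta * (Rad * T) `^ (- delta))) * (v / w) by ring.
have -> : c0^-1 * (C1 * (S%:R `^ delta * (Rad * T) `^ (- delta) * u) * I0) =
  (c0^-1 * C1 * I0 * (S%:R `^ delta * (Rad * T) `^ (- delta))) * u by ring.
by apply: ler_wpM2l => //; positivity.
Unshelve. all: by end_near. Qed.

End MultiplierError.

(** * The Bochner-Riesz kernel *)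

Section SpectralSums.
Context {R : realType}.
Implicit Types (x z t a b g T Rad : R) (j n P : nat).
Variables (kap : R) (s : nat -> R) (g : R).
Hypothesis kap1 : -1 < 2 * kap.
Hypothesis g0 : 0 < g.
Hypothesis sgt0 : forall j, 0 < s j.
Hypothesis sgap : forall j, s j + g <= s j.+1.

(** The cost of replacing the frequency [sj] by [Rad]. The power of [sj / Rad] exceeds 1 above [Rad]
    when [kap > 0], and below [Rad] when [kap < 0]. *)
Lemma Phi_ratio (sj Rad x : R) : 0 < sj -> 0 < Rad -> 0 < x ->
  Phi kap (sj * x) <= Phi kap (Rad * x) * Num.max 1 ((sj / Rad) `^ kap).
Proof.
move=> s0 R0 x0; set r := sj / Rad.
have r0 : 0 < r by exact: divr_gt0.
have R0x : 0 < Rad * x by exact: mulr_gt0.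
have e : sj * x = r * (Rad * x) by rewrite /r; field; rewrite gt_eqF.
move: (Rad * x) R0x e => v v0 ->.
have m1 : 1 <= Num.max 1 (r `^ kap) by rewrite le_max lexx.
have m2 : r `^ kap <= Num.max 1 (r `^ kap) by rewrite le_max lexx orbT.
have rv0 : 0 < r * v by exact: mulr_gt0.
rewrite /Phi; case: ifPn => h1; case: ifPn => h2.
- rewrite powRM ?(ltW r0) ?(ltW v0) // mulrC; apply: ler_wpM2l => //; exact: powR_ge0.
- rewrite mul1r; move: h2; rewrite -ltNge => h2.
  have [k0|k0] := leP 0 kap.
    apply: le_trans m1; apply: (@le_trans _ _ (1 `^ kap)); last by rewrite powR1.
    by apply: ge0_ler_powR => //; rewrite nnegrE // ltW.
  apply: le_trans m2; apply: le0_powR_anti => //; first exact: ltW.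
  by rewrite ler_peMr // ltW.
- move: h1; rewrite -ltNge => h1.
  have [k0|k0] := leP 0 kap.
    apply: (@le_trans _ _ (v `^ kap * r `^ kap)); last by apply: ler_wpM2l => //; exact: powR_ge0.
    rewrite -powRM ?(ltW r0) ?(ltW v0) // mulrC.
    apply: (@le_trans _ _ (1 `^ kap)); first by rewrite powR1.
    by apply: ge0_ler_powR => //; rewrite ?nnegrE // ltW.
  apply: (@le_trans _ _ (v `^ kap)); last by rewrite ler_peMr // powR_ge0.
  apply: (@le_trans _ _ (1 `^ kap)); first by rewrite powR1.
  by apply: le0_powR_anti => //; exact: ltW.
- by rewrite mul1r.
Qed.

Let sS j : s j <= s j.+1.
Proof. by apply: le_trans (sgap j); rewrite lerDl ltW. Qed.

Let inv_step (p q e : R) : 0 < e -> 1 <= p -> p + e <= q -> (q ^+ 2)^-1 <= e^-1 * (p^-1 - q^-1).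
Proof.
move=> e0 p1 pq; have p0 : 0 < p by lra.
have q0 : 0 < q by lra.
rewrite (_ : p^-1 - q^-1 = (q - p) / (p * q)); last by field; rewrite !gt_eqF.
rewrite mulrA ler_pdivlMr ?mulr_gt0 //.
rewrite (_ : (q ^+ 2)^-1 * (p * q) = p / q); last by field; rewrite gt_eqF.
apply: (@le_trans _ _ 1); first by rewrite ler_pdivrMr // mul1r; lra.
by rewrite mulrC ler_pdivlMr // mul1r; lra.
Qed.

(** On each side of [Rad] the numbers [w j] are separated by [T g], so [inv_step] makes the sum
    telescope; the two terms next to [Rad] are bounded by 1 each. *)
Lemma sum_gap_le T Rad n : 0 < T ->
  \sum_(j < n) ((1 + T * `|s j - Rad|) ^+ 2)^-1 <= 2 + 2 * (T * g)^-1.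
Proof.
move=> T0; have e0 : 0 < T * g by exact: mulr_gt0.
have ei0 : 0 < (T * g)^-1 by rewrite invr_gt0.
pose w j := 1 + T * `|s j - Rad|.
have w1 j : 1 <= w j by rewrite lerDl mulr_ge0 // ltW.
have wi j : (w j)^-1 <= 1 by rewrite invf_le1 // (lt_le_trans ltr01).
have wi0 j : 0 < (w j)^-1 by rewrite invr_gt0 (lt_le_trans ltr01).
have w2 j : (w j ^+ 2)^-1 <= 1 by rewrite invf_le1 ?exprn_ege1 // (lt_le_trans ltr01) // exprn_ege1.
(* The form of the bound changes when [s n] passes [Rad]: below it the telescoping quantity grows
   with [n], above it [(w n)^-1] is subtracted. *)
have main : \sum_(j < n.+1) (w j ^+ 2)^-1 <=
  if s n < Rad then (w n ^+ 2)^-1 + (T * g)^-1 * (w n)^-1 else 2 + (T * g)^-1 * (2 - (w n)^-1).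
  elim: n => [|n IH].
    rewrite big_ord_recr big_ord0 /= add0r; case: ifPn => _.
      by rewrite lerDl mulr_ge0 // ltW.
    have : 0 <= (T * g)^-1 * (2 - (w 0%N)^-1) by rewrite mulr_ge0 ?(ltW ei0) // subr_ge0; have := wi 0%N; lra.
    by have := w2 0%N; lra.
  rewrite big_ord_recr /=; apply: (le_trans (lerD IH (lexx _))).
  have gap := sgap n.
  case: ifPn => h1; case: ifPn => h2.
  - have a1 : w n.+1 + T * g <= w n.
      rewrite /w !ltr0_norm ?subr_lt0 //; have : T * (s n + g) <= T * s n.+1 by rewrite ler_pM2l.
      rewrite mulrDr !mulrN !mulrBr; move: (T * g) (T * s n) (T * s n.+1) (T * Rad) => u v u' v'; lra.
    have := inv_step e0 (w1 n.+1) a1; rewrite mulrBr; lra.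
  - have p1 : (T * g)^-1 * (w n)^-1 <= (T * g)^-1 by rewrite ler_piMr ?wi // ltW.
    have p2 : (T * g)^-1 * (w n.+1)^-1 <= (T * g)^-1 by rewrite ler_piMr ?wi // ltW.
    by rewrite mulrBr; have := w2 n; have := w2 n.+1; lra.
  - by exfalso; move/negP: h1; apply; exact: le_lt_trans (sS n) h2.
  - have a1 : w n + T * g <= w n.+1.
      move: h1 h2; rewrite -!leNgt => h1 h2.
      rewrite /w !ger0_norm ?subr_ge0 //; have : T * (s n + g) <= T * s n.+1 by rewrite ler_pM2l.
      rewrite mulrDr !mulrBr; move: (T * g) (T * s n) (T * s n.+1) (T * Rad) => u v u' v'; lra.
    have := inv_step e0 (w1 n) a1; rewrite !mulrBr; lra.
have mono : \sum_(j < n) (w j ^+ 2)^-1 <= \sum_(j < n.+1) (w j ^+ 2)^-1.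
  by rewrite big_ord_recr /= lerDl invr_ge0 exprn_ge0 // (le_trans ler01).
apply: (le_trans mono); apply: (le_trans main); case: ifPn => _.
  have : (T * g)^-1 * (w n)^-1 <= (T * g)^-1 by rewrite ler_piMr ?wi // ltW.
  by have := w2 n; lra.
by have := mulr_gt0 ei0 (wi0 n); rewrite mulrBr; lra.
Qed.

Lemma powR_concave (c a b : R) : 0 < c -> c <= 1 -> 0 < a -> a <= b ->
  c * b `^ (c - 1) * (b - a) <= b `^ c - a `^ c.
Proof.
move=> c0 c1 a0 ab.
have [||x] := @MVT_segment R (fun t => t `^ c) (fun t => c * t `^ (c - 1)) a b ab.
- by move=> t; rewrite in_itv /= => /andP[at_ _]; apply: der_powR; exact: lt_trans at_.
- apply: derivable_within_continuous => t; rewrite in_itv /= => /andP[at_ _].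
  by have [] := der_powR c (lt_le_trans a0 at_).
rewrite in_itv /= => /andP[ax xb] ->; apply: ler_wpM2r; first by rewrite subr_ge0.
apply: ler_wpM2l; first exact: ltW.
by apply: le0_powR_anti => //; [rewrite subr_le0|exact: lt_le_trans ax].
Qed.

(** Comparison with the increments of the concave function [t^(2 kap + 1)], using the gaps; the
    summand [(s 0)^-1] of [C] starts the induction. *)
Lemma sum_powR_le : kap <= 0 -> exists C : R, 0 < C /\ forall n Rad, 0 < Rad ->
  \sum_(j < n) (if s j < Rad then s j `^ (2 * kap) else 0) <= C * Rad `^ (2 * kap + 1).
Proof.
move=> k0; set al := 2 * kap.
have al0 : 0 < al + 1 by rewrite -ltrBlDr sub0r.
have al1 : al + 1 <= 1 by rewrite gerDr; move: k0; rewrite /al; lra.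
pose C := ((al + 1) * g)^-1 + (s 0%N)^-1.
have C0 : 0 < C by rewrite addr_gt0 // invr_gt0 // mulr_gt0.
exists C; split => //.
have full n : \sum_(j < n.+1) s j `^ al <= C * s n `^ (al + 1).
  elim: n => [|n IH].
    rewrite big_ord_recr big_ord0 /= add0r (powRS (al + 1) (sgt0 0%N)) addrK mulrA.
    rewrite ler_peMl ?powR_ge0 // /C mulrDl mulVf ?gt_eqF // lerDr mulr_ge0 ?(ltW (sgt0 _)) //.
    by rewrite invr_ge0; positivity.
  rewrite big_ord_recr /=; apply: (le_trans (lerD IH (lexx _))).
  have le1 := sS n.
  have := powR_concave al0 al1 (sgt0 n) le1; rewrite addrK => h.
  have h2 : s n.+1 `^ al <= C * (s n.+1 `^ (al + 1) - s n `^ (al + 1)).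
    apply: (@le_trans _ _ (C * ((al + 1) * s n.+1 `^ al * (s n.+1 - s n)))).
      have p0 := powR_ge0 (s n.+1) al; move: (s n.+1 `^ al) p0 => p p0.
      rewrite (_ : C * _ = p * (C * ((al + 1) * (s n.+1 - s n)))); last by ring.
      rewrite ler_peMr //; apply: (@le_trans _ _ (C * ((al + 1) * g))).
        rewrite /C mulrDl mulVf ?gt_eqF ?mulr_gt0 // lerDl mulr_ge0 ?invr_ge0 ?(ltW (sgt0 _)) //.
        by rewrite mulr_ge0 // ltW.
      apply: ler_wpM2l; first exact: ltW.
      by apply: ler_wpM2l; [exact: ltW|rewrite lerBrDl].
    by apply: ler_wpM2l => //; exact: ltW.
  by rewrite mulrBr in h2; lra.
move=> n Rad R0; elim: n => [|n IH].
  by rewrite big_ord0 mulr_ge0 ?powR_ge0 // ltW.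
have [h|h] := ltP (s n) Rad; last first.
  by rewrite big_ord_recr /= ltNge h /= addr0.
apply: (@le_trans _ _ (\sum_(j < n.+1) s j `^ al)).
  by apply: ler_sum => j _; case: ifP => // _; exact: powR_ge0.
apply: (le_trans (full n)); apply: ler_wpM2l; first exact: ltW.
by apply: ge0_ler_powR; rewrite ?nnegrE ?(ltW al0) ?(ltW R0) ?(ltW (sgt0 n)) // ltW.
Qed.

(** For [kap >= 0] the growth [(s_j / Rad)^(2 kap)] consumes at most [Num.bound (2 kap)] powers of
    the weight; two more make the sum converge. *)
Definition wexp : nat := addn (Num.bound (2 * kap)) 2.

(** For [kap >= 0], [s_j / Rad <= 1 + T |s_j - Rad|] because [T >= 1 / Rad]. For [kap < 0] the power
    is large only when [s_j < Rad / 2]; there the weight is at most [2 / (T Rad)] and [sum_powR_le]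
    takes over. *)
Lemma weight_sum_le (T0 : R) : 0 < T0 -> exists C : R, 0 < C /\ forall T Rad n, Rad^-1 <= T -> T <= T0 ->
  0 < Rad ->
  \sum_(j < n) ((1 + T * `|s j - Rad|) ^+ wexp)^-1 * (Num.max 1 ((s j / Rad) `^ kap)) ^+ 2 <= C / T.
Proof.
move=> T00.
have base T Rad n : 0 < T -> T <= T0 -> \sum_(j < n) ((1 + T * `|s j - Rad|) ^+ 2)^-1 <= (2 * T0 + 2 / g) / T.
  move=> Tp TT; apply: (le_trans (sum_gap_le Rad n Tp)).
  rewrite ler_pdivlMr // mulrDl (_ : 2 * (T * g)^-1 * T = 2 / g); last by field; rewrite !gt_eqF.
  by lra.
have [k0|k0] := leP 0 kap.
  exists (2 * T0 + 2 / g); split; first by rewrite addr_gt0 ?divr_gt0 ?mulr_gt0.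
  move=> T Rad n hT TT R0; have Tp : 0 < T by apply: lt_le_trans hT; rewrite invr_gt0.
  apply: le_trans (base T Rad n Tp TT); apply: ler_sum => j _.
  set w := 1 + T * `|s j - Rad|.
  have w1 : 1 <= w by rewrite lerDl mulr_ge0 // ltW.
  have w0 : 0 < w by lra.
  have hm : Num.max 1 ((s j / Rad) `^ kap) <= w `^ kap.
    have sw : s j / Rad <= w.
      rewrite (_ : s j / Rad = 1 + Rad^-1 * (s j - Rad)); last by field; rewrite gt_eqF.
      rewrite lerD2l; apply: (@le_trans _ _ (Rad^-1 * `|s j - Rad|)).
        by apply: ler_wpM2l; [rewrite invr_ge0 ltW|exact: ler_norm].
      by apply: ler_wpM2r.
    rewrite ge_max; apply/andP; split.
      apply: (@le_trans _ _ (1 `^ kap)); first by rewrite powR1.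
      by apply: ge0_ler_powR => //; rewrite ?nnegrE // ltW.
    by apply: ge0_ler_powR => //; rewrite nnegrE ?(ltW w0) // divr_ge0 // ltW.
  have hm2 : Num.max 1 ((s j / Rad) `^ kap) ^+ 2 <= w ^+ Num.bound (2 * kap).
    apply: (@le_trans _ _ ((w `^ kap) ^+ 2)).
      by rewrite lerXn2r ?nnegrE ?powR_ge0 // le_max ler01.
    rewrite -powR_mulrn ?powR_ge0 // -powRrM -powR_mulrn ?(ltW w0) //.
    by apply: ler_powR => //; rewrite mulrC; apply: ltW; apply: archi_boundP; rewrite mulr_ge0.
  rewrite /wexp exprD invfM.
  rewrite (_ : _ * _ * _ = (w ^+ 2)^-1 * ((w ^+ Num.bound (2 * kap))^-1 * Num.max 1 ((s j / Rad) `^ kap) ^+ 2)); last by ring.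
  rewrite ler_piMr ?invr_ge0 ?exprn_ge0 ?(ltW w0) //.
  by rewrite mulrC ler_pdivrMr ?exprn_gt0 // mul1r.
have [C [C0 hC]] := sum_powR_le (ltW k0).
exists (4 * (2 * T0 + 2 / g) + 2 * C); split.
  by rewrite addr_gt0 ?mulr_gt0 // addr_gt0 ?divr_gt0 ?mulr_gt0.
move=> T Rad n hT TT R0; have Tp : 0 < T by apply: lt_le_trans hT; rewrite invr_gt0.
have TR0 : 0 < T * Rad by exact: mulr_gt0.
have h1 := base T Rad n Tp TT.
have h2 := hC n Rad R0.
pose q := 2 / (T * Rad) * Rad `^ (- (2 * kap)).
have q0 : 0 <= q by rewrite mulr_ge0 ?powR_ge0 // divr_ge0 // ltW.
apply: (@le_trans _ _ (4 * (\sum_(j < n) ((1 + T * `|s j - Rad|) ^+ 2)^-1) +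
   q * \sum_(j < n) (if s j < Rad then s j `^ (2 * kap) else 0))); last first.
  rewrite [leRHS]mulrDl; apply: lerD; first by rewrite -mulrA; apply: ler_wpM2l.
  apply: (@le_trans _ _ (q * (C * Rad `^ (2 * kap + 1)))); first by apply: ler_wpM2l.
  rewrite /q (powRS (2 * kap + 1) R0) addrK.
  have e : Rad `^ (- (2 * kap)) * Rad `^ (2 * kap) = 1.
    by rewrite -powRD ?(gt_eqF R0) ?implybT // addNr powRr0.
  move: (Rad `^ (- (2 * kap))) (Rad `^ (2 * kap)) e => u v e.
  have -> : 2 / (T * Rad) * u * (C * (Rad * v)) = (u * v) * (2 * C / T) by field; rewrite !gt_eqF.
  by rewrite e mul1r.
rewrite !mulr_sumr -big_split /=; apply: ler_sum => j _.
set w := 1 + T * `|s j - Rad|.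
have w1 : 1 <= w by rewrite lerDl mulr_ge0 // ltW.
have w0 : 0 < w by lra.
have wP : (w ^+ wexp)^-1 <= (w ^+ 2)^-1.
  by rewrite lef_pV2 ?posrE ?exprn_gt0 //; apply: ler_weXn2l => //; exact: leq_addl.
have wi0 : 0 <= (w ^+ 2)^-1 by rewrite invr_ge0 exprn_ge0 // ltW.
have wj0 : 0 <= (w ^+ wexp)^-1 by rewrite invr_ge0 exprn_ge0 // ltW.
have sR0 : 0 < s j / Rad by exact: divr_gt0.
have [hs|hs] := leP (Rad / 2) (s j).
  have hm : Num.max 1 ((s j / Rad) `^ kap) <= 2.
    rewrite ge_max; apply/andP; split; first by lra.
    apply: (@le_trans _ _ ((2^-1) `^ kap)).
      apply: le0_powR_anti => //; first exact: ltW.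
      by rewrite ler_pdivlMr // mulrC.
    rewrite -powR_inv1 // -powRrM mulN1r; apply: (@le_trans _ _ (2 `^ 1)); last by rewrite powRr1.
    by apply: ler_powR; [|have k1 := kap1]; lra.
  apply: (@le_trans _ _ (4 * (w ^+ 2)^-1)).
    rewrite mulrC; apply: ler_pM => //.
    rewrite (_ : 4 = 2 ^+ 2); last by ring.
    by rewrite lerXn2r ?nnegrE // le_max ler01.
  by rewrite lerDl mulr_ge0 //; case: ifP => // _; exact: powR_ge0.
have sR : s j < Rad by lra.
rewrite sR; apply: (@le_trans _ _ (q * s j `^ (2 * kap))); last by rewrite lerDr mulr_ge0.
have hm : Num.max 1 ((s j / Rad) `^ kap) = (s j / Rad) `^ kap.
  apply: max_r; apply: (@le_trans _ _ (1 `^ kap)); first by rewrite powR1.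
  by apply: le0_powR_anti => //; [exact: ltW|rewrite ler_pdivrMr // mul1r ltW].
have e : ((s j / Rad) `^ kap) ^+ 2 = Rad `^ (- (2 * kap)) * s j `^ (2 * kap).
  rewrite -powR_mulrn ?powR_ge0 // -powRrM mulrC powRM ?(ltW (sgt0 j)) ?invr_ge0 ?(ltW R0) //.
  by rewrite -(powR_inv1 (ltW R0)) -powRrM mulN1r [kap * 2]mulrC.
rewrite hm e /q -mulrA; apply: ler_wpM2r; first by rewrite mulr_ge0 ?powR_ge0.
have hw : T * Rad / 2 <= w.
  rewrite /w distrC ger0_norm; last by rewrite subr_ge0 ltW.
  have : T * (Rad / 2) <= T * (Rad - s j) by rewrite ler_pM2l //; lra.
  by rewrite mulrA; lra.
apply: (le_trans wP).
have -> : 2 / (T * Rad) = (T * Rad / 2)^-1 by field; rewrite !gt_eqF.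
rewrite lef_pV2 ?posrE ?exprn_gt0 ?divr_gt0 //.
by apply: (le_trans hw); rewrite expr2 ler_peMl // ltW.
Qed.

End SpectralSums.

(** * Pointwise bounds of the kernel *)

Section RieszKernel.
Context {R : realType}.
Implicit Types (x z t a b T Rad : R) (j n : nat).
Variables (kap : R) (y k : R -> R).
Hypothesis kap1 : -1 < 2 * kap.
Hypothesis yD : forall z, is_derive z 1 y (- (z * k z)).
Hypothesis kD : forall z, is_derive z 1 (fun t => t * k t) (y z - 2 * kap * k z).
Hypothesis kc : continuous k.
Hypothesis y0 : y 0 != 0.
Variable s : nat -> R.
Hypothesis s_mono : {homo s : m n / (m < n)%N >-> m < n}.
Hypothesis s_zero : forall z, 0 < z /\ y z = 0 <-> exists j, s j = z.
Hypothesis ks : forall j, k (s j) != 0.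
Variable delta : R.
Hypothesis delta0 : 0 < delta.
Notation ef := (ef y k s).
Notation Phi := (Phi kap).
Notation rmR := (rmR delta).

Let sgt0 j : 0 < s j. Proof. exact: (s_gt0 s_zero). Qed.

(** The sum is complete as soon as [s n >= Rad]. The factor [(x z)^kap], which turns [ef] into
    [phi], is left out. *)
Definition rker Rad n x z : R := \sum_(j < n) rmR Rad (s j) * (ef j x * ef j z).

Lemma rmR_eq0 Rad lam : 0 < Rad -> Rad <= lam -> rmR Rad lam = 0.
Proof.
move=> R0 h; apply: rm_eq0 => //; rewrite ger0_norm; first by rewrite ler_pdivlMr // mul1r.
by rewrite divr_ge0 ?(ltW R0) // (le_trans (ltW R0) h).
Qed.

Lemma rmR_ge0_le1 Rad lam : 0 <= rmR Rad lam <= 1.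
Proof. by rewrite /rmR rm_ge0 rm_le1. Qed.

Lemma rker_stable Rad n m x z : 0 < Rad -> Rad <= s n -> (n <= m)%N -> rker Rad m x z = rker Rad n x z.
Proof.
move=> R0 hn nm; rewrite /rker -!(big_mkord xpredT (fun j => rmR Rad (s j) * (ef j x * ef j z))).
have t0 : \sum_(n <= j < m) rmR Rad (s j) * (ef j x * ef j z) = 0.
  rewrite big_nat_cond big1 // => j /andP[/andP[nj _] _]; rewrite rmR_eq0 ?mul0r //.
  by apply: (le_trans hn); rewrite (s_le s_mono).
by rewrite (@big_cat_nat _ _ _ n 0%N m) //= t0 addr0.
Qed.

Lemma rker_small Rad n x z : 0 < Rad -> Rad <= s 0%N -> rker Rad n x z = 0.
Proof. by move=> R0 h; rewrite (rker_stable _ _ R0 h (leq0n n)) /rker big_ord0. Qed.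

Lemma rkerC Rad n x z : rker Rad n x z = rker Rad n z x.
Proof. by apply: eq_bigr => j _; rewrite (mulrC (ef j x)). Qed.

Let Mx Rad j : R := Num.max 1 ((s j / Rad) `^ kap).
Let wt T Rad j : R := ((1 + T * `|s j - Rad|) ^+ wexp kap)^-1.

Let Mx1 Rad j : 1 <= Mx Rad j ^+ 2.
Proof. by rewrite exprn_ege1 // /Mx le_max lexx. Qed.

Let wt_ge0 T Rad j : 0 <= T -> 0 <= wt T Rad j.
Proof. by move=> T0; rewrite invr_ge0 exprn_ge0 // addr_ge0 // mulr_ge0. Qed.

Let rm_wt Rad j : 0 < Rad -> rmR Rad (s j) <= 2 ^+ wexp kap * wt Rad^-1 Rad j.
Proof.
move=> R0; have q0 : 0 <= Rad^-1 * `|s j - Rad| by rewrite mulr_ge0 // invr_ge0 ltW.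
have q1 : 0 < 1 + Rad^-1 * `|s j - Rad| by lra.
have [h|h] := leP Rad (s j).
  by rewrite rmR_eq0 // mulr_ge0 ?exprn_ge0 // wt_ge0 // invr_ge0 ltW.
apply: (@le_trans _ _ 1); first by case/andP: (rmR_ge0_le1 Rad (s j)).
rewrite /wt -exprVn -exprMn exprn_ege1 // ler_pdivlMr // mul1r.
rewrite ltr0_norm ?subr_lt0 // opprB mulrBr mulVf ?gt_eqF //.
have : 0 <= Rad^-1 * s j by rewrite mulr_ge0 ?invr_ge0 ?(ltW (sgt0 j)) // ltW.
lra.
Qed.

Lemma term_le : exists C : R, 0 < C /\ forall Rad j x z, 0 < Rad -> 0 < x -> 0 < z ->
  x `^ kap * z `^ kap * `|ef j x * ef j z| <= C * (Phi (Rad * x) * Phi (Rad * z)) * Mx Rad j ^+ 2.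
Proof.
have [C [C0 hC]] := ef_le yD kD s_mono s_zero ks.
exists (C ^+ 2); split; first exact: exprn_gt0.
move=> Rad j x z R0 x0 z0.
have key u : 0 < u -> u `^ kap * `|ef j u| <= C * (Phi (Rad * u) * Mx Rad j).
  move=> u0; apply: (le_trans (hC j u u0)); apply: ler_wpM2l; first exact: ltW.
  exact: Phi_ratio.
rewrite normrM.
have -> : x `^ kap * z `^ kap * (`|ef j x| * `|ef j z|) = (x `^ kap * `|ef j x|) * (z `^ kap * `|ef j z|) by ring.
have -> : C ^+ 2 * (Phi (Rad * x) * Phi (Rad * z)) * Mx Rad j ^+ 2 =
  (C * (Phi (Rad * x) * Mx Rad j)) * (C * (Phi (Rad * z) * Mx Rad j)) by ring.
by apply: ler_pM; [rewrite mulr_ge0 ?powR_ge0|rewrite mulr_ge0 ?powR_ge0|exact: key|exact: key].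
Qed.

Lemma weight_sum (T0 : R) : 0 < T0 -> exists C : R, 0 < C /\ forall T Rad n, Rad^-1 <= T -> T <= T0 ->
  0 < Rad -> \sum_(j < n) wt T Rad j * Mx Rad j ^+ 2 <= C / T.
Proof.
have [g [g0 hg]] := s_gap yD kD s_mono s_zero.
by move=> T00; have [C [C0 hC]] := weight_sum_le kap1 g0 sgt0 hg T00; exists C.
Qed.

(** The multiplier is dominated by the weight with [T = 1 / Rad], whose sum is [O(Rad)]. For
    [Rad <= s 0] the kernel is zero, so [T] stays below [1 / s 0]. *)
Lemma rker_diag_le : exists C : R, 0 < C /\ forall Rad n x z, 0 < Rad -> 0 < x -> 0 < z ->
  x `^ kap * z `^ kap * `|rker Rad n x z| <= C * (Rad * (Phi (Rad * x) * Phi (Rad * z))).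
Proof.
have [C1 [C10 h1]] := term_le.
have i0 : 0 < (s 0%N)^-1 by rewrite invr_gt0.
have [C2 [C20 h2]] := weight_sum i0.
exists (C1 * (2 ^+ wexp kap * C2)); split; first by positivity.
move=> Rad n x z R0 x0 z0.
have P0 : 0 < Phi (Rad * x) * Phi (Rad * z) by rewrite mulr_gt0 // Phi_gt0 // mulr_gt0.
have [hs|hs] := leP Rad (s 0%N).
  rewrite rker_small // normr0 mulr0; positivity.
apply: (@le_trans _ _ (\sum_(j < n) C1 * (Phi (Rad * x) * Phi (Rad * z)) * 2 ^+ wexp kap * (wt Rad^-1 Rad j * Mx Rad j ^+ 2))).
  apply: (@le_trans _ _ (\sum_(j < n) rmR Rad (s j) * (x `^ kap * z `^ kap * `|ef j x * ef j z|))).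
    apply: (@le_trans _ _ (x `^ kap * z `^ kap * \sum_(j < n) `|rmR Rad (s j) * (ef j x * ef j z)|)).
      by apply: ler_wpM2l; [rewrite mulr_ge0 ?powR_ge0|exact: ler_norm_sum].
    rewrite mulr_sumr; apply: ler_sum => j _; rewrite normrM.
    by rewrite (ger0_norm (andP (rmR_ge0_le1 Rad (s j))).1) mulrCA.
  apply: ler_sum => j _.
  have -> : C1 * (Phi (Rad * x) * Phi (Rad * z)) * 2 ^+ wexp kap * (wt Rad^-1 Rad j * Mx Rad j ^+ 2) =
    (2 ^+ wexp kap * wt Rad^-1 Rad j) * (C1 * (Phi (Rad * x) * Phi (Rad * z)) * Mx Rad j ^+ 2) by ring.
  apply: ler_pM; [by case/andP: (rmR_ge0_le1 Rad (s j))| |exact: rm_wt|exact: h1].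
  by rewrite !mulr_ge0 ?powR_ge0.
rewrite -mulr_sumr.
apply: (@le_trans _ _ (C1 * (Phi (Rad * x) * Phi (Rad * z)) * 2 ^+ wexp kap * (C2 / Rad^-1))).
  apply: ler_wpM2l; first by positivity.
  by apply: h2 => //; rewrite lef_pV2 ?posrE // ltW.
by rewrite invrK le_eqVlt; apply/orP; left; apply/eqP; ring.
Qed.

(** With [T] half the distance, [x + T < z], and by [kernel_propagation] the kernel of the
    band-limited part [q] sums to zero. What is left is the error of [multiplier_split]: a factor
    [(Rad T)^(-delta)] times a weight with sum [O(1 / T)]. *)
Lemma rker_off_lt : exists C : R, 0 < C /\ forall Rad n x z, 0 < Rad -> 0 < x -> x < z -> z < 1 ->
  Rad <= s n -> 1 <= Rad * ((z - x) / 2) ->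
  x `^ kap * z `^ kap * `|rker Rad n x z| <=
  C * (Rad * (Phi (Rad * x) * Phi (Rad * z))) * (Rad * ((z - x) / 2)) `^ (- 1 - delta).
Proof.
have [C1 [C10 h1]] := term_le.
have [C2 [C20 h2]] := weight_sum (@ltr01 R).
have [C3 [C30 h3]] := multiplier_split delta0 (wexp kap).
have i0 : 0 < (s 0%N)^-1 by rewrite invr_gt0.
have [C4 [C40 h4]] := weight_sum i0.
exists (C3 * C1 * C2); split; first by positivity.
move=> Rad n x z R0 x0 xz z1 Rn RT1.
have z0 : 0 < z by exact: lt_trans xz.
pose T : R := (z - x) / 2; rewrite -/T in RT1 *.
have T0 : 0 < T by rewrite divr_gt0 // subr_gt0.
have RT0 : 0 < Rad * T by exact: mulr_gt0.
have P0 : 0 < Phi (Rad * x) * Phi (Rad * z) by rewrite mulr_gt0 // Phi_gt0 // mulr_gt0.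
have T1 : T <= 1 by rewrite /T; lra.
have RT : Rad^-1 <= T by rewrite -[Rad^-1]mul1r ler_pdivrMr // mulrC.
have [hs|hs] := leP Rad (s 0%N).
  rewrite rker_small // normr0 mulr0; positivity.
have [m1 [hm1 hm2]] := h3 Rad T R0 T0.
pose q j := m1 (s j).
have err j : `|rmR Rad (s j) - q j| <= C3 * (Rad * T) `^ (- delta) * wt T Rad j.
  exact: (hm2 _ (ltW (sgt0 j))).
have err_sum m : \sum_(j < m) C3 * (Rad * T) `^ (- delta) * wt T Rad j * Mx Rad j ^+ 2 <= C3 * (Rad * T) `^ (- delta) * (C2 / T).
  under eq_bigr do rewrite -mulrA.
  by rewrite -mulr_sumr; apply: ler_wpM2l; [positivity|exact: h2].
pose B := 2 ^+ wexp kap * (C4 / Rad^-1) + C3 * (Rad * T) `^ (- delta) * (C2 / T).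
have qB m : \sum_(j < m) `|q j| <= B.
  apply: (@le_trans _ _ (\sum_(j < m) (2 ^+ wexp kap * (wt Rad^-1 Rad j * Mx Rad j ^+ 2) + C3 * (Rad * T) `^ (- delta) * wt T Rad j * Mx Rad j ^+ 2))).
    apply: ler_sum => j _.
    have -> : q j = rmR Rad (s j) - (rmR Rad (s j) - q j) by ring.
    apply: (le_trans (ler_normB _ _)); apply: lerD.
      rewrite (ger0_norm (andP (rmR_ge0_le1 Rad (s j))).1); apply: (le_trans (rm_wt j R0)).
      apply: ler_wpM2l; first exact: exprn_ge0.
      by rewrite ler_peMr // wt_ge0 // invr_ge0 ltW.
    apply: (le_trans (err j)); rewrite ler_peMr // mulr_ge0 ?wt_ge0 ?(ltW T0) //.
    by rewrite mulr_ge0 ?powR_ge0 // ltW.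
  rewrite big_split /=; apply: lerD; last exact: err_sum.
  rewrite -mulr_sumr; apply: ler_wpM2l; first exact: exprn_ge0.
  by apply: h4 => //; rewrite lef_pV2 ?posrE // ltW.
have xTz : x + T < z by rewrite /T; lra.
have lim := kernel_propagation kap1 yD kD kc y0 s_mono s_zero ks x0 xTz z1 (ltW T0) qB (hm1 s).
set X := x `^ kap * z `^ kap.
have X0 : 0 <= X by rewrite mulr_ge0 ?powR_ge0.
pose Bd := C3 * C1 * C2 * (Rad * (Phi (Rad * x) * Phi (Rad * z))) * (Rad * T) `^ (- 1 - delta).
rewrite -/Bd.
have bnd m : (n <= m)%N -> X * `|rker Rad n x z - \sum_(j < m) q j * (ef j x * ef j z)| <= Bd.
  move=> nm; rewrite -(rker_stable x z R0 Rn nm) /rker -sumrB.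
  apply: (@le_trans _ _ (\sum_(j < m) C1 * (Phi (Rad * x) * Phi (Rad * z)) * (C3 * (Rad * T) `^ (- delta) * wt T Rad j * Mx Rad j ^+ 2))).
    apply: (@le_trans _ _ (X * \sum_(j < m) `|rmR Rad (s j) * (ef j x * ef j z) - q j * (ef j x * ef j z)|)).
      by apply: ler_wpM2l => //; exact: ler_norm_sum.
    rewrite mulr_sumr; apply: ler_sum => j _; rewrite -mulrBl normrM mulrCA.
    have -> : C1 * (Phi (Rad * x) * Phi (Rad * z)) * (C3 * (Rad * T) `^ (- delta) * wt T Rad j * Mx Rad j ^+ 2) =
      (C3 * (Rad * T) `^ (- delta) * wt T Rad j) * (C1 * (Phi (Rad * x) * Phi (Rad * z)) * Mx Rad j ^+ 2) by ring.
    by apply: ler_pM; [exact: normr_ge0|rewrite mulr_ge0|exact: err|exact: h1].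
  rewrite -mulr_sumr; apply: (@le_trans _ _ (C1 * (Phi (Rad * x) * Phi (Rad * z)) * (C3 * (Rad * T) `^ (- delta) * (C2 / T)))).
    by apply: ler_wpM2l; [positivity|exact: err_sum].
  rewrite /Bd (_ : - 1 - delta = - delta - 1); last by ring.
  rewrite (powRS (- delta) RT0).
  by rewrite le_eqVlt; apply/orP; left; apply/eqP; field; rewrite gt_eqF.
have lim2 : X * `|rker Rad n x z - \sum_(j < m) q j * (ef j x * ef j z)| @[m --> \oo] --> X * `|rker Rad n x z - 0|.
  by apply: cvgMr; apply: cvg_norm; apply: cvgB; [exact: cvg_cst|exact: lim].
rewrite subr0 in lim2; apply: (@cvgr_to_le _ _ _ _ _ _ _ lim2).
by near=> m; apply: bnd; near: m; exact: nbhs_infty_ge.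
Unshelve. all: by end_near. Qed.

Definition decay (t : R) : R := Num.min 1 (t `^ (- 1 - delta)).

Lemma rker_le : exists C : R, 0 < C /\ forall Rad n x z, 0 < Rad -> 0 < x < 1 -> 0 < z < 1 ->
  Rad <= s n -> x != z ->
  x `^ kap * z `^ kap * `|rker Rad n x z| <=
  C * (Rad * (Phi (Rad * x) * Phi (Rad * z))) * decay (Rad * `|x - z|).
Proof.
have [C1 [C10 h1]] := rker_diag_le; have [C2 [C20 h2]] := rker_off_lt.
(* The price of passing from half the distance to the distance; it also keeps the claimed bound
   above the diagonal one when [Rad (z - x) < 2]. *)
pose E : R := 2 `^ (1 + delta).
have E1 : 1 <= E.
  by rewrite /E -[leLHS](powRr0 2); apply: ler_powR; [lra|rewrite addr_ge0 // ltW].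
exists ((C1 + C2) * E); split; first by rewrite mulr_gt0 ?addr_gt0 // (lt_le_trans ltr01).
move=> Rad n.
suff main x z : 0 < Rad -> 0 < x -> x < z -> z < 1 -> Rad <= s n ->
  x `^ kap * z `^ kap * `|rker Rad n x z| <=
  (C1 + C2) * E * (Rad * (Phi (Rad * x) * Phi (Rad * z))) * decay (Rad * `|x - z|).
  move=> x z R0 /andP[x0 x1] /andP[z0 z1] Rn xz.
  have [h|h] := ltP x z; first exact: main.
  have {}h : z < x by rewrite lt_neqAle eq_sym xz.
  by rewrite rkerC distrC (mulrC (x `^ kap)) (mulrC (Phi (Rad * x))); exact: main.
move=> R0 x0 xz z1 Rn; have z0 := lt_trans x0 xz.
set X := x `^ kap * z `^ kap * _; set P := Rad * _.
have P0 : 0 < P by rewrite !mulr_gt0 // Phi_gt0 // mulr_gt0.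
have b1 : X <= C1 * P by exact: h1.
have d0 : 0 < z - x by rewrite subr_gt0.
have xzd : `|x - z| = z - x by rewrite distrC gtr0_norm.
rewrite xzd /decay.
set v := Rad * (z - x).
have v0 : 0 < v by exact: mulr_gt0.
have vh : Rad * ((z - x) / 2) = v / 2 by rewrite mulrA.
have vE : (v / 2) `^ (- 1 - delta) = E * v `^ (- 1 - delta).
  rewrite powRM ?(ltW v0) // mulrC /E; congr (_ * _).
  by rewrite -powR_inv1 // -powRrM; congr (_ `^ _); ring.
have CE : C1 * P <= (C1 + C2) * E * P.
  apply: ler_wpM2r; first exact: ltW.
  apply: (@le_trans _ _ ((C1 + C2) * 1)); first by lra.
  by apply: ler_wpM2l => //; lra.
case: (leP 1 (v `^ (- 1 - delta))) => hv.
  by rewrite mulr1; apply: (le_trans b1).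
have [hv2|hv2] := leP 1 (v / 2).
  have := h2 Rad n x z R0 x0 xz z1 Rn; rewrite vh => /(_ hv2) b2; apply: (le_trans b2).
  rewrite vE -/P (_ : C2 * P * (E * _) = C2 * E * P * v `^ (- 1 - delta)); last by ring.
  apply: ler_wpM2r; first exact: powR_ge0.
  apply: ler_wpM2r; first exact: ltW.
  by apply: ler_wpM2r; lra.
apply: (le_trans b1).
have e1 : 1 <= E * v `^ (- 1 - delta).
  rewrite -vE; apply: (@le_trans _ _ (1 `^ (- 1 - delta))); first by rewrite powR1.
  by apply: le0_powR_anti; [have dd := delta0; lra|lra|exact: ltW].
apply: (@le_trans _ _ ((C1 + C2) * P * (E * v `^ (- 1 - delta)))); last first.
  by rewrite le_eqVlt; apply/orP; left; apply/eqP; ring.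
apply: (@le_trans _ _ ((C1 + C2) * P)); first by apply: ler_wpM2r; [exact: ltW|lra].
by rewrite ler_peMr // mulr_ge0 // ltW //; lra.
Qed.

End RieszKernel.

(** * Bochner-Riesz means as integral operators *)

Section ConcreteKernel.
Context {R : realType}.
Notation mu := (@lebesgue_measure R).
Implicit Types (x z t Rad : R) (j n : nat) (f : R -> R).
Variables (nu delta : R) (s : nat -> R).
Hypothesis nu1 : -1 < nu.
Hypothesis delta0 : 0 < delta.
Hypothesis zeros : bessel_zeros nu s.

Let kap : R := nu + 1 / 2.
Let y : R -> R := bj nu.
Let k : R -> R := fun z => bj (nu + 1) z / 2.

Lemma kap_gt : -1 < 2 * kap.
Proof. by rewrite /kap mulrDr mulrA mulr1 mulfV ?pnatr_eq0 //; have h := nu1; lra. Qed.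

Let yD z : is_derive z 1 y (- (z * k z)).
Proof. exact: bj_der. Qed.

Let kD z : is_derive z 1 (fun t => t * k t) (y z - 2 * kap * k z).
Proof.
have h := bj_der2 z nu1; apply: der_eq h _; rewrite /y /k /kap.
by have -> : 2 * (nu + 1 / 2) = 2 * nu + 1 by field.
Qed.

Let kc : continuous k.
Proof.
have nu2 : -1 < nu + 1 by have h := nu1; lra.
by move=> z; apply: cvgM; [exact: bj_cont|exact: cvg_cst].
Qed.

Let s_mono : {homo s : m n / (m < n)%N >-> m < n}. Proof. exact: zeros.1. Qed.

Let s_zero z : 0 < z /\ y z = 0 <-> exists j, s j = z.
Proof.
rewrite -(zeros.2 z); split=> -[z0 h]; split=> //.
  by rewrite besselJE // -/y h mulr0.
apply/eqP; move/eqP: h; rewrite besselJE // mulf_eq0 gt_eqF //=.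
by apply: powR_gt0; rewrite divr_gt0.
Qed.

Let sgt0 j : 0 < s j. Proof. exact: (s_gt0 s_zero). Qed.

Let ks j : k (s j) != 0.
Proof.
have [c [c0 hc]] := vf_s_lower yD kD s_mono s_zero.
apply/eqP => h; have := hc j; rewrite h mulr0 normr0 mulr0 => hh.
by have := lt_le_trans c0 hh; rewrite ltxx.
Qed.

(** The value is [1 / Gamma (nu + 1)]. Were it 0, the functional equation would annihilate all
    coefficients (with [0^-1 = 0]), so every positive number would be a zero, in particular
    [s 0 / 2], below the least one. *)
Let y0 : y 0 != 0.
Proof.
apply/eqP => h0.
have bc0 : bc nu 0 = 0.
  move: h0; rewrite /y /bj mul0r expr0n /= /bser => <-; apply/esym; apply: lim_near_cst => //.
  near=> n; have n0 : (0 < n)%N by near: n; exact: nbhs_infty_gt.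
  rewrite /pseries /series /= (big_ltn n0) expr0 mulr1 big_nat_cond big1; first by rewrite addr0.
  move=> i /andP[/andP[i0 _] _]; by rewrite expr0n gtn_eqF // mulr0.
have G m : Gamma (m%:R + nu + 1) = 0 :> R.
  elim: m => [|m IH]; last by rewrite bc_GammaD1 // IH mulr0.
  move/eqP: bc0; rewrite /bc expr0 mul1r invr_eq0 mulf_eq0 pnatr_eq0 /= => /eqP.
  by [].
have y_0 z : y z = 0.
  rewrite /y /bj /bser (_ : pseries _ _ = fun=> 0); first exact: lim_cst.
  apply/funext => n; rewrite /pseries /series /=; apply: big1 => i _.
  by rewrite /bc G mulr0 invr0 mulr0 mul0r.
have [j hj] : exists j, s j = s 0%N / 2.
  by apply/s_zero; rewrite y_0; split => //; rewrite divr_gt0.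
have : s 0%N <= s j by rewrite (s_le s_mono).
by rewrite hj; have h := sgt0 0%N; lra.
Unshelve. all: by end_near. Qed.

Lemma phiE j x : 0 < x -> phi nu s j x = x `^ kap * ef y k s j x.
Proof.
move=> x0; have s0 := sgt0 j.
have nu2 : -1 < nu + 1 by have h := nu1; lra.
rewrite /phi besselJE ?mulr_gt0 // besselJE // -/y /ef /ec.
have -> : bj (nu + 1) (s j) = 2 * k (s j) by rewrite /k; field.
have hs : 0 < s j / 2 by exact: divr_gt0.
rewrite (powRS (nu + 1) hs) addrK.
have -> : s j * x / 2 = s j / 2 * x by ring.
rewrite powRM ?(ltW hs) ?(ltW x0) // sqrtrM //.
have -> : x `^ kap = x `^ nu * Num.sqrt x.
  by rewrite -powR12_sqrt ?(ltW x0) // -powRD ?(gt_eqF x0) ?implybT // /kap mul1r.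
have -> : s j / 2 * (s j / 2) `^ nu * (2 * k (s j)) = (s j / 2) `^ nu * (s j * k (s j)) by field.
rewrite normrM (gtr0_norm (powR_gt0 _ hs)).
have p0 : (s j / 2) `^ nu != 0 by rewrite gt_eqF // powR_gt0.
have d0 : `|s j * k (s j)| != 0 by rewrite normr_eq0 mulf_neq0 // gt_eqF.
move: (`|s j * k (s j)|) ((s j / 2) `^ nu) d0 p0 => D P d0 p0; field.
by rewrite d0 p0.
Qed.

(** Agrees with [decay] for [t > 0]; the case distinction gives the value 1 on the diagonal, where a
    negative power of 0 is 0 by convention. *)
Definition dk (t : R) : R := if t <= 1 then 1 else t `^ (- 1 - delta).
Definition kR (Rad x z : R) : R := Rad * (Phi kap (Rad * x) * Phi kap (Rad * z)) * dk (Rad * `|x - z|).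

Lemma dk_ge0 t : 0 <= dk t. Proof. by rewrite /dk; case: ifP => // _; exact: powR_ge0. Qed.

Lemma measurable_dk : measurable_fun setT dk.
Proof.
by apply: measurable_fun_ifT => //; exact: measurable_fun_ler.
Qed.

Lemma measurable_Phi : measurable_fun setT (Phi kap).
Proof.
by apply: measurable_fun_ifT => //; exact: measurable_fun_ler.
Qed.

Lemma measurable_kR Rad x : measurable_fun setT (kR Rad x).
Proof.
apply: measurable_funM; last first.
  apply: (@measurableT_comp _ _ _ _ _ _ dk _ (fun z => Rad * `|x - z|)); first exact: measurable_dk.
  by apply: measurable_funM => //; apply: measurableT_comp => //; exact: measurable_funB.
apply: measurable_funM => //; apply: measurable_funM => //.
apply: (@measurableT_comp _ _ _ _ _ _ (Phi kap) _ (fun z => Rad * z)); first exact: measurable_Phi.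
exact: measurable_funM.
Qed.

Lemma kR_ge0 Rad x z : 0 < Rad -> 0 < x -> 0 < z -> 0 <= kR Rad x z.
Proof.
by move=> R0 x0 z0; rewrite !mulr_ge0 ?dk_ge0 ?(ltW R0) // ltW // Phi_gt0 // mulr_gt0.
Qed.

Let rk := rker y k s delta.

Lemma rker_kR : exists C : R, 0 < C /\ forall Rad n x z, 0 < Rad -> 0 < x < 1 -> 0 < z < 1 ->
  Rad <= s n -> x `^ kap * z `^ kap * `|rk Rad n x z| <= C * kR Rad x z.
Proof.
have [C1 [C10 h1]] := rker_diag_le kap_gt yD kD s_mono s_zero ks delta0.
have [C2 [C20 h2]] := rker_le kap_gt yD kD kc y0 s_mono s_zero ks delta0.
exists (C1 + C2); split; first by rewrite addr_gt0.
move=> Rad n x z R0 x01 z01 Rn.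
have [x0 _] := andP x01; have [z0 _] := andP z01.
have P0 : 0 < Rad * (Phi kap (Rad * x) * Phi kap (Rad * z)).
  by rewrite !mulr_gt0 // Phi_gt0 // mulr_gt0.
rewrite /kR /dk mulrA; case: ifPn => ht.
  rewrite mulr1; apply: (le_trans (h1 Rad n x z R0 x0 z0)).
  by apply: ler_wpM2r; [exact: ltW|lra].
have xz : x != z.
  by apply/eqP => e; move: ht; rewrite e subrr normr0 mulr0 ler01.
apply: (le_trans (h2 Rad n x z R0 x01 z01 Rn xz)).
apply: ler_pM; [| | |by rewrite /decay ge_min lexx orbT].
- by apply: mulr_ge0; exact: ltW.
- by rewrite /decay le_min ler01 powR_ge0.
- by apply: ler_wpM2r; [exact: ltW|lra].
Qed.

Lemma measurable_phi j : measurable_fun (`]0%R, 1%R[ : set R) (phi nu s j).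
Proof.
apply: (@eq_measurable_fun _ _ _ _ _ (fun z => z `^ kap * ef y k s j z)).
  by move=> z; rewrite inE /= in_itv /= => /andP[z0 _]; rewrite phiE.
apply: oo_continuous_measurable => z /andP[z0 _]; apply: cvgM; first exact: continuous_powR.
exact: (ef_cont yD).
Qed.

Lemma phi_le j : exists C : R, 0 < C /\ forall z, 0 < z < 1 -> `|phi nu s j z| <= C * z `^ kap.
Proof.
have [M [M0 hM]] := continuous_bounded01 (@ef_cont R y k yD s j).
exists (M + 1); split; first by lra.
move=> z /andP[z0 z1]; rewrite phiE // normrM (ger0_norm (powR_ge0 _ _)) mulrC.
apply: ler_wpM2r; first exact: powR_ge0.
by apply: (@le_trans _ _ M); [apply: hM; rewrite !ltW|lra].
Qed.

Lemma s_unbounded Rad : exists n, Rad <= s n.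
Proof.
have [g [g0 hg]] := s_lower yD kD s_mono s_zero.
have [n hn] : exists n : nat, Rad / g <= n%:R.
  exists (Num.bound `|Rad / g|); apply: (le_trans (ler_norm _)); apply: ltW; exact: archi_boundP.
exists n; apply: le_trans (hg n); rewrite -ler_pdivrMl // mulrC; apply: (le_trans hn).
by rewrite ler_nat.
Qed.

Lemma bochner_sum f Rad n x : 0 < Rad -> Rad <= s n ->
  bochner_riesz nu s delta f Rad x = \sum_(j < n) rmR delta Rad (s j) * coef nu s f j * phi nu s j x.
Proof.
move=> R0 hn; rewrite /bochner_riesz; apply: lim_near_cst => //; near=> m.
have nm : (n <= m)%N by near: m; exact: nbhs_infty_ge.
have e j : Num.max (1 - s j ^+ 2 / Rad ^+ 2) 0 `^ delta = rmR delta Rad (s j).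
  by rewrite /rmR /rm expr_div_n.
rewrite /series /= (@big_cat_nat _ _ _ n 0%N m) //= big_mkord.
rewrite [X in _ + X]big_nat_cond [X in _ + X]big1; last first.
  move=> j /andP[/andP[nj _] _]; rewrite e rmR_eq0 ?mul0r //.
  by apply: (le_trans hn); rewrite (s_le s_mono).
by rewrite addr0; apply: eq_bigr => j _; rewrite e.
Unshelve. all: by end_near. Qed.

Definition coef_integrable f := forall j,
  mu.-integrable (`]0%R, 1%R[ : set R) (EFin \o (fun t => f t * phi nu s j t)).

Lemma bochner_le : exists C : R, 0 < C /\ forall f Rad x, measurable_fun (`]0%R, 1%R[ : set R) f ->
  coef_integrable f -> 0 < Rad -> 0 < x < 1 ->
  (`|bochner_riesz nu s delta f Rad x|%:E <=
   C%:E * \int[mu]_(z in `]0%R, 1%R[) (`|f z| * kR Rad x z)%:E)%E.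
Proof.
have [C [C0 hC]] := rker_kR.
exists C; split => // f Rad x mf fi R0 x01; have [x0 x1] := andP x01.
have [n hn] := s_unbounded Rad.
rewrite (bochner_sum f x R0 hn).
pose F m z := \sum_(j < m) (rmR delta Rad (s j) * phi nu s j x) * (f z * phi nu s j z).
have Fi m : mu.-integrable (`]0%R, 1%R[ : set R) (EFin \o F m) /\
   \sum_(j < m) rmR delta Rad (s j) * coef nu s f j * phi nu s j x = \int[mu]_(z in `]0, 1[) F m z.
  elim: m => [|m [IH1 IH2]].
    split; last by rewrite big_ord0 /F; under eq_Rintegral do rewrite big_ord0; rewrite Rintegral_cst ?mul0r.
    rewrite (_ : _ \o _ = cst 0%E); first exact: integrable0.
    by apply/funext => z; rewrite /= /F big_ord0.
  have i1 : mu.-integrable (`]0%R, 1%R[ : set R) (EFin \o (fun z => (rmR delta Rad (s m) * phi nu s m x) * (f z * phi nu s m z))).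
    pose fm z := f z * phi nu s m z.
    have h : mu.-integrable (`]0%R, 1%R[ : set R) (fun z => (rmR delta Rad (s m) * phi nu s m x)%:E *
        (EFin \o fm) z)%E by apply: integrableZl => //; exact: fi.
    exact: h.
  have e : F m.+1 = (fun z => F m z + (rmR delta Rad (s m) * phi nu s m x) * (f z * phi nu s m z)).
    by apply/funext => z; rewrite /F big_ord_recr.
  split.
    pose fm z := (rmR delta Rad (s m) * phi nu s m x) * (f z * phi nu s m z).
    have h : mu.-integrable (`]0%R, 1%R[ : set R) ((EFin \o F m) \+ (EFin \o fm))%E by apply: integrableD.
    by rewrite e; exact: h.
  rewrite e RintegralD // -IH2 big_ord_recr /=; congr (_ + _).
  by rewrite RintegralZl //; rewrite /coef /Rintegral; ring.
have [Fint ->] := Fi n.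
rewrite /Rintegral.
have fin : (\int[mu]_(z in `]0%R, 1%R[) (F n z)%:E)%E \is a fin_num by apply: integrable_fin_num.
rewrite -[X in (X <= _)%E](_ : `|(\int[mu]_(z in `]0%R, 1%R[) (F n z)%:E)%E|%E = _); last by rewrite -[in LHS](fineK fin).
apply: (le_trans (le_abse_integral _ _ (measurable_int mu Fint))); first by [].
have mk : measurable_fun (`]0%R, 1%R[ : set R) (fun z => `|f z| * kR Rad x z).
  by apply: measurable_funM; [exact: measurableT_comp|exact: measurable_funTS (measurable_kR _ _)].
have mFn := measurable_int mu Fint.
have k0 z : 0 < z -> 0 <= `|f z| * kR Rad x z.
  by move=> z0; rewrite mulr_ge0 // kR_ge0.
rewrite -ge0_integralZl_EFin //; last 3 first.
- by move=> z; rewrite /= in_itv /= => /andP[z0 _]; rewrite lee_fin k0.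
- exact: measurableT_comp.
- exact: ltW.
apply: ge0_le_integral => //.
- exact: measurableT_comp.
- by apply: measurable_funeM; exact: measurableT_comp.
move=> z; rewrite /= in_itv /= => z01; have [z0 z1] := andP z01.
rewrite lee_fin.
have -> : F n z = f z * (x `^ kap * z `^ kap * rk Rad n x z).
  rewrite /F /rk /rker !mulr_sumr; apply: eq_bigr => j _.
  by rewrite !phiE //; ring.
rewrite normrM mulrCA; apply: ler_wpM2l => //.
rewrite !normrM (ger0_norm (powR_ge0 _ _)) (ger0_norm (powR_ge0 z _)).
exact: hC.
Unshelve. all: by end_near. Qed.

End ConcreteKernel.

(** * Schur's test and the maximal function *)

Section IntegralTools.
Local Open Scope ereal_scope.
Context {d : measure_display} {T : measurableType d} {R : realType}.
Variable mu : {measure set T -> \bar R}.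
Implicit Types (D : set T) (f F : T -> \bar R).
Import HBNNSimple.

(* Unlike [ge0_le_integral], no measurability is required. *)
Lemma ge0_le_integralW D f F : (forall x, D x -> 0 <= f x) ->
  (forall x, D x -> f x <= F x) -> \int[mu]_(x in D) f x <= \int[mu]_(x in D) F x.
Proof.
move=> f0 fF; have F0 x : D x -> 0 <= F x by move=> Dx; apply: le_trans (fF x Dx); exact: f0.
rewrite (ge0_integralE _ f0) (ge0_integralE _ F0).
apply: le_ereal_sup => _ [h hf <-]; exists h => // x; apply: (le_trans (hf x)).
by rewrite /patch; case: ifPn => //; rewrite inE; exact: fF.
Qed.

Lemma sintegral_mrestr D (mD : measurable D) (h : {nnsfun T >-> R}) :
  sintegral (mrestr mu mD) h = sintegral mu (h \_ D).
Proof.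
rewrite !sintegralET; apply: eq_fsbigr => r _; have [->|r0] := eqVneq r 0%R; first by rewrite !mul0e.
congr (_ * _); rewrite /mrestr /=; congr (mu _); apply/seteqP; split => x /=.
  by move=> [<- Dx]; rewrite patchE mem_set.
rewrite patchE; case: ifPn; first by rewrite inE.
by move=> _ e; rewrite -e eqxx in r0.
Qed.

(** Proved on the simple functions below [F]: it will be applied to the supremum over all [Rad],
    whose measurability is not established. *)
Lemma integral_mrestr D (mD : measurable D) F : (forall x, 0 <= F x) ->
  \int[mrestr mu mD]_x F x = \int[mu]_(x in D) F x.
Proof.
move=> F0; apply/eqP; rewrite eq_le; apply/andP; split.
  rewrite (ge0_integralE (mrestr mu mD)) // (ge0_integralE mu) //.
  apply: ge_ereal_sup => _ [h hF <-]; rewrite sintegral_mrestr (mrestrict h mD).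
  apply: ereal_sup_ubound; exists (proj_nnsfun h mD) => // x; rewrite -mrestrict !patchE.
  case: ifPn => // _; move: (hF x); rewrite patchE.
  by rewrite mem_set.
rewrite (ge0_integralE (mrestr mu mD)) // (ge0_integralE mu) //.
apply: le_ereal_sup => _ [h hF <-]; exists h.
  move=> x; rewrite [leRHS]patchE mem_set //; apply: (le_trans (hF x)).
  by rewrite patchE; case: ifPn => // _; exact: F0.
rewrite sintegral_mrestr; apply: eq_sintegral => x; rewrite patchE; case: ifPn => // xD.
apply/eqP; rewrite eq_le; apply/andP; split; first by rewrite fun_ge0.
by move: (hF x); rewrite patchE (negbTE xD) lee_fin.
Qed.

Lemma measurable_powR_comp D (f : T -> R) (c : R) : measurable_fun D f ->
  measurable_fun D (fun x => (f x `^ c)%R).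
Proof.
move=> mf; apply: (@measurableT_comp _ _ _ _ _ _ (fun t : R => (t `^ c)%R)) => //.
Qed.

End IntegralTools.

Section PowerIntegrals.
Context {R : realType}.
Notation mu := (@lebesgue_measure R).
Implicit Types (x t u gam sig : R).

Lemma integral_powR0 gam t : -1 < gam -> 0 < t ->
  (\int[mu]_(x in `]0%R, t[) (x `^ gam)%:E = (t `^ (gam + 1) / (gam + 1))%:E)%E.
Proof.
move=> g1 t0; have c0 : 0 < gam + 1 by lra.
have FD x : 0 < x < t -> is_derive x 1 (fun x => x `^ (gam + 1) / (gam + 1)) (x `^ gam).
  by move=> /andP[x0 _]; have h := der_powR_prim (lt0r_neq0 c0) x0; rewrite addrK in h; exact: h.
have fc x : 0 < x < t -> {for x, continuous (fun x => x `^ gam)}.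
  by move=> /andP[x0 _]; exact: continuous_powR.
have f0 x : 0 < x < t -> 0 <= x `^ gam by move=> _; exact: powR_ge0.
have c1 : x `^ (gam + 1) / (gam + 1) @[x --> 0^'+] --> 0 `^ (gam + 1) / (gam + 1).
  by apply: cvgM; last exact: cvg_cst; rewrite powR0 ?gt_eqF //; exact: powR_cvg0.
have c2 : x `^ (gam + 1) / (gam + 1) @[x --> t^'-] --> t `^ (gam + 1) / (gam + 1).
  apply: cvgM; last exact: cvg_cst.
  by apply: cvg_at_left_filter; exact: continuous_powR.
have [_ ->] := FTC_oo_ge0 t0 FD fc f0 c1 c2.
by rewrite powR0 ?gt_eqF // mul0r subr0.
Qed.

Lemma integral_powRoo sig t u : 0 < sig -> 0 < t ->
  (\int[mu]_(x in `[t, u]) (x `^ (- 1 - sig))%:E <= (t `^ (- sig) / sig)%:E)%E.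
Proof.
move=> s0 t0; have [ut|tu] := leP u t.
  have [->|ne] := eqVneq u t.
    by rewrite set_itv1 integral_set1 lee_fin divr_ge0 ?powR_ge0 // ltW.
  rewrite set_itv_ge ?integral_set0 ?lee_fin ?divr_ge0 ?powR_ge0 ?(ltW s0) //.
  by rewrite bnd_simp -ltNge lt_neqAle ne.
have [||_ ->] := @FTC_cc R (fun x => x `^ (- 1 - sig)) (fun x => - (x `^ (- sig) / sig)) t u tu.
- move=> x /andP[tx _]; have x0 := lt_le_trans t0 tx.
  have h := derN (derM (der_powR (- sig) x0) (der_cst x sig^-1)).
  apply: der_eq h _; rewrite (_ : - sig - 1 = - 1 - sig); last by ring.
  by field; rewrite gt_eqF.
- by move=> x /andP[tx _]; apply: continuous_powR; exact: lt_le_trans tx.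
rewrite lee_fin opprK addrC gerBl; apply: divr_ge0; [exact: powR_ge0|exact: ltW].
Qed.

End PowerIntegrals.

(** * Schur's test with power weights *)

Section Schur.
Context {R : realType}.
Notation mu := (@lebesgue_measure R).
Implicit Types (x y : R) (G : R -> R).
Variables (K : R * R -> R) (e p q C1 C2 : R).
Hypothesis mK : measurable_fun setT K.
Hypothesis K0 : forall z, 0 <= K z.
Hypothesis Kpos : forall x y, K (x, y) != 0 -> 0 < x /\ 0 < y.
Hypotheses (p0 : 0 < p) (q0 : 0 < q) (pq : p^-1 + q^-1 = 1).
Hypotheses (C10 : 0 <= C1) (C20 : 0 <= C2).
Hypothesis hx : forall x, 0 < x ->
  (\int[mu]_y (K (x, y) * y `^ (- (e * q)))%:E <= (C1 * x `^ (- (e * q)))%:E)%E.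
Hypothesis hy : forall y, 0 < y ->
  (\int[mu]_x (K (x, y) * x `^ (- (e * p)))%:E <= (C2 * y `^ (- (e * p)))%:E)%E.
Variable G : R -> R.
Hypothesis mG : measurable_fun setT G.
Hypothesis G0 : forall y, 0 <= G y.

Let mKx x : measurable_fun setT (fun y => K (x, y)).
Proof. exact: (measurableT_comp mK (measurable_pair1 x)). Qed.

(** Hoelder's inequality for the factors [K^(1/p) y^e G] and [K^(1/q) y^(-e)]. *)
Lemma schur_pointwise x : 0 < x -> (poweR (\int[mu]_y (K (x, y) * G y)%:E) p <=
  \int[mu]_y (C1 `^ (p / q) * x `^ (- (e * p)) * (K (x, y) * (y `^ (e * p) * G y `^ p)))%:E)%E.
Proof.
move=> x0.
have mpw c : measurable_fun setT (fun y : R => y `^ c) by exact: measurable_powR.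
have mKp c : measurable_fun setT (fun y => K (x, y) `^ c).
  exact: measurable_powR_comp (mKx x).
pose F y := K (x, y) `^ p^-1 * y `^ e * G y.
pose H y := K (x, y) `^ q^-1 * y `^ (- e).
have mF : measurable_fun setT F by do 2! apply: measurable_funM => //.
have mH : measurable_fun setT H by apply: measurable_funM.
have F0 y : 0 <= F y by rewrite !mulr_ge0 ?powR_ge0.
have H0 y : 0 <= H y by rewrite !mulr_ge0 ?powR_ge0.
have pn : p != 0 by rewrite gt_eqF.
have qn : q != 0 by rewrite gt_eqF.
have FH y : F y * H y = K (x, y) * G y.
  have [k0|k0] := eqVneq (K (x, y)) 0.
    by rewrite /F k0 powR0 ?invr_eq0 // !mul0r.
  have [_ y0] := Kpos k0.
  have e1 : K (x, y) `^ p^-1 * K (x, y) `^ q^-1 = K (x, y).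
    by rewrite -powRD ?k0 ?implybT // pq powRr1.
  have e2 : y `^ e * y `^ (- e) = 1 by rewrite -powRD ?(gt_eqF y0) ?implybT // subrr powRr0.
  have -> : F y * H y = (K (x, y) `^ p^-1 * K (x, y) `^ q^-1) * (y `^ e * y `^ (- e)) * G y by rewrite /F /H; ring.
  by rewrite e1 e2 mulr1.
have := hoelder mu mF mH p0 q0 pq; rewrite Lnorm1.
have -> : (\int[mu]_x `|(EFin \o (F \* H)%R) x| = \int[mu]_y (K (x, y) * G y)%:E)%E.
  by apply: eq_integral => y _; rewrite /= FH ger0_norm // mulr_ge0.
move=> hol.
have I0 : (0 <= \int[mu]_y (K (x, y) * G y)%:E)%E by apply: integral_ge0 => y _; rewrite lee_fin mulr_ge0.
have := @gt0_ler_poweR R p (ltW p0) (\int[mu]_y (K (x, y) * G y)%:E)%E ('N[mu]_p%:E[EFin \o F] * 'N[mu]_q%:E[EFin \o H])%E.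
rewrite !in_itv /= I0 !leey mule_ge0 ?Lnorm_ge0 // => /(_ isT isT hol) {}hol.
apply: (le_trans hol); rewrite poweRM ?Lnorm_ge0 // poweR_Lnorm //.
have -> : (poweR ('N[mu]_q%:E[EFin \o H]) p = poweR (\int[mu]_y (K (x, y) * y `^ (- (e * q)))%:E) (p / q))%E.
  have -> : (\int[mu]_y (K (x, y) * y `^ (- (e * q)))%:E = poweR ('N[mu]_q%:E[EFin \o H]) q)%E.
    rewrite poweR_Lnorm //; apply: eq_integral => y _.
    rewrite /= ger0_norm // /H powRM ?powR_ge0 // -!powRrM mulVf // powRr1 // mulNr //.
  by rewrite -poweRrM mulrC divfK.
have hb := hx x0.
have J0 : (0 <= \int[mu]_y (K (x, y) * y `^ (- (e * q)))%:E)%E.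
  by apply: integral_ge0 => y _; rewrite lee_fin mulr_ge0 // powR_ge0.
have := @gt0_ler_poweR R (p / q) (ltW (divr_gt0 p0 q0)) (\int[mu]_y (K (x, y) * y `^ (- (e * q)))%:E)%E (C1 * x `^ (- (e * q)))%:E.
rewrite !in_itv /= J0 !leey lee_fin mulr_ge0 ?powR_ge0 // => /(_ isT isT hb) {}hb.
have -> : (\int[mu]_x0 poweR `|(EFin \o F) x0| p = \int[mu]_y (F y `^ p)%:E)%E.
  by apply: eq_integral => y _; rewrite /= ger0_norm.
have IF0 : (0 <= \int[mu]_y (F y `^ p)%:E)%E by apply: integral_ge0 => y _; rewrite lee_fin powR_ge0.
apply: (le_trans (lee_wpmul2l IF0 hb)).
rewrite muleC -ge0_integralZl_EFin //.
- rewrite le_eqVlt; apply/orP; left; apply/eqP; apply: eq_integral => y _.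
  have eF : F y `^ p = K (x, y) * y `^ (e * p) * G y `^ p.
    by rewrite /F !powRM ?mulr_ge0 ?powR_ge0 // -!powRrM mulVf // powRr1.
  have eC : (C1 * x `^ (- (e * q))) `^ (p / q) = C1 `^ (p / q) * x `^ (- (e * p)).
    by rewrite powRM ?powR_ge0 // -powRrM; congr (_ * _ `^ _); field.
  by rewrite -EFinM eF eC; congr (_%:E); ring.
- by move=> y _; rewrite lee_fin powR_ge0.
- by apply: measurableT_comp => //; exact: measurable_powR_comp.
- exact: powR_ge0.
Qed.

Lemma schur : (\int[mu]_x poweR (\int[mu]_y (K (x, y) * G y)%:E) p <=
  (C1 `^ (p / q) * C2)%:E * \int[mu]_y (G y `^ p)%:E)%E.
Proof.
pose Q (z : R * R) : R := C1 `^ (p / q) * z.1 `^ (- (e * p)) * (K z * (z.2 `^ (e * p) * G z.2 `^ p)).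
have Q0 z : 0 <= Q z by rewrite !mulr_ge0 ?powR_ge0.
have mQ : measurable_fun setT Q.
  apply: measurable_funM; first apply: measurable_funM => //.
    exact: measurable_powR_comp measurable_fst.
  apply: measurable_funM => //; apply: measurable_funM.
    exact: measurable_powR_comp measurable_snd.
  apply: measurable_powR_comp; exact: (measurableT_comp mG measurable_snd).
have step1 : (\int[mu]_x poweR (\int[mu]_y (K (x, y) * G y)%:E) p <= \int[mu]_x \int[mu]_y (Q (x, y))%:E)%E.
  apply: ge0_le_integralW => x _; first exact: poweR_ge0.
  have [x0|x0] := ltP 0 x; first exact: schur_pointwise.
  have Kz y : K (x, y) = 0.
    by apply/eqP; apply/negPn/negP => /Kpos[]; rewrite ltNge x0.
  rewrite integral0_eq; last by move=> y _; rewrite Kz mul0r.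
  by rewrite poweR0r ?gt_eqF //; apply: integral_ge0 => y _; rewrite lee_fin.
apply: (le_trans step1).
rewrite (@fubini_tonelli _ _ _ _ _ mu mu (EFin \o Q)); last 2 first.
- exact: measurableT_comp.
- by move=> z; rewrite lee_fin.
rewrite -ge0_integralZl_EFin //; last 3 first.
- by move=> y _; rewrite lee_fin powR_ge0.
- by apply: measurableT_comp => //; exact: measurable_powR_comp.
- by rewrite mulr_ge0 ?powR_ge0.
apply: ge0_le_integralW => y _; first by apply: integral_ge0 => x _; rewrite lee_fin.
have [y0|y0] := ltP 0 y; last first.
  rewrite integral0_eq; first by rewrite lee_fin !mulr_ge0 ?powR_ge0.
  move=> x _; rewrite /Q /=; have [->|/Kpos[_]] := eqVneq (K (x, y)) 0; first by rewrite mul0r mulr0.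
  by rewrite ltNge y0.
have -> : (\int[mu]_x (EFin \o Q) (x, y) = (C1 `^ (p / q) * (y `^ (e * p) * G y `^ p))%:E * \int[mu]_x (K (x, y) * x `^ (- (e * p)))%:E)%E.
  rewrite -ge0_integralZl_EFin //.
  - by apply: eq_integral => x _; rewrite /= -EFinM /Q /=; congr (_%:E); ring.
  - by move=> x _; rewrite lee_fin mulr_ge0 ?powR_ge0.
  - apply: measurableT_comp => //; apply: measurable_funM; last exact: measurable_powR.
    exact: (measurableT_comp mK (measurable_pair2 y)).
  - by rewrite !mulr_ge0 ?powR_ge0.
apply: (le_trans (lee_wpmul2l _ (hy y0))); first by rewrite lee_fin !mulr_ge0 ?powR_ge0.
rewrite -!EFinM lee_fin.
have ee : y `^ (e * p) * y `^ (- (e * p)) = 1 by rewrite -powRD ?(gt_eqF y0) ?implybT // subrr powRr0.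
move: (y `^ (e * p)) (y `^ (- (e * p))) ee => u v ee.
have -> : C1 `^ (p / q) * (u * G y `^ p) * (C2 * v) = C1 `^ (p / q) * C2 * G y `^ p * (u * v) by ring.
by rewrite ee mulr1.
Qed.

End Schur.

(** * The Hardy-Littlewood maximal function *)

Section MaximalFunction.
Context {R : realType}.
Notation mu := (@lebesgue_measure R).
Implicit Types (x y t r lam : R) (G : R -> R).
Local Open Scope ereal_scope.

Lemma integral_if (D : set R) (P : pred R) (f : R -> \bar R) : (D = [set x | P x]) ->
  \int[mu]_x (if P x then f x else 0) = \int[mu]_(x in D) f x.
Proof.
move=> ->; rewrite [RHS]integral_mkcond; apply: eq_integral => x _; rewrite patchE.
have e : (x \in [set x | P x]) = P x by apply/idP/idP => [/set_mem|/mem_set].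
by rewrite e.
Qed.

Lemma integrable_locT G : measurable_fun setT G -> (forall y, (0 <= G y)%R) ->
  \int[mu]_y (G y)%:E < +oo -> locally_integrable setT G.
Proof.
move=> mG G0 Goo; apply: open_integrable_locally; first exact: openT.
apply/integrableP; split; first exact: measurableT_comp.
by under eq_integral do rewrite /= ger0_norm //.
Qed.

Lemma iavg_le_HL G x r : (0 < r)%R -> iavg G (ball x r) <= HL_maximal G x.
Proof.
by move=> r0; apply: ereal_sup_ubound; exists r => //=; rewrite in_itv /= r0.
Qed.

Lemma integral_ball_le G x r : (0 < r)%R -> (forall y, (0 <= G y)%R) ->
  \int[mu]_(y in ball x r) (G y)%:E <= (r *+ 2)%:E * HL_maximal G x.
Proof.
move=> r0 G0.
have b0 : (0 < r *+ 2)%R by rewrite pmulrn_lgt0.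
apply: (@le_trans _ _ ((r *+ 2)%:E * iavg G (ball x r))); last first.
  by apply: lee_wpmul2l; [rewrite lee_fin ltW|exact: iavg_le_HL].
rewrite /iavg lebesgue_measure_ball ?(ltW r0) // inver gt_eqF // muleA -EFinM mulfV ?gt_eqF // mul1e.
by under [leRHS]eq_integral do rewrite /= ger0_norm //.
Qed.

Section Strong.
Variable p : R.
Hypothesis p1 : (1 < p)%R.
Variable G : R -> R.
Hypothesis mG : measurable_fun setT G.
Hypothesis G0 : forall y, (0 <= G y)%R.
Hypothesis Goo : \int[mu]_y (G y)%:E < +oo.

Let V := HL_maximal G.
Let locG : locally_integrable setT G. Proof. exact: integrable_locT. Qed.
Let V0 x : 0 <= V x. Proof. exact: HL_maximalT_ge0. Qed.
Let mV : measurable_fun setT V. Proof. exact: measurable_HL_maximal. Qed.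

(* Splitting [G] at height [lam / 2] costs only [lam / 2] in the maximal function. *)
Let Gup lam y : R := if (G y <= lam / 2)%R then 0%R else G y.

Let mGup lam : measurable_fun setT (Gup lam).
Proof. by apply: measurable_fun_ifT => //; exact: measurable_fun_ler. Qed.

Let Gup0 lam y : (0 <= Gup lam y)%R. Proof. by rewrite /Gup; case: ifP. Qed.

Let Gup_oo lam : \int[mu]_y (Gup lam y)%:E < +oo.
Proof.
apply: le_lt_trans Goo; apply: ge0_le_integralW => y _; rewrite lee_fin //.
by rewrite /Gup; case: ifP.
Qed.

Lemma HL_split lam x : (0 < lam)%R -> lam%:E < V x -> (lam / 2)%:E < HL_maximal (Gup lam) x.
Proof.
move=> l0 hV; have [z [r hr zE] hl] := ereal_sup_gt hV.
move: hr; rewrite /= in_itv /= andbT => r0; rewrite -{z}zE in hl.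
have b0 : (0 < r *+ 2)%R by rewrite pmulrn_lgt0.
pose g2 y : R := if (G y <= lam / 2)%R then G y else 0%R.
have mg2 : measurable_fun setT g2 by apply: measurable_fun_ifT => //; exact: measurable_fun_ler.
have e : G = (Gup lam \+ g2)%R.
  by apply/funext => y; rewrite /= /Gup /g2; case: ifP; rewrite ?add0r ?addr0.
have mb : measurable (ball x r : set R) by exact: measurable_ball.
have fb : mu (ball x r) < +oo by rewrite lebesgue_measure_ball ?(ltW r0) // ltry.
have h := @iavgD R (Gup lam) g2 (ball x r) mb fb (measurable_funTS (mGup lam)) (measurable_funTS mg2).
rewrite -e in h.
have h2 : iavg g2 (ball x r) <= (lam / 2)%:E.
  rewrite /iavg lebesgue_measure_ball ?(ltW r0) // inver gt_eqF //.
  apply: (@le_trans _ _ (((r *+ 2)^-1)%:E * \int[mu]_(y in ball x r) (lam / 2)%:E)).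
    apply: lee_wpmul2l; first by rewrite lee_fin invr_ge0 ltW.
    apply: ge0_le_integralW => y _; first exact: abse_ge0.
    rewrite lee_fin /g2; case: ifPn => hy; first by rewrite ger0_norm.
    by rewrite normr0 divr_ge0 // ltW.
  have mbE : mu (ball x r) = (r *+ 2)%:E := @lebesgue_measure_ball R x r (ltW r0).
  have -> : \int[mu]_(y in ball x r) (lam / 2)%:E = (lam / 2)%:E * (r *+ 2)%:E.
    by rewrite integral_cst //; congr (_ * _); exact: mbE.
  by rewrite -!EFinM lee_fin mulrCA mulVf ?gt_eqF // mulr1.
have h3 : iavg (Gup lam) (ball x r) <= HL_maximal (Gup lam) x by exact: iavg_le_HL.
have h4 : lam%:E < HL_maximal (Gup lam) x + (lam / 2)%:E.
  by apply: (lt_le_trans hl); apply: (le_trans h); exact: leeD.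
have fl : (lam / 2)%:E \is a fin_num by [].
move: h4; rewrite -(lteBlDr _ _ fl) -EFinB.
by have -> : (lam - lam / 2 = lam / 2)%R by field.
Qed.

Lemma HL_weak lam : (0 < lam)%R ->
  mu [set x | lam%:E < V x] <= (6 / lam)%:E * \int[mu]_y (Gup lam y)%:E.
Proof.
move=> l0; have l2 : (0 < lam / 2)%R by rewrite divr_gt0.
have locU : locally_integrable setT (Gup lam) by exact: integrable_locT.
apply: (@le_trans _ _ (mu [set x | (lam / 2)%:E < HL_maximal (Gup lam) x])).
  apply: le_measure; rewrite ?inE.
  - by rewrite -[X in measurable X]setTI; apply: emeasurable_fun_o_infty.
  - rewrite -[X in measurable X]setTI; exact: (emeasurable_fun_o_infty measurableT (measurable_HL_maximal locU)).
  - by move=> x /=; exact: HL_split.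
apply: (le_trans (maximal_inequality locU l2)).
have -> : (3 / (lam / 2) = 6 / lam)%R by field; rewrite gt_eqF.
by under eq_integral do rewrite /= ger0_norm //.
Qed.

(** The density [p lam^(p - 1)] of the layer-cake formula for [V^p]; [hV] cuts it off at height [V],
    and [hk] is what the weak-type bound puts in its place. *)
Let h (z : R * R) : R := if (z.2 <= 0)%R then 0%R else (p * z.2 `^ (p - 1))%R.

Let hV (z : R * R) : R := if V z.1 <= z.2%:E then 0%R else h z.

Let hk (z : R * R) : R := if (z.2 <= 0)%R then 0%R else (6 * p * z.2 `^ (p - 2) * Gup z.2 z.1)%R.

Let p0 : (0 < p)%R. Proof. exact: lt_trans p1. Qed.

Let h0 z : (0 <= h z)%R.
Proof. by rewrite /h; case: ifP => // _; rewrite mulr_ge0 ?powR_ge0 // ltW. Qed.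

Let hV0 z : (0 <= hV z)%R. Proof. by rewrite /hV; case: ifP. Qed.

Let hk0 z : (0 <= hk z)%R.
Proof.
rewrite /hk; case: ifPn => //; rewrite -ltNge => z0.
by rewrite !mulr_ge0 ?powR_ge0 // ltW.
Qed.

Let mh : measurable_fun setT h.
Proof.
apply: measurable_fun_ifT => //.
  by apply: measurable_fun_ler => //; exact: measurable_snd.
by apply: measurable_funM => //; apply: measurable_powR_comp; exact: measurable_snd.
Qed.

Let mhV : measurable_fun setT hV.
Proof.
apply: measurable_fun_ifT => //; apply: measurable_fun_lee.
  exact: (measurableT_comp mV measurable_fst).
by apply: measurableT_comp => //; exact: measurable_snd.
Qed.

Let mhk : measurable_fun setT hk.
Proof.
apply: measurable_fun_ifT => //.
  by apply: measurable_fun_ler => //; exact: measurable_snd.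
apply: measurable_funM.
  by apply: measurable_funM => //; apply: measurable_powR_comp; exact: measurable_snd.
apply: measurable_fun_ifT => //; last exact: (measurableT_comp mG measurable_fst).
apply: measurable_fun_ler; first exact: (measurableT_comp mG measurable_fst).
by apply: measurable_funM => //; exact: measurable_snd.
Qed.

Let layer x : poweR (V x) p <= \int[mu]_lam (hV (x, lam))%:E.
Proof.
have fin v : (0 < v)%R -> v%:E <= V x -> (v `^ p)%:E <= \int[mu]_lam (hV (x, lam))%:E.
  move=> v0 vV.
  have e : (v `^ p)%:E = p%:E * \int[mu]_(lam in `]0%R, v[) (lam `^ (p - 1))%:E.
    rewrite integral_powR0 //; last by rewrite ltrBrDl subrr.
    by rewrite subrK -EFinM mulrCA mulfV ?mulr1 // gt_eqF.
  rewrite e -ge0_integralZl_EFin //; last 3 first.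
  - by move=> t _; rewrite lee_fin powR_ge0.
  - by apply: measurableT_comp => //; apply: measurable_powR_comp.
  - exact: ltW.
  rewrite [leLHS]integral_mkcond; apply: ge0_le_integralW => t _.
    by rewrite patchE; case: ifP => // _; rewrite -EFinM lee_fin mulr_ge0 ?powR_ge0 // ltW.
  rewrite patchE; case: ifPn; last by rewrite lee_fin.
  rewrite inE /= in_itv /= => /andP[t0 tv]; rewrite /hV /h /=.
  have -> : (V x <= t%:E) = false by apply/negbTE; rewrite -ltNge; apply: lt_le_trans vV; rewrite lte_fin.
  by rewrite [(t <= 0)%R]leNgt t0 /= EFinM.
case hv : (V x) => [v| |]; last by have := V0 x; rewrite hv.
  have := V0 x; rewrite hv lee_fin le_eqVlt => /predU1P[<-|v0].
    by rewrite poweR0r ?gt_eqF //; apply: integral_ge0 => t _; rewrite lee_fin.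
  by rewrite poweR_EFin fin // hv.
rewrite (_ : \int[mu]_lam _ = +oo) ?leey //; apply: eq_infty => r.
pose v := (Num.max 1 r)%R.
have v1 : (1 <= v)%R by rewrite /v le_max lexx.
have v0 : (0 < v)%R by exact: lt_le_trans v1.
apply: le_trans (fin v v0 _); last by rewrite hv leey.
rewrite lee_fin; apply: (@le_trans _ _ v); first by rewrite /v le_max lexx orbT.
by rewrite -[leLHS](powRr1 (ltW v0)); apply: ler_powR => //; exact: ltW.
Qed.

(** Marcinkiewicz interpolation: layer cake, weak-type bound for the part of [G] above [lam / 2],
    then Tonelli. The inner integral of [lam^(p - 2)] over []0, 2 G y[] converges because
    [p > 1]. *)
Lemma HL_strong : \int[mu]_x poweR (V x) p <=
  (6 * p * 2 `^ (p - 1) / (p - 1))%:E * \int[mu]_x (G x `^ p)%:E.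
Proof.
have pm1 : (0 < p - 1)%R by rewrite subr_gt0.
apply: (@le_trans _ _ (\int[mu]_x \int[mu]_lam (hV (x, lam))%:E)).
  by apply: ge0_le_integralW => x _; [exact: poweR_ge0|exact: layer].
rewrite (@fubini_tonelli _ _ _ _ _ mu mu (EFin \o hV)); last 2 first.
- exact: measurableT_comp.
- by move=> z; rewrite lee_fin.
apply: (@le_trans _ _ (\int[mu]_lam \int[mu]_y (hk (y, lam))%:E)).
  apply: ge0_le_integralW => lam _; first by apply: integral_ge0 => x _; rewrite lee_fin.
  have [l0|l0] := leP lam 0%R.
    rewrite integral0_eq; first by apply: integral_ge0 => x _; rewrite lee_fin.
    by move=> x _; rewrite /= /hV /h l0; case: ifP.
  have c0 : (0 <= p * lam `^ (p - 1))%R by rewrite mulr_ge0 ?powR_ge0 // ltW.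
  have mS : measurable [set x | lam%:E < V x].
    by rewrite -[X in measurable X]setTI; apply: emeasurable_fun_o_infty.
  have -> : \int[mu]_x (EFin \o hV) (x, lam) = (p * lam `^ (p - 1))%:E * mu [set x | lam%:E < V x].
    rewrite -integral_cst // -[RHS](@integral_if _ (fun x => lam%:E < V x) (fun=> (p * lam `^ (p - 1))%:E)) //.
    apply: eq_integral => x _; rewrite /= /hV /h /= [(V x <= _)%E]leNgt [(lam <= 0)%R]leNgt l0 /=.
    by case: (lam%:E < V x).
  apply: (le_trans (lee_wpmul2l _ (HL_weak l0))); first by rewrite lee_fin.
  rewrite muleA -EFinM -ge0_integralZl_EFin //; last 3 first.
  - by move=> y _; rewrite lee_fin.
  - by apply: measurableT_comp => //; exact: mGup.
  - by rewrite mulr_ge0 // divr_ge0 // ltW.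
  apply: ge0_le_integralW => y _.
    by rewrite -EFinM lee_fin mulr_ge0 // mulr_ge0 // divr_ge0 // ltW.
  rewrite -EFinM lee_fin /hk /= [(lam <= 0)%R]leNgt l0 /=.
  rewrite (_ : (p - 1 = (p - 2) + 1)%R); last by ring.
  rewrite (powRS (p - 2 + 1) l0) addrK le_eqVlt; apply/orP; left; apply/eqP; field; rewrite gt_eqF //.
rewrite -(@fubini_tonelli _ _ _ _ _ mu mu (EFin \o hk)); last 2 first.
- exact: measurableT_comp.
- by move=> z; rewrite lee_fin.
have C0 : (0 <= 6 * p * 2 `^ (p - 1) / (p - 1))%R.
  by rewrite divr_ge0 ?(ltW pm1) // !mulr_ge0 ?powR_ge0 // ltW.
rewrite -ge0_integralZl_EFin //; last 2 first.
- by move=> y _; rewrite lee_fin powR_ge0.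
- by apply: measurableT_comp => //; exact: measurable_powR_comp.
apply: ge0_le_integralW => y _; first by apply: integral_ge0 => lam _; rewrite lee_fin.
have [Gy|Gy] := leP (G y) 0%R.
  rewrite integral0_eq; first by rewrite -EFinM lee_fin mulr_ge0 ?powR_ge0.
  move=> lam _; rewrite /= /hk /=; case: ifPn => //; rewrite -ltNge => l0; rewrite /Gup.
  by rewrite (le_trans Gy) ?mulr0 // divr_ge0 // ltW.
have G2 : (0 < 2 * G y)%R by rewrite mulr_gt0.
rewrite (_ : \int[mu]_lam _ = \int[mu]_(lam in `]0%R, (2 * G y)%R[) ((6 * p * G y)%:E * (lam `^ (p - 2))%:E)); last first.
  rewrite [RHS]integral_mkcond; apply: eq_integral => lam _; rewrite patchE /= /hk /=.
  case: ifPn => [l0|]; last first.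
    rewrite -ltNge => l0; rewrite /Gup; case: ifPn => hG.
      rewrite mulr0; case: ifPn => //; rewrite inE /= in_itv /= l0 /= => hl; exfalso.
      by move: hG; rewrite ler_pdivlMr // mulrC leNgt hl.
    move: hG; rewrite -ltNge ltr_pdivrMr // mulrC => hG.
    rewrite mem_set /=; last by rewrite in_itv /= l0.
    by rewrite -EFinM; congr (_%:E); ring.
  case: ifPn => //; rewrite inE /= in_itv /= => /andP[l1 _]; exfalso.
  by move: l0; rewrite leNgt l1.
rewrite ge0_integralZl_EFin //; last 3 first.
- by move=> t _; rewrite lee_fin powR_ge0.
- by apply: measurableT_comp => //; apply: measurable_powR_comp.
- by rewrite !mulr_ge0 // ltW.
rewrite integral_powR0 //; last by rewrite ltrBrDl; lra.
rewrite -!EFinM lee_fin (_ : (p - 2 + 1 = p - 1)%R); last by ring.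
rewrite powRM // (powRS p Gy).
by rewrite le_eqVlt; apply/orP; left; apply/eqP; field; rewrite gt_eqF.
Qed.

End Strong.

Section DyadicAverage.
Variable delta : R.
Hypothesis delta0 : (0 < delta)%R.
Notation dk := (dk delta).

(** The decreasing profile is dominated by multiples of the indicators of [[0, 2^(k+1)[]. *)
Lemma dk_dyadic N t : (0 <= t)%R -> (t < 2 ^+ N.+1)%R ->
  (dk t <= \sum_(k < N.+1) (2 ^+ k) `^ (- 1 - delta) * (if t < 2 * 2 ^+ k then 1 else 0))%R.
Proof.
move=> t0; elim: N => [|N IH] ht.
  rewrite big_ord_recr big_ord0 /= add0r expr0 powR1 mulr1 mul1r -[2%R]/(2 ^+ 1)%R ht.
  by rewrite /dk; case: ifPn => //; rewrite -ltNge => t1; apply: (@le_trans _ _ (t `^ 0)%R); [apply: ler_powR; [exact: ltW|have d0 := delta0; lra]|rewrite powRr0].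
have [h|h] := ltP t (2 ^+ N.+1)%R.
  rewrite big_ord_recr /=; apply: (le_trans (IH h)); rewrite lerDl.
  by rewrite mulr_ge0 ?powR_ge0 //; case: ifP.
rewrite big_ord_recr /= -exprS ht mulr1.
apply: (@le_trans _ _ ((2 ^+ N.+1) `^ (- 1 - delta))%R); last first.
  by rewrite lerDr; apply: sumr_ge0 => k _; rewrite mulr_ge0 ?powR_ge0 //; case: ifP.
have t1 : (1 < t)%R by apply: lt_le_trans h; rewrite exprn_egt1 //; lra.
have -> : dk t = (t `^ (- 1 - delta))%R by rewrite /dk leNgt t1.
by apply: le0_powR_anti => //; have d0 := delta0; lra.
Qed.

Lemma geometric_le N : (\sum_(k < N) (2 ^+ k) `^ (- delta) <= (1 - 2 `^ (- delta))^-1 :> R)%R.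
Proof.
set c := (2 `^ (- delta))%R.
have c0 : (0 < c)%R by exact: powR_gt0.
have c1 : (c < 1)%R.
  rewrite /c powRN invf_lt1 ?powR_gt0 //; apply: (@le_lt_trans _ _ (1 `^ delta)%R); first by rewrite powR1.
  by apply: gt0_ltr_powR; rewrite ?nnegrE //; lra.
have e k : ((2 ^+ k) `^ (- delta) = c ^+ k :> R)%R.
  by rewrite -(powR_mulrn k (ler0n R 2)) -powRrM -[RHS](powR_mulrn k (ltW c0)) /c -powRrM mulrC.
under eq_bigr do rewrite e.
have d0 : (0 < 1 - c)%R by lra.
rewrite -[leRHS]mul1r ler_pdivlMr //.
have := subrX1 c N; have := exprn_ge0 N (ltW c0).
by move: (c ^+ N)%R (\sum_(i < N) c ^+ i)%R => u S u0 h; rewrite mulrBr mulr1; lra.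
Qed.

Let Cd : R := (4 * (1 - 2 `^ (- delta))^-1)%R.

(** On the ball of radius [2^(k+1) / Rad] the average of [G] is at most its maximal function; the
    length [4 * 2^k / Rad] of the ball turns the coefficient into [4 * 2^(- k delta)], which is
    summable. As [|x - y| < 1], finitely many balls suffice. *)
Lemma dk_average G Rad x : measurable_fun setT G -> (forall y, (0 <= G y)%R) ->
  \int[mu]_y (G y)%:E < +oo -> (0 < Rad)%R -> (0 < x < 1)%R ->
  (forall y, ~~ (0 < y < 1)%R -> G y = 0%R) ->
  \int[mu]_y (Rad * dk (Rad * `|x - y|) * G y)%:E <= Cd%:E * HL_maximal G x.
Proof.
move=> mG G0 Goo R0 /andP[x0 x1] Gs.
have locG : locally_integrable setT G by exact: integrable_locT.
have V0 : 0 <= HL_maximal G x by exact: HL_maximalT_ge0.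
have [N hN] : exists N : nat, (Rad < 2 ^+ N.+1)%R.
  exists (Num.bound Rad); apply: (@lt_trans _ _ (Num.bound Rad)%:R%R).
    by apply: archi_boundP; exact: ltW.
  by rewrite -natrX ltr_nat (ltn_trans (ltn_expl _ (ltnSn 1))) // ltn_exp2l.
pose c k : R := ((2 ^+ k) `^ (- 1 - delta))%R.
pose F (k : 'I_N.+1) y : \bar R := ((Rad * c k) * ((if (Rad * `|x - y| < 2 * 2 ^+ k) then 1 else 0) * G y))%R%:E.
have mI (k : nat) : measurable_fun setT (fun y => (if (Rad * `|x - y| < 2 * 2 ^+ k) then 1 else 0) * G y)%R.
  apply: measurable_funM => //; apply: measurable_fun_ifT => //; apply: measurable_fun_ltr => //.
  by apply: measurable_funM => //; apply: measurableT_comp => //; exact: measurable_funB.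
have i0 (k : nat) y : (0 <= (if (Rad * `|x - y| < 2 * 2 ^+ k) then 1 else 0) * G y)%R.
  by rewrite mulr_ge0 //; case: ifP.
have F0 k y : 0 <= F k y.
  by rewrite lee_fin mulr_ge0 // mulr_ge0 ?powR_ge0 // ltW.
have mF k : measurable_fun setT (F k).
  by apply: measurableT_comp => //; exact: measurable_funM.
apply: (@le_trans _ _ (\int[mu]_y \sum_(k <- index_enum 'I_N.+1) F k y)).
  apply: ge0_le_integralW => y _; first by rewrite lee_fin !mulr_ge0 ?dk_ge0 // ltW.
  rewrite /F sumEFin lee_fin.
  have [y01|/Gs ->] := boolP (0 < y < 1)%R; last by rewrite mulr0; apply: sumr_ge0 => k _; rewrite mulr0 mulr0.
  have ht : (Rad * `|x - y| < 2 ^+ N.+1)%R.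
    apply: le_lt_trans hN; rewrite ler_piMr ?(ltW R0) // ler_norml.
    by case/andP: y01 => ? ?; apply/andP; split; lra.
  have h := dk_dyadic (mulr_ge0 (ltW R0) (normr_ge0 _)) ht.
  apply: (@le_trans _ _ (Rad * (\sum_(k < N.+1) c k * (if (Rad * `|x - y| < 2 * 2 ^+ k) then 1 else 0)) * G y)%R).
    by apply: ler_wpM2r => //; apply: ler_wpM2l => //; exact: ltW.
  rewrite mulr_sumr mulr_suml le_eqVlt; apply/orP; left; apply/eqP; apply: eq_bigr => k _; ring.
rewrite ge0_integral_sum //.
apply: (@le_trans _ _ (\sum_(k < N.+1) (4 * (2 ^+ k) `^ (- delta))%R%:E * HL_maximal G x)).
  apply: lee_sum => k _; rewrite /F.
  have -> : \int[mu]_y ((Rad * c k) * ((if (Rad * `|x - y| < 2 * 2 ^+ k) then 1 else 0) * G y))%R%:E =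
    (Rad * c k)%:E * \int[mu]_(y in ball x (2 * 2 ^+ k / Rad)%R) (G y)%:E.
    have -> : \int[mu]_(y in ball x (2 * 2 ^+ k / Rad)%R) (G y)%:E =
        \int[mu]_y (if (Rad * `|x - y| < 2 * 2 ^+ k)%R then (G y)%:E else 0).
      apply/esym; apply: (@integral_if _ (fun y => Rad * `|x - y| < 2 * 2 ^+ k)%R (EFin \o G)).
      by apply/seteqP; split => y /=; rewrite /ball /= ltr_pdivlMr // mulrC.
    rewrite -ge0_integralZl_EFin //.
    - by apply: eq_integral => y _; case: ifP => _; rewrite ?mul1r ?mul0r ?mulr0 ?mule0 ?EFinM.
    - by move=> y _; case: ifP => //; rewrite lee_fin.
    - rewrite (_ : (fun y => _) = EFin \o (fun y => (if (Rad * `|x - y| < 2 * 2 ^+ k) then 1 else 0) * G y)%R).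
        by apply: measurableT_comp => //; exact: (mI k).
      by apply/funext => y /=; case: ifP => _; rewrite ?mul1r ?mul0r.
    - by rewrite mulr_ge0 ?powR_ge0 // ltW.
  have r0 : (0 < 2 * 2 ^+ k / Rad)%R by rewrite divr_gt0 // mulr_gt0 // exprn_gt0.
  apply: (le_trans (lee_wpmul2l _ (integral_ball_le x r0 G0))).
    by rewrite lee_fin mulr_ge0 ?powR_ge0 // ltW.
  rewrite muleA -EFinM; apply: lee_wpmul2r => //; rewrite lee_fin.
  have k0 : (0 < 2 ^+ k :> R)%R by rewrite exprn_gt0.
  rewrite /c (_ : (- 1 - delta = - delta - 1)%R); last by ring.
  rewrite (powRS (- delta) k0) -mulr_natr.
  by rewrite le_eqVlt; apply/orP; left; apply/eqP; field; rewrite gt_eqF.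
rewrite -ge0_sume_distrl; last by move=> k _; rewrite lee_fin mulr_ge0 ?powR_ge0.
apply: lee_wpmul2r => //; rewrite sumEFin lee_fin -mulr_sumr; apply: ler_wpM2l => //.
exact: geometric_le.
Qed.

End DyadicAverage.
End MaximalFunction.

(** * Weighted estimates *)

Section PowerVersusOne.
Context {R : realType}.
Implicit Types z c : R.

Lemma ge1_powR_ge1 z c : 1 <= z -> 0 <= c -> 1 <= z `^ c.
Proof. by move=> z1 c0; have := ler_powR z1 c0; rewrite powRr0. Qed.

Lemma ge1_powR_le1 z c : 1 <= z -> c <= 0 -> z `^ c <= 1.
Proof. by move=> z1 c0; have := ler_powR z1 c0; rewrite powRr0. Qed.

Lemma le1_powR_ge1 z c : 0 < z -> z <= 1 -> c <= 0 -> 1 <= z `^ c.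
Proof.
by move=> z0 z1 c0; have := @ger_powR _ z; rewrite z0 z1 => /(_ isT _ _ c0); rewrite powRr0.
Qed.

Lemma le1_powR_le1 z c : 0 < z -> z <= 1 -> 0 <= c -> z `^ c <= 1.
Proof.
by move=> z0 z1 c0; have := @ger_powR _ z; rewrite z0 z1 => /(_ isT _ _ c0); rewrite powRr0.
Qed.

End PowerVersusOne.

(** * The kernel off and near the diagonal *)

Section KernelBounds.
Context {R : realType}.
Implicit Types (x y u v t Rad : R).
Variables (nu delta : R).
Hypothesis nu1 : -1 < nu.
Hypothesis delta0 : 0 < delta.

Let kap : R := nu + 1 / 2.
Let theta : R := Num.min kap delta.
Notation dk := (dk delta).
Notation kR := (kR nu delta).

Lemma dk_le1 t : dk t <= 1.
Proof.
rewrite /dk; case: ifPn => //; rewrite -ltNge => t1.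
by apply: ge1_powR_le1; [exact: ltW|have h := delta0; lra].
Qed.

Lemma dk_le t : 0 < t -> dk t <= t `^ (- 1 - delta).
Proof.
move=> t0; rewrite /dk; case: ifPn => // t1.
by apply: le1_powR_ge1 => //; have h := delta0; lra.
Qed.

Lemma kR_sym Rad u v : kR Rad u v = kR Rad v u.
Proof. by rewrite /kR distrC [Phi _ (Rad * u) * _]mulrC. Qed.

Lemma dk_off Rad u v : 0 < Rad -> 0 < u -> 2 * u <= v ->
  dk (Rad * `|u - v|) <= 2 `^ (1 + delta) * (Rad * v) `^ (- 1 - delta).
Proof.
move=> R0 u0 uv; have v0 : 0 < v by lra.
have uv' : `|u - v| = v - u by rewrite distrC ger0_norm //; lra.
rewrite uv'; apply: (le_trans (dk_le _)); first by apply: mulr_gt0 => //; lra.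
apply: (@le_trans _ _ ((Rad * v / 2) `^ (- 1 - delta))).
  apply: le0_powR_anti; [have h := delta0; lra|by apply: divr_gt0 => //; exact: mulr_gt0|].
  by rewrite -mulrA; apply: ler_wpM2l; [exact: ltW|lra].
rewrite powRM ?invr_ge0 ?mulr_ge0 ?(ltW R0) ?(ltW v0) // mulrC; apply: ler_wpM2r; first exact: powR_ge0.
rewrite -[2^-1]powR_inv1 // -powRrM le_eqVlt; apply/orP; left; apply/eqP; congr (_ `^ _); ring.
Qed.

(** By homogeneity only [a = Rad u] and [b = Rad v] matter. For [b <= 1] the bound rests on
    [theta <= kap] and [2 kap > -1], for [b > 1] on [theta <= delta] and the decay of [dk]. *)
Lemma kR_off Rad u v : 0 < Rad -> 0 < u -> 2 * u <= v ->
  kR Rad u v <= 2 `^ (1 + delta) * (u `^ theta * v `^ (- 1 - theta)).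
Proof.
move=> R0 u0 uv; have v0 : 0 < v by lra.
have hD := dk_off R0 u0 uv; have hD1 := dk_le1 (Rad * `|u - v|).
rewrite /kR -/kap; set D := dk _ in hD hD1 *.
have D0 : 0 <= D by exact: dk_ge0.
have k1 := kap_gt nu1; rewrite -/kap in k1; have d0 := delta0.
have tk : theta <= kap by rewrite /theta ge_min lexx.
have td : theta <= delta by rewrite /theta ge_min lexx orbT.
set a := Rad * u; set b := Rad * v in hD *.
have a0 : 0 < a by exact: mulr_gt0.
have b0 : 0 < b by exact: mulr_gt0.
have ab : a <= b by apply: ler_wpM2l; [exact: ltW|lra].
have C1 : 1 <= 2 `^ (1 + delta) by apply: ge1_powR_ge1; lra.
have eU : u `^ theta * v `^ (- 1 - theta) = Rad * (a `^ theta * b `^ (- 1 - theta)).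
  rewrite /a /b !powRM ?(ltW R0) ?(ltW u0) ?(ltW v0) //.
  have e : Rad * (Rad `^ theta * Rad `^ (- 1 - theta)) = 1.
    rewrite -powRD ?(gt_eqF R0) ?implybT // (_ : theta + (- 1 - theta) = -1); last by ring.
    by rewrite powR_inv1 ?(ltW R0) // mulfV ?gt_eqF.
  by rewrite -[LHS]mul1r -{1}e; ring.
suff h : Phi kap a * Phi kap b * D <= 2 `^ (1 + delta) * (a `^ theta * b `^ (- 1 - theta)).
  rewrite eU (_ : _ * (Rad * _) = Rad * (2 `^ (1 + delta) * (a `^ theta * b `^ (- 1 - theta)))); last by ring.
  by rewrite -mulrA; apply: ler_wpM2l => //; exact: ltW.
have pw c : 0 <= a `^ c /\ 0 <= b `^ c by split; exact: powR_ge0.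
have [b1|b1] := leP b 1.
  have a1 : a <= 1 by exact: le_trans b1.
  rewrite /Phi a1 b1.
  apply: (@le_trans _ _ (a `^ kap * b `^ kap * 1)).
    by apply: ler_wpM2l => //; rewrite mulr_ge0 ?powR_ge0.
  rewrite mulr1; apply: (@le_trans _ _ (a `^ theta * b `^ (- 1 - theta))); last first.
    by rewrite ler_peMl // mulr_ge0 ?powR_ge0.
  have -> : kap = theta + (kap - theta) by ring.
  rewrite [a `^ (_ + _)]powRD ?(gt_eqF a0) ?implybT // -mulrA; apply: ler_wpM2l; first exact: powR_ge0.
  apply: (@le_trans _ _ (b `^ (kap - theta) * b `^ (theta + (kap - theta)))).
    apply: ler_wpM2r; first exact: powR_ge0.
    by apply: ge0_ler_powR; rewrite ?nnegrE ?(ltW a0) ?(ltW b0) // subr_ge0.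
  rewrite -powRD ?(gt_eqF b0) ?implybT //; apply: ger_powR; first by rewrite b0.
  lra.
have -> : Phi kap b = 1 by rewrite /Phi leNgt b1.
rewrite mulr1.
have hP : Phi kap a <= a `^ theta * b `^ (delta - theta).
  rewrite /Phi; case: ifPn => a1.
    apply: (@le_trans _ _ (a `^ theta)); first by apply: ger_powR => //; rewrite a0.
    by rewrite ler_peMr ?powR_ge0 //; apply: ge1_powR_ge1; [exact: ltW|lra].
  rewrite -ltNge in a1.
  have [t0|t0] := leP 0 theta.
    by apply: mulr_ege1; apply: ge1_powR_ge1; rewrite ?(ltW a1) ?(ltW b1) //; lra.
  apply: (@le_trans _ _ (a `^ theta * a `^ (- theta))).
    by rewrite -powRD ?(gt_eqF a0) ?implybT // subrr powRr0.
  apply: ler_wpM2l; first exact: powR_ge0.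
  apply: (@le_trans _ _ (b `^ (- theta))).
    by apply: ge0_ler_powR; rewrite ?nnegrE ?(ltW a0) ?(ltW b0) // oppr_ge0 ltW.
  by apply: ler_powR; [exact: ltW|lra].
have P0 : 0 <= Phi kap a by apply: ltW; exact: Phi_gt0.
apply: (le_trans (ler_pM P0 D0 hP hD)).
rewrite le_eqVlt; apply/orP; left; apply/eqP.
rewrite (_ : - 1 - theta = (delta - theta) + (- 1 - delta)); last by ring.
by rewrite (@powRD _ b (delta - theta)) ?(gt_eqF b0) ?implybT //; ring.
Qed.

(* When [kap < 0] and [Rad * x < 1] the kernel exceeds its diagonal size at scale [Rad], and
   [x^-1] is the right scale. *)
Definition Rnear Rad x : R := if (kap < 0) && (Rad * x < 1) then x^-1 else Rad.

Lemma Rnear_gt0 Rad x : 0 < Rad -> 0 < x -> 0 < Rnear Rad x.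
Proof. by move=> R0 x0; rewrite /Rnear; case: ifP => // _; rewrite invr_gt0. Qed.

Lemma Phi_le1 z : 0 <= kap -> 0 < z -> Phi kap z <= 1.
Proof.
move=> k0 z0; rewrite /Phi; case: ifPn => // z1.
exact: le1_powR_le1.
Qed.

Lemma Phi_half z w : kap < 0 -> 0 < w -> w / 2 < z -> w <= 1 -> Phi kap z <= 2 `^ `|kap| * w `^ kap.
Proof.
move=> k0 w0 wz w1; rewrite ltr0_norm //.
have e : 2 `^ (- kap) * w `^ kap = (w / 2) `^ kap.
  rewrite powRM ?invr_ge0 ?(ltW w0) // mulrC; congr (_ * _).
  by rewrite -[2^-1]powR_inv1 // -powRrM mulN1r.
have w2 : 0 < w / 2 by exact: divr_gt0.
rewrite e /Phi; case: ifPn => [z1|_]; first by apply: le0_powR_anti; rewrite ?(ltW k0) // ltW.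
by apply: le1_powR_ge1 => //; [lra|exact: ltW].
Qed.

Lemma kR_near Rad x y : 0 < Rad -> 0 < x -> x < 2 * y -> y < 2 * x ->
  kR Rad x y <= 2 `^ `|kap| * (Rnear Rad x * dk (Rnear Rad x * `|x - y|)).
Proof.
move=> R0 x0 xy yx; have y0 : 0 < y by lra.
have C1 : 1 <= 2 `^ `|kap| by apply: ge1_powR_ge1; [lra|exact: normr_ge0].
have Rx : 0 < Rad * x by exact: mulr_gt0.
have Ry : 0 < Rad * y by exact: mulr_gt0.
have half : Rad * x / 2 < Rad * y by rewrite -mulrA ltr_pM2l //; lra.
have p2 : 0 <= 2 `^ `|kap| by exact: powR_ge0.
(* In this case the size is [Rad (Rad x)^(2 kap) = x^-1 (Rad x)^(2 kap + 1) <= x^-1]. *)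
rewrite /kR -/kap /Rnear; case: ifPn => [/andP[k0 Rx1]|].
  have -> : dk (x^-1 * `|x - y|) = 1.
    rewrite /dk ifT // mulrC ler_pdivrMr // mul1r ler_norml; apply/andP; split; lra.
  have h := Phi_half k0 Rx half (ltW Rx1).
  have e : Phi kap (Rad * x) = (Rad * x) `^ kap by rewrite /Phi (ltW Rx1).
  rewrite e mulr1; apply: (@le_trans _ _ (Rad * ((Rad * x) `^ kap * (2 `^ `|kap| * (Rad * x) `^ kap)) * 1)).
    apply: ler_pM; rewrite ?dk_ge0 ?dk_le1 //.
      by rewrite !mulr_ge0 ?powR_ge0 ?(ltW R0) // ltW // Phi_gt0.
    by apply: ler_wpM2l; [exact: ltW|apply: ler_wpM2l => //; exact: powR_ge0].
  rewrite (_ : _ * 1 = 2 `^ `|kap| * (x^-1 * ((Rad * x) * ((Rad * x) `^ kap * (Rad * x) `^ kap)))); last by field; rewrite gt_eqF.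
  apply: ler_wpM2l => //; rewrite -[leRHS]mulr1; apply: ler_wpM2l; first by rewrite invr_ge0 ltW.
  rewrite -powRD ?(gt_eqF Rx) ?implybT // -{1}(powRr1 (ltW Rx)) -powRD ?(gt_eqF Rx) ?implybT //.
  by apply: le1_powR_le1 => //; [exact: ltW|have := kap_gt nu1; rewrite -/kap; lra].
move=> hc; rewrite [leRHS]mulrA; apply: ler_wpM2r; first exact: dk_ge0.
rewrite [leRHS]mulrC; apply: ler_wpM2l; first exact: ltW.
have Px0 := Phi_gt0 kap Rx; have Py0 := Phi_gt0 kap Ry.
have [k0|k0] := leP 0 kap.
  by apply: le_trans C1; rewrite -[leRHS]mulr1; apply: ler_pM; rewrite ?Phi_le1 //; exact: ltW.
rewrite k0 /= -leNgt in hc.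
have Px1 : Phi kap (Rad * x) <= 1.
  by rewrite /Phi; case: ifPn => // h; rewrite (_ : Rad * x = 1) ?powR1 //; apply/eqP; rewrite eq_le h.
rewrite -[leRHS]mul1r; apply: ler_pM => //; [exact: ltW|exact: ltW|].
have half' : 1 / 2 < Rad * y by apply: le_lt_trans half; rewrite ler_wpM2r // invr_ge0.
by have := Phi_half k0 ltr01 half' (lexx 1); rewrite powR1 mulr1.
Qed.

End KernelBounds.

(** * Hardy kernels and bounds uniform in [Rad] *)

Section BoundedOperators.
Context {R : realType}.
Notation mu := (@lebesgue_measure R).
Implicit Types (x y t Rad b c r : R) (G : R -> R) (K : R -> R -> R -> R).

Lemma two_powers (F : R -> R) (c1 e1 c2 e2 t : R) : -1 < e1 -> 0 < e2 -> 0 < t ->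
  0 <= c1 -> 0 <= c2 -> (forall y, 0 < y < 1 -> 0 <= F y) ->
  (forall y, 0 < y < 1 -> y < t -> F y <= c1 * y `^ e1) ->
  (forall y, 0 < y < 1 -> t <= y -> F y <= c2 * y `^ (- 1 - e2)) ->
  (\int[mu]_(y in `]0%R, 1%R[) (F y)%:E <= (c1 * (t `^ (e1 + 1) / (e1 + 1)) + c2 * (t `^ (- e2) / e2))%:E)%E.
Proof.
move=> h1 h2 t0 c10 c20 F0 F1 F2.
pose f1 (y : R) : \bar R := (c1%:E * (y `^ e1)%:E)%E.
pose f2 (y : R) : \bar R := (c2%:E * (y `^ (- 1 - e2))%:E)%E.
have f10 y : (0 <= f1 y)%E by rewrite mule_ge0 // lee_fin powR_ge0.
have f20 y : (0 <= f2 y)%E by rewrite mule_ge0 // lee_fin powR_ge0.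
have mf1 : measurable_fun setT f1.
  by apply: measurable_funeM; apply: measurableT_comp => //; exact: measurable_powR.
have mf2 : measurable_fun setT f2.
  by apply: measurable_funeM; apply: measurableT_comp => //; exact: measurable_powR.
have p1 y : (0 <= (f1 \_ `]0%R, t[) y)%E by rewrite patchE; case: ifP.
have p2 y : (0 <= (f2 \_ `[t, 1%R]) y)%E by rewrite patchE; case: ifP.
have mp1 : measurable_fun setT (f1 \_ `]0%R, t[).
  by apply/(measurable_restrictT _ _).1 => //; exact: measurable_funTS.
have mp2 : measurable_fun setT (f2 \_ `[t, 1%R]).
  by apply/(measurable_restrictT _ _).1 => //; exact: measurable_funTS.
apply: (@le_trans _ _ (\int[mu]_y ((f1 \_ `]0%R, t[) y + (f2 \_ `[t, 1%R]) y))%E).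
  rewrite integral_mkcond; apply: ge0_le_integralW => y _; rewrite !patchE.
    by case: ifPn => //; rewrite inE /= in_itv /= => h; rewrite lee_fin F0.
  case: ifPn => [|_]; last by apply: adde_ge0; case: ifP.
  rewrite inE /= in_itv /= => h; have [y0 y1] := andP h.
  have [yt|ty] := ltP y t.
    rewrite (@mem_set _ (`]0%R, t[)) /=; last by rewrite in_itv /= y0.
    by rewrite -[leLHS]adde0; apply: leeD; [rewrite /f1 -EFinM lee_fin F1|case: ifP].
  rewrite (@mem_set _ (`[t, 1%R])) /=; last by rewrite in_itv /= ty ltW.
  by rewrite -[leLHS]add0e; apply: leeD; [case: ifP|rewrite /f2 -EFinM lee_fin F2].
rewrite ge0_integralD // -!integral_mkcond EFinD; apply: leeD.
  rewrite ge0_integralZl_EFin //; last 2 first.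
  - by move=> y _; rewrite lee_fin powR_ge0.
  - by apply: measurableT_comp => //; exact: measurable_funTS (measurable_powR _).
  by rewrite integral_powR0 // -EFinM.
rewrite ge0_integralZl_EFin //; last 2 first.
- by move=> y _; rewrite lee_fin powR_ge0.
- by apply: measurableT_comp => //; exact: measurable_funTS (measurable_powR _).
by rewrite EFinM; apply: lee_wpmul2l => //; exact: integral_powRoo.
Qed.

(* The Hardy kernel [x^b y^(-1-b)], which is homogeneous of degree [-1]. *)
Definition kcone b (z : R * R) : R :=
  if [&& 0 < z.1, 2 * z.1 <= z.2 & z.2 < 1] then z.1 `^ b * z.2 `^ (- 1 - b) else 0.

Lemma kcone_ge0 b z : 0 <= kcone b z.
Proof. by rewrite /kcone; case: ifP => // _; rewrite mulr_ge0 ?powR_ge0. Qed.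

Lemma measurable_kcone b : measurable_fun setT (kcone b).
Proof.
apply: measurable_fun_ifT => //; last first.
  by apply: measurable_funM; apply: measurable_powR_comp; [exact: measurable_fst|exact: measurable_snd].
apply: measurable_and; first by apply: measurable_fun_ltr => //; exact: measurable_fst.
apply: measurable_and; last by apply: measurable_fun_ltr => //; exact: measurable_snd.
by apply: measurable_fun_ler; [apply: measurable_funM => //; exact: measurable_fst|exact: measurable_snd].
Qed.

Lemma kcone_pos b x y : kcone b (x, y) != 0 -> 0 < x /\ 0 < y.
Proof. by rewrite /kcone /=; case: ifPn => [/and3P[x0 xy _] _|]; rewrite ?eqxx //; split => //; lra. Qed.

Lemma cone_out b r x : 0 < b + r -> 0 < x ->
  (\int[mu]_y (kcone b (x, y) * y `^ (- r))%:E <= ((b + r)^-1 * x `^ (- r))%:E)%E.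
Proof.
move=> br x0.
pose f (y : R) : \bar R := ((x `^ b)%:E * (y `^ (- 1 - (b + r)))%:E)%E.
have f0 y : (0 <= f y)%E by rewrite /f -EFinM lee_fin mulr_ge0 ?powR_ge0.
apply: (@le_trans _ _ (\int[mu]_(y in `[x, 1%R]) f y)%E).
  rewrite [leRHS]integral_mkcond; apply: ge0_le_integralW => y _.
    by rewrite lee_fin mulr_ge0 ?powR_ge0 ?kcone_ge0.
  rewrite patchE /kcone /=; case: ifPn => [/and3P[_ xy y1]|_]; last by rewrite mul0r; case: ifP.
  rewrite mem_set /=; last by rewrite in_itv /=; apply/andP; split; lra.
  have y0 : 0 < y by lra.
  rewrite /f -EFinM lee_fin -mulrA -powRD ?(gt_eqF y0) ?implybT //.
  by rewrite (_ : - 1 - b + - r = - 1 - (b + r)) //; ring.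
rewrite ge0_integralZl_EFin ?powR_ge0 //; last 2 first.
- by move=> y _; rewrite lee_fin powR_ge0.
- by apply: measurableT_comp => //; exact: measurable_funTS (measurable_powR _).
apply: (le_trans (lee_wpmul2l _ (integral_powRoo 1 br x0))); first by rewrite lee_fin powR_ge0.
rewrite -EFinM lee_fin mulrA -powRD ?(gt_eqF x0) ?implybT //.
rewrite (_ : b - (b + r) = - r); last by ring.
by rewrite mulrC.
Qed.

Lemma cone_in b r y : r < b + 1 -> 0 < y ->
  (\int[mu]_x (kcone b (x, y) * x `^ (- r))%:E <= ((b - r + 1)^-1 * y `^ (- r))%:E)%E.
Proof.
move=> br y0.
pose f (x : R) : \bar R := ((y `^ (- 1 - b))%:E * (x `^ (b - r))%:E)%E.
have f0 x : (0 <= f x)%E by rewrite /f -EFinM lee_fin mulr_ge0 ?powR_ge0.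
apply: (@le_trans _ _ (\int[mu]_(x in `]0%R, y[) f x)%E).
  rewrite [leRHS]integral_mkcond; apply: ge0_le_integralW => x _.
    by rewrite lee_fin mulr_ge0 ?powR_ge0 ?kcone_ge0.
  rewrite patchE /kcone /=; case: ifPn => [/and3P[x0 xy y1]|_]; last by rewrite mul0r; case: ifP.
  rewrite mem_set /=; last by rewrite in_itv /=; apply/andP; split; lra.
  by rewrite /f -EFinM lee_fin powRD ?(gt_eqF x0) ?implybT // le_eqVlt; apply/orP; left; apply/eqP; ring.
rewrite ge0_integralZl_EFin ?powR_ge0 //; last 2 first.
- by move=> x _; rewrite lee_fin powR_ge0.
- by apply: measurableT_comp => //; exact: measurable_funTS (measurable_powR _).
rewrite integral_powR0 //; last by lra.
rewrite -EFinM lee_fin mulrA -powRD ?(gt_eqF y0) ?implybT //.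
rewrite (_ : - 1 - b + (b - r + 1) = - r); last by ring.
by rewrite mulrC.
Qed.

Section FiniteExponent.
Variables (p q : R).
Hypotheses (p1 : 1 < p) (q0 : 0 < q) (pq : p^-1 + q^-1 = 1).

Let p0 : 0 < p. Proof. by have h := p1; lra. Qed.

Definition admissible G := [/\ measurable_fun setT G, forall y, 0 <= G y,
  forall y, ~~ (0 < y < 1) -> G y = 0 & (\int[mu]_y (G y)%:E < +oo)%E].

(** The function [H] is a measurable majorant for all [Rad] at once; it carries the supremum, so
    that the supremum itself need not be integrated as a measurable function. *)
Definition bounded_op K := exists C : R, 0 <= C /\ forall G, admissible G ->
  exists H : R -> \bar R, [/\ measurable_fun setT H, forall x, (0 <= H x)%E,
    forall Rad x, 0 < Rad -> 0 < x < 1 -> (\int[mu]_y (K Rad x y * G y)%:E <= H x)%E &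
    (\int[mu]_(x in `]0%R, 1%R[) poweR (H x) p <= C%:E * \int[mu]_y (G y `^ p)%:E)%E].

Lemma bounded_opW c K K' : 0 <= c ->
  (forall Rad x y, 0 < Rad -> 0 < x < 1 -> 0 < y < 1 -> 0 <= K Rad x y) ->
  (forall Rad x, measurable_fun setT (K' Rad x)) ->
  (forall Rad x y, 0 < Rad -> 0 < x < 1 -> 0 < y < 1 -> K Rad x y <= c * K' Rad x y) ->
  (forall Rad x y, 0 < Rad -> 0 < x < 1 -> 0 <= K' Rad x y) ->
  bounded_op K' -> bounded_op K.
Proof.
move=> c0 K0 mK' KK' K'0 [C [C0 hC]]; exists (c `^ p * C); split; first by rewrite mulr_ge0 ?powR_ge0.
move=> G aG; have [mG G0 Gs Goo] := aG; have [H [mH H0 hH1 hH2]] := hC G aG.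
exists (fun x => c%:E * H x)%E; split.
- exact: measurable_funeM.
- by move=> x; rewrite mule_ge0.
- move=> Rad x R0 x01; apply: (@le_trans _ _ (c%:E * \int[mu]_y (K' Rad x y * G y)%:E)%E); last first.
    by apply: lee_wpmul2l => //; exact: hH1.
  have mKG : measurable_fun setT (fun y => K' Rad x y * G y) by exact: measurable_funM.
  rewrite -ge0_integralZl_EFin //; last 2 first.
  + by move=> y _; rewrite lee_fin mulr_ge0 // K'0.
  + by apply: measurableT_comp => //; exact: mKG.
  apply: ge0_le_integralW => y _; have [y01|/Gs ->] := boolP (0 < y < 1); rewrite ?mulr0 ?mule0 //.
    by rewrite lee_fin mulr_ge0 // K0.
  by rewrite -EFinM lee_fin mulrA; apply: ler_wpM2r => //; exact: KK'.
- under eq_integral do rewrite poweRM ?lee_fin //= .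
  rewrite ge0_integralZl_EFin ?powR_ge0 //; last 2 first.
  + by move=> x _; exact: poweR_ge0.
  + by apply: measurable_funTS; exact: (measurableT_comp (measurable_poweR p)).
  by rewrite EFinM -muleA; apply: lee_wpmul2l => //; rewrite lee_fin powR_ge0.
Qed.

Lemma poweRD_le (u v : \bar R) : (0 <= u -> 0 <= v ->
  poweR (u + v) p <= (2 `^ p)%:E * (poweR u p + poweR v p))%E.
Proof.
wlog uv : u v / (u <= v)%E.
  move=> h u0 v0; have [uv|/ltW vu] := leP u v; first exact: h.
  by rewrite addeC [X in (_ * X)%E]addeC; exact: h.
move=> u0 v0; apply: (@le_trans _ _ (poweR (2%:E * v) p)).
  apply: gt0_ler_poweR; rewrite ?in_itv /= ?leey ?andbT ?mule_ge0 ?adde_ge0 //; first exact: ltW.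
  rewrite (_ : 2%:E = 1 + 1)%E; last by rewrite -EFinD.
  by rewrite ge0_muleDl // mul1e; apply: leeD.
rewrite poweRM //; apply: lee_wpmul2l; first exact: poweR_ge0.
by rewrite -[leLHS]add0e; apply: leeD => //; exact: poweR_ge0.
Qed.

Lemma bounded_opD K1 K2 :
  (forall Rad x, measurable_fun setT (K1 Rad x)) -> (forall Rad x, measurable_fun setT (K2 Rad x)) ->
  (forall Rad x y, 0 < Rad -> 0 < x < 1 -> 0 <= K1 Rad x y) ->
  (forall Rad x y, 0 < Rad -> 0 < x < 1 -> 0 <= K2 Rad x y) ->
  bounded_op K1 -> bounded_op K2 -> bounded_op (fun Rad x y => K1 Rad x y + K2 Rad x y).
Proof.
move=> mK1 mK2 K10 K20 [C1 [C10 h1]] [C2 [C20 h2]]; exists (2 `^ p * (C1 + C2)).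
split; first by rewrite mulr_ge0 ?powR_ge0 ?addr_ge0.
move=> G aG; have [mG G0 Gs Goo] := aG.
have [H1 [mH1 H10 hH1 hp1]] := h1 G aG; have [H2 [mH2 H20 hH2 hp2]] := h2 G aG.
exists (fun x => H1 x + H2 x)%E; split.
- exact: emeasurable_funD.
- by move=> x; exact: adde_ge0.
- move=> Rad x R0 x01; under eq_integral do rewrite mulrDl EFinD.
  have m1 : measurable_fun setT (fun y => K1 Rad x y * G y) by exact: measurable_funM.
  have m2 : measurable_fun setT (fun y => K2 Rad x y * G y) by exact: measurable_funM.
  rewrite ge0_integralD //.
  + by apply: leeD; [exact: hH1|exact: hH2].
  + by move=> y _; rewrite lee_fin mulr_ge0 // K10.
  + by apply: measurableT_comp => //; exact: m1.
  + by move=> y _; rewrite lee_fin mulr_ge0 // K20.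
  + by apply: measurableT_comp => //; exact: m2.
- have mp (H : R -> \bar R) : measurable_fun setT H -> measurable_fun (`]0%R, 1%R[ : set R) (fun x => poweR (H x) p).
    by move=> mH; apply: measurable_funTS; exact: (measurableT_comp (measurable_poweR p)).
  apply: (@le_trans _ _ (\int[mu]_(x in `]0%R, 1%R[) ((2 `^ p)%:E * (poweR (H1 x) p + poweR (H2 x) p)))%E).
    by apply: ge0_le_integralW => x _; [exact: poweR_ge0|exact: poweRD_le].
  rewrite ge0_integralZl_EFin ?powR_ge0 //; last 2 first.
  + by move=> x _; apply: adde_ge0; exact: poweR_ge0.
  + by apply: emeasurable_funD; exact: mp.
  rewrite ge0_integralD //; last 4 first.
  + by move=> x _; exact: poweR_ge0.
  + exact: mp.
  + by move=> x _; exact: poweR_ge0.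
  + exact: mp.
  rewrite EFinM -muleA; apply: lee_wpmul2l; first by rewrite lee_fin powR_ge0.
  rewrite EFinD ge0_muleDl ?lee_fin //; exact: leeD.
Qed.

Let schur_op (K : R * R -> R) e C1 C2 : measurable_fun setT K -> (forall z, 0 <= K z) ->
  (forall x y, K (x, y) != 0 -> 0 < x /\ 0 < y) -> 0 <= C1 -> 0 <= C2 ->
  (forall x, 0 < x -> (\int[mu]_y (K (x, y) * y `^ (- (e * q)))%:E <= (C1 * x `^ (- (e * q)))%:E)%E) ->
  (forall y, 0 < y -> (\int[mu]_x (K (x, y) * x `^ (- (e * p)))%:E <= (C2 * y `^ (- (e * p)))%:E)%E) ->
  bounded_op (fun _ x y => K (x, y)).
Proof.
move=> mK K0 Kpos C10 C20 hx hy; exists (C1 `^ (p / q) * C2); split; first by rewrite mulr_ge0 ?powR_ge0.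
move=> G [mG G0 Gs Goo]; exists (fun x => \int[mu]_y (K (x, y) * G y)%:E)%E; split => //.
- apply: (@measurable_fun_fubini_tonelli_F _ _ _ _ _ mu (fun z => (K z * G z.2)%:E)).
    have mKG : measurable_fun setT (fun z : R * R => K z * G z.2).
      by apply: measurable_funM => //; exact: (measurableT_comp mG measurable_snd).
    by apply: measurableT_comp => //; exact: mKG.
  by move=> z; rewrite lee_fin mulr_ge0.
- by move=> x; apply: integral_ge0 => y _; rewrite lee_fin mulr_ge0.
- apply: le_trans (schur mK K0 Kpos p0 q0 pq C10 C20 hx hy mG G0).
  rewrite [leLHS]integral_mkcond; apply: ge0_le_integralW => x _; rewrite patchE; case: ifP => // _; exact: poweR_ge0.
Qed.

Lemma cone_op b : - p^-1 < b -> bounded_op (fun _ x y => kcone b (x, y)).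
Proof.
move=> hb; have pi0 : 0 < p^-1 by rewrite invr_gt0.
have qi0 : 0 < q^-1 by rewrite invr_gt0.
pose e : R := ((- b * q^-1) + (b + 1) * p^-1) / 2.
have qE : q^-1 = 1 - p^-1 by have h := pq; lra.
have e1 : 0 < b + e * q.
  have -> : b + e * q = (b * q^-1 + e) * q by field; rewrite gt_eqF.
  by rewrite mulr_gt0 // /e qE; nra.
have e2 : e * p < b + 1.
  have -> : e * p = e / p^-1 by rewrite invrK.
  by rewrite ltr_pdivrMr // /e qE; nra.
have h1 : 0 <= (b + e * q)^-1 by rewrite invr_ge0 ltW.
have h2 : 0 <= (b - e * p + 1)^-1 by rewrite invr_ge0; lra.
apply: (schur_op (measurable_kcone b) (kcone_ge0 b) (@kcone_pos b) h1 h2).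
- by move=> x x0; exact: cone_out.
- by move=> y y0; exact: cone_in.
Qed.

Lemma cone_op_tr b : - q^-1 < b -> bounded_op (fun _ x y => kcone b (y, x)).
Proof.
move=> hb; have pi0 : 0 < p^-1 by rewrite invr_gt0.
have qi0 : 0 < q^-1 by rewrite invr_gt0.
pose e : R := ((- b * p^-1) + (b + 1) * q^-1) / 2.
have qE : q^-1 = 1 - p^-1 by have h := pq; lra.
have e1 : 0 < b + e * p.
  have -> : b + e * p = (b * p^-1 + e) * p by field; rewrite gt_eqF.
  by rewrite mulr_gt0 // /e; nra.
have e2 : e * q < b + 1.
  have -> : e * q = e / q^-1 by rewrite invrK.
  by rewrite ltr_pdivrMr // /e; nra.
have h1 : 0 <= (b - e * q + 1)^-1 by rewrite invr_ge0; lra.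
have h2 : 0 <= (b + e * p)^-1 by rewrite invr_ge0 ltW.
apply: (@schur_op (fun z => kcone b (z.2, z.1)) e _ _ _ _ _ h1 h2).
- apply: (measurableT_comp (measurable_kcone b)).
  by apply: measurable_fun_pair; [exact: measurable_snd|exact: measurable_fst].
- by move=> z; exact: kcone_ge0.
- by move=> x y /= /kcone_pos[].
- by move=> x x0; exact: cone_in.
- by move=> y y0; exact: cone_out.
Qed.

End FiniteExponent.
End BoundedOperators.

(** * The near-diagonal kernel and the critical exponent [A = 1 + delta - 1/p] *)

Section WeightedKernel.
Context {R : realType}.
Notation mu := (@lebesgue_measure R).
Implicit Types (x y t Rad : R) (G : R -> R) (K : R -> R -> R -> R).
Variables (nu delta : R).
Hypothesis nu1 : -1 < nu.
Hypothesis delta0 : 0 < delta.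

Let kap : R := nu + 1 / 2.
Let theta : R := Num.min kap delta.
Notation dk := (dk delta).
Notation kR := (kR nu delta).

Definition knear Rad x y : R := Rnear nu Rad x * dk (Rnear nu Rad x * `|x - y|).

Lemma knear_ge0 Rad x y : 0 < Rad -> 0 < x -> 0 <= knear Rad x y.
Proof. by move=> R0 x0; rewrite mulr_ge0 ?dk_ge0 // ltW // Rnear_gt0. Qed.

Lemma measurable_knear Rad x : measurable_fun setT (knear Rad x).
Proof.
apply: measurable_funM => //.
have h : measurable_fun setT (fun z : R => Rnear nu Rad x * `|x - z|).
  by apply: measurable_funM => //; apply: measurableT_comp => //; exact: measurable_funB.
exact: (measurableT_comp (measurable_dk delta) h).
Qed.

(** [dk_average] bounds every scale by the same [HL_maximal G x], so the scale may depend on [x], as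
    [Rnear] does. *)
Lemma near_op p : 1 < p -> bounded_op p knear.
Proof.
move=> p1; pose Cd : R := 4 * (1 - 2 `^ (- delta))^-1.
have g0 : 0 <= (1 - 2 `^ (- delta))^-1.
  by apply: le_trans (geometric_le delta0 0); rewrite big_ord0.
have Cd0 : 0 <= Cd by rewrite mulr_ge0.
have cp : 0 <= 6 * p * 2 `^ (p - 1) / (p - 1).
  by rewrite divr_ge0 ?subr_ge0 ?(ltW p1) // !mulr_ge0 ?powR_ge0 //; lra.
exists (Cd `^ p * (6 * p * 2 `^ (p - 1) / (p - 1))); split.
  by apply: mulr_ge0 => //; exact: powR_ge0.
move=> G [mG G0 Gs Goo]; exists (fun x => Cd%:E * HL_maximal G x)%E; split.
- by apply: measurable_funeM; apply: measurable_HL_maximal; exact: integrable_locT.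
- by move=> x; apply: mule_ge0 => //; apply: HL_maximalT_ge0; exact: integrable_locT.
- by move=> Rad x R0 x01; have [x0 x1] := andP x01; apply: dk_average => //; exact: Rnear_gt0.
- have H0 x : (0 <= HL_maximal G x)%E by apply: HL_maximalT_ge0; exact: integrable_locT.
  apply: (@le_trans _ _ (\int[mu]_x ((Cd `^ p)%:E * poweR (HL_maximal G x) p))%E).
    rewrite [leLHS]integral_mkcond; apply: ge0_le_integralW => x _; rewrite patchE; case: ifP => // _; try exact: poweR_ge0.
      by rewrite poweRM ?lee_fin.
    by apply: mule_ge0; [rewrite lee_fin powR_ge0|exact: poweR_ge0].
  rewrite ge0_integralZl_EFin ?powR_ge0 //; last 2 first.
  + by move=> x _; exact: poweR_ge0.
  + apply: (measurableT_comp (measurable_poweR p)).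
    by apply: measurable_HL_maximal; exact: integrable_locT.
  by rewrite EFinM -muleA; apply: lee_wpmul2l; [rewrite lee_fin powR_ge0|exact: HL_strong].
Qed.

(** Split at [y = 1 / Rad]: the integrand is a multiple of [y^((kap - A) q)] below and equals
    [y^(- 1 - delta q)] above, and both pieces scale like [Rad^(delta q)]. *)
Lemma weightPhi (A q Rad : R) : 0 < q -> A * q = 1 + delta * q -> -1 < (kap - A) * q -> 0 < Rad ->
  (\int[mu]_(y in `]0%R, 1%R[) ((Phi kap (Rad * y) * y `^ (- A)) `^ q)%:E <=
   ((((kap - A) * q + 1)^-1 + (delta * q)^-1) * Rad `^ (delta * q))%:E)%E.
Proof.
move=> q0 Aq kA R0; have dq : 0 < delta * q by exact: mulr_gt0.
have t0 : 0 < Rad^-1 by rewrite invr_gt0.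
have := @two_powers R (fun y => (Phi kap (Rad * y) * y `^ (- A)) `^ q) (Rad `^ (kap * q)) ((kap - A) * q) 1 (delta * q) Rad^-1 kA dq t0 (powR_ge0 _ _) ler01.
move=> h; apply: (le_trans (h _ _ _)) => {h}.
- by move=> y _; exact: powR_ge0.
- move=> y /andP[y0 y1] yt; have Ry : Rad * y <= 1 by rewrite -(mulfV (lt0r_neq0 R0)) ler_wpM2l // ltW.
  rewrite /Phi Ry (powRM _ (ltW R0) (ltW y0)) -mulrA -powRD ?(gt_eqF y0) ?implybT //.
  by rewrite powRM ?powR_ge0 // -!powRrM.
- move=> y /andP[y0 y1] yt; have Ry : 1 <= Rad * y by rewrite -(mulfV (lt0r_neq0 R0)) ler_wpM2l // ltW.
  have -> : Phi kap (Rad * y) = 1.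
    by rewrite /Phi; case: ifPn => // h; rewrite (_ : Rad * y = 1) ?powR1 //; apply/eqP; rewrite eq_le h.
  by rewrite !mul1r -powRrM mulNr Aq opprD.
rewrite lee_fin mul1r.
have e c : (Rad^-1) `^ c = Rad `^ (- c) by rewrite -powR_inv1 ?(ltW R0) // -powRrM mulN1r.
rewrite !e opprK mulrA -powRD ?(gt_eqF R0) ?implybT //.
have -> : kap * q - ((kap - A) * q + 1) = delta * q by rewrite mulrBl Aq; ring.
rewrite le_eqVlt; apply/orP; left; apply/eqP; ring.
Qed.

(* Replaces the Hardy kernel when [A = 1 + delta - p^-1]; its [y]-norm compensates
   [Rad `^ (- delta)]. *)
Definition kspec A a Rad x y : R :=
  x `^ (a - 1 - delta) * Rad `^ (- delta) * (Phi kap (Rad * y) * y `^ (- A)).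

Lemma measurable_kspec A a Rad x : measurable_fun setT (kspec A a Rad x).
Proof.
apply: measurable_funM => //; apply: measurable_funM => //.
by apply: (measurableT_comp (measurable_Phi nu)); exact: measurable_funM.
Qed.

(** Hoelder's inequality in [y]: by [weightPhi] the powers of [Rad] cancel, leaving the majorant
    [x^(a - 1 - delta)] times the norm of [G], which is in [L^p] of []0, 1[]. *)
Lemma spec_op A a p q : 1 < p -> 0 < q -> p^-1 + q^-1 = 1 -> A * q = 1 + delta * q ->
  -1 < (kap - A) * q -> -1 < (a - 1 - delta) * p -> bounded_op p (kspec A a).
Proof.
move=> p1 q0 pq Aq kA hap; have p0 : 0 < p by lra.
have dq : 0 < delta * q by exact: mulr_gt0.
pose M := (((kap - A) * q + 1)^-1 + (delta * q)^-1).
have M0 : 0 <= M by rewrite addr_ge0 ?invr_ge0 ?(ltW dq) //; lra.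
exists (M `^ (p / q) / ((a - 1 - delta) * p + 1)); split.
  by rewrite divr_ge0 ?powR_ge0 //; lra.
move=> G [mG G0 Gs Goo]; pose N := ('N[mu]_p%:E[EFin \o G])%E.
have N0 : (0 <= N)%E by exact: Lnorm_ge0.
have Np : (poweR N p = \int[mu]_y (G y `^ p)%:E)%E.
  rewrite (poweR_Lnorm _ _ (lt0r_neq0 p0)); apply: eq_integral => y _.
  by rewrite /= (ger0_norm (G0 y)).
exists (fun x => (M `^ q^-1 * x `^ (a - 1 - delta))%:E * N)%E; split.
- rewrite (_ : (fun x => _) = (fun x => N * (EFin \o (fun x => (M `^ q^-1 * x `^ (a - 1 - delta))%R)) x)%E).
    apply: measurable_funeM; apply: measurableT_comp => //.
    by apply: measurable_funM => //; exact: measurable_powR.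
  by apply/funext => x; rewrite /= muleC.
- by move=> x; apply: mule_ge0 => //; rewrite lee_fin mulr_ge0 ?powR_ge0.
- move=> Rad x R0 /andP[x0 x1].
  pose F y : R := if 0 < y < 1 then Phi kap (Rad * y) * y `^ (- A) else 0.
  have F0 y : 0 <= F y.
    rewrite /F; case: ifPn => // /andP[y0 _]; rewrite mulr_ge0 ?powR_ge0 // ltW // Phi_gt0 //.
    exact: mulr_gt0.
  have mF : measurable_fun setT F.
    apply: measurable_fun_ifT => //.
      by apply: measurable_and; apply: measurable_fun_ltr.
    apply: measurable_funM; last exact: measurable_powR.
    by apply: (measurableT_comp (measurable_Phi nu)); exact: measurable_funM.
  have mFG : measurable_fun setT (fun y => F y * G y) by exact: measurable_funM.
  pose c := x `^ (a - 1 - delta) * Rad `^ (- delta).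
  have c0 : 0 <= c by rewrite mulr_ge0 ?powR_ge0.
  have -> : (\int[mu]_y (kspec A a Rad x y * G y)%:E = c%:E * \int[mu]_y (F y * G y)%:E)%E.
    rewrite -ge0_integralZl_EFin //; last 2 first.
    + by move=> y _; rewrite lee_fin mulr_ge0.
    + by apply: measurableT_comp => //; exact: mFG.
    apply: eq_integral => y _; rewrite -EFinM /kspec /F /c; congr (_%:E).
    by case: ifPn => [_|/Gs ->]; ring.
  have hol := hoelder mu mF mG q0 p0 (etrans (addrC _ _) pq).
  rewrite Lnorm1 in hol.
  have e1 : (\int[mu]_x `|(EFin \o (F \* G)%R) x| = \int[mu]_y (F y * G y)%:E)%E.
    by apply: eq_integral => y _; rewrite /= ger0_norm // mulr_ge0.
  rewrite e1 in hol.
  have hF : ('N[mu]_q%:E[EFin \o F] <= (M `^ q^-1 * Rad `^ delta)%:E)%E.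
    have h := weightPhi q0 Aq kA R0; rewrite -/M in h.
    have e2 : ('N[mu]_q%:E[EFin \o F] = poweR (\int[mu]_y (F y `^ q)%:E) q^-1)%E.
      have -> : (\int[mu]_y (F y `^ q)%:E = poweR ('N[mu]_q%:E[EFin \o F]) q)%E.
        rewrite (poweR_Lnorm _ _ (lt0r_neq0 q0)); apply: eq_integral => y _.
        by rewrite /= (ger0_norm (F0 y)).
      by rewrite -poweRrM mulfV ?gt_eqF // poweRe1 // Lnorm_ge0.
    have e3 : (M `^ q^-1 * Rad `^ delta)%:E = poweR (M * Rad `^ (delta * q))%:E q^-1.
      by rewrite poweR_EFin powRM ?powR_ge0 // -powRrM mulfK ?gt_eqF.
    have I0 : (0 <= \int[mu]_y (F y `^ q)%:E)%E by apply: integral_ge0 => y _; rewrite lee_fin powR_ge0.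
    have B0 : (0 <= (M * Rad `^ (delta * q))%:E)%E by rewrite lee_fin mulr_ge0 ?powR_ge0.
    have qi : 0 <= q^-1 by rewrite invr_ge0 ltW.
    have := @gt0_ler_poweR R q^-1 qi (\int[mu]_y (F y `^ q)%:E)%E (M * Rad `^ (delta * q))%:E.
    rewrite !in_itv /= I0 B0 !leey /= => /(_ isT isT) mono; rewrite e2 e3; apply: mono.
    apply: le_trans h; rewrite [leRHS]integral_mkcond; apply: ge0_le_integralW => y _.
      by rewrite lee_fin powR_ge0.
    rewrite patchE /F; case: ifPn => h; first by rewrite mem_set //= in_itv.
    rewrite powR0 ?gt_eqF //; case: ifP => // _; by rewrite lee_fin powR_ge0.
  apply: (@le_trans _ _ (c%:E * ((M `^ q^-1 * Rad `^ delta)%:E * N))%E).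
    apply: lee_wpmul2l => //; apply: (le_trans hol); exact: lee_wpmul2r.
  rewrite muleA -EFinM le_eqVlt; apply/orP; left; apply/eqP; congr (_%:E * _)%E.
  have ee : Rad `^ (- delta) * Rad `^ delta = 1.
    by rewrite -powRD ?(gt_eqF R0) ?implybT // addrC subrr powRr0.
  rewrite /c (_ : _ * _ * (_ * _) = M `^ q^-1 * x `^ (a - 1 - delta) * (Rad `^ (- delta) * Rad `^ delta)); last by ring.
  by rewrite ee mulr1.
- have e x : poweR ((M `^ q^-1 * x `^ (a - 1 - delta))%:E * N)%E p =
     (((M `^ (p / q))%:E * poweR N p) * (x `^ ((a - 1 - delta) * p))%:E)%E.
    rewrite poweRM ?lee_fin ?mulr_ge0 ?powR_ge0 // poweR_EFin powRM ?powR_ge0 // -!powRrM.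
    by rewrite EFinM [(q^-1 * p)%R]mulrC muleAC.
  under eq_integral do rewrite e.
  rewrite ge0_integralZl //; last 3 first.
  + by apply: measurableT_comp => //; exact: measurable_funTS (measurable_powR _).
  + by move=> x _; rewrite lee_fin powR_ge0.
  + by apply: mule_ge0; [rewrite lee_fin powR_ge0|exact: poweR_ge0].
  by rewrite integral_powR0 // powR1 div1r Np EFinM muleAC.
Qed.

End WeightedKernel.

(** * The weighted kernel for finite [p] *)

Section WeightedBounds.
Context {R : realType}.
Notation mu := (@lebesgue_measure R).
Implicit Types (x y t Rad : R) (G : R -> R) (K : R -> R -> R -> R).
Variables (nu delta a A : R).
Hypothesis nu1 : -1 < nu.
Hypothesis delta0 : 0 < delta.
Hypothesis Aa : A <= a.

Let kap : R := nu + 1 / 2.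
Let theta : R := Num.min kap delta.
Notation kR := (kR nu delta).
Notation knear := (knear nu delta).
Notation kspec := (kspec nu delta A a).

Definition wkR Rad x y : R := x `^ a * kR Rad x y * y `^ (- A).

Lemma wkR_ge0 Rad x y : 0 < Rad -> 0 < x -> 0 < y -> 0 <= wkR Rad x y.
Proof. by move=> R0 x0 y0; rewrite mulr_ge0 ?powR_ge0 // mulr_ge0 ?powR_ge0 // kR_ge0. Qed.

Lemma measurable_wkR Rad x : measurable_fun setT (wkR Rad x).
Proof.
apply: measurable_funM; last exact: measurable_powR.
by apply: measurable_funM => //; exact: measurable_kR.
Qed.

Let xaA x : 0 < x < 1 -> x `^ a <= x `^ A.
Proof. by move=> /andP[x0 x1]; apply: ger_powR => //; rewrite x0 ltW. Qed.

Lemma wkR_low Rad x y : 0 < Rad -> 0 < x < 1 -> 0 < y < 1 -> 2 * y <= x ->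
  wkR Rad x y <= 2 `^ (1 + delta) * kcone (theta - A) (y, x).
Proof.
move=> R0 x01 y01 yx; have [x0 x1] := andP x01; have [y0 y1] := andP y01.
rewrite /kcone /= y0 yx x1 /= /wkR kR_sym.
have h := kR_off nu1 delta0 R0 y0 yx; rewrite -/kap -/theta in h.
apply: (@le_trans _ _ (x `^ A * (2 `^ (1 + delta) * (y `^ theta * x `^ (- 1 - theta))) * y `^ (- A))).
  apply: ler_wpM2r; first exact: powR_ge0.
  by apply: ler_pM; rewrite ?powR_ge0 ?kR_ge0 ?xaA.
have e1 : y `^ (theta - A) = y `^ theta * y `^ (- A) by rewrite -powRD ?(gt_eqF y0) ?implybT.
have e2 : x `^ (- 1 - (theta - A)) = x `^ A * x `^ (- 1 - theta).
  by rewrite -powRD ?(gt_eqF x0) ?implybT //; congr (_ `^ _); ring.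
by rewrite e1 e2 le_eqVlt; apply/orP; left; apply/eqP; ring.
Qed.

Lemma wkR_high Rad x y : 0 < Rad -> 0 < x < 1 -> 0 < y < 1 -> 2 * x <= y ->
  wkR Rad x y <= 2 `^ (1 + delta) * (x `^ (a + theta) * y `^ (- 1 - theta - A)).
Proof.
move=> R0 /andP[x0 x1] /andP[y0 y1] xy.
have h := kR_off nu1 delta0 R0 x0 xy; rewrite -/kap -/theta in h.
apply: (@le_trans _ _ (x `^ a * (2 `^ (1 + delta) * (x `^ theta * y `^ (- 1 - theta))) * y `^ (- A))).
  by apply: ler_wpM2r; [exact: powR_ge0|apply: ler_wpM2l => //; exact: powR_ge0].
rewrite (powRD (r := a)) ?(gt_eqF x0) ?implybT // (powRD (r := - 1 - theta)) ?(gt_eqF y0) ?implybT //.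
by rewrite le_eqVlt; apply/orP; left; apply/eqP; ring.
Qed.

Lemma wkR_high_cone Rad x y : 0 < Rad -> 0 < x < 1 -> 0 < y < 1 -> 2 * x <= y ->
  wkR Rad x y <= 2 `^ (1 + delta) * kcone (a + theta) (x, y).
Proof.
move=> R0 x01 y01 xy; apply: (le_trans (wkR_high R0 x01 y01 xy)).
have [x0 x1] := andP x01; have [y0 y1] := andP y01.
rewrite /kcone /= x0 xy y1 /=; apply: ler_wpM2l; first exact: powR_ge0.
apply: ler_wpM2l; first exact: powR_ge0.
by apply: ger_powR; [rewrite y0 ltW|have h := Aa; lra].
Qed.

Lemma wkR_near Rad x y : 0 < Rad -> 0 < x < 1 -> x < 2 * y -> y < 2 * x ->
  wkR Rad x y <= 2 `^ `|kap| * 2 `^ `|A| * knear Rad x y.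
Proof.
move=> R0 x01 xy yx; have [x0 x1] := andP x01; have y0 : 0 < y by lra.
have h := kR_near nu1 delta0 R0 x0 xy yx; rewrite -/kap in h.
have hy : y `^ (- A) <= 2 `^ `|A| * x `^ (- A).
  have [A0|A0] := leP 0 A.
    rewrite ger0_norm //; apply: (@le_trans _ _ ((x / 2) `^ (- A))).
      by apply: le0_powR_anti; rewrite ?oppr_le0 ?divr_gt0 //; lra.
    by rewrite powRM ?invr_ge0 ?(ltW x0) // -[2^-1]powR_inv1 // -powRrM mulN1r opprK mulrC.
  rewrite ltr0_norm //; rewrite -powRM ?(ltW x0) //; apply: ge0_ler_powR; rewrite ?nnegrE ?(ltW y0) //.
  - by rewrite oppr_ge0 ltW.
  - by lra.
  - exact: ltW.
have hx : x `^ a * x `^ (- A) <= 1.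
  by rewrite -powRD ?(gt_eqF x0) ?implybT //; apply: le1_powR_le1; rewrite ?(ltW x1) // subr_ge0.
have n0 : 0 <= knear Rad x y by exact: knear_ge0.
have k0 : 0 <= kR Rad x y by exact: kR_ge0.
apply: (@le_trans _ _ (x `^ a * (2 `^ `|kap| * knear Rad x y) * (2 `^ `|A| * x `^ (- A)))).
  apply: ler_pM => //; [by rewrite mulr_ge0 ?powR_ge0|exact: powR_ge0|].
  by apply: ler_wpM2l => //; exact: powR_ge0.
rewrite (_ : _ * _ * _ = 2 `^ `|kap| * 2 `^ `|A| * knear Rad x y * (x `^ a * x `^ (- A))); last by ring.
by rewrite ler_piMr // mulr_ge0 // mulr_ge0 ?powR_ge0.
Qed.

(** Unlike in [kR_off], the factor [Phi (Rad y)] and the decay in [Rad x] are kept as they are, and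
    only [Phi (Rad x) <= 1] is given up. *)
Lemma wkR_spec Rad x y : 0 <= kap -> 0 < Rad -> 0 < x -> 0 < y -> 2 * y <= x ->
  wkR Rad x y <= 2 `^ (1 + delta) * kspec Rad x y.
Proof.
move=> k0 R0 x0 y0 yx; have Rx : 0 < Rad * x by exact: mulr_gt0.
have Ry : 0 < Rad * y by exact: mulr_gt0.
have h := dk_off delta0 R0 y0 yx; have hP := Phi_le1 k0 Rx.
have Px0 := ltW (Phi_gt0 kap Rx); have Py0 := ltW (Phi_gt0 kap Ry).
rewrite /wkR kR_sym /kR -/kap /kspec -/kap.
have hk : Rad * (Phi kap (Rad * y) * Phi kap (Rad * x)) * dk delta (Rad * `|y - x|) <=
    Rad * (Phi kap (Rad * y) * 1) * (2 `^ (1 + delta) * (Rad * x) `^ (- 1 - delta)).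
  apply: ler_pM => //; rewrite ?dk_ge0 ?mulr_ge0 ?(ltW R0) //.
  by apply: ler_wpM2l; [exact: ltW|exact: ler_wpM2l].
apply: (le_trans (ler_wpM2r (powR_ge0 _ _) (ler_wpM2l (powR_ge0 _ _) hk))).
have e1 : x `^ (a - 1 - delta) = x `^ a * x `^ (- 1 - delta).
  by rewrite -powRD ?(gt_eqF x0) ?implybT //; congr (_ `^ _); ring.
have e2 : Rad `^ (- delta) = Rad * Rad `^ (- 1 - delta).
  by rewrite (powRS _ R0); congr (_ * _ `^ _); ring.
rewrite e1 e2 powRM ?(ltW R0) ?(ltW x0) //.
by rewrite le_eqVlt; apply/orP; left; apply/eqP; ring.
Qed.

Lemma wkR_split C1 C3 (K1 K3 : R -> R -> R -> R) : 0 <= C1 -> 0 <= C3 ->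
  (forall Rad x y, 0 < Rad -> 0 < x < 1 -> 0 <= K1 Rad x y) ->
  (forall Rad x y, 0 < Rad -> 0 < x < 1 -> 0 <= K3 Rad x y) ->
  (forall Rad x y, 0 < Rad -> 0 < x < 1 -> 0 < y < 1 -> 2 * y <= x -> wkR Rad x y <= C1 * K1 Rad x y) ->
  (forall Rad x y, 0 < Rad -> 0 < x < 1 -> 0 < y < 1 -> 2 * x <= y -> wkR Rad x y <= C3 * K3 Rad x y) ->
  forall Rad x y, 0 < Rad -> 0 < x < 1 -> 0 < y < 1 ->
  wkR Rad x y <= (C1 + C3 + 2 `^ `|kap| * 2 `^ `|A|) * (K1 Rad x y + K3 Rad x y + knear Rad x y).
Proof.
move=> C10 C30 K10 K30 h1 h3 Rad x y R0 x01 y01; have [x0 x1] := andP x01.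
have k1 := K10 Rad x y R0 x01; have k3 := K30 Rad x y R0 x01.
have k2 : 0 <= knear Rad x y by exact: knear_ge0.
set C2 := 2 `^ `|kap| * 2 `^ `|A|; have C20 : 0 <= C2 by rewrite mulr_ge0 ?powR_ge0.
have [yx|xy] := leP (2 * y) x.
  by apply: (le_trans (h1 _ _ _ R0 x01 y01 yx)); apply: ler_pM => //; lra.
have [xy'|yx'] := leP (2 * x) y.
  by apply: (le_trans (h3 _ _ _ R0 x01 y01 xy')); apply: ler_pM => //; lra.
apply: (le_trans (wkR_near R0 x01 xy yx')); apply: ler_pM => //; rewrite -/C2; lra.
Qed.

Let kcone_tr_measurable b x : measurable_fun setT (fun y => kcone b (y, x)).
Proof. exact: (measurableT_comp (measurable_kcone b) (measurable_pair2 x)). Qed.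

Let kcone_measurable b x : measurable_fun setT (fun y => kcone b (x, y)).
Proof. exact: (measurableT_comp (measurable_kcone b) (measurable_pair1 x)). Qed.

Let kspec_ge0 Rad x y : 0 <= kspec Rad x y.
Proof.
by rewrite !mulr_ge0 ?powR_ge0 // /Phi; case: ifP => // _; exact: powR_ge0.
Qed.

Let C20 : 0 <= 2 `^ (1 + delta) :> R. Proof. exact: powR_ge0. Qed.

Let Ctot0 : 0 <= 2 `^ (1 + delta) + 2 `^ (1 + delta) + 2 `^ `|kap| * 2 `^ `|A|.
Proof. by rewrite !addr_ge0 ?mulr_ge0 ?powR_ge0. Qed.

(** For [2 x <= y] the two lower bounds on [a] amount to [a + theta > - 1/p]. For [2 y <= x] the two
    upper bounds on [A], when strict, amount to [theta - A > - 1/q]. Both are the ranges of the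
    Hardy kernels. *)
Lemma wkR_op p q : 1 < p -> 0 < q -> p^-1 + q^-1 = 1 ->
  - p^-1 - kap < a -> A < 1 - p^-1 + kap -> - delta - p^-1 < a -> A <= 1 + delta - p^-1 ->
  (A < 1 + delta - p^-1 \/ A < a) -> bounded_op p wkR.
Proof.
move=> p1 q0 pq c1 c2 c3 c4 c45; have p0 : 0 < p by lra.
have qE : q^-1 = 1 - p^-1 by lra.
have tb : - p^-1 < a + theta.
  by rewrite /theta; have [h|h] := leP kap delta; lra.
have op3 := cone_op p1 q0 pq tb.
have opn := near_op nu delta0 p1.
have K3ge : forall Rad x y, 0 < Rad -> 0 < x < 1 -> 0 <= kcone (a + theta) (x, y).
  by move=> *; exact: kcone_ge0.
have h3 : forall Rad x y, 0 < Rad -> 0 < x < 1 -> 0 < y < 1 -> 2 * x <= y ->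
    wkR Rad x y <= 2 `^ (1 + delta) * kcone (a + theta) (x, y).
  by move=> Rad x y; exact: wkR_high_cone.
have fin K1 : (forall Rad x, measurable_fun setT (K1 Rad x)) ->
  (forall Rad x y, 0 < Rad -> 0 < x < 1 -> 0 <= K1 Rad x y) ->
  (forall Rad x y, 0 < Rad -> 0 < x < 1 -> 0 < y < 1 -> 2 * y <= x ->
     wkR Rad x y <= 2 `^ (1 + delta) * K1 Rad x y) -> bounded_op p K1 -> bounded_op p wkR.
  move=> mK1 K10 h1 op1.
  have sp := wkR_split C20 C20 K10 K3ge h1 h3.
  have ge2 Rad x y : 0 < Rad -> 0 < x < 1 -> 0 <= knear Rad x y.
    by move=> R0 /andP[x0 _]; exact: knear_ge0.
  have ge13 Rad x y : 0 < Rad -> 0 < x < 1 -> 0 <= K1 Rad x y + kcone (a + theta) (x, y).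
    by move=> R0 x01; rewrite addr_ge0 ?K10 ?kcone_ge0.
  have m13 Rad x : measurable_fun setT (fun y => K1 Rad x y + kcone (a + theta) (x, y)).
    by apply: measurable_funD.
  have mn Rad x : measurable_fun setT (knear Rad x) by exact: measurable_knear.
  apply: (bounded_opW Ctot0 _ _ sp) => //.
  - by move=> Rad x y R0 /andP[x0 _] /andP[y0 _]; exact: wkR_ge0.
  - by move=> Rad x; apply: measurable_funD.
  - by move=> Rad x y R0 x01; rewrite addr_ge0 ?ge13 ?ge2.
  apply: (bounded_opD p1 m13 mn ge13 ge2) => //.
  exact: (bounded_opD p1 mK1 _ K10 K3ge op1 op3).
have [lt|ge] := ltP A (1 + delta - p^-1).
  have tc : - q^-1 < theta - A.
    by rewrite /theta; have [h|h] := leP kap delta; lra.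
  apply: (fin (fun _ x y => kcone (theta - A) (y, x))).
  - by move=> Rad x; exact: kcone_tr_measurable.
  - by move=> Rad x y _ _; exact: kcone_ge0.
  - by move=> Rad x y; exact: wkR_low.
  - exact: (cone_op_tr p1 q0 pq tc).
(* The critical case: [c2] now reads [delta < kap], and [c45] leaves [A < a]; these are the two
   conditions of [spec_op]. *)
have eA : A = 1 + delta - p^-1 by apply/eqP; rewrite eq_le c4.
have ltAa : A < a by case: c45 => //; rewrite ltNge ge.
have kd : delta < kap by lra.
have qi0 : 0 < q^-1 by rewrite invr_gt0.
have Aq : A * q = 1 + delta * q.
  by rewrite eA (_ : 1 + delta - p^-1 = q^-1 + delta) ?mulrDl ?mulVf ?gt_eqF //; lra.
have kA : -1 < (kap - A) * q.
  have := mulr_gt0 (_ : 0 < kap - delta) q0; rewrite subr_gt0 => /(_ kd).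
  by rewrite !mulrBl Aq; lra.
have ap : -1 < (a - 1 - delta) * p.
  by rewrite -ltr_pdivrMr // mulN1r; lra.
apply: (fin kspec).
- by move=> Rad x; exact: measurable_kspec.
- by move=> Rad x y _ _; exact: kspec_ge0.
- move=> Rad x y R0 /andP[x0 _] /andP[y0 _] yx; apply: wkR_spec => //.
  by have d0 := delta0; lra.
by apply: (spec_op delta0 p1 q0 pq Aq _ ap).
Qed.

End WeightedBounds.

(** * The case of the sup norm *)

Section UniformKernels.
Context {R : realType}.
Notation mu := (@lebesgue_measure R).
Implicit Types (x y t Rad : R) (G : R -> R) (K : R -> R -> R -> R).

Definition bounded_sup K := exists C : R, 0 <= C /\ forall Rad x, 0 < Rad -> 0 < x < 1 ->
  (\int[mu]_(y in `]0%R, 1%R[) (K Rad x y)%:E <= C%:E)%E.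

Lemma bounded_supW c K K' : 0 <= c ->
  (forall Rad x y, 0 < Rad -> 0 < x < 1 -> 0 < y < 1 -> 0 <= K Rad x y) ->
  (forall Rad x, measurable_fun setT (K' Rad x)) ->
  (forall Rad x y, 0 < Rad -> 0 < x < 1 -> 0 < y < 1 -> K Rad x y <= c * K' Rad x y) ->
  (forall Rad x y, 0 < Rad -> 0 < x < 1 -> 0 <= K' Rad x y) ->
  bounded_sup K' -> bounded_sup K.
Proof.
move=> c0 K0 mK' KK' K'0 [C [C0 hC]]; exists (c * C); split; first exact: mulr_ge0.
move=> Rad x R0 x01; apply: (@le_trans _ _ (c%:E * \int[mu]_(y in `]0%R, 1%R[) (K' Rad x y)%:E)%E); last first.
  by rewrite EFinM; apply: lee_wpmul2l => //; exact: hC.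
rewrite -ge0_integralZl_EFin //; last 2 first.
- by move=> y _; rewrite lee_fin K'0.
- by apply: measurableT_comp => //; exact: measurable_funTS (mK' Rad x).
apply: ge0_le_integralW => y; rewrite /= in_itv /= => y01; first by rewrite lee_fin K0.
by rewrite -EFinM lee_fin KK'.
Qed.

Lemma bounded_supD K1 K2 :
  (forall Rad x, measurable_fun setT (K1 Rad x)) -> (forall Rad x, measurable_fun setT (K2 Rad x)) ->
  (forall Rad x y, 0 < Rad -> 0 < x < 1 -> 0 <= K1 Rad x y) ->
  (forall Rad x y, 0 < Rad -> 0 < x < 1 -> 0 <= K2 Rad x y) ->
  bounded_sup K1 -> bounded_sup K2 -> bounded_sup (fun Rad x y => K1 Rad x y + K2 Rad x y).
Proof.
move=> mK1 mK2 K10 K20 [C1 [C10 h1]] [C2 [C20 h2]]; exists (C1 + C2); split; first exact: addr_ge0.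
move=> Rad x R0 x01; under eq_integral do rewrite EFinD.
rewrite ge0_integralD //.
- by rewrite EFinD; apply: leeD; [exact: h1|exact: h2].
- by move=> y _; rewrite lee_fin K10.
- by apply: measurableT_comp => //; exact: measurable_funTS (mK1 Rad x).
- by move=> y _; rewrite lee_fin K20.
- by apply: measurableT_comp => //; exact: measurable_funTS (mK2 Rad x).
Qed.

Lemma cone_sup b : 0 < b -> bounded_sup (fun _ x y => kcone b (x, y)).
Proof.
move=> b0; exists b^-1; split; first by rewrite invr_ge0 ltW.
move=> Rad x R0 /andP[x0 _]; have b1 : 0 < b + 0 by rewrite addr0.
have := cone_out b1 x0; rewrite oppr0 powRr0 mulr1 addr0; apply: le_trans.
rewrite [leLHS]integral_mkcond; apply: ge0_le_integralW => y _; rewrite patchE.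
  by case: ifP => // _; rewrite lee_fin kcone_ge0.
by rewrite powRr0 mulr1; case: ifP => // _; rewrite lee_fin kcone_ge0.
Qed.

Lemma cone_sup_tr b : - 1 < b -> bounded_sup (fun _ x y => kcone b (y, x)).
Proof.
move=> b0; have b1 : 0 < b + 1 by lra.
exists (b + 1)^-1; split; first by rewrite invr_ge0 ltW.
move=> Rad x R0 /andP[x0 _].
have := cone_in b1 x0; rewrite oppr0 powRr0 mulr1 addr0; apply: le_trans.
rewrite [leLHS]integral_mkcond; apply: ge0_le_integralW => y _; rewrite patchE.
  by case: ifP => // _; rewrite lee_fin kcone_ge0.
by rewrite powRr0 mulr1; case: ifP => // _; rewrite lee_fin kcone_ge0.
Qed.

End UniformKernels.

Section UniformWeighted.
Context {R : realType}.
Notation mu := (@lebesgue_measure R).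
Implicit Types (x y t Rad : R) (G : R -> R) (K : R -> R -> R -> R).
Variables (nu delta a A : R).
Hypothesis nu1 : -1 < nu.
Hypothesis delta0 : 0 < delta.
Hypothesis Aa : A <= a.

Let kap : R := nu + 1 / 2.
Let theta : R := Num.min kap delta.
Notation kR := (kR nu delta).
Notation knear := (knear nu delta).
Notation kspec := (kspec nu delta A a).
Notation wkR := (wkR nu delta a A).

(** [dk_average] for the indicator function of []0, 1[], whose maximal function is at most 1. *)
Lemma near_sup : bounded_sup knear.
Proof.
pose G y : R := if 0 < y < 1 then 1 else 0.
have G0 y : 0 <= G y by rewrite /G; case: ifP.
have mG : measurable_fun setT G.
  by apply: measurable_fun_ifT => //; apply: measurable_and; apply: measurable_fun_ltr.
have Gs y : ~~ (0 < y < 1) -> G y = 0 by rewrite /G => /negbTE ->.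
have Goo : (\int[mu]_y (G y)%:E < +oo)%E.
  apply: (@le_lt_trans _ _ (\int[mu]_(y in `[0%R, 1%R]) (cst 1%:E y))%E).
    rewrite [leRHS]integral_mkcond; apply: ge0_le_integralW => y _; first by rewrite lee_fin.
    rewrite patchE /G; case: ifPn => h; last by case: ifP.
    by rewrite mem_set //= in_itv /=; have [? ?] := andP h; rewrite !ltW.
  by rewrite integral_cst //= lebesgue_measure_itv /= lte_fin ltr01 mul1e -EFinB ltry.
have HL1 x : (HL_maximal G x <= 1)%E.
  apply: ge_ereal_sup => _ [r hr <-]; move: hr; rewrite /= in_itv /= andbT => r0.
  have b0 : 0 < r *+ 2 by rewrite pmulrn_lgt0.
  have mb : measurable (ball x r : set R) by exact: measurable_ball.
  have mbE : mu (ball x r) = (r *+ 2)%:E := @lebesgue_measure_ball R x r (ltW r0).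
  rewrite /iavg lebesgue_measure_ball ?(ltW r0) // inver gt_eqF //.
  apply: (@le_trans _ _ (((r *+ 2)^-1)%:E * (r *+ 2)%:E)%E); last by rewrite -EFinM mulVf ?gt_eqF.
  apply: lee_wpmul2l; first by rewrite lee_fin invr_ge0 ltW.
  have <- : (\int[mu]_(y in ball x r) (cst 1%:E y))%E = (r *+ 2)%:E.
    by rewrite integral_cst // mul1e; exact: mbE.
  apply: ge0_le_integralW => y _; first exact: abse_ge0.
  by rewrite /= lee_fin ger0_norm // /G; case: ifP.
pose Cd : R := 4 * (1 - 2 `^ (- delta))^-1.
have g0 : 0 <= (1 - 2 `^ (- delta))^-1.
  by apply: le_trans (geometric_le delta0 0); rewrite big_ord0.
have Cd0 : 0 <= Cd by rewrite mulr_ge0.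
exists Cd; split => // Rad x R0 x01; have [x0 x1] := andP x01.
apply: (@le_trans _ _ (Cd%:E * HL_maximal G x)%E); last first.
  by rewrite -[leRHS]mule1; apply: lee_wpmul2l.
apply: le_trans (dk_average delta0 mG G0 Goo (Rnear_gt0 nu R0 x0) x01 Gs).
rewrite [leLHS]integral_mkcond; apply: ge0_le_integralW => y _; rewrite patchE.
  by case: ifP => // _; rewrite lee_fin knear_ge0.
case: ifPn => [|_]; last by rewrite lee_fin !mulr_ge0 ?dk_ge0 // ltW // Rnear_gt0.
by rewrite inE /= in_itv /= /G => ->; rewrite mulr1.
Qed.

Lemma spec_sup : A = 1 + delta -> delta < kap -> bounded_sup kspec.
Proof.
move=> eA kd; pose M := (kap - A + 1)^-1 + delta^-1.
have M0 : 0 <= M by rewrite addr_ge0 ?invr_ge0 ?(ltW delta0) //; lra.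
exists M; split => // Rad x R0 /andP[x0 x1].
have Aq : A * 1 = 1 + delta * 1 by rewrite !mulr1.
have kA : -1 < (kap - A) * 1 by rewrite mulr1; lra.
have h := weightPhi delta0 ltr01 Aq kA R0; rewrite !mulr1 in h.
pose c := x `^ (a - 1 - delta) * Rad `^ (- delta).
have c0 : 0 <= c by rewrite mulr_ge0 ?powR_ge0.
have mF : measurable_fun setT (fun y => Phi kap (Rad * y) * y `^ (- A)).
  apply: measurable_funM; last exact: measurable_powR.
  by apply: (measurableT_comp (measurable_Phi nu)); exact: measurable_funM.
have F0 y : 0 <= Phi kap (Rad * y) * y `^ (- A).
  by rewrite mulr_ge0 ?powR_ge0 // /Phi; case: ifP => // _; exact: powR_ge0.
have -> : (\int[mu]_(y in `]0%R, 1%R[) (kspec Rad x y)%:E =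
    c%:E * \int[mu]_(y in `]0%R, 1%R[) ((Phi kap (Rad * y) * y `^ (- A)) `^ 1)%:E)%E.
  rewrite -ge0_integralZl_EFin //; last 2 first.
  - by move=> y _; rewrite lee_fin powR_ge0.
  - by apply: measurableT_comp => //; apply: measurable_powR_comp; exact: measurable_funTS mF.
  by apply: eq_integral => y _; rewrite powRr1 // -EFinM.
apply: (le_trans (lee_wpmul2l _ h)); first by rewrite lee_fin.
rewrite -EFinM lee_fin /c -/M.
have ee : Rad `^ (- delta) * Rad `^ delta = 1.
  by rewrite -powRD ?(gt_eqF R0) ?implybT // addrC subrr powRr0.
rewrite (_ : _ * (_ * _) = M * x `^ (a - 1 - delta) * (Rad `^ (- delta) * Rad `^ delta)); last by ring.
rewrite ee mulr1 ler_piMr //; apply: le1_powR_le1; rewrite ?(ltW x1) //.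
by have h' := Aa; lra.
Qed.

(* For [p = oo], [a = A = - kap] and [kap < delta], the Hardy kernel [kcone 0] is not integrable;
   here [Rad^-1] separates growth and decay in [y]. *)
Definition kcrit Rad x y : R := if 2 * x <= y then wkR Rad x y else 0.

Lemma crit_sup : a = - kap -> A = - kap -> kap < delta -> bounded_sup kcrit.
Proof.
(* For [y >= 1 / Rad] the growth [x^(-kap) Phi (Rad x) y^kap] is at most [(Rad y)^m], and
   [m < delta] leaves the decay exponent [delta - m]. *)
move=> ea eA kd; pose m := Num.max kap 0.
have m0 : 0 <= m by rewrite /m le_max lexx orbT.
have mk : kap <= m by rewrite /m le_max lexx.
have md : m < delta by rewrite /m gt_max kd.
have d0 := delta0; have k1 := kap_gt nu1; rewrite -/kap in k1.
have e2 : 0 < delta - m by rewrite subr_gt0.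
have k2 : 0 < 2 * kap + 1 by lra.
exists ((2 * kap + 1)^-1 + 2 `^ (1 + delta) * (delta - m)^-1); split.
  by rewrite addr_ge0 ?mulr_ge0 ?powR_ge0 // invr_ge0 ltW.
move=> Rad x R0 /andP[x0 x1]; have t0 : 0 < Rad^-1 by rewrite invr_gt0.
pose c1 : R := Rad `^ (2 * kap + 1).
pose c2 : R := 2 `^ (1 + delta) * Rad `^ (m - delta).
have c20 : 0 <= c2 by rewrite mulr_ge0 ?powR_ge0.
have := @two_powers R (kcrit Rad x) c1 (2 * kap) c2 (delta - m) Rad^-1 k1 e2 t0 (powR_ge0 _ _) c20.
move=> h; apply: (le_trans (h _ _ _)) => {h}.
- by move=> y /andP[y0 _]; rewrite /kcrit; case: ifP => // _; exact: wkR_ge0.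
- move=> y /andP[y0 y1] yt; rewrite /kcrit; case: ifPn => xy; last by rewrite mulr_ge0 ?powR_ge0.
  have Ry1 : Rad * y <= 1 by rewrite -(mulfV (lt0r_neq0 R0)) ler_wpM2l // ltW.
  have Rx1 : Rad * x <= 1 by apply: le_trans Ry1; apply: ler_wpM2l; [exact: ltW|lra].
  rewrite /wkR /kR -/kap /Phi Ry1 Rx1 ea eA opprK.
  rewrite (powRM _ (ltW R0) (ltW x0)) (powRM _ (ltW R0) (ltW y0)).
  have ex : x `^ (- kap) * x `^ kap = 1 by rewrite -powRD ?(gt_eqF x0) ?implybT // addrC subrr powRr0.
  have eR : c1 = Rad * (Rad `^ kap * Rad `^ kap).
    rewrite -powRD ?(gt_eqF R0) ?implybT // -{1}(powRr1 (ltW R0)) -powRD ?(gt_eqF R0) ?implybT //.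
    by rewrite /c1; congr (_ `^ _); ring.
  have ey : y `^ (2 * kap) = y `^ kap * y `^ kap.
    by rewrite -powRD ?(gt_eqF y0) ?implybT //; congr (_ `^ _); ring.
  rewrite (_ : _ * _ * _ = (Rad * (Rad `^ kap * Rad `^ kap)) * (y `^ kap * y `^ kap) *
     (x `^ (- kap) * x `^ kap) * dk delta (Rad * `|x - y|)); last by ring.
  by rewrite ex mulr1 eR ey ler_piMr ?dk_le1 // !mulr_ge0 ?powR_ge0 // ltW.
- move=> y /andP[y0 y1] yt; rewrite /kcrit; case: ifPn => xy; last by rewrite mulr_ge0 ?powR_ge0.
  have Ry0 : 0 < Rad * y by exact: mulr_gt0.
  have Rx0 : 0 < Rad * x by exact: mulr_gt0.
  have Ry : 1 <= Rad * y by rewrite -(mulfV (lt0r_neq0 R0)) ler_wpM2l // ltW.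
  have PY : Phi kap (Rad * y) = 1.
    by rewrite /Phi; case: ifPn => // h; rewrite (_ : Rad * y = 1) ?powR1 //; apply/eqP; rewrite eq_le h.
  have hD := dk_off d0 R0 x0 xy.
  have hP : x `^ (- kap) * Phi kap (Rad * x) * y `^ kap <= (Rad * y) `^ m.
    rewrite /Phi; case: ifPn => Rx.
      rewrite (powRM _ (ltW R0) (ltW x0)).
      have ex : x `^ (- kap) * x `^ kap = 1 by rewrite -powRD ?(gt_eqF x0) ?implybT // addrC subrr powRr0.
      rewrite (_ : _ * _ * _ = (x `^ (- kap) * x `^ kap) * (Rad `^ kap * y `^ kap)); last by ring.
      by rewrite ex mul1r -powRM ?(ltW R0) ?(ltW y0) //; exact: ler_powR.
    rewrite -ltNge in Rx; rewrite mulr1.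
    have [k0|k0] := leP 0 kap.
      have -> : m = kap by rewrite /m max_l.
      have -> : x `^ (- kap) = x^-1 `^ kap by rewrite -powR_inv1 ?(ltW x0) // -powRrM mulN1r.
      rewrite (powRM _ (ltW R0) (ltW y0)); apply: ler_wpM2r; first exact: powR_ge0.
      apply: ge0_ler_powR; rewrite ?nnegrE ?invr_ge0 ?(ltW x0) ?(ltW R0) //.
      by rewrite -[leLHS]mul1r ler_pdivrMr // ltW.
    apply: (@le_trans _ _ 1); last exact: ge1_powR_ge1.
    apply: (@le_trans _ _ (y `^ (- kap) * y `^ kap)).
      apply: ler_wpM2r; first exact: powR_ge0.
      by apply: ge0_ler_powR; rewrite ?nnegrE ?oppr_ge0 ?(ltW x0) ?(ltW y0) ?(ltW k0) //; lra.
    by rewrite -powRD ?(gt_eqF y0) ?implybT // addrC subrr powRr0.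
  rewrite /wkR /kR -/kap PY ea eA opprK mulr1.
  have D0 : 0 <= dk delta (Rad * `|x - y|) by exact: dk_ge0.
  rewrite (_ : _ * _ * _ = (Rad * dk delta (Rad * `|x - y|)) * (x `^ (- kap) * Phi kap (Rad * x) * y `^ kap)); last by ring.
  apply: (@le_trans _ _ ((Rad * (2 `^ (1 + delta) * (Rad * y) `^ (- 1 - delta))) * (Rad * y) `^ m)).
    apply: ler_pM => //.
    - by rewrite mulr_ge0 // ltW.
    - rewrite !mulr_ge0 ?powR_ge0 // ltW // Phi_gt0 //.
    - by apply: ler_wpM2l => //; exact: ltW.
  have e5 : (Rad * y) `^ (- 1 - delta) * (Rad * y) `^ m = Rad `^ (m - delta - 1) * y `^ (- 1 - (delta - m)).
    rewrite -powRD ?(gt_eqF Ry0) ?implybT // powRM ?(ltW R0) ?(ltW y0) //.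
    by congr (_ `^ _ * _ `^ _); ring.
  rewrite (_ : _ * _ * _ = Rad * 2 `^ (1 + delta) * ((Rad * y) `^ (- 1 - delta) * (Rad * y) `^ m)); last by ring.
  rewrite e5 /c2 (powRS (m - delta) R0).
  by rewrite le_eqVlt; apply/orP; left; apply/eqP; ring.
have e c : (Rad^-1) `^ c = Rad `^ (- c) by rewrite -powR_inv1 ?(ltW R0) // -powRrM mulN1r.
rewrite lee_fin !e opprK /c1 /c2.
have e3 : Rad `^ (2 * kap + 1) * Rad `^ (- (2 * kap + 1)) = 1.
  by rewrite -powRD ?(gt_eqF R0) ?implybT // subrr powRr0.
have e4 : Rad `^ (m - delta) * Rad `^ (delta - m) = 1.
  by rewrite -powRD ?(gt_eqF R0) ?implybT // (_ : m - delta + (delta - m) = 0) ?powRr0 //; ring.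
rewrite !mulrA e3 mul1r -(mulrA (2 `^ _)) e4 mulr1 //.
Qed.

End UniformWeighted.

Section UniformBound.
Context {R : realType}.
Notation mu := (@lebesgue_measure R).
Implicit Types (x y t Rad : R) (K : R -> R -> R -> R).
Variables (nu delta a A : R).
Hypothesis nu1 : -1 < nu.
Hypothesis delta0 : 0 < delta.
Hypothesis Aa : A <= a.

Let kap : R := nu + 1 / 2.
Let theta : R := Num.min kap delta.
Notation knear := (knear nu delta).
Notation kspec := (kspec nu delta A a).
Notation wkR := (wkR nu delta a A).

Definition good_kernel K := [/\ forall Rad x, measurable_fun setT (K Rad x),
  forall Rad x y, 0 < Rad -> 0 < x < 1 -> 0 <= K Rad x y & bounded_sup K].

Let low_kernel : A < 1 + kap -> A <= 1 + delta -> exists2 K, good_kernel K &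
  forall Rad x y, 0 < Rad -> 0 < x < 1 -> 0 < y < 1 -> 2 * y <= x ->
    wkR Rad x y <= 2 `^ (1 + delta) * K Rad x y.
Proof.
move=> c2 c4; have [lt|ge] := ltP A (1 + delta).
  have tc : - 1 < theta - A.
    by rewrite /theta; have [h|h] := leP kap delta; lra.
  exists (fun _ x y => kcone (theta - A) (y, x)).
    split; last exact: cone_sup_tr.
    - by move=> Rad x; exact: (measurableT_comp (measurable_kcone _) (measurable_pair2 x)).
    - by move=> Rad x y _ _; exact: kcone_ge0.
  by move=> Rad x y; exact: wkR_low.
have eA : A = 1 + delta by apply/eqP; rewrite eq_le c4.
have kd : delta < kap by lra.
exists kspec.
  split; last exact: spec_sup.
  - by move=> Rad x; exact: measurable_kspec.
  - move=> Rad x y _ _; rewrite !mulr_ge0 ?powR_ge0 // /Phi; case: ifP => // _; exact: powR_ge0.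
move=> Rad x y R0 /andP[x0 _] /andP[y0 _]; apply: wkR_spec => //.
by have h := delta0; rewrite -/kap; lra.
Qed.

(** If [a + theta > 0] the Hardy kernel is integrable. If [a + theta = 0] and [A < a], the spare
    power of [y] gives the integrable [y^(- 1 + a - A)]. If moreover [A = a], then [c35] forces
    [theta = kap < delta], and [kcrit] applies. *)
Let high_kernel : - kap <= a -> - delta <= a -> (- delta < a \/ A < a) -> exists2 K, good_kernel K &
  forall Rad x y, 0 < Rad -> 0 < x < 1 -> 0 < y < 1 -> 2 * x <= y ->
    wkR Rad x y <= 2 `^ (1 + delta) * K Rad x y.
Proof.
move=> c1 c3 c35; have C1 : 1 <= 2 `^ (1 + delta).
  by apply: ge1_powR_ge1; [lra|have h := delta0; lra].
have : 0 <= a + theta by rewrite /theta; have [h|h] := leP kap delta; lra.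
rewrite le_eqVlt => /predU1P[b0|b0]; last first.
  exists (fun _ x y => kcone (a + theta) (x, y)).
    split; last exact: cone_sup.
    - by move=> Rad x; exact: (measurableT_comp (measurable_kcone _) (measurable_pair1 x)).
    - by move=> Rad x y _ _; exact: kcone_ge0.
  by move=> Rad x y; exact: wkR_high_cone.
have [ltAa|leaA] := ltP A a.
  have c0 : -1 < -1 + (a - A) by lra.
  have cE : -1 + (a - A) + 1 = a - A by ring.
  exists (fun _ _ y => y `^ (- 1 + (a - A))).
    split.
    - by move=> Rad x; exact: measurable_powR.
    - by move=> Rad x y _ _; exact: powR_ge0.
    - exists (a - A)^-1; split; first by rewrite invr_ge0 subr_ge0 ltW.
      by move=> Rad x R0 x01; rewrite integral_powR0 // cE powR1 div1r.
  move=> Rad x y R0 x01 y01 xy; apply: (le_trans (wkR_high a A nu1 delta0 R0 x01 y01 xy)).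
  rewrite -/kap -/theta -b0 powRr0 mul1r (_ : - 1 - theta - A = - 1 + (a - A)) //; lra.
have eA : A = a by apply/eqP; rewrite eq_le Aa.
have d : theta < delta by case: c35; lra.
have tk : theta = kap by move: d; rewrite /theta; have [h|h] := leP kap delta; rewrite ?ltxx.
have ea : a = - kap by lra.
exists (kcrit nu delta a A).
  split; last by apply: crit_sup; rewrite // -/kap -?ea // -tk.
  - move=> Rad x; apply: measurable_fun_ifT => //; last exact: measurable_wkR.
    exact: measurable_fun_ler.
  - move=> Rad x y R0 /andP[x0 _]; rewrite /kcrit; case: ifPn => // xy; apply: wkR_ge0 => //; lra.
move=> Rad x y R0 x01 y01 xy; have [x0 _] := andP x01; have [y0 _] := andP y01.
by rewrite /kcrit xy ler_peMl // wkR_ge0.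
Qed.

Lemma wkR_sup : - kap <= a -> A < 1 + kap -> - delta <= a -> A <= 1 + delta ->
  (- delta < a \/ A < a) -> bounded_sup wkR.
Proof.
move=> c1 c2 c3 c4 c35.
have [K1 [m1 p1 b1] h1] := low_kernel c2 c4.
have [K3 [m3 p3 b3] h3] := high_kernel c1 c3 c35.
have C0 : 0 <= 2 `^ (1 + delta) :> R by exact: powR_ge0.
have sp := wkR_split nu1 delta0 Aa C0 C0 p1 p3 h1 h3.
have Ctot0 : 0 <= 2 `^ (1 + delta) + 2 `^ (1 + delta) + 2 `^ `|nu + 1 / 2| * 2 `^ `|A| :> R.
  by rewrite !addr_ge0 ?mulr_ge0 ?powR_ge0.
have pn Rad x y : 0 < Rad -> 0 < x < 1 -> 0 <= knear Rad x y.
  by move=> R0 /andP[x0 _]; exact: knear_ge0.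
have mn Rad x : measurable_fun setT (knear Rad x) by exact: measurable_knear.
have p13 Rad x y : 0 < Rad -> 0 < x < 1 -> 0 <= K1 Rad x y + K3 Rad x y.
  by move=> R0 x01; rewrite addr_ge0 ?p1 ?p3.
have m13 Rad x : measurable_fun setT (fun y => K1 Rad x y + K3 Rad x y) by exact: measurable_funD.
apply: (bounded_supW Ctot0 _ _ sp).
- by move=> Rad x y R0 /andP[x0 _] /andP[y0 _]; exact: wkR_ge0.
- by move=> Rad x; apply: measurable_funD; [exact: m13|exact: mn].
- by move=> Rad x y R0 x01; rewrite addr_ge0 ?p13 ?pn.
apply: (bounded_supD m13 mn p13 pn); last exact: near_sup.
exact: (bounded_supD m1 m3 p1 p3).
Qed.

End UniformBound.

(** * Reduction of the maximal operator to the weighted kernel *)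

Section WeightedFunction.
Context {R : realType}.
Notation mu := (@lebesgue_measure R).
Implicit Types (x y t Rad : R).
Variables (nu delta a A : R) (s : nat -> R).
Hypothesis nu1 : -1 < nu.
Hypothesis delta0 : 0 < delta.
Hypothesis zeros : bessel_zeros nu s.
Let kap : R := nu + 1 / 2.
Notation wkR := (wkR nu delta a A).

Definition wfun (f : R -> R) : R -> R := (fun y => y `^ A * `|f y|) \_ `]0%R, 1%R[.

Section OneFunction.
Variable f : R -> R.
Hypothesis mf : measurable_fun (`]0%R, 1%R[ : set R) f.
Notation G := (wfun f).

Lemma wfunE y : 0 < y < 1 -> G y = y `^ A * `|f y|.
Proof. by move=> y01; rewrite /wfun patchE mem_set //= in_itv. Qed.

Lemma wfun0 y : ~~ (0 < y < 1) -> G y = 0.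
Proof. by move=> h; rewrite /wfun patchE ifF //; apply/negP; rewrite inE /= in_itv; exact/negP. Qed.

Lemma wfun_ge0 y : 0 <= G y.
Proof. by have [h|/wfun0->//] := boolP (0 < y < 1); rewrite wfunE // mulr_ge0 ?powR_ge0. Qed.

Lemma measurable_wfun : measurable_fun setT G.
Proof.
apply/(measurable_restrictT _ _).1 => //; apply: measurable_funM.
  exact: measurable_funTS (measurable_powR _).
exact: measurableT_comp.
Qed.

Lemma coef_integrable_of : (\int[mu]_(y in `]0%R, 1%R[) (y `^ (kap - A) * G y)%:E < +oo)%E ->
  coef_integrable nu s f.
Proof.
move=> fin j; have [C [C0 hC]] := phi_le nu1 zeros j.
have mfp : measurable_fun (`]0%R, 1%R[ : set R) (fun t => f t * phi nu s j t).
  by apply: measurable_funM => //; exact: measurable_phi.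
apply/integrableP; split; first exact: measurableT_comp.
have mh : measurable_fun (`]0%R, 1%R[ : set R) (fun y => y `^ (kap - A) * G y).
  apply: measurable_funM; last exact: measurable_funTS measurable_wfun.
  exact: measurable_funTS (measurable_powR _).
apply: (@le_lt_trans _ _ (C%:E * \int[mu]_(y in `]0%R, 1%R[) (y `^ (kap - A) * G y)%:E)%E); last first.
  by apply: lte_mul_pinfty => //; rewrite lee_fin ltW.
rewrite -ge0_integralZl_EFin //; last 3 first.
- by move=> y _; rewrite lee_fin mulr_ge0 ?powR_ge0 // wfun_ge0.
- exact: measurableT_comp.
- exact: ltW.
apply: ge0_le_integralW => y; first by move=> _; exact: abse_ge0.
rewrite /= in_itv /= => y01; have [y0 y1] := andP y01.
rewrite -EFinM lee_fin normrM wfunE //.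
have -> : C * (y `^ (kap - A) * (y `^ A * `|f y|)) = `|f y| * (C * y `^ kap).
  rewrite (_ : y `^ kap = y `^ (kap - A) * y `^ A); first ring.
  by rewrite -powRD ?(gt_eqF y0) ?implybT // subrK.
by apply: ler_wpM2l => //; exact: hC.
Qed.

Lemma bochner_max_le x (M : \bar R) : 0 < x -> (0 <= M)%E ->
  (forall Rad, 0 < Rad -> ((x `^ a * `|bochner_riesz nu s delta f Rad x|)%:E <= M)%E) ->
  ((x `^ a)%:E * bochner_riesz_max nu s delta f x <= M)%E.
Proof.
move=> x0 M0 h; have xa : 0 < x `^ a by exact: powR_gt0.
have -> : M = ((x `^ a)%:E * ((x `^ a)^-1%:E * M))%E.
  by rewrite muleA -EFinM mulfV ?gt_eqF // mul1e.
apply: lee_wpmul2l; first by rewrite lee_fin ltW.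
apply: ge_ereal_sup => _ [Rad /= R0 <-].
have -> : (`|bochner_riesz nu s delta f Rad x|%:E =
   (x `^ a)^-1%:E * (x `^ a * `|bochner_riesz nu s delta f Rad x|)%:E)%E.
  by rewrite -EFinM mulrA mulVf ?mul1r // gt_eqF.
by apply: lee_wpmul2l; [rewrite lee_fin invr_ge0 ltW|exact: h].
Qed.

Lemma bochner_max_ge0 x : (0 <= bochner_riesz_max nu s delta f x)%E.
Proof.
by apply: le_trans (ereal_sup_ubound _); last (exists 1 => //=; exact: ltr01); rewrite lee_fin.
Qed.

End OneFunction.

Lemma bochner_wkR : exists C : R, 0 < C /\ forall (f : R -> R) Rad x, measurable_fun (`]0%R, 1%R[ : set R) f ->
  coef_integrable nu s f -> 0 < Rad -> 0 < x < 1 ->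
  ((x `^ a * `|bochner_riesz nu s delta f Rad x|)%:E <=
   C%:E * \int[mu]_(y in `]0%R, 1%R[) (wkR Rad x y * wfun f y)%:E)%E.
Proof.
have [C [C0 hC]] := bochner_le nu1 delta0 zeros; exists C; split => // f Rad x mf fi R0 x01.
have [x0 x1] := andP x01.
rewrite EFinM; apply: (le_trans (lee_wpmul2l _ (hC f Rad x mf fi R0 x01))); first by rewrite lee_fin powR_ge0.
rewrite muleCA; apply: lee_wpmul2l; first by rewrite lee_fin ltW.
rewrite -ge0_integralZl_EFin //; last 3 first.
- by move=> y; rewrite /= in_itv /= => /andP[y0 _]; rewrite lee_fin mulr_ge0 // kR_ge0.
- apply: measurableT_comp => //; apply: measurable_funM; first exact: measurableT_comp.
  exact: measurable_funTS (measurable_kR nu delta Rad x).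
- exact: powR_ge0.
apply: ge0_le_integralW => y; rewrite /= in_itv /= => y01; have [y0 _] := andP y01.
  by rewrite -EFinM lee_fin mulr_ge0 ?powR_ge0 // mulr_ge0 // kR_ge0.
rewrite -EFinM lee_fin wfunE // /wkR.
have e : y `^ (- A) * y `^ A = 1 by rewrite -powRD ?(gt_eqF y0) ?implybT // addrC subrr powRr0.
rewrite (_ : _ * (_ * _) = x `^ a * kR nu delta Rad x y * `|f y| * (y `^ (- A) * y `^ A)); last by ring.
by rewrite e mulr1 le_eqVlt; apply/orP; left; apply/eqP; ring.
Qed.

End WeightedFunction.

(** * The norm inequalities *)

Section MainEstimates.
Context {R : realType}.
Notation mu := (@lebesgue_measure R).
Implicit Types (x y t Rad : R).

Lemma Lnorm01_fin (r : R) (g : R -> \bar R) :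
  Lnorm01 r%:E g = poweR (\int[mu]_(x in `]0%R, 1%R[) poweR `|g x| r)%E r^-1.
Proof.
rewrite /Lnorm01 unlock /=; congr (poweR _ _).
by apply: integral_mrestr => x; exact: poweR_ge0.
Qed.

Lemma mrestr01_gt0 : (0 < mrestr mu measurable01 setT)%E.
Proof.
by rewrite /mrestr setTI lebesgue_measure_itv /= lte_fin ltr01 -EFinB lte_fin subr0.
Qed.

Lemma Lnorm01_oo (g : R -> \bar R) :
  Lnorm01 +oo g = ess_sup (mrestr mu measurable01) (abse \o g).
Proof.
by rewrite /Lnorm01 unlock /= mrestr01_gt0.
Qed.

Lemma ae_restr01 (P : R -> Prop) : {ae mrestr mu measurable01, forall x, P x} <->
  {ae mu, forall x, 0 < x < 1 -> P x}.
Proof.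
split=> -[N [mN N0 hN]].
  exists (N `&` `]0%R, 1%R[); split => //; first exact: measurableI.
  move=> x /= h; have [x01|nx] := boolP (0 < x < 1).
    by split; [apply: hN => /= Px; exact: h|rewrite in_itv].
  by exfalso; apply: h => x01; rewrite x01 in nx.
exists (N `|` ~` `]0%R, 1%R[); split.
- by apply: measurableU => //; exact: measurableC.
- rewrite /mrestr setIUl setICl setU0; apply/eqP; rewrite eq_le measure_ge0 andbT -N0.
  by apply: le_measure => //; rewrite inE //; exact: measurableI.
- move=> x /= h; have [x01|nx] := boolP (0 < x < 1); last by right; rewrite in_itv /=; exact/negP.
  by left; apply: hN => /= h'; apply: h; exact: h'.
Qed.

(** Hoelder's inequality. With [c = kap - A] it makes the Fourier-Bessel coefficients genuine
    integrals, with [c = 0] it makes [G] admissible for the maximal function. *)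
Lemma integral_powR_fin (G : R -> R) (p q c : R) : 0 < p -> 0 < q -> p^-1 + q^-1 = 1 -> -1 < c * q ->
  measurable_fun setT G -> (forall y, 0 <= G y) -> (\int[mu]_y (G y `^ p)%:E < +oo)%E ->
  (\int[mu]_(y in `]0%R, 1%R[) (y `^ c * G y)%:E < +oo)%E.
Proof.
move=> p0 q0 pq cq mG G0 Gp.
pose F : R -> R := (fun y => y `^ c) \_ `]0%R, 1%R[.
have F0 y : 0 <= F y by rewrite /F patchE; case: ifP => // _; exact: powR_ge0.
have mF : measurable_fun setT F.
  by apply/(measurable_restrictT _ _).1 => //; exact: measurable_funTS (measurable_powR _).
have hol := hoelder mu mF mG q0 p0 (etrans (addrC _ _) pq).
rewrite Lnorm1 in hol.
have e1 : (\int[mu]_x `|(EFin \o (F \* G)%R) x| = \int[mu]_(y in `]0%R, 1%R[) (y `^ c * G y)%:E)%E.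
  rewrite [RHS]integral_mkcond; apply: eq_integral => y _; rewrite /= ger0_norm ?mulr_ge0 //.
  by rewrite /F !patchE; case: ifP; rewrite ?mul0r.
rewrite e1 in hol; apply: (le_lt_trans hol).
have fin (H : R -> R) (r : R) : 0 < r -> (forall y, 0 <= H y) -> (\int[mu]_y (H y `^ r)%:E < +oo)%E ->
    ('N[mu]_r%:E[EFin \o H] < +oo)%E.
  move=> r0 H0 hH; rewrite unlock /=; apply: poweR_lty.
  have -> : (\int[mu]_x poweR `|(H x)%:E| r = \int[mu]_y (H y `^ r)%:E)%E; last by [].
  by apply: eq_integral => y _; rewrite /= (ger0_norm (H0 y)).
apply: lte_mul_pinfty; first exact: Lnorm_ge0.
- rewrite (ge0_fin_numE (Lnorm_ge0 _ _ _)); apply: (fin F q q0 F0).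
  apply: (@le_lt_trans _ _ (\int[mu]_(y in `]0%R, 1%R[) (y `^ (c * q))%:E)%E).
    rewrite [leRHS]integral_mkcond; apply: ge0_le_integralW => y _; first by rewrite lee_fin powR_ge0.
    rewrite /F !patchE; case: ifP => _; first by rewrite powRrM.
    by rewrite powR0 // gt_eqF.
  by rewrite integral_powR0 // ltry.
- exact: fin.
Qed.

Variables (nu delta a A : R) (s : nat -> R).
Hypothesis nu1 : -1 < nu.
Hypothesis delta0 : 0 < delta.
Hypothesis zeros : bessel_zeros nu s.
Hypothesis Aa : A <= a.
Let kap : R := nu + 1 / 2.
Notation wkR := (wkR nu delta a A).

Lemma max_bound_fin p q : 1 < p -> 0 < q -> p^-1 + q^-1 = 1 ->
  A < 1 - p^-1 + kap -> bounded_op p wkR ->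
  exists C : R, 0 < C /\ forall f : R -> R, measurable_fun (`]0%R, 1%R[ : set R) f ->
   (Lnorm01 p%:E (fun x => (x `^ a)%:E * bochner_riesz_max nu s delta f x) <=
    C%:E * Lnorm01 p%:E (fun x => (x `^ A * f x)%:E))%E.
Proof.
move=> p1 q0 pq c2 [C1 [C10 hop]]; have p0 : 0 < p by lra.
have [C2 [C20 hC2]] := bochner_wkR a A nu1 delta0 zeros.
pose C3 := C2 `^ p * C1; have C30 : 0 <= C3 by rewrite mulr_ge0 ?powR_ge0.
exists (C3 `^ p^-1 + 1); split; first by rewrite ltr_wpDl ?powR_ge0.
move=> f mf; pose G := wfun A f.
have mG : measurable_fun setT G by exact: measurable_wfun.
have G0 y : 0 <= G y by exact: wfun_ge0.
pose I := (\int[mu]_y (G y `^ p)%:E)%E.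
have I0 : (0 <= I)%E by apply: integral_ge0 => y _; rewrite lee_fin powR_ge0.
have eR : Lnorm01 p%:E (fun x => (x `^ A * f x)%:E) = poweR I p^-1.
  rewrite Lnorm01_fin integral_mkcond; congr (poweR _ _); apply: eq_integral => y _.
  rewrite patchE /G /wfun patchE; case: ifP => _; last by rewrite powR0 // gt_eqF.
  by rewrite /= normrM (ger0_norm (powR_ge0 _ _)).
have pi0 : 0 < p^-1 by rewrite invr_gt0.
(* An infinite right-hand side leaves nothing to prove; here the positivity of the constant, ensured
   by the summand 1, is used. *)
rewrite eR; have [Ioo|] := eqVneq I +oo%E.
  rewrite Ioo poweRyr ?gt_eqF // gt0_muley ?leey //.
  by rewrite lte_fin ltr_wpDl ?powR_ge0.
rewrite -ltey => Ifin.
have qE : q^-1 = 1 - p^-1 by lra.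
have kq : -1 < (kap - A) * q.
  by rewrite -ltr_pdivrMr // mulN1r; lra.
have zq : -1 < 0 * q by rewrite mul0r; lra.
have fi : coef_integrable nu s f.
  by apply: (coef_integrable_of nu1 zeros mf); exact: (integral_powR_fin p0 q0 pq kq mG G0 Ifin).
have Gs y : ~~ (0 < y < 1) -> G y = 0 by exact: wfun0.
have Goo : (\int[mu]_y (G y)%:E < +oo)%E.
  apply: le_lt_trans (integral_powR_fin p0 q0 pq zq mG G0 Ifin).
  rewrite [leRHS]integral_mkcond; apply: ge0_le_integralW => y _; first by rewrite lee_fin.
  rewrite patchE powRr0 mul1r; case: ifPn => // h; rewrite Gs //; apply/negP => y01.
  by move/negP: h; apply; rewrite inE /= in_itv.
have [H [mH H0 hH1 hH2]] := hop G (And4 mG G0 Gs Goo).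
have B0 x : (0 <= (x `^ a)%:E * bochner_riesz_max nu s delta f x)%E.
  by apply: mule_ge0; [rewrite lee_fin powR_ge0|exact: bochner_max_ge0].
have bx x : 0 < x < 1 -> ((x `^ a)%:E * bochner_riesz_max nu s delta f x <= C2%:E * H x)%E.
  move=> x01; have [x0 x1] := andP x01; apply: bochner_max_le => //.
    by apply: mule_ge0 => //; rewrite lee_fin ltW.
  move=> Rad R0; apply: (le_trans (hC2 f Rad x mf fi R0 x01)).
  apply: lee_wpmul2l; first by rewrite lee_fin ltW.
  apply: le_trans (hH1 Rad x R0 x01); rewrite integral_mkcond; apply: ge0_le_integralW => y _.
    rewrite patchE; case: ifPn => // ; rewrite inE /= in_itv /= => /andP[y0 _].
    by rewrite lee_fin mulr_ge0 ?wfun_ge0 // wkR_ge0.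
  rewrite patchE; case: ifPn => // h; rewrite -/G Gs ?mulr0 //; apply/negP => y01.
  by move/negP: h; apply; rewrite inE /= in_itv.
have hI : (\int[mu]_(x in `]0%R, 1%R[) poweR `|(x `^ a)%:E * bochner_riesz_max nu s delta f x| p <= C3%:E * I)%E.
  apply: (@le_trans _ _ (\int[mu]_(x in `]0%R, 1%R[) ((C2 `^ p)%:E * poweR (H x) p))%E).
    apply: ge0_le_integralW => x; first by move=> _; exact: poweR_ge0.
    rewrite /= in_itv /= => x01; rewrite gee0_abs //.
    have CH0 : (0 <= C2%:E * H x)%E by apply: mule_ge0 => //; rewrite lee_fin ltW.
    have := @gt0_ler_poweR R p (ltW p0) ((x `^ a)%:E * bochner_riesz_max nu s delta f x)%E (C2%:E * H x)%E.
    rewrite !in_itv /= B0 CH0 !leey => /(_ isT isT (bx x x01)) h; apply: (le_trans h).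
    by rewrite poweRM ?lee_fin ?(ltW C20).
  rewrite ge0_integralZl_EFin ?powR_ge0 //; last 2 first.
  - by move=> x _; exact: poweR_ge0.
  - by apply: measurable_funTS; exact: (measurableT_comp (measurable_poweR p)).
  by rewrite /C3 EFinM -muleA; apply: lee_wpmul2l => //; rewrite lee_fin powR_ge0.
rewrite Lnorm01_fin.
set J := (\int[mu]_(x in _) _)%E in hI *.
have J0 : (0 <= J)%E by apply: integral_ge0 => x _; exact: poweR_ge0.
have CI0 : (0 <= C3%:E * I)%E by apply: mule_ge0.
have := @gt0_ler_poweR R p^-1 (ltW pi0) J (C3%:E * I)%E.
rewrite !in_itv /= J0 CI0 !leey => /(_ isT isT hI) h; apply: (le_trans h).
rewrite poweRM ?lee_fin // poweR_EFin; apply: lee_wpmul2r; first exact: poweR_ge0.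
by rewrite lee_fin lerDl.
Qed.

(** The inequality [G <= N] holds only almost everywhere, but it enters under the integral in [y];
    the resulting bound therefore holds at every [x] of []0, 1[]. *)
Lemma max_bound_oo : A < 1 + kap -> bounded_sup wkR ->
  exists C : R, 0 < C /\ forall f : R -> R, measurable_fun (`]0%R, 1%R[ : set R) f ->
   (Lnorm01 +oo (fun x => (x `^ a)%:E * bochner_riesz_max nu s delta f x) <=
    C%:E * Lnorm01 +oo (fun x => (x `^ A * f x)%:E))%E.
Proof.
move=> c2 [C1 [C10 hK]].
have [C2 [C20 hC2]] := bochner_wkR a A nu1 delta0 zeros.
have C3 : 0 < C2 * C1 + 1 by rewrite ltr_wpDl // mulr_ge0 // ltW.
exists (C2 * C1 + 1); split => // f mf; pose G := wfun A f.
have mG : measurable_fun setT G by exact: measurable_wfun.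
have G0 y : 0 <= G y by exact: wfun_ge0.
rewrite !Lnorm01_oo; set N := (X in (_ <= _ * X)%E).
have hN : {ae mu, forall y, 0 < y < 1 -> ((G y)%:E <= N)%E}.
  have [M [mM M0 hM]] := (ae_restr01 _).1 (ess_sup_ge (mrestr mu measurable01) (abse \o (fun x => (x `^ A * f x)%:E))).
  exists M; split => // y /= hy; apply: hM => /= h; apply: hy => y01; apply: le_trans (h y01).
  by rewrite /G wfunE //= normrM (ger0_norm (powR_ge0 _ _)).
have N0 : (0 <= N)%E.
  have : (ess_sup (mrestr mu measurable01) (cst 0%E) <= N)%E by apply: le_ess_sup; apply: aeW => y; exact: abse_ge0.
  by rewrite ess_sup_cst //; exact: mrestr01_gt0.
have [->|] := eqVneq N +oo%E; first by rewrite gt0_muley ?leey // lte_fin.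
rewrite -ltey => Nfin; have [n nE] : exists n, N = n%:E.
  by exists (fine N); rewrite fineK // ge0_fin_numE.
rewrite nE lee_fin in N0 hN *.
have dom (F : R -> R) : measurable_fun setT F -> (forall y, 0 < y < 1 -> 0 <= F y) ->
  (\int[mu]_(y in `]0%R, 1%R[) (F y * G y)%:E <= n%:E * \int[mu]_(y in `]0%R, 1%R[) (F y)%:E)%E.
  move=> mF F0; have mD : measurable (`]0%R, 1%R[%classic : set R) by exact: measurable_itv.
  have F0' y : (`]0%R, 1%R[%classic : set R) y -> (0 <= (F y)%:E)%E.
    by rewrite /= in_itv /= => y01; rewrite lee_fin F0.
  have mFD : measurable_fun (`]0%R, 1%R[%classic : set R) (EFin \o F).
    by apply: measurableT_comp => //; exact: measurable_funTS.
  rewrite -ge0_integralZl_EFin //.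
  apply: ae_ge0_le_integral => //.
  - by move=> y /F0'; rewrite !lee_fin => h; rewrite mulr_ge0.
  - apply: measurableT_comp => //; apply: measurable_funM; exact: measurable_funTS.
  - by move=> y /F0' h; rewrite mule_ge0 // lee_fin.
  - exact: measurable_funeM.
  - have [M [mM M0 hM]] := hN; exists M; split => // y /= hy; apply: hM => /= h; apply: hy => Dy; have y01 : 0 < y < 1 by move: Dy; rewrite /= in_itv.
    have := h y01; rewrite -EFinM !lee_fin => h'.
    by rewrite mulrC ler_wpM2r // F0.
have fi : coef_integrable nu s f.
  apply: (coef_integrable_of nu1 zeros mf).
  apply: (le_lt_trans (dom (fun y => y `^ (kap - A)) _ _)).
  - exact: measurable_powR.
  - by move=> y _; exact: powR_ge0.
  by rewrite integral_powR0 // ?ltry //; lra.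
apply/ess_supP; apply/ae_restr01; apply: aeW => x x01 /=.
have [x0 x1] := andP x01.
have B0 : (0 <= (x `^ a)%:E * bochner_riesz_max nu s delta f x)%E.
  by apply: mule_ge0; [rewrite lee_fin powR_ge0|exact: bochner_max_ge0].
rewrite gee0_abs //; apply: bochner_max_le => //.
  by rewrite -EFinM lee_fin mulr_ge0 // ltW.
move=> Rad R0; apply: (le_trans (hC2 f Rad x mf fi R0 x01)).
have h1 := dom (wkR Rad x) (measurable_wkR nu delta a A Rad x) (fun y y01 => wkR_ge0 nu delta a A R0 x0 (andP y01).1).
have h2 : (n%:E * \int[mu]_(y in `]0%R, 1%R[) (wkR Rad x y)%:E <= n%:E * C1%:E)%E.
  by apply: lee_wpmul2l => //; exact: hK.
apply: (le_trans (lee_wpmul2l _ (le_trans h1 h2))); first by rewrite lee_fin ltW.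
by rewrite -!EFinM lee_fin mulrA mulrAC; apply: ler_wpM2r => //; rewrite lerDl.
Qed.

End MainEstimates.

Theorem theorem8 (R : realType) (nu delta a A : R) (p : \bar R) (s : nat -> R) :
  -1 < nu -> 0 < delta -> (1 < p)%E -> bessel_zeros nu s ->
  (* (1) *)
  (if p is +oo%E then - (nu + 1/2) <= a else - invp p - (nu + 1/2) < a) ->
  (* (2) (p > 1, so always strict) *)
  A < 1 - invp p + (nu + 1/2) ->
  (* (3) *)
  (if p is +oo%E then - delta <= a else - delta - invp p < a) ->
  (* (4) *)
  A <= 1 + delta - invp p ->
  (* (5) *)
  A <= a ->
  (* strictness in at least one of each pair *)
  (A < 1 - invp p + (nu + 1/2) \/ A < a) ->
  (- delta - invp p < a \/ A < a) ->
  (p <> +oo%E -> A < 1 + delta - invp p \/ A < a) ->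
  exists C : R, 0 < C /\
    forall f : R -> R, measurable_fun (`]0%R, 1%R[ : set R) f ->
      (Lnorm01 p (fun x => (x `^ a)%:E * bochner_riesz_max nu s delta f x)
       <= C%:E * Lnorm01 p (fun x => (x `^ A * f x)%:E))%E.
Proof.
move=> nu1 delta0; case: p => [p| |] //= p1 zeros c1 c2 c3 c4 c5 _ c35 c45.
  rewrite lte_fin in p1; have p0 : 0 < p by lra.
  have pi1 : 0 < 1 - p^-1 by rewrite subr_gt0 invf_lt1.
  have q0 : 0 < (1 - p^-1)^-1 by rewrite invr_gt0.
  have pq : p^-1 + (1 - p^-1)^-1^-1 = 1 by rewrite invrK; ring.
  apply: (max_bound_fin nu1 delta0 zeros p1 q0 pq c2).
  by apply: (wkR_op nu1 delta0 c5 p1 q0 pq) => //; exact: c45.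
(* For [p = +oo], [invp p] is 0. *)
rewrite !subr0 in c2 c4 c35.
by apply: max_bound_oo => //; exact: wkR_sup.
Qed.
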